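(* Let $\lambda\in(0,1/2)$ and let $\delta\ge2$ be an integer. For every $\theta\ge 0$ and $g\in\mathcal L(\lambda)$ there exist a positive $\tau_*\in I(g)$ and a function $C:[0,\tau_*]\to\mathbb R_+=[0,+\infty)$ such that, with $\beta_*=\tau_*/(\delta^\lambda-1)$: (i) for $0\le\tau<\tau_*$, the sequence of solutions $\{f_n(t,z)\}_{n\in\mathbb N_0}$ of the problem $$\frac{\partial f_n(t,z)}{\partial t}=\tau(\Delta_\theta f_n)(t,z),\ t\in[0,1],\qquad f_n(0,z)=\left[f_{n-1}(1,z\delta^{-1-\lambda})\right]^\delta,\ n\in\mathbb N,$$ with $f_0(1,z)=C(\tau)g(z)$, converges (for each $t\in[0,1]$) in $\mathcal A_{\beta_*^{-1}}$ to the function $f(t,z)\equiv 1$; (ii) for $\tau=\tau_*$, the sequence of solutions of the same problem with $f_0(1,z)=C(\tau_* )g(z)$ converges (for each $t\in[0,1]$) in $\mathcal A_{\beta_*^{-1}}$ to $$f_*(t,z)=\delta^{-\delta\theta\lambda/(\delta-1)}\left[1-t(1-\delta^{-\lambda})\right]^{-\theta}\exp\left(\frac{1}{\tau_*}\,\frac{1-\delta^{-\lambda}}{1-t(1-\delta^{-\lambda})}\,z\right).$$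
   Context: Let $\mathcal E$ be the set of entire functions $\mathbb C\to\mathbb C$. For $b>0$ put $\|f\|_b=\sup_{k\ge 0} b^{-k}|f^{(k)}(0)|$. For $a\ge 0$, $\mathcal A_a=\{f\in\mathcal E: \|f\|_b<\infty\ \forall b>a\}$, a Fréchet space with the topology given by the norms $\|\cdot\|_b$, $b>a$. $\mathcal L$ (Laguerre entire functions) is the set of entire functions of the form $f(z)=Cz^m\exp(\alpha z)\prod_{j=1}^\infty(1+\gamma_j z)$ with $C\in\mathbb C$, $m\in\mathbb N_0$, $\alpha\ge 0$, $\gamma_j\ge\gamma_{j+1}\ge 0$, $\sum_j\gamma_j<\infty$; $\mathcal L^{(1)}=\{f\in\mathcal L: f(0)=1\}$. For $g$ of this form with $g(0)>0$ put $m_k(g)=\sum_j\gamma_j^k$, and $I(g)=[0,(\delta^\lambda-1)/\alpha]$ if $\alpha>0$, $I(g)=[0,\infty)$ if $\alpha=0$. For $\theta\ge0$, $(\Delta_\theta f)(z)=\theta f'(z)+zf''(z)$. Let $\epsilon=(1-2\lambda)/4$ and $\vartheta(\lambda)=\dfrac{1-\delta^{-\epsilon}}{\delta^\lambda-\delta^{-\epsilon}}$. The family $\mathcal L(\lambda)$ consists of the non-constant $g\in\mathcal L^{(1)}$ such that $$\frac{m_2(g)}{[\alpha+m_1(g)]^2}\le\frac{\delta^{1/2}}{\theta+1}\vartheta(\lambda),\qquad \frac{m_2(g)}{[m_1(g)]^2}\le\frac{\delta^{1/2}}{\theta+1},$$ where the second condition is regarded as satisfied when $m_1(g)=0$ (i.e.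 $g(z)=e^{\alpha z}$). For $g\in\mathcal L^{(1)}$, a constant $C>0$ and $\tau\in I(g)$, the solutions $f_n$ of the recursive Cauchy problem $\frac{\partial f_n(t,z)}{\partial t}=\tau(\Delta_\theta f_n)(t,z)$, $t\in[0,1]$, $f_n(0,z)=\left[f_{n-1}(1,z\delta^{-1-\lambda})\right]^\delta$, $n\in\mathbb N$, $f_0(1,z)=Cg(z)$, are understood as the unique solutions with $f_n(t,\cdot)\in\mathcal A_\alpha$ (differentiable in $t\in[0,1]$). *)

(* Defs.v *)
From Stdlib Require Import Reals Lra Lia.
From Coquelicot Require Import Coquelicot.

Open Scope R_scope.

Definition cexp (z : C) : C :=
  (exp (Re z) * cos (Im z), exp (Re z) * sin (Im z)).

Definition entire (f : C -> C) : Prop :=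
  forall z : C, ex_derive (K := C_AbsRing) (V := C_NormedModule) f z.

Fixpoint C_derive_n (f : C -> C) (k : nat) : C -> C :=
  match k with
  | O => f
  | S k => C_derive (C_derive_n f k)
  end.

Fixpoint Cprod_n (u : nat -> C) (n : nat) : C :=
  match n with
  | O => RtoC 1
  | S n => (Cprod_n u n * u n)%C
  end.

Definition is_Cprod (u : nat -> C) (p : C) : Prop :=
  filterlim (Cprod_n u) eventually (locally (p : C_UniformSpace)).

Definition A_norm (b : R) (f : C -> C) : Rbar :=
  Sup_seq (fun k => Finite (/ b ^ k * Cmod (C_derive_n f k (RtoC 0)))).

Definition A_space (a : R) (f : C -> C) : Prop :=
  entire f /\ forall b, a < b -> Rbar_lt (A_norm b f) p_infty.

(** [A_lim F a u l]: along the filter [F], the family [u] lies in [A_a] and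
    tends to [l] in the topology given by the norms [A_norm b], [b > a]. *)
Definition A_lim {T : Type} (F : (T -> Prop) -> Prop) (a : R)
    (u : T -> C -> C) (l : C -> C) : Prop :=
  A_space a l /\
  F (fun x => A_space a (u x)) /\
  forall b, a < b -> forall eps : R, 0 < eps ->
    F (fun x => Rbar_lt (A_norm b (fun z => (u x z - l z)%C)) (Finite eps)).

(** The pair [(alpha, gamma)] is determined by [g] as soon as [g] is not
    identically zero; the indices [j = 1, 2, ...] are shifted to start at 0. *)
Definition laguerre_form (g : C -> C) (c : C) (m : nat) (alpha : R)
    (gamma : nat -> R) : Prop :=
  0 <= alpha /\
  (forall j, 0 <= gamma (S j) <= gamma j) /\
  ex_series gamma /\
  forall z : C, exists p : C,
    is_Cprod (fun j => (1 + RtoC (gamma j) * z)%C) p /\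
    g z = (c * Cpow z m * cexp (RtoC alpha * z) * p)%C.

Definition laguerre1 (g : C -> C) (alpha : R) (gamma : nat -> R) : Prop :=
  (exists (c : C) (m : nat), laguerre_form g c m alpha gamma) /\
  g (RtoC 0) = RtoC 1.

Definition moment (gamma : nat -> R) (k : nat) : R :=
  Series (fun j => gamma j ^ k).

Definition vartheta (delta : nat) (lambda : R) : R :=
  let d := INR delta in
  let epsilon := (1 - 2 * lambda) / 4 in
  (1 - Rpower d (- epsilon)) / (Rpower d lambda - Rpower d (- epsilon)).

Definition laguerre_family (delta : nat) (lambda theta : R) (g : C -> C)
    (alpha : R) (gamma : nat -> R) : Prop :=
  laguerre1 g alpha gamma /\
  (exists z1 z2 : C, g z1 <> g z2) /\
  moment gamma 2 / (alpha + moment gamma 1) ^ 2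
    <= Rpower (INR delta) (1 / 2) / (theta + 1) * vartheta delta lambda /\
  (moment gamma 1 = 0 \/
   moment gamma 2 / moment gamma 1 ^ 2
     <= Rpower (INR delta) (1 / 2) / (theta + 1)).

Definition in_I (delta : nat) (lambda alpha tau : R) : Prop :=
  0 <= tau /\ (0 < alpha -> tau <= (Rpower (INR delta) lambda - 1) / alpha).

Definition Delta (theta : R) (f : C -> C) (z : C) : C :=
  (RtoC theta * C_derive f z + z * C_derive_n f 2 z)%C.

(** [df/dt = tau * Delta_theta f] on [[0, 1]] with values in [A_a]: the
    [t]-derivative (one-sided at 0 and 1) is taken in the topology of [A_a]. *)
Definition heat_equation (theta tau a : R) (f : R -> C -> C) : Prop :=
  forall t, 0 <= t <= 1 ->
    A_space a (f t) /\
    A_lim (within (fun s => 0 <= s <= 1) (locally' t)) a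
      (fun s z => ((f s z - f t z) / RtoC (s - t))%C)
      (fun z => (RtoC tau * Delta theta (f t) z)%C).

(** [f 0 t] is only meaningful for [t = 1]. *)
Definition recursive_solution (delta : nat) (lambda theta tau a : R)
    (f0 : C -> C) (f : nat -> R -> C -> C) : Prop :=
  (forall z, f O 1 z = f0 z) /\
  forall n,
    heat_equation theta tau a (f (S n)) /\
    forall z, f (S n) 0 z
      = Cpow (f n 1 (z * RtoC (Rpower (INR delta) (- 1 - lambda)))%C) delta.

Definition unique_recursive_solution (delta : nat) (lambda theta tau a : R)
    (f0 : C -> C) (f : nat -> R -> C -> C) : Prop :=
  recursive_solution delta lambda theta tau a f0 f /\
  forall h, recursive_solution delta lambda theta tau a f0 h ->
    forall n t z, 0 <= t <= 1 -> h (S n) t z = f (S n) t z.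

Definition f_star (delta : nat) (lambda theta tau_star t : R) (z : C) : C :=
  let d := INR delta in
  let q := 1 - Rpower d (- lambda) in
  (RtoC (Rpower d (- (d * theta * lambda / (d - 1)))
         * Rpower (1 - t * q) (- theta))
   * cexp (RtoC (1 / tau_star * (q / (1 - t * q))) * z))%C.

(* Main.v *)
Require Import Defs.
From Stdlib Require Import Reals Lra Lia List Factorial ClassicalEpsilon FunctionalExtensionality Permutation Sorted.
From Coquelicot Require Import Coquelicot.
(* Again, since Coquelicot shadows [Forall]. *)
From Stdlib Require Import List.
Open Scope R_scope.

(* Everything is read on the coefficients [c_k = f^(k)(0)].  The heat flow [exp (s Delta_theta)] is an
   explicit series in [s] on them, and it preserves limits of real-rooted polynomials with
   nonnegative coefficients, because [1 + s Delta_theta] does (Rolle).  Let [c^(n)] be the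
   coefficients of the unnormalised iterates, [a_n = c^(n)_1 / c^(n)_0] and
   [b_n = a_n^2 - c^(n)_2 / c^(n)_0]; these play the role of [alpha + m_1] and [m_2].
   Along the flow [a' = a^2 - (theta+1) b], [b' <= 4 a b], so with [x = tau a], [y = tau^2 b] and
   [L = delta^lambda], [x_(n+1) <= (x_n/L) / (1 - x_n/L)], whose unstable fixed point is [L - 1],
   while the family condition on [g] ensures that an orbit reaching
   [X = L - delta^(-epsilon)] never drops below it again.  Below a threshold all
   orbits stay under [X]; let [tau_*] be the least [tau] there for which no [x_n] falls below
   [L - 1].  For smaller [tau] the orbit tends to 0; at [tau_*] it is trapped in [[L - 1, X]], where
   [y_n -> 0] and hence [x_n -> L - 1].
   Since [b_n -> 0], the normalised coefficients tend to those of [exp (a z)], [a = lim a_n].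
   Finally [ln f_n(1, 0)] obeys an affine recursion with multiplier [delta] and converging forcing,
   so exactly one constant [C(tau)] keeps it bounded, and it then converges. *)

(** The scaling [sigma = delta^(-1-lambda)] and [e = delta^(-epsilon)] satisfy
    [delta * sigma^2 = (e/L)^4], and one step multiplies [y] by at most [(e/L)^4 / (1 - x/L)^4]; so
    [X = L - e] is the largest [x] at which this factor is at most 1. The family condition, with
    [vartheta = (1-e)/(L-e)], bounds [y] by the largest value for which the lower estimate still
    sends [x = X] to at least [X]. The obstacle is that no monotonicity of the orbits in [tau] is
    available, so [tau_star] is found in two stages. Let [tp] be the largest parameter in [I(g)]
    such that all parameters up to it keep their orbits under [X]. Its orbit cannot fall below
    [L - 1]: slightly larger parameters would then stay under [X] too, unless [tp] is the right end
    of [I(g)], where the exponential type [alpha] keeps [x_n] at least [L - 1]. Hence some parameter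
    in [[0, tp]] has an orbit that never falls, and the least one exists by continuity. Since
    [entire] means complex differentiable, reading functions on coefficients rests on Goursat's
    theorem and Cauchy's formula. *)

Lemma is_lim_seq_eps (u : nat -> R) (l : R) :
  is_lim_seq u l <->
  forall eps : posreal, eventually (fun n => Rabs (u n - l) < eps).
Proof. split; intros H; [apply (proj2 (is_lim_seq_spec u l)) in H|apply is_lim_seq_spec]; exact H. Qed.

(** Tannery's theorem: beyond a finite index both series are controlled by the tail of [B], and
    finitely many terms converge one by one. Limits pass through the flow, through Taylor series and
    through the series defining the normalising constant by this lemma. *)
Lemma Series_tannery (u : nat -> nat -> R) (v B : nat -> R) :
  ex_series B ->
  eventually (fun i => forall j, Rabs (u i j) <= B j) ->
  (forall j, is_lim_seq (fun i => u i j) (v j)) ->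
  ex_series v /\ is_lim_seq (fun i => Series (u i)) (Series v).
Proof.
intros HB [n0 Hn0] Hv.
assert (Hvb : forall j, Rabs (v j) <= B j).
{ intros j.
  apply (is_lim_seq_le_loc (fun i => Rabs (u i j)) (fun _ => B j) (Rabs (v j)) (B j)).
  - exists n0; intros i Hi; apply Hn0, Hi.
  - apply (is_lim_seq_abs _ (v j)), Hv.
  - apply is_lim_seq_const. }
assert (Hex : ex_series v).
{ apply (ex_series_le (K := R_AbsRing) (V := R_CompleteNormedModule)) with B; auto. }
split; [exact Hex|].
apply is_lim_seq_eps; intros eps.
assert (HB0 : is_lim_seq (sum_n B) (Series B)) by (apply Series_correct, HB).
assert (He4 : 0 < eps / 4) by (destruct eps; simpl; lra).
destruct (proj1 (is_lim_seq_eps _ _) HB0 (mkposreal _ He4)) as [N HN].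
specialize (HN N (le_n _)); simpl in HN.
assert (Htail : Series (fun k => B (S N + k)%nat) < eps / 4).
{ rewrite (Series_incr_n B (S N)) in HN; [|lia|exact HB].
  simpl pred in HN. rewrite sum_n_Reals in HN.
  apply Rabs_def2 in HN. simpl in *; lra. }
assert (Hfin : is_lim_seq (fun i => sum_f_R0 (u i) N) (sum_f_R0 v N)).
{ clear - Hv. induction N as [|N IH]; simpl.
  - apply Hv.
  - apply is_lim_seq_plus'; auto. }
destruct (proj1 (is_lim_seq_eps _ _) Hfin (mkposreal _ He4)) as [n1 Hn1].
exists (max n0 n1); intros i Hi.
assert (Hui : forall j, Rabs (u i j) <= B j) by (apply Hn0; lia).
assert (Hexu : ex_series (u i)).
{ apply (ex_series_le (K := R_AbsRing) (V := R_CompleteNormedModule)) with B; auto. }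
assert (Ht : forall w : nat -> R, (forall j, Rabs (w j) <= B j) ->
   Rabs (Series (fun k => w (S N + k)%nat)) <= Series (fun k => B (S N + k)%nat)).
{ intros w Hw.
  assert (HBt : ex_series (fun k => B (S N + k)%nat)) by (apply ex_series_incr_n; auto).
  assert (ex_series (fun k => Rabs (w (S N + k)%nat))).
  { apply (ex_series_le (K := R_AbsRing) (V := R_CompleteNormedModule)) with (2 := HBt).
    intros k. unfold norm; simpl; unfold abs; simpl. rewrite Rabs_Rabsolu; auto. }
  eapply Rle_trans; [apply Series_Rabs; auto|].
  apply Series_le; auto. intros k; split; auto using Rabs_pos. }
rewrite (Series_incr_n (u i) (S N)); [|lia|auto].
rewrite (Series_incr_n v (S N)); [|lia|auto].
simpl pred.
specialize (Hn1 i ltac:(lia)); simpl in Hn1.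
pose proof (Ht _ Hui) as H1; pose proof (Ht _ Hvb) as H2.
replace (_ - _) with ((sum_f_R0 (u i) N - sum_f_R0 v N)
  + (Series (fun k => u i (S N + k)%nat) - Series (fun k => v (S N + k)%nat))) by ring.
eapply Rle_lt_trans; [apply Rabs_triang|].
eapply Rle_lt_trans; [apply Rplus_le_compat_l, Rabs_triang|].
rewrite Rabs_Ropp. lra.
Qed.

(** * Coefficient sequences of Laguerre functions *)

(* A sequence [c] stands for the entire function [sum_k c k z^k / k!]; on such sequences [mulL g] is
   multiplication by [1 + g z]. *)
Definition mulL (g : R) (c : nat -> R) (k : nat) : R :=
  c k + g * INR k * c (pred k).

Definition oneL (k : nat) : R := match k with O => 1 | _ => 0 end.

Fixpoint polyL (l : list R) : nat -> R :=
  match l with nil => oneL | g :: l => mulL g (polyL l) end.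

Notation nonneg_list := (Forall (fun g : R => 0 <= g)).

Lemma polyL_0 l : polyL l 0%nat = 1.
Proof. induction l; simpl; auto. unfold mulL; simpl. rewrite IHl. ring. Qed.

Lemma polyL_nonneg l k : nonneg_list l -> 0 <= polyL l k.
Proof.
intros H; revert k; induction H; intros k; simpl.
- destruct k; simpl; lra.
- unfold mulL. pose proof (IHForall k). pose proof (IHForall (pred k)).
  pose proof (pos_INR k).
  assert (0 <= x * INR k * polyL l (pred k)) by (repeat apply Rmult_le_pos; auto). lra.
Qed.

(** The left side consists of the first two terms of the binomial expansion. *)
Lemma pow_plus_ge a g k : 0 <= a -> 0 <= g ->
  a ^ k + g * INR k * a ^ (pred k) <= (a + g) ^ k.
Proof.
intros Ha Hg. induction k as [|k IH]; [simpl; lra|].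
rewrite S_INR. simpl pred.
replace ((a + g) ^ S k) with ((a + g) * (a + g) ^ k) by (simpl; ring).
apply Rle_trans with ((a + g) * (a ^ k + g * INR k * a ^ pred k)).
2: apply Rmult_le_compat_l; lra.
assert (H1 : 0 <= g * g * (INR k * a ^ pred k)).
{ apply Rmult_le_pos; [nra|]. apply Rmult_le_pos; [apply pos_INR|apply pow_le; auto]. }
destruct k; [simpl in *; lra|].
rewrite S_INR in *. simpl pred in *. simpl pow in *. nra.
Qed.

(** Coefficientwise form of [1 + g z <= exp (g z)]: the product is dominated by [exp (a z)], where
    [a] is the sum of the list. All growth bounds on Laguerre functions come from here. *)
Lemma polyL_le_pow l k : nonneg_list l -> polyL l k <= polyL l 1%nat ^ k.
Proof.
intros H; revert k; induction H; intros k; simpl polyL.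
- destruct k; simpl; [lra|]. rewrite Rmult_0_l; lra.
- unfold mulL at 2. simpl INR. simpl pred. rewrite polyL_0, !Rmult_1_r.
  eapply Rle_trans; [|apply pow_plus_ge; auto; apply polyL_nonneg; auto].
  unfold mulL. apply Rplus_le_compat; auto.
  apply Rmult_le_compat_l; auto. apply Rmult_le_pos; auto using pos_INR.
Qed.

(** The expression is the third cumulant; it is additive over factors and each factor [1 + g z]
    contributes [2 g^3]. *)
Lemma polyL_cubic l : nonneg_list l ->
  0 <= polyL l 3%nat - 3 * polyL l 2%nat * polyL l 1%nat + 2 * polyL l 1%nat ^ 3.
Proof.
intros H; induction H; simpl polyL.
- simpl; lra.
- unfold mulL; simpl pred; simpl INR. rewrite polyL_0.
  assert (0 <= x ^ 3) by (apply pow_le; auto). simpl in *. nra.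
Qed.

(** Writing [f_j] for the product [f] without its factor [1 + g_j z], one has
    [f' = a f - sum_j g_j^2 z f_j] with [a] the sum of the [g_j], and [f_j <= f] coefficientwise;
    the difference [a^2 - c_2] is [sum_j g_j^2]. Together with [polyL_le_pow] this squeezes the
    coefficients towards powers of [a] when the sum of squares is small. *)
Lemma polyL_lower l k : nonneg_list l ->
  polyL l 1%nat * polyL l k
   - INR k * (polyL l 1%nat ^ 2 - polyL l 2%nat) * polyL l (pred k) <= polyL l (S k).
Proof.
intros H; revert k; induction H; intros k; simpl polyL.
- destruct k; simpl; lra.
- assert (Hg3 : 0 <= x ^ 3) by (apply pow_le; auto).
  destruct k as [|k].
  { unfold mulL; simpl. rewrite polyL_0. lra. }
  pose proof (IHForall k) as H1; pose proof (IHForall (S k)) as H2.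
  unfold mulL; rewrite ?S_INR in *; simpl pred in *; rewrite polyL_0.
  replace (INR 0) with 0 by reflexivity.
  set (a := polyL l 1%nat) in *; set (c2 := polyL l 2%nat) in *.
  pose proof (pos_INR k) as Hk.
  pose proof (polyL_nonneg l (pred k) H0) as Hp.
  set (u := polyL l (pred k)) in *; set (v := polyL l k) in *;
  set (w := polyL l (S k)) in *; set (y := polyL l (S (S k))) in *.
  assert (Hkk : 0 <= (INR k + 1) * x * (v * 0 + (w - (a * v - INR k * (a ^ 2 - c2) * u)))).
  { apply Rmult_le_pos; [apply Rmult_le_pos; lra|lra]. }
  assert (0 <= (INR k + 1) * x ^ 3 * (INR k * u)).
  { repeat apply Rmult_le_pos; try lra. }
  nra.
Qed.

(* Locally uniform limits of the products [C prod_j (1 + g_j z)], i.e. the Laguerre functions with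
   [f(0) > 0]. *)
Definition LK (c : nat -> R) : Prop :=
  0 < c 0%nat /\
  exists l : nat -> list R, (forall i, nonneg_list (l i)) /\
    forall k, is_lim_seq (fun i => c 0%nat * polyL (l i) k) (c k).

(** The form with finitely many coefficients and one tolerance is what makes closure under limits a
    diagonal argument; going back to a sequence of lists takes a choice for each tolerance
    [1 / (i + 1)]. *)
Lemma LK_approx c : LK c <->
  0 < c 0%nat /\ forall N (eps : posreal), exists l, nonneg_list l /\
    forall k, (k <= N)%nat -> Rabs (c 0%nat * polyL l k - c k) < eps.
Proof.
split; intros [H0 H]; split; auto.
- destruct H as [l [Hl Hlim]]. intros N eps.
  assert (exists n, forall i, (n <= i)%nat -> forall k, (k <= N)%nat ->
    Rabs (c 0%nat * polyL (l i) k - c k) < eps) as [n Hn].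
  { induction N as [|N [n1 IH]].
    - destruct (proj1 (is_lim_seq_eps _ _) (Hlim 0%nat) eps) as [n Hn].
      exists n; intros i Hi k Hk. replace k with 0%nat by lia. apply Hn; auto.
    - destruct (proj1 (is_lim_seq_eps _ _) (Hlim (S N)) eps) as [n Hn].
      exists (max n n1); intros i Hi k Hk.
      destruct (Nat.eq_dec k (S N)) as [->|]; [apply Hn; lia|apply IH; lia]. }
  exists (l n); split; auto.
- destruct (constructive_indefinite_description
    (fun l : nat -> list R => forall i, nonneg_list (l i) /\
      forall k, (k <= i)%nat -> Rabs (c 0%nat * polyL (l i) k - c k) < / (INR i + 1)))
    as [l Hl].
  { assert (Hp : forall i : nat, 0 < / (INR i + 1)).
    { intros; apply Rinv_0_lt_compat. pose proof (pos_INR i); lra. }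
    exists (fun i => proj1_sig (constructive_indefinite_description _ (H i (mkposreal _ (Hp i))))).
    intros i. destruct (constructive_indefinite_description _ _) as [l Hl]; simpl; auto. }
  exists l; split; [intros; apply Hl|].
  intros k. apply is_lim_seq_eps; intros eps.
  destruct (archimed_cor1 eps (cond_pos eps)) as [N [HN HN0]].
  exists (max N k); intros i Hi.
  eapply Rlt_trans; [apply (proj2 (Hl i)); lia|].
  eapply Rle_lt_trans; [|exact HN].
  apply Rinv_le_contravar; [apply lt_0_INR; auto|].
  assert (INR N <= INR i) by (apply le_INR; lia). lra.
Qed.

Lemma LK_ext c d : (forall k, c k = d k) -> LK c -> LK d.
Proof.
intros E [H0 [l [Hl H]]]. split; [rewrite <- E; auto|].
exists l; split; auto. intros k. rewrite <- (E k), <- (E 0%nat). apply H.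
Qed.

Lemma LK_closed (u : nat -> nat -> R) c :
  0 < c 0%nat -> (forall i, LK (u i)) ->
  (forall k, is_lim_seq (fun i => u i k) (c k)) -> LK c.
Proof.
intros H0 Hu Hlim. apply LK_approx; split; auto. intros N eps.
assert (Hn : forall k, is_lim_seq (fun i => c 0%nat * (u i k / u i 0%nat)) (c k)).
{ intros k.
  replace (Finite (c k)) with (Finite (c 0%nat * (c k / c 0%nat))) by (f_equal; field; lra).
  apply is_lim_seq_mult'; [apply is_lim_seq_const|].
  apply is_lim_seq_div'; auto. lra. }
assert (He2 : 0 < eps / 2) by (destruct eps; simpl; lra).
assert (exists n, forall i, (n <= i)%nat -> forall k, (k <= N)%nat ->
    Rabs (c 0%nat * (u i k / u i 0%nat) - c k) < eps / 2) as [n Hn'].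
{ clear - Hn He2. induction N as [|N [n1 IH]].
  - destruct (proj1 (is_lim_seq_eps _ _) (Hn 0%nat) (mkposreal _ He2)) as [n Hn'].
    exists n; intros i Hi k Hk. replace k with 0%nat by lia. apply Hn'; auto.
  - destruct (proj1 (is_lim_seq_eps _ _) (Hn (S N)) (mkposreal _ He2)) as [n Hn'].
    exists (max n n1); intros i Hi k Hk.
    destruct (Nat.eq_dec k (S N)) as [->|]; [apply Hn'; lia|apply IH; lia]. }
destruct (proj1 (LK_approx _) (Hu n)) as [Hp Ha].
(* The polynomial approximates [u n] with leading coefficient [u n 0], but it is to be used with
   [c 0]; the tolerance is rescaled by the quotient of the two. *)
assert (He3 : 0 < u n 0%nat / c 0%nat * (eps / 2)).
{ apply Rmult_lt_0_compat; auto. apply Rdiv_lt_0_compat; auto. }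
destruct (Ha N (mkposreal _ He3)) as [l [Hl Hla]].
exists l; split; auto. intros k Hk.
specialize (Hla k Hk); specialize (Hn' n (le_n _) k Hk); simpl in Hla.
replace (c 0%nat * polyL l k - c k) with
  ((c 0%nat / u n 0%nat) * (u n 0%nat * polyL l k - u n k)
    + (c 0%nat * (u n k / u n 0%nat) - c k)) by (field; lra).
eapply Rle_lt_trans; [apply Rabs_triang|].
rewrite Rabs_mult, (Rabs_pos_eq (c 0%nat / u n 0%nat)).
2: apply Rlt_le, Rdiv_lt_0_compat; auto.
assert (c 0%nat / u n 0%nat * Rabs (u n 0%nat * polyL l k - u n k) < eps / 2).
{ apply Rmult_lt_reg_l with (u n 0%nat / c 0%nat); [apply Rdiv_lt_0_compat; auto|].
  eapply Rle_lt_trans; [|exact Hla]. right; field; split; lra. }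
lra.
Qed.

Section LK_facts.
Variable c : nat -> R.
Hypothesis Hc : LK c.

Lemma LK_pos : 0 < c 0%nat.
Proof. apply Hc. Qed.

Lemma LK_lim : exists l : nat -> list R, (forall i, nonneg_list (l i)) /\
    forall k, is_lim_seq (fun i => polyL (l i) k) (c k / c 0%nat).
Proof.
destruct Hc as [H0 [l [Hl H]]]. exists l; split; auto. intros k.
apply is_lim_seq_ext with (fun i => c 0%nat * polyL (l i) k / c 0%nat).
{ intros; field; lra. }
apply is_lim_seq_div'; auto; [apply is_lim_seq_const|lra].
Qed.

Lemma LK_nonneg k : 0 <= c k.
Proof.
destruct Hc as [H0 [l [Hl H]]].
apply (is_lim_seq_le (fun _ => 0) _ 0 (c k) ) with (3 := H k).
- intros; apply Rmult_le_pos; [lra|apply polyL_nonneg; auto].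
- apply is_lim_seq_const.
Qed.

Lemma LK_le_pow k : c k <= c 0%nat * (c 1%nat / c 0%nat) ^ k.
Proof.
destruct LK_lim as [l [Hl H]]. pose proof LK_pos.
apply Rmult_le_reg_l with (/ c 0%nat); [apply Rinv_0_lt_compat; auto|].
rewrite <- Rmult_assoc, Rinv_l, Rmult_1_l by lra.
replace (/ c 0%nat * c k) with (c k / c 0%nat) by (field; lra).
apply (is_lim_seq_le (fun i => polyL (l i) k) (fun i => polyL (l i) 1%nat ^ k)
  (c k / c 0%nat) ((c 1%nat / c 0%nat) ^ k)).
- intros; apply polyL_le_pow; auto.
- apply H.
- clear - H. induction k; simpl; [apply is_lim_seq_const|].
  apply is_lim_seq_mult'; auto.
Qed.

Lemma LK_turan : c 2%nat / c 0%nat <= (c 1%nat / c 0%nat) ^ 2.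
Proof.
pose proof (LK_le_pow 2) as H. pose proof LK_pos.
apply Rmult_le_reg_l with (c 0%nat); auto.
replace (c 0%nat * (c 2%nat / c 0%nat)) with (c 2%nat) by (field; lra); auto.
Qed.

Lemma LK_cubic :
  0 <= c 3%nat / c 0%nat - 3 * (c 2%nat / c 0%nat) * (c 1%nat / c 0%nat)
       + 2 * (c 1%nat / c 0%nat) ^ 3.
Proof.
destruct LK_lim as [l [Hl H]].
eapply (is_lim_seq_le (fun _ => 0) (fun i => polyL (l i) 3%nat
  - 3 * polyL (l i) 2%nat * polyL (l i) 1%nat
  + 2 * (polyL (l i) 1%nat * (polyL (l i) 1%nat * (polyL (l i) 1%nat * 1)))) 0
  (Finite _)).
- intros; apply polyL_cubic; auto.
- apply is_lim_seq_const.
- pose proof (H 1%nat); pose proof (H 2%nat); pose proof (H 3%nat).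
  apply is_lim_seq_plus'; [apply is_lim_seq_minus'; auto|];
  repeat apply is_lim_seq_mult'; auto; apply is_lim_seq_const.
Qed.

Lemma LK_lower k :
  c 1%nat / c 0%nat * (c k / c 0%nat)
   - INR k * ((c 1%nat / c 0%nat) ^ 2 - c 2%nat / c 0%nat) * (c (pred k) / c 0%nat)
  <= c (S k) / c 0%nat.
Proof.
destruct LK_lim as [l [Hl H]].
eapply (is_lim_seq_le (fun i => polyL (l i) 1%nat * polyL (l i) k
   - INR k * (polyL (l i) 1%nat * (polyL (l i) 1%nat * 1) - polyL (l i) 2%nat)
     * polyL (l i) (pred k))
   (fun i => polyL (l i) (S k)) (Finite _) (Finite _)).
- intros; apply polyL_lower; auto.
- apply is_lim_seq_minus'; [apply is_lim_seq_mult'; auto|].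
  apply is_lim_seq_mult'; auto. apply is_lim_seq_mult'; [apply is_lim_seq_const|].
  apply is_lim_seq_minus'; auto. simpl.
  repeat apply is_lim_seq_mult'; auto; apply is_lim_seq_const.
- auto.
Qed.
End LK_facts.

Lemma LK_polyL m l : 0 < m -> nonneg_list l -> LK (fun k => m * polyL l k).
Proof.
intros Hm Hl; split; [rewrite polyL_0; lra|].
exists (fun _ => l); split; auto. intros k.
rewrite polyL_0, Rmult_1_r. apply is_lim_seq_const.
Qed.

Lemma LK_scal m c : 0 < m -> LK c -> LK (fun k => m * c k).
Proof.
intros Hm [H0 [l [Hl H]]]; split; [apply Rmult_lt_0_compat; auto|].
exists l; split; auto. intros k.
apply is_lim_seq_ext with (fun i => m * (c 0%nat * polyL (l i) k)); [intros; ring|].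
apply is_lim_seq_mult'; auto. apply is_lim_seq_const.
Qed.

(** * Real-rootedness is preserved by 1 + s Delta_theta *)

Definition eval_upto (N : nat) (c : nat -> R) (z : R) : R :=
  sum_f_R0 (fun k => c k / INR (fact k) * z ^ k) N.

Lemma ev_ext N c d z : (forall k, (k <= N)%nat -> c k = d k) -> eval_upto N c z = eval_upto N d z.
Proof. intros H; apply sum_eq; intros; rewrite H; auto. Qed.

Lemma ev_plus N c d z : eval_upto N (fun k => c k + d k) z = eval_upto N c z + eval_upto N d z.
Proof.
unfold eval_upto; induction N; simpl sum_f_R0; [|rewrite IHN]; unfold Rdiv; ring.
Qed.

Lemma ev_scal N m c z : eval_upto N (fun k => m * c k) z = m * eval_upto N c z.
Proof.
unfold eval_upto; induction N; simpl sum_f_R0; [|rewrite IHN]; unfold Rdiv; ring.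
Qed.

Lemma ev_mulL N g c z : eval_upto (S N) (mulL g c) z = eval_upto (S N) c z + g * z * eval_upto N c z.
Proof.
unfold eval_upto, mulL; induction N.
- simpl; field.
- rewrite tech5, IHN. rewrite (tech5 _ (S N)), (tech5 _ N).
  simpl pred. rewrite !fact_simpl, !mult_INR, !S_INR.
  pose proof (pos_INR N). pose proof (lt_0_INR _ (lt_O_fact N)).
  simpl pow. field. repeat split; lra.
Qed.

Lemma ev_zshift N c z :
  eval_upto (S N) (fun k => INR k * c (S k)) z = z * eval_upto N (fun k => c (S (S k))) z.
Proof.
unfold eval_upto; induction N.
- simpl; field.
- rewrite tech5, IHN. rewrite (tech5 _ N).
  rewrite !fact_simpl, !mult_INR, !S_INR.
  pose proof (pos_INR N). pose proof (lt_0_INR _ (lt_O_fact N)).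
  simpl pow. field. repeat split; lra.
Qed.

Definition supp (d : nat) (c : nat -> R) : Prop := forall k, (d < k)%nat -> c k = 0.

Lemma ev_supp d c N z : supp d c -> (d <= N)%nat -> eval_upto N c z = eval_upto d c z.
Proof.
intros H HN; induction HN as [|N HN IH]; auto.
rewrite <- IH. unfold eval_upto. rewrite tech5, (H (S N)) by lia. unfold Rdiv; ring.
Qed.

Lemma supp_polyL l : supp (length l) (polyL l).
Proof.
induction l; intros k Hk; simpl in *.
- destruct k; simpl; auto; lia.
- unfold mulL. rewrite !IHl by lia. ring.
Qed.

Fixpoint lprod (l : list R) (z : R) : R :=
  match l with nil => 1 | g :: l => (1 + g * z) * lprod l z end.
(** The product rule for the first derivative, and below for the second, kept as explicit recursions
    so that signs can be proved by induction on the list. *)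
Fixpoint lprod' (l : list R) (z : R) : R :=
  match l with nil => 0 | g :: l => g * lprod l z + (1 + g * z) * lprod' l z end.
Fixpoint lprod'' (l : list R) (z : R) : R :=
  match l with nil => 0 | g :: l => 2 * g * lprod' l z + (1 + g * z) * lprod'' l z end.

Lemma is_derive_lprod l z : is_derive (lprod l) z (lprod' l z).
Proof.
revert z; induction l; intros z; simpl.
- apply is_derive_ext with (fun _ => 1); [auto|]. apply @is_derive_const.
- auto_derive; [exists (lprod' l z); auto|].
  replace (Derive _ z) with (lprod' l z) by (symmetry; apply is_derive_unique, IHl). ring.
Qed.

Lemma continuity_lprod l : continuity (lprod l) /\ continuity (lprod' l) /\ continuity (lprod'' l).
Proof.
induction l as [|g l [H0 [H1 H2]]]; simpl.
- repeat split; apply continuity_const; red; auto.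
- assert (Hl : continuity (fun z => 1 + g * z)) by
    (apply derivable_continuous; intros z; auto_derive_fun (fun z => 1 + g * z);
     intros; apply ex_derive_Reals_0; auto_derive; auto).
  assert (Hg : forall h, continuity (fun _ : R => h)) by
    (intros; apply continuity_const; red; auto).
  repeat split.
  + apply (continuity_mult (fun z => 1 + g * z)); auto.
  + apply (continuity_plus (fun z => g * lprod l z) (fun z => (1 + g * z) * lprod' l z)).
    * apply (continuity_mult (fun _ => g)); auto.
    * apply (continuity_mult (fun z => 1 + g * z)); auto.
  + apply (continuity_plus (fun z => 2 * g * lprod' l z) (fun z => (1 + g * z) * lprod'' l z)).
    * apply (continuity_mult (fun _ => 2 * g)); auto.
    * apply (continuity_mult (fun z => 1 + g * z)); auto.
Qed.

(** Laguerre's inequality: [(f'/f)' = - sum g^2 / (1 + g z)^2 <= 0]. Multiplied out, it holds at the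
    zeros of [f] as well. *)
Lemma lprod_laguerre l z : lprod l z * lprod'' l z <= lprod' l z ^ 2.
Proof.
induction l as [|g l IH]; simpl lprod; simpl lprod'; simpl lprod''; [lra|].
assert (0 <= (1 + g * z) ^ 2 * (lprod' l z ^ 2 - lprod l z * lprod'' l z)).
{ apply Rmult_le_pos; [apply pow2_ge_0|lra]. }
assert (0 <= (g * lprod l z) ^ 2) by apply pow2_ge_0. nra.
Qed.

Lemma lprod_nonneg l z : nonneg_list l -> 0 <= z ->
  1 <= lprod l z /\ 0 <= lprod' l z /\ 0 <= lprod'' l z.
Proof.
intros Hl Hz; induction Hl as [|g l Hg Hl [I0 [I1 I2]]]; simpl; [lra|].
assert (0 <= g * z) by (apply Rmult_le_pos; auto).
assert (0 <= g * lprod l z) by (apply Rmult_le_pos; lra).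
assert (0 <= g * lprod' l z) by (apply Rmult_le_pos; lra).
repeat split; nra.
Qed.

Lemma ev_polyL l N z : (length l <= N)%nat ->
  eval_upto N (polyL l) z = lprod l z /\ eval_upto N (fun k => polyL l (S k)) z = lprod' l z /\
  eval_upto N (fun k => polyL l (S (S k))) z = lprod'' l z.
Proof.
revert N; induction l as [|g l IH]; intros N HN; simpl in HN.
- assert (Hz : forall c, (forall k, c k = 0) -> forall N, eval_upto N c z = 0).
  { intros c Hc M. unfold eval_upto. induction M; simpl; rewrite Hc; [|rewrite IHM]; unfold Rdiv; ring. }
  simpl polyL. repeat split.
  + rewrite (ev_supp 0); [unfold eval_upto; simpl; field| |lia].
    intros k Hk; destruct k; [lia|auto].
  + apply Hz; auto.
  + apply Hz; auto.
- destruct N as [|N]; [lia|].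
  destruct (IH (S N) ltac:(lia)) as [I0 [I1 I2]].
  destruct (IH N ltac:(lia)) as [J0 [J1 J2]].
  simpl polyL. simpl lprod. simpl lprod'. simpl lprod''. repeat split.
  + rewrite ev_mulL, I0, J0; ring.
  + rewrite (ev_ext _ _ (fun k => mulL g (fun k => polyL l (S k)) k + g * polyL l k)).
    * rewrite ev_plus, ev_scal, ev_mulL, I0, I1, J1; ring.
    * intros k _; unfold mulL; simpl pred; rewrite S_INR.
      destruct k; simpl pred; [simpl|]; ring.
  + rewrite (ev_ext _ _ (fun k => mulL g (fun k => polyL l (S (S k))) k
        + 2 * g * polyL l (S k))).
    * rewrite ev_plus, ev_scal, ev_mulL, I1, I2, J2; ring.
    * intros k _; unfold mulL; simpl pred; rewrite !S_INR.
      destruct k; simpl pred; [simpl|]; ring.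
Qed.

(* coefficients of (1 + s Delta_theta) f *)
Definition euler_step (theta s : R) (c : nat -> R) (k : nat) : R :=
  c k + s * ((INR k + theta) * c (S k)).

Definition stepP (theta s : R) (l : list R) (z : R) : R :=
  lprod l z + s * (theta * lprod' l z + z * lprod'' l z).

Lemma ev_step theta s l N z : (length l <= N)%nat ->
  eval_upto (S N) (euler_step theta s (polyL l)) z = stepP theta s l z.
Proof.
intros HN. unfold euler_step.
rewrite ev_plus, ev_scal.
rewrite (ev_ext _ (fun k => (INR k + theta) * polyL l (S k))
    (fun k => INR k * polyL l (S k) + theta * polyL l (S k)))
  by (intros; ring).
rewrite ev_plus, ev_scal, (ev_zshift N (polyL l)).
destruct (ev_polyL l (S N) z ltac:(lia)) as [-> [-> _]].
destruct (ev_polyL l N z ltac:(lia)) as [_ [_ ->]]. unfold stepP; ring.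
Qed.

Lemma continuity_stepP theta s l : continuity (stepP theta s l).
Proof.
destruct (continuity_lprod l) as [H0 [H1 H2]].
assert (Hg : forall h, continuity (fun _ : R => h)) by
    (intros; apply continuity_const; red; auto).
apply (continuity_plus (lprod l) (fun z => s * (theta * lprod' l z + z * lprod'' l z))); auto.
apply (continuity_mult (fun _ => s)); auto.
apply (continuity_plus (fun z => theta * lprod' l z) (fun z => z * lprod'' l z)).
- apply (continuity_mult (fun _ => theta)); auto.
- apply (continuity_mult (fun z => z)); auto. apply derivable_continuous, derivable_id.
Qed.

Lemma lprod_app l1 l2 z : lprod (l1 ++ l2) z = lprod l1 z * lprod l2 z.
Proof. induction l1; simpl; [ring|rewrite IHl1; ring]. Qed.

Lemma lprod_sign l1 l2 s :
  Forall (fun g => -1 < g * s) l1 -> Forall (fun g => g * s < -1) l2 ->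
  0 < (-1) ^ length l2 * lprod (l1 ++ l2) s.
Proof.
intros H1 H2. rewrite lprod_app.
assert (0 < lprod l1 s).
{ induction H1; simpl; [lra|]. apply Rmult_lt_0_compat; auto; lra. }
assert (0 < (-1) ^ length l2 * lprod l2 s).
{ clear -H2; induction H2; simpl; [lra|]. nra. }
nra.
Qed.

Lemma lprod_root l g : In g l -> g <> 0 -> lprod l (- / g) = 0.
Proof.
intros H Hg; induction l; simpl in *; [tauto|]. destruct H as [->|H].
- replace (1 + g * - / g) with 0 by (field; auto). ring.
- rewrite IHl; auto; ring.
Qed.

(* Rolle: a zero of the derivative between two consecutive zeros. *)
Lemma crit_point l1 g g' l2 : 0 < g ->
  StronglySorted Rlt (l1 ++ g :: g' :: l2) ->
  exists s, s < 0 /\ lprod' (l1 ++ g :: g' :: l2) s = 0 /\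
    Forall (fun x => -1 < x * s) (l1 ++ g :: nil) /\
    Forall (fun x => x * s < -1) (g' :: l2).
Proof.
intros Hg HS. set (l := l1 ++ g :: g' :: l2) in *.
assert (Hs : StronglySorted Rlt (g :: g' :: l2) /\ Forall (fun x => x < g) l1).
{ clear -HS. unfold l in HS. clear l. induction l1; simpl in *; [auto|].
  inversion_clear HS. destruct (IHl1 H) as [A B]. split; auto. constructor; auto.
  rewrite Forall_forall in H0. apply H0, in_or_app; right; left; auto. }
destruct Hs as [Hs Hl1].
inversion_clear Hs as [|? ? Hs' Hgl]. inversion_clear Hs' as [|? ? _ Hg'l].
inversion_clear Hgl as [|? ? Hgg _].
assert (Hlt : - / g < - / g').
{ apply Ropp_lt_contravar, Rinv_lt_contravar; auto; nra. }
destruct (MVT_cor2 (lprod l) (lprod' l) (- / g) (- / g') Hlt) as [s [Hs1 Hs2]].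
{ intros; apply is_derive_Reals, is_derive_lprod. }
rewrite !lprod_root in Hs1; try lra.
2,3: unfold l; apply in_or_app; simpl; auto.
assert (Hs0 : s < 0).
{ apply Rlt_trans with (1 := proj2 Hs2). apply Ropp_lt_gt_0_contravar, Rinv_0_lt_compat; lra. }
assert (E1 : -1 < g * s).
{ replace (-1) with (g * - / g) by (field; lra). apply Rmult_lt_compat_l; lra. }
assert (E2 : g' * s < -1).
{ replace (-1) with (g' * - / g') by (field; lra). apply Rmult_lt_compat_l; lra. }
exists s; repeat split; auto.
- symmetry in Hs1. rewrite Rminus_0_r in Hs1. apply Rmult_integral in Hs1. destruct Hs1; lra.
- apply Forall_app; split.
  + eapply Forall_impl; [|exact Hl1]. intros x Hx; simpl in Hx. nra.
  + constructor; auto.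
- constructor; auto. eapply Forall_impl; [|exact Hg'l]. intros x Hx; simpl in Hx. nra.
Qed.

(** At a critical point the new polynomial equals [f + s0 s f'']. There Laguerre's inequality reads
    [f f'' <= 0], so with [s <= 0] the added term has the sign of [f] or vanishes. *)
Lemma stepP_sign theta s0 l1 l2 s : 0 <= s0 -> s <= 0 ->
  lprod' (l1 ++ l2) s = 0 ->
  Forall (fun g => -1 < g * s) l1 -> Forall (fun g => g * s < -1) l2 ->
  0 < (-1) ^ length l2 * stepP theta s0 (l1 ++ l2) s.
Proof.
intros H0 Hs H1 HA HB. pose proof (lprod_sign l1 l2 s HA HB) as HP.
set (e := (-1) ^ length l2) in *. set (l := l1 ++ l2) in *.
pose proof (lprod_laguerre l s) as HL. rewrite H1 in HL.
unfold stepP. rewrite H1.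
assert (He : e * e = 1).
{ unfold e. rewrite <- Rpow_mult_distr. replace (-1 * -1) with 1 by ring. apply pow1. }
assert (e * lprod l s * (e * lprod'' l s) <= 0) by nra.
assert (e * lprod'' l s <= 0) by nra.
assert (0 <= s0 * (s * (e * lprod'' l s))) by (apply Rmult_le_pos; nra). nra.
Qed.

(** The test points are the critical points between consecutive zeros of [lprod], and 0 as the
    rightmost one. By [stepP_sign] the values at neighbouring test points have opposite signs, so a
    root lies between them. The induction runs over [l2], the factors that are negative at [s]; it
    yields one root fewer than there are factors. *)
Lemma stepP_roots theta s0 : 0 <= s0 -> 0 <= theta -> forall l2 l1 g,
  Forall (fun x => 0 < x) (l1 ++ g :: l2) -> StronglySorted Rlt (l1 ++ g :: l2) ->
  exists s T, s <= 0 /\ Forall (fun x => -1 < x * s) (l1 ++ g :: nil) /\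
    0 < (-1) ^ length l2 * stepP theta s0 (l1 ++ g :: l2) s /\
    length T = length l2 /\ NoDup T /\
    Forall (fun t => s < t < 0 /\ stepP theta s0 (l1 ++ g :: l2) t = 0) T.
Proof.
intros H0 Hth l2; induction l2 as [|g' l2 IH]; intros l1 g Hpos HS.
- exists 0, nil. repeat split; auto; try lra.
  + apply Forall_forall; intros; lra.
  + simpl. destruct (lprod_nonneg (l1 ++ g :: nil) 0) as [A [B D]]; try lra.
    { eapply Forall_impl; [|exact Hpos]; simpl; intros; lra. }
    unfold stepP. assert (0 <= s0 * (theta * lprod' (l1 ++ g :: nil) 0)).
    { repeat apply Rmult_le_pos; auto. } lra.
  + constructor.
- assert (E : l1 ++ g :: g' :: l2 = (l1 ++ g :: nil) ++ g' :: l2) by (rewrite <- app_assoc; auto).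
  assert (Hgp : 0 < g).
  { rewrite Forall_forall in Hpos. apply Hpos, in_or_app; right; left; auto. }
  destruct (crit_point l1 g g' l2 Hgp HS) as [s [Hs [Hs1 [Hs2 Hs3]]]].
  rewrite E in *.
  destruct (IH (l1 ++ g :: nil) g' Hpos HS) as [s' [T [Hs' [HA' [Hq' [HT1 [HT2 HT3]]]]]]].
  pose proof (stepP_sign theta s0 _ _ s H0 (Rlt_le _ _ Hs) Hs1 Hs2 Hs3) as Hq.
  set (l := (l1 ++ g :: nil) ++ g' :: l2) in *.
  assert (Hss : s < s').
  { inversion_clear Hs3. apply Forall_app in HA'. destruct HA' as [_ HA'].
    inversion_clear HA'.
    assert (0 < g').
    { rewrite Forall_forall in Hpos. apply Hpos. unfold l; apply in_or_app; right; left; auto. }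
    nra. }
  assert (Hsgn : stepP theta s0 l s * stepP theta s0 l s' < 0).
  { simpl length in Hq. simpl pow in Hq.
    assert (He : (-1) ^ length l2 * (-1) ^ length l2 = 1).
    { rewrite <- Rpow_mult_distr. replace (-1 * -1) with 1 by ring. apply pow1. }
    set (e := (-1) ^ length l2) in *.
    set (A := stepP theta s0 l s) in *. set (B := stepP theta s0 l s') in *.
    assert (0 < (-1 * e * A) * (e * B)) by (apply Rmult_lt_0_compat; auto).
    replace ((-1 * e * A) * (e * B)) with (- (e * e) * (A * B)) in H by ring.
    rewrite He in H. lra. }
  destruct (IVT_cor (stepP theta s0 l) s s' (continuity_stepP theta s0 l)) as [t [Ht Hqt]]; [lra|lra|].
  assert (t <> s) by (intros ->; rewrite Hqt in Hsgn; lra).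
  assert (t <> s') by (intros ->; rewrite Hqt in Hsgn; lra).
  exists s, (t :: T). simpl length.
  split; [lra|]. split; [auto|]. split; [exact Hq|]. split; [auto|]. split.
  + constructor; auto. intros Hin. rewrite Forall_forall in HT3.
    destruct (HT3 _ Hin); lra.
  + constructor; [repeat split; auto; lra|].
    eapply Forall_impl; [|exact HT3]. intros x [Hx1 Hx2]; split; auto; lra.
Qed.

Fixpoint divL (g : R) (c : nat -> R) (k : nat) : R :=
  match k with O => c O | S k => c (S k) - g * INR (S k) * divL g c k end.

Lemma mulL_divL g c k : mulL g (divL g c) k = c k.
Proof. destruct k; unfold mulL; simpl pred; [simpl; ring|]. change (divL g c (S k)) with (c (S k) - g * INR (S k) * divL g c k). ring. Qed.

(** At [- / g] the partial sums of [(1 + g z)] times the quotient telescope to their top term. So if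
    [c] is a polynomial vanishing there, its formal quotient by [1 + g z] has no coefficients from
    the degree of [c] on. *)
Lemma ev_divL g c N : g <> 0 ->
  eval_upto N c (- / g) = divL g c N / INR (fact N) * (- / g) ^ N.
Proof.
intros Hg. destruct N.
- unfold eval_upto; simpl; ring.
- rewrite (ev_ext _ _ (mulL g (divL g c))) by (intros; now rewrite mulL_divL).
  rewrite ev_mulL. unfold eval_upto at 1. rewrite tech5. fold (eval_upto N (divL g c) (- / g)).
  field. split; [apply INR_fact_neq_0|auto].
Qed.

(** Each root is divided out as a factor [1 + g z] with [g = - / t]. The degree may exceed the
    number of known roots by one: the linear factor left at the end cannot have negative slope,
    because the polynomial is positive on the half-line [z >= 0]. *)
Lemma real_rooted_polyL (T : list R) : Forall (fun t => t < 0) T -> NoDup T ->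
  forall c, supp (S (length T)) c -> 0 < c 0%nat ->
  (forall z, 0 <= z -> 0 < eval_upto (S (length T)) c z) ->
  Forall (fun t => eval_upto (S (length T)) c t = 0) T ->
  exists l, nonneg_list l /\ forall k, c k = c 0%nat * polyL l k.
Proof.
induction T as [|t T IH]; intros HT Hnd c Hsupp Hc0 Hpos Hroots; simpl length in *.
- assert (Hc1 : 0 <= c 1%nat).
  { destruct (Rle_lt_dec 0 (c 1%nat)) as [|Hlt]; auto. exfalso.
    assert (Hz : 0 <= - (c 0%nat / c 1%nat)).
    { apply Rlt_le. replace (- (c 0%nat / c 1%nat)) with (c 0%nat / - c 1%nat) by (field; lra).
      apply Rdiv_lt_0_compat; lra. }
    specialize (Hpos _ Hz). unfold eval_upto in Hpos. simpl in Hpos.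
    field_simplify in Hpos; lra. }
  exists (c 1%nat / c 0%nat :: nil). split.
  { constructor; auto. apply Rmult_le_pos; auto. apply Rlt_le, Rinv_0_lt_compat; auto. }
  intros [|[|k]]; simpl; unfold mulL; simpl.
  + ring.
  + field; lra.
  + rewrite Hsupp by lia. ring.
- inversion_clear HT as [|? ? Ht HT']. inversion_clear Hnd as [|? ? Hnt Hnd'].
  inversion_clear Hroots as [|? ? Hrt Hroots'].
  set (g := - / t). set (d := S (length T)) in *.
  assert (Hg : 0 < g) by (unfold g; apply Ropp_0_gt_lt_contravar, Rinv_lt_0_compat; auto).
  assert (Hgt : t = - / g) by (unfold g; field; lra).
  set (c' := divL g c).
  assert (Hs' : supp d c').
  { intros k Hk. pose proof (ev_divL g c k ltac:(lra)) as E.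
    rewrite (ev_supp (S d)) in E; auto. rewrite Hgt in Hrt. rewrite Hrt in E.
    symmetry in E. apply Rmult_integral in E. destruct E as [E|E].
    - apply Rmult_integral in E. destruct E as [E|E]; auto.
      exfalso. revert E. apply Rinv_neq_0_compat, INR_fact_neq_0.
    - exfalso. revert E. apply pow_nonzero. rewrite <- Hgt; lra. }
  assert (Hev : forall z, eval_upto (S d) c z = (1 + g * z) * eval_upto d c' z).
  { intros z. rewrite (ev_ext _ _ (mulL g c')) by (intros; unfold c'; now rewrite mulL_divL).
    rewrite ev_mulL, (ev_supp d c' (S d)); auto. ring. }
  destruct (IH HT' Hnd' c') as [l [Hl El]]; auto.
  + intros z Hz. specialize (Hpos z Hz). rewrite Hev in Hpos.
    assert (0 < 1 + g * z) by nra.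
    apply Rmult_lt_reg_l with (1 + g * z); auto. lra.
  + rewrite Forall_forall in *. intros x Hx. specialize (Hroots' x Hx).
    rewrite Hev in Hroots'. apply Rmult_integral in Hroots'. destruct Hroots'; auto.
    exfalso. apply Hnt. replace t with x; auto. rewrite Hgt.
    apply Rmult_eq_reg_l with g; [|lra]. rewrite <- Ropp_mult_distr_r, Rinv_r; lra.
  + exists (g :: l); split; [constructor; auto; lra|].
    intros k. rewrite <- (mulL_divL g c k). fold c'. simpl polyL. unfold mulL.
    rewrite (El k), (El (pred k)). change (c' 0%nat) with (c 0%nat). ring.
Qed.

Lemma step_polyL_sorted theta s l : 0 <= theta -> 0 <= s ->
  Forall (fun x => 0 < x) l -> StronglySorted Rlt l ->
  LK (euler_step theta s (polyL l)).
Proof.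
intros Hth Hs Hpos HS.
assert (Hnn : nonneg_list l) by (eapply Forall_impl; [|exact Hpos]; simpl; intros; lra).
assert (Hc0 : 0 < euler_step theta s (polyL l) 0%nat).
{ unfold euler_step. rewrite polyL_0. simpl INR.
  assert (0 <= s * ((0 + theta) * polyL l 1%nat)).
  { repeat apply Rmult_le_pos; auto; try lra. apply polyL_nonneg; auto. } lra. }
assert (exists l', nonneg_list l' /\
   forall k, euler_step theta s (polyL l) k = euler_step theta s (polyL l) 0%nat * polyL l' k) as [l' [Hl' E]].
{ destruct l as [|g l].
  - exists nil; split; [constructor|]. intros k.
    unfold euler_step; simpl polyL. destruct k; simpl; ring.
  - destruct (stepP_roots theta s Hs Hth l nil g Hpos HS) as [s' [T [_ [_ [_ [HT1 [HT2 HT3]]]]]]].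
    simpl app in HT3.
    assert (Hev : forall z, eval_upto (S (length T)) (euler_step theta s (polyL (g :: l))) z = stepP theta s (g :: l) z).
    { intros z. rewrite <- (ev_step theta s (g :: l) (S (length T))) by (simpl; lia).
      symmetry. apply ev_supp; [|lia].
      intros k Hk. unfold euler_step. rewrite !supp_polyL by (simpl; lia). ring. }
    apply (real_rooted_polyL T); auto.
    + eapply Forall_impl; [|exact HT3]; simpl; intros; lra.
    + intros k Hk. unfold euler_step. rewrite !supp_polyL by (simpl; lia). ring.
    + intros z Hz. rewrite Hev. destruct (lprod_nonneg (g :: l) z Hnn Hz) as [A [B D]].
      unfold stepP. assert (0 <= s * (theta * lprod' (g :: l) z + z * lprod'' (g :: l) z)).
      { apply Rmult_le_pos; auto. apply Rplus_le_le_0_compat; apply Rmult_le_pos; auto. } lra.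
    + eapply Forall_impl; [|exact HT3]; simpl; intros x [_ Hx]. rewrite Hev; auto. }
apply LK_ext with (fun k => euler_step theta s (polyL l) 0%nat * polyL l' k); [intros; rewrite (E k); auto|].
apply LK_polyL; auto.
Qed.

Lemma polyL_perm l l' k : Permutation l l' -> polyL l k = polyL l' k.
Proof.
intros H; revert k; induction H; intros k; simpl; auto.
- unfold mulL; rewrite !IHPermutation; auto.
- unfold mulL; ring.
- rewrite IHPermutation1; auto.
Qed.

Lemma sorted_insert x l : StronglySorted Rlt l -> ~ In x l ->
  exists l', Permutation (x :: l) l' /\ StronglySorted Rlt l'.
Proof.
intros H; induction H as [|y l H IH HF]; intros Hin.
- exists (x :: nil); split; auto. repeat constructor.
- destruct (Rlt_le_dec x y) as [Hxy|Hyx].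
  + exists (x :: y :: l); split; auto. constructor; [constructor; auto|].
    constructor; auto. eapply Forall_impl; [|exact HF]. simpl; intros; lra.
  + destruct IH as [l' [HP HSl]]; [simpl in Hin; tauto|].
    exists (y :: l'); split.
    * eapply perm_trans; [apply perm_swap|]. constructor; auto.
    * constructor; auto. apply (Permutation_Forall HP). constructor; auto.
      simpl in Hin. assert (y <> x) by (intros ->; tauto). lra.
Qed.

Lemma fresh_between (l : list R) a b : a < b -> exists x, a < x < b /\ ~ In x l.
Proof.
revert a b; induction l as [|y l IH]; intros a b Hab.
- exists ((a + b) / 2); split; [lra|auto].
- destruct (Rlt_le_dec a y) as [Hy|Hy].
  + destruct (IH a (Rmin y b)) as [x [Hx Hin]]; [apply Rmin_case; auto|].
    assert (x < y /\ x < b) by (split; eapply Rlt_le_trans; try apply Hx; auto using Rmin_l, Rmin_r).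
    exists x; split; [lra|]. simpl; intros [->|]; [lra|auto].
  + destruct (IH a b Hab) as [x [Hx Hin]]. exists x; split; auto.
    simpl; intros [->|]; [lra|auto].
Qed.

(** Rolle's argument needs distinct positive parameters, so every [g], zero included, is moved to a
    slightly larger value not yet in the list. *)
Lemma polyL_sorted_dense l : nonneg_list l ->
  exists L : nat -> list R,
    (forall i, Forall (fun x => 0 < x) (L i) /\ StronglySorted Rlt (L i)) /\
    forall k, is_lim_seq (fun i => polyL (L i) k) (polyL l k).
Proof.
induction 1 as [|g l Hg Hl [L [HL Hlim]]].
- exists (fun _ => nil); split; [repeat constructor|]. intros; apply is_lim_seq_const.
- assert (Hex : forall i : nat, exists x, g < x < g + / (INR i + 1) /\ ~ In x (L i)).
  { intros i. apply fresh_between.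
    assert (0 < / (INR i + 1)) by (apply Rinv_0_lt_compat; pose proof (pos_INR i); lra). lra. }
  set (x := fun i => proj1_sig (constructive_indefinite_description _ (Hex i))).
  assert (Hx : forall i, g < x i < g + / (INR i + 1) /\ ~ In (x i) (L i)).
  { intros i; unfold x. destruct (constructive_indefinite_description _ _); auto. }
  assert (Hex2 : forall i, exists l', Permutation (x i :: L i) l' /\ StronglySorted Rlt l').
  { intros i. apply sorted_insert; apply HL || apply Hx. }
  exists (fun i => proj1_sig (constructive_indefinite_description _ (Hex2 i))). split.
  + intros i. destruct (constructive_indefinite_description _ _) as [l' [HP HSl]]; simpl.
    split; auto. apply (Permutation_Forall HP). constructor; [|apply HL].
    destruct (Hx i); lra.
  + intros k.
    apply is_lim_seq_ext with (fun i => mulL (x i) (polyL (L i)) k).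
    { intros i. destruct (constructive_indefinite_description _ _) as [l' [HP HSl]]; simpl.
      rewrite <- (polyL_perm _ _ k HP). auto. }
    simpl polyL. unfold mulL. apply is_lim_seq_plus'; auto.
    apply is_lim_seq_mult'; auto. apply is_lim_seq_mult'; [|apply is_lim_seq_const].
    apply is_lim_seq_eps. intros eps.
    destruct (archimed_cor1 eps (cond_pos eps)) as [N [HN HN0]].
    exists N; intros i Hi. destruct (Hx i) as [[Ha Hb] _].
    rewrite Rabs_pos_eq by lra.
    assert (/ (INR i + 1) <= / INR N).
    { apply Rinv_le_contravar; [apply lt_0_INR; auto|]. pose proof (le_INR _ _ Hi). lra. }
    lra.
Qed.

Lemma LK_step theta s c : 0 <= theta -> 0 <= s -> LK c -> LK (euler_step theta s c).
Proof.
intros Hth Hs Hc.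
assert (Hpoly : forall l, nonneg_list l -> LK (euler_step theta s (polyL l))).
{ intros l Hl. destruct (polyL_sorted_dense l Hl) as [L [HL Hlim]].
  apply LK_closed with (fun i => euler_step theta s (polyL (L i))).
  - unfold euler_step. rewrite polyL_0.
    assert (0 <= s * ((INR 0 + theta) * polyL l 1%nat)).
    { simpl; repeat apply Rmult_le_pos; try lra. apply polyL_nonneg; auto. } lra.
  - intros; apply step_polyL_sorted; auto; apply HL.
  - intros k. unfold euler_step. apply is_lim_seq_plus'; auto.
    repeat (apply is_lim_seq_mult'; [apply is_lim_seq_const|]). auto. }
destruct (Hc) as [H0 [l [Hl Hlim]]].
apply LK_closed with (fun i k => c 0%nat * euler_step theta s (polyL (l i)) k).
- unfold euler_step. pose proof (LK_nonneg c Hc 1).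
  assert (0 <= s * ((INR 0 + theta) * c 1%nat)).
  { simpl; repeat apply Rmult_le_pos; lra. } lra.
- intros; apply LK_scal; auto.
- intros k. unfold euler_step.
  apply is_lim_seq_ext with (fun i => c 0%nat * polyL (l i) k
    + s * ((INR k + theta) * (c 0%nat * polyL (l i) (S k)))); [intros; ring|].
  apply is_lim_seq_plus'; auto.
  repeat (apply is_lim_seq_mult'; [apply is_lim_seq_const|]). auto.
Qed.

(** * The heat flow on coefficients *)

Fixpoint poch (x : R) (j : nat) : R :=
  match j with O => 1 | S j => poch x j * (x + INR j) end.

Lemma poch_S x j : poch x (S j) = x * poch (x + 1) j.
Proof.
induction j as [|j IH]; [simpl; ring|].
change (poch x (S (S j))) with (poch x (S j) * (x + INR (S j))).
rewrite IH, S_INR. simpl. ring.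
Qed.

Lemma poch_nonneg x j : 0 <= x -> 0 <= poch x j.
Proof.
intros; induction j; simpl; [lra|]. apply Rmult_le_pos; auto. pose proof (pos_INR j); lra.
Qed.

Lemma poch_le x y j : 0 <= x <= y -> poch x j <= poch y j.
Proof.
intros H; induction j; simpl; [lra|]. pose proof (pos_INR j).
apply Rmult_le_compat; try lra. apply poch_nonneg; lra.
Qed.

Lemma poch_pos x j : 0 < x -> 0 < poch x j.
Proof.
intros; induction j; simpl; [lra|]. pose proof (pos_INR j). apply Rmult_lt_0_compat; lra.
Qed.

(** The binomial coefficient of [x + j - 1] over [j], i.e. the coefficient of [s^j] in
    [(1 - s)^(-x)]. *)
Definition gs (x : R) (j : nat) : R := poch x j / INR (fact j).

Lemma gs_S x j : INR (S j) * gs x (S j) = x * gs (x + 1) j.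
Proof.
unfold gs. rewrite poch_S, fact_simpl, mult_INR. field.
split; [apply INR_fact_neq_0|apply not_0_INR; lia].
Qed.

Lemma gs_S' x j : gs x (S j) = gs x j * ((x + INR j) / (INR j + 1)).
Proof.
unfold gs. rewrite fact_simpl, mult_INR, S_INR. simpl poch. field.
pose proof (pos_INR j). split; [lra|apply INR_fact_neq_0].
Qed.

Lemma gs_nonneg x j : 0 <= x -> 0 <= gs x j.
Proof.
intros; apply Rmult_le_pos; [apply poch_nonneg; auto|].
apply Rlt_le, Rinv_0_lt_compat, lt_0_INR, lt_O_fact.
Qed.

Lemma gs_le x y j : 0 <= x <= y -> gs x j <= gs y j.
Proof.
intros; apply Rmult_le_compat_r; [|apply poch_le; auto].
apply Rlt_le, Rinv_0_lt_compat, lt_0_INR, lt_O_fact.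
Qed.

Lemma gs_radius x : 0 < x -> CV_radius (gs x) = 1.
Proof.
intros Hx. rewrite (CV_radius_finite_DAlembert (gs x) 1); [f_equal; lra| |lra|].
- intros n. apply Rgt_not_eq. apply Rdiv_lt_0_compat; [apply poch_pos; auto|].
  apply lt_0_INR, lt_O_fact.
- apply is_lim_seq_ext with (fun n => 1 + (x - 1) * / (INR n + 1)).
  + intros n. pose proof (pos_INR n).
    assert (0 < gs x n).
    { apply Rdiv_lt_0_compat; [apply poch_pos; auto|apply lt_0_INR, lt_O_fact]. }
    rewrite gs_S'. replace (gs x n * _ / gs x n) with ((x + INR n) / (INR n + 1)) by (field; lra).
    rewrite Rabs_pos_eq; [field; lra|]. apply Rmult_le_pos; [lra|].
    apply Rlt_le, Rinv_0_lt_compat; lra.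
  + replace (Finite 1) with (Finite (1 + (x - 1) * 0)) by (f_equal; ring).
    apply is_lim_seq_plus'; [apply is_lim_seq_const|].
    apply is_lim_seq_mult'; [apply is_lim_seq_const|].
    apply is_lim_seq_ext with (fun n => / INR (S n)); [intros; rewrite S_INR; auto|].
    apply is_lim_seq_incr_1 with (u := fun n => / INR n).
    replace (Finite 0) with (Rbar_inv p_infty) by reflexivity.
    apply is_lim_seq_inv; [apply is_lim_seq_INR|discriminate].
Qed.

(** The ratio test wants nonzero terms, which fails at [k = 0]; hence the comparison with the
    parameter [k + 1]. *)
Lemma gs_ex_series k x : 0 <= k -> 0 <= x < 1 -> ex_series (fun j => gs k j * x ^ j).
Proof.
intros Hk Hx.
apply (ex_series_le (K := R_AbsRing) (V := R_CompleteNormedModule)) with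
  (fun j => Rabs (gs (k + 1) j * x ^ j)).
- intros j. unfold norm; simpl; unfold abs; simpl.
  pose proof (pow_le x j (proj1 Hx)).
  rewrite !Rabs_pos_eq; [|apply Rmult_le_pos; auto; apply gs_nonneg; lra..].
  apply Rmult_le_compat_r; auto. apply gs_le; lra.
- apply CV_disk_inside. rewrite gs_radius by lra. simpl. rewrite Rabs_pos_eq; lra.
Qed.

Lemma radius_gt (a : nat -> R) x r : Rabs x < r ->
  ex_series (fun n => Rabs (a n * r ^ n)) -> Rbar_lt (Rabs x) (CV_radius a).
Proof.
intros H1 H2. apply Rbar_lt_le_trans with r; auto.
apply (proj1 (Lub_Rbar_correct (CV_disk a))). exact H2.
Qed.

Lemma gs_radius_gt k x : 0 <= k -> 0 <= x < 1 -> Rbar_lt (Rabs x) (CV_radius (gs k)).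
Proof.
intros Hk Hx. apply radius_gt with ((1 + x) / 2); [rewrite Rabs_pos_eq; lra|].
apply ex_series_ext with (fun j => gs k j * ((1 + x) / 2) ^ j).
- intros j. symmetry; apply Rabs_pos_eq, Rmult_le_pos; [apply gs_nonneg; auto|apply pow_le; lra].
- apply gs_ex_series; lra.
Qed.

(** The series [S] solves [(1 - y) S' = k S], so [S (1 - y)^k] has derivative zero and keeps its
    value 1 at the origin. *)
Lemma gs_sum k x : 0 <= k -> 0 <= x < 1 -> PSeries (gs k) x = Rpower (1 - x) (- k).
Proof.
intros Hk Hx.
set (h := fun y => PSeries (gs k) y * Rpower (1 - y) k).
assert (Hd : forall y, 0 <= y < 1 -> is_derive (PSeries (gs k)) y (k * PSeries (gs k) y / (1 - y))).
{ intros y Hy. pose proof (gs_radius_gt k y Hk Hy) as Hr.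
  replace (k * PSeries (gs k) y / (1 - y)) with (PSeries (PS_derive (gs k)) y);
    [apply is_derive_PSeries; auto|].
  apply Rmult_eq_reg_r with (1 - y); [|lra]. field_simplify; [|lra].
  assert (He : ex_pseries (PS_derive (gs k)) y) by (apply ex_pseries_derive; auto).
  assert (He0 : ex_pseries (gs k) y) by (apply CV_radius_inside; auto).
  replace (- PSeries (PS_derive (gs k)) y * y + PSeries (PS_derive (gs k)) y) with
    (PSeries (PS_minus (PS_derive (gs k)) (PS_incr_1 (PS_derive (gs k)))) y).
  - replace (PSeries (gs k) y * k) with (k * PSeries (gs k) y) by ring.
    rewrite <- PSeries_scal. apply PSeries_ext. intros n.
    destruct n.
    + change (INR 1 * gs k 1 + - 0 = k * gs k 0). rewrite gs_S'. simpl; field.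
    + change (INR (S (S n)) * gs k (S (S n)) + - (INR (S n) * gs k (S n)) = k * gs k (S n)).
      rewrite gs_S', (S_INR (S n)). pose proof (pos_INR (S n)). field. lra.
  - rewrite PSeries_minus; auto; [|apply ex_pseries_incr_1; auto].
    rewrite PSeries_incr_1. ring. }
assert (Hh : forall y, 0 <= y < 1 -> is_derive h y 0).
{ intros y Hy. unfold h.
  assert (E0 : (k * PSeries (gs k) y / (1 - y)) * Rpower (1 - y) k
    + PSeries (gs k) y * (- k * Rpower (1 - y) k / (1 - y)) = 0) by (field; lra).
  rewrite <- E0.
  apply (is_derive_mult (PSeries (gs k)) (fun y => Rpower (1 - y) k)); [auto| |intros; apply Rmult_comm].
  unfold Rpower. auto_derive; [lra|]. unfold Rminus; field. lra. }
assert (E : h x = h 0).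
{ destruct (Req_dec x 0) as [->|Hx0]; auto.
  destruct (MVT_cor2 h (fun _ => 0) 0 x) as [c [Hc _]]; [lra| |lra].
  intros c Hc. apply is_derive_Reals, Hh. lra. }
unfold h in E. rewrite PSeries_0, Rminus_0_r in E.
assert (E1 : Rpower 1 k = 1) by (unfold Rpower; rewrite ln_1, Rmult_0_r, exp_0; auto).
rewrite E1 in E. unfold gs at 2 in E. simpl in E.
rewrite Rpower_Ropp. pose proof (exp_pos (k * ln (1 - x))) as He.
change (exp (k * ln (1 - x))) with (Rpower (1 - x) k) in He.
apply Rmult_eq_reg_r with (Rpower (1 - x) k); [|lra]. rewrite E, Rinv_l; lra.
Qed.

(** For [c k = f^(k)(0)] and [b > 0] this is the bound [A_norm b f <= M]: exponential type at most
    [b]. *)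
Definition expo (M b : R) (c : nat -> R) : Prop := forall k, Rabs (c k) <= M * b ^ k.

(* Coefficients of [exp (s Delta_theta) f]: one has
   [Delta_theta (z^(k+1) / (k+1)!) = (k + theta) z^k / k!]. *)
Definition Flow (theta s : R) (c : nat -> R) (k : nat) : R :=
  PSeries (fun j => gs (INR k + theta) j * c (k + j)%nat) s.

Section FlowSec.
Variable theta : R.
Hypothesis Hth : 0 <= theta.

Lemma order_nonneg k : 0 <= INR k + theta.
Proof. pose proof (pos_INR k); lra. Qed.

Lemma Flow_dom M b c k s : 0 <= b -> 0 <= s -> s * b < 1 -> expo M b c ->
  ex_series (fun j => M * b ^ k * (gs (INR k + theta) j * (s * b) ^ j)) /\
  forall j, Rabs (gs (INR k + theta) j * c (k + j)%nat * s ^ j)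
     <= M * b ^ k * (gs (INR k + theta) j * (s * b) ^ j).
Proof.
intros Hb Hs Hsb Hc. split.
- apply (ex_series_scal (V := R_NormedModule) (M * b ^ k)
    (fun j => gs (INR k + theta) j * (s * b) ^ j)).
  apply gs_ex_series; [apply order_nonneg|]. split; auto. apply Rmult_le_pos; auto.
- intros j. pose proof (gs_nonneg (INR k + theta) j (order_nonneg k)).
  rewrite !Rabs_mult, (Rabs_pos_eq (gs _ _)), (Rabs_pos_eq (s ^ j)); auto using pow_le.
  rewrite Rpow_mult_distr.
  replace (M * b ^ k * (gs (INR k + theta) j * (s ^ j * b ^ j))) with
   (gs (INR k + theta) j * (M * b ^ (k + j)) * s ^ j) by (rewrite pow_add; ring).
  apply Rmult_le_compat_r; auto using pow_le. apply Rmult_le_compat_l; auto.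
Qed.

Lemma Flow_radius M b c k s : 0 <= b -> Rabs s * b < 1 -> expo M b c ->
  Rbar_lt (Rabs s) (CV_radius (fun j => gs (INR k + theta) j * c (k + j)%nat)).
Proof.
intros Hb Hsb Hc. pose proof (Rabs_pos s).
(* A radius slightly beyond [Rabs s] with [r * b < 1] still; dividing by [b + 1] instead of [b]
   covers [b = 0]. *)
set (r := Rabs s + (1 - Rabs s * b) / (2 * (b + 1))).
assert (Hr : Rabs s < r).
{ unfold r. assert (0 < (1 - Rabs s * b) / (2 * (b + 1))) by (apply Rdiv_lt_0_compat; lra). lra. }
assert (Hrb : r * b < 1).
{ unfold r. rewrite Rmult_plus_distr_r.
  assert ((1 - Rabs s * b) / (2 * (b + 1)) * b <= (1 - Rabs s * b) / 2).
  { apply Rmult_le_reg_r with (2 * (b + 1)); [lra|]. field_simplify; lra. } lra. }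
apply radius_gt with r; auto.
destruct (Flow_dom M b c k r) as [He Hle]; auto; [lra|].
apply (ex_series_le (K := R_AbsRing) (V := R_CompleteNormedModule)) with (2 := He).
intros n. unfold norm; simpl; unfold abs; simpl. rewrite Rabs_Rabsolu. apply Hle.
Qed.

(** Termwise differentiation shifts [j], and [gs_S] turns the factor [j + 1] into [k + theta]. This
    is the heat equation on coefficients: the [k]-th coefficient of [Delta_theta f] is
    [(k + theta) f^(k+1)(0)]. *)
Lemma Flow_is_derive M b c k s : 0 <= b -> Rabs s * b < 1 -> expo M b c ->
  is_derive (fun s => Flow theta s c k) s ((INR k + theta) * Flow theta s c (S k)).
Proof.
intros Hb Hs Hc. unfold Flow at 2. rewrite <- PSeries_scal.
rewrite (PSeries_ext _ (PS_derive (fun j => gs (INR k + theta) j * c (k + j)%nat))).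
- apply is_derive_PSeries. eapply Flow_radius; eauto.
- intros n. unfold PS_derive, PS_scal.
  change (scal (INR k + theta) ?x) with ((INR k + theta) * x).
  rewrite <- (Rmult_assoc (INR (S n))), gs_S, Nat.add_succ_r, S_INR.
  replace (INR k + 1 + theta) with (INR k + theta + 1) by ring. simpl; ring.
Qed.

Lemma Flow_0 c k : Flow theta 0 c k = c k.
Proof. unfold Flow. rewrite PSeries_0. unfold gs; simpl. rewrite Nat.add_0_r. field. Qed.

Lemma Flow_scal m s c k : Flow theta s (fun k => m * c k) k = m * Flow theta s c k.
Proof.
unfold Flow. rewrite <- PSeries_scal. apply PSeries_ext; intros.
unfold PS_scal, scal; simpl; unfold mult; simpl; ring.
Qed.

Lemma Flow_ext s c d k : (forall k, c k = d k) -> Flow theta s c k = Flow theta s d k.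
Proof. intros H. apply PSeries_ext; intros; now rewrite H. Qed.

(** In terms of functions, [exp (b z)] flows to [(1 - s b)^(-theta) exp (b z / (1 - s b))]. This
    gives the shape of [f_star] and the comparison function for the bounds below. *)
Lemma Flow_geom b k s : 0 <= b -> 0 <= s -> s * b < 1 ->
  Flow theta s (fun k => b ^ k) k = b ^ k * Rpower (1 - s * b) (- (INR k + theta)).
Proof.
intros Hb Hs Hsb. rewrite <- gs_sum; [|apply order_nonneg|split; auto; apply Rmult_le_pos; auto].
unfold Flow, PSeries. rewrite <- Series_scal_l. apply Series_ext; intros n.
rewrite pow_add, Rpow_mult_distr. ring.
Qed.

Lemma Flow_le M b c d k s : 0 <= b -> 0 <= s -> s * b < 1 -> expo M b d ->
  (forall k, 0 <= c k <= d k) -> Flow theta s c k <= Flow theta s d k.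
Proof.
intros Hb Hs Hsb Hd Hcd. unfold Flow, PSeries. apply Series_le.
- intros n. pose proof (gs_nonneg (INR k + theta) n (order_nonneg k)).
  destruct (Hcd (k + n)%nat). split.
  + apply Rmult_le_pos; [apply Rmult_le_pos|]; auto using pow_le.
  + apply Rmult_le_compat_r; auto using pow_le. apply Rmult_le_compat_l; auto.
- destruct (Flow_dom M b d k s) as [He Hle]; auto.
  apply (ex_series_le (K := R_AbsRing) (V := R_CompleteNormedModule)) with (2 := He).
  intros n. apply Hle.
Qed.

Lemma Flow_bound M b c k s : 0 <= b -> 0 <= s -> s * b < 1 ->
  (forall k, 0 <= c k <= M * b ^ k) ->
  0 <= Flow theta s c k <= M * b ^ k * Rpower (1 - s * b) (- (INR k + theta)).
Proof.
intros Hb Hs Hsb Hc.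
assert (HE : expo M b (fun k => M * b ^ k)).
{ intros j. rewrite Rabs_pos_eq; [lra|]. destruct (Hc j); lra. }
split.
- replace 0 with (Flow theta s (fun _ => 0) k).
  + apply Flow_le with M b; auto.
    * intros j. rewrite Rabs_pos_eq; apply Hc.
    * intros j; destruct (Hc j); lra.
  + rewrite (Flow_ext s _ (fun k => 0 * c k)) by (intros; ring). rewrite Flow_scal; ring.
- rewrite Rmult_assoc, <- Flow_geom, <- Flow_scal; auto. apply Flow_le with M b; auto.
Qed.

Lemma Flow_lower m M b b' c k s : 0 <= m -> 0 <= b -> 0 <= b' -> 0 <= s -> s * b < 1 -> s * b' < 1 ->
  expo M b' c -> (forall k, m * b ^ k <= c k) ->
  m * b ^ k * Rpower (1 - s * b) (- (INR k + theta)) <= Flow theta s c k.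
Proof.
intros Hm Hb Hb' Hs Hsb Hsb' Hc Hmc.
rewrite Rmult_assoc, <- Flow_geom, <- Flow_scal; auto. apply Flow_le with M b'; auto.
intros j; split; auto. apply Rmult_le_pos; auto using pow_le.
Qed.

Lemma Flow_ge M b c k s : 0 <= b -> 0 <= s -> s * b < 1 -> expo M b c ->
  (forall k, 0 <= c k) -> c k <= Flow theta s c k.
Proof.
intros Hb Hs Hsb Hc Hp. unfold Flow, PSeries.
assert (He : ex_series (fun j => gs (INR k + theta) j * c (k + j)%nat * s ^ j)).
{ destruct (Flow_dom M b c k s) as [He Hle]; auto.
  apply (ex_series_le (K := R_AbsRing) (V := R_CompleteNormedModule)) with (2 := He).
  intros n. apply Hle. }
rewrite Series_incr_1; auto. unfold gs at 1. simpl. rewrite Nat.add_0_r.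
assert (0 <= Series (fun j => gs (INR k + theta) (S j) * c (k + S j)%nat * (s * s ^ j))).
{ rewrite <- (Rmult_0_l (Series (fun _ => 0))), <- Series_scal_l. apply Series_le.
  - intros n; split; [lra|]. rewrite Rmult_0_l.
    apply Rmult_le_pos; [apply Rmult_le_pos|apply (pow_le s (S n))]; auto.
    apply gs_nonneg, order_nonneg.
  - apply ex_series_incr_1 in He. exact He. }
lra.
Qed.

Lemma Flow_tannery (u : nat -> nat -> R) (t : nat -> R) (c : nat -> R) (s M b : R) k :
  0 <= b -> (forall i, 0 <= t i) -> is_lim_seq t s -> s * b < 1 ->
  eventually (fun i => expo M b (u i)) ->
  (forall k, is_lim_seq (fun i => u i k) (c k)) ->
  is_lim_seq (fun i => Flow theta (t i) (u i) k) (Flow theta s c k).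
Proof.
intros Hb Ht Hlim Hsb [n0 Hu] Hc.
assert (Hs : 0 <= s).
{ apply (is_lim_seq_le (fun _ => 0) t 0 s); auto. apply is_lim_seq_const. }
(* The times [t i] eventually lie below [r], so one convergent series at time [r] dominates all of
   them. *)
set (r := s + (1 - s * b) / (2 * (b + 1))).
assert (Hr : s < r).
{ unfold r. assert (0 < (1 - s * b) / (2 * (b + 1))) by (apply Rdiv_lt_0_compat; lra). lra. }
assert (Hrb : r * b < 1).
{ unfold r. rewrite Rmult_plus_distr_r.
  assert ((1 - s * b) / (2 * (b + 1)) * b <= (1 - s * b) / 2).
  { apply Rmult_le_reg_r with (2 * (b + 1)); [lra|]. field_simplify; lra. } lra. }
destruct (Flow_dom M b (u n0) k r) as [He _]; auto; [lra|].
apply (Series_tannery (fun i j => gs (INR k + theta) j * u i (k + j)%nat * t i ^ j)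
  (fun j => gs (INR k + theta) j * c (k + j)%nat * s ^ j) _ He).
- assert (Hp : 0 < r - s) by lra.
  destruct (proj1 (is_lim_seq_eps _ _) Hlim (mkposreal _ Hp)) as [n1 Hn1]. simpl in Hn1.
  exists (max n0 n1); intros i Hi j.
  specialize (Hn1 i ltac:(lia)). apply Rabs_def2 in Hn1.
  destruct (Flow_dom M b (u i) k r) as [_ Hle]; auto; try lra; [apply Hu; lia|].
  eapply Rle_trans; [|apply (Hle j)].
  rewrite !Rabs_mult. apply Rmult_le_compat_l; [apply Rmult_le_pos; apply Rabs_pos|].
  rewrite !Rabs_pos_eq; try (apply pow_le; auto; lra). apply pow_incr. split; auto; lra.
- intros j. apply is_lim_seq_mult'.
  + apply is_lim_seq_mult'; auto. apply is_lim_seq_const.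
  + clear -Hlim. induction j; simpl; [apply is_lim_seq_const|]. apply is_lim_seq_mult'; auto.
Qed.

Lemma LK_expo c : LK c -> expo (c 0%nat) (c 1%nat / c 0%nat) c.
Proof.
intros Hc k. rewrite Rabs_pos_eq; [apply LK_le_pow|apply LK_nonneg]; auto.
Qed.

Lemma LK_ratio c : LK c -> 0 <= c 1%nat / c 0%nat.
Proof.
intros Hc. apply Rmult_le_pos; [apply LK_nonneg; auto|].
apply Rlt_le, Rinv_0_lt_compat, LK_pos; auto.
Qed.

(** For sequences in [LK] the first two coefficients control all others, and these two converge; so
    pointwise convergence already supplies the uniform exponential bound that [Flow_tannery] asks
    for. *)
Lemma Flow_LK_lim (u : nat -> nat -> R) (t : nat -> R) (c : nat -> R) (s : R) k :
  eventually (fun i => LK (u i)) -> LK c ->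
  (forall i, 0 <= t i) -> is_lim_seq t s -> s * (c 1%nat / c 0%nat) < 1 ->
  (forall k, is_lim_seq (fun i => u i k) (c k)) ->
  is_lim_seq (fun i => Flow theta (t i) (u i) k) (Flow theta s c k).
Proof.
intros [n0 Hu] Hc Ht Hlim Hsa Hk.
set (a := c 1%nat / c 0%nat) in *. pose proof (LK_ratio c Hc) as Ha. fold a in Ha.
pose proof (LK_pos c Hc) as Hc0.
assert (Hs : 0 <= s).
{ apply (is_lim_seq_le (fun _ => 0) t 0 s); auto. apply is_lim_seq_const. }
set (b := a + (1 - s * a) / (2 * (s + 1))).
assert (Hab : a < b).
{ unfold b. assert (0 < (1 - s * a) / (2 * (s + 1))) by (apply Rdiv_lt_0_compat; lra). lra. }
assert (Hsb : s * b < 1).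
{ unfold b. rewrite Rmult_plus_distr_l.
  assert (s * ((1 - s * a) / (2 * (s + 1))) <= (1 - s * a) / 2).
  { apply Rmult_le_reg_r with (2 * (s + 1)); [lra|]. field_simplify; lra. } lra. }
apply Flow_tannery with (c 0%nat + 1) b; auto; [lra|].
assert (Hp : 0 < b - a) by lra.
assert (Hla : is_lim_seq (fun i => u i 1%nat / u i 0%nat) a).
{ apply is_lim_seq_div'; auto. lra. }
destruct (proj1 (is_lim_seq_eps _ _) Hla (mkposreal _ Hp)) as [n1 Hn1]. simpl in Hn1.
destruct (proj1 (is_lim_seq_eps _ _) (Hk 0%nat) (mkposreal _ Rlt_0_1)) as [n2 Hn2]. simpl in Hn2.
exists (max n0 (max n1 n2)); intros i Hi j.
specialize (Hu i ltac:(lia)). specialize (Hn1 i ltac:(lia)). specialize (Hn2 i ltac:(lia)).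
apply Rabs_def2 in Hn1. apply Rabs_def2 in Hn2.
eapply Rle_trans; [apply LK_expo; auto|].
pose proof (LK_ratio _ Hu). pose proof (LK_pos _ Hu).
apply Rmult_le_compat; try lra; [apply pow_le; auto|]. apply pow_incr; lra.
Qed.

(* Euler's scheme for the flow on polynomials: [euler n j] is the binomial coefficient. *)
Fixpoint euler (n j : nat) : R :=
  match n, j with
  | O, O => 1
  | O, S _ => 0
  | S n, O => euler n O
  | S n, S j => euler n (S j) + euler n j
  end.

Lemma euler_0 n : euler n 0 = 1.
Proof. induction n; simpl; auto. Qed.

Lemma euler_rec n j : INR (S j) * euler n (S j) = (INR n - INR j) * euler n j.
Proof.
revert j; induction n as [|n IH]; intros j.
- destruct j; simpl; ring.
- destruct j.
  + change (euler (S n) 1) with (euler n 1 + euler n 0). rewrite Rmult_plus_distr_l, IH, !euler_0, (S_INR n).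
    simpl; ring.
  + change (euler (S n) (S (S j))) with (euler n (S (S j)) + euler n (S j)).
    change (euler (S n) (S j)) with (euler n (S j) + euler n j).
    pose proof (IH j) as E. pose proof (IH (S j)) as E2.
    rewrite !S_INR in *.
    replace ((INR j + 1 + 1) * (euler n (S (S j)) + euler n (S j))) with
      ((INR j + 1 + 1) * euler n (S (S j)) + ((INR j + 1) * euler n (S j) + euler n (S j))) by ring.
    rewrite E2, E. replace ((INR n + 1 - (INR j + 1)) * (euler n (S j) + euler n j)) with
      ((INR n + 1 - (INR j + 1)) * euler n (S j) + (INR n - INR j) * euler n j) by ring. ring.
Qed.

Lemma euler_lim s j : is_lim_seq (fun n => euler (S n) j * (s / INR (S n)) ^ j) (s ^ j / INR (fact j)).
Proof.
induction j as [|j IH].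
- apply is_lim_seq_ext with (fun _ => 1); [intros; rewrite euler_0; simpl; ring|].
  simpl. replace (1 / 1) with 1 by field. apply is_lim_seq_const.
- apply is_lim_seq_ext with (fun n => (euler (S n) j * (s / INR (S n)) ^ j) *
     (s / INR (S j) * (1 - INR j * / INR (S n)))).
  + intros n. pose proof (euler_rec (S n) j) as E.
    assert (INR (S n) <> 0) by (apply not_0_INR; lia).
    assert (INR (S j) <> 0) by (apply not_0_INR; lia).
    replace (euler (S n) (S j)) with ((INR (S n) - INR j) * euler (S n) j / INR (S j))
      by (rewrite <- E; field; auto).
    change ((s / INR (S n)) ^ S j) with (s / INR (S n) * (s / INR (S n)) ^ j). field; auto.
  + replace (s ^ S j / INR (fact (S j))) with
      (s ^ j / INR (fact j) * (s / INR (S j) * (1 - INR j * 0))).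
    * apply is_lim_seq_mult'; auto.
      apply is_lim_seq_mult'; [apply is_lim_seq_const|].
      apply is_lim_seq_minus'; [apply is_lim_seq_const|].
      apply is_lim_seq_mult'; [apply is_lim_seq_const|].
      apply is_lim_seq_incr_1 with (u := fun n => / INR n).
      replace (Finite 0) with (Rbar_inv p_infty) by reflexivity.
      apply is_lim_seq_inv; [apply is_lim_seq_INR|discriminate].
    * rewrite fact_simpl, mult_INR. simpl pow. field.
      split; [apply INR_fact_neq_0|apply not_0_INR; lia].
Qed.

(** The binomial theorem for [(1 + h Delta_theta)^n]; the [j]-th power of [Delta_theta] sends
    [z^(k+j) / (k+j)!] to [poch (k + theta) j] times [z^k / k!]. *)
Lemma iter_step h c d n k : supp d c ->
  Nat.iter n (euler_step theta h) c k =
  sum_f_R0 (fun j => euler n j * h ^ j * (poch (INR k + theta) j * c (k + j)%nat)) d.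
Proof.
intros Hc. revert k; induction n as [|n IH]; intros k.
- simpl Nat.iter. clear Hc. induction d as [|d IH]; [simpl; rewrite Nat.add_0_r; ring|].
  rewrite tech5, <- IH. simpl; ring.
- change (Nat.iter (S n) (euler_step theta h) c) with (euler_step theta h (Nat.iter n (euler_step theta h) c)).
  unfold euler_step at 1. rewrite !IH.
  replace (h * ((INR k + theta) * _)) with
   (sum_f_R0 (fun j => euler n j * h ^ S j * (poch (INR k + theta) (S j) * c (k + S j)%nat)) d).
  2:{ rewrite <- Rmult_assoc, scal_sum. apply sum_eq; intros j _.
      rewrite poch_S. replace (INR (S k) + theta) with (INR k + theta + 1) by (rewrite S_INR; ring).
      replace (k + S j)%nat with (S k + j)%nat by lia. change (h ^ S j) with (h * h ^ j). ring. }
  (* Pascal's rule summed up to [m] leaves a boundary term, which vanishes at [m = d] because [c] is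
     supported up to [d]. *)
  assert (H : forall m, sum_f_R0 (fun j => euler (S n) j * h ^ j * (poch (INR k + theta) j * c (k + j)%nat)) m
    + euler n m * h ^ S m * (poch (INR k + theta) (S m) * c (k + S m)%nat) =
    sum_f_R0 (fun j => euler n j * h ^ j * (poch (INR k + theta) j * c (k + j)%nat)) m +
    sum_f_R0 (fun j => euler n j * h ^ S j * (poch (INR k + theta) (S j) * c (k + S j)%nat)) m).
  { induction m as [|m IHm].
    - cbn [sum_f_R0]. rewrite !euler_0. simpl; ring.
    - rewrite !tech5.
      change (euler (S n) (S m)) with (euler n (S m) + euler n m).
      match goal with |- ?A + ?B + ?D = _ => transitivity ((A + euler n m * h ^ S m * (poch (INR k + theta) (S m) * c (k + S m)%nat)) + (B - euler n m * h ^ S m * (poch (INR k + theta) (S m) * c (k + S m)%nat)) + D); [ring|rewrite IHm; ring] end. }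
  specialize (H d). rewrite (Hc (k + S d)%nat) in H by lia. lra.
Qed.

Lemma LK_iter_step h c n : 0 <= h -> LK c -> LK (Nat.iter n (euler_step theta h) c).
Proof. intros Hh Hc; induction n; simpl; auto. apply LK_step; auto. Qed.

Lemma Flow_supp s c d k : supp d c ->
  Flow theta s c k = sum_f_R0 (fun j => s ^ j / INR (fact j) * (poch (INR k + theta) j * c (k + j)%nat)) d.
Proof.
intros Hc. unfold Flow, PSeries. rewrite <- sum_n_Reals.
apply is_series_unique.
apply is_series_ext with (fun j => s ^ j / INR (fact j) * (poch (INR k + theta) j * c (k + j)%nat)).
{ intros n. unfold gs. simpl. unfold Rdiv; ring. }
apply filterlim_ext_loc with (fun _ => sum_n (fun j => s ^ j / INR (fact j) * (poch (INR k + theta) j * c (k + j)%nat)) d).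
2: apply filterlim_const.
exists d; intros n Hn. induction Hn as [|n Hn IH]; auto.
rewrite sum_Sn, <- IH, (Hc (k + S n)%nat) by lia. rewrite !Rmult_0_r. symmetry; apply Rplus_0_r.
Qed.

(** On polynomials the flow is the coefficientwise limit of [n + 1] Euler steps of length
    [s / (n + 1)], and each of them preserves [LK]. *)
Lemma LK_Flow_polyL s l : 0 <= s -> nonneg_list l -> LK (Flow theta s (polyL l)).
Proof.
intros Hs Hl. pose proof (supp_polyL l) as Hsupp. set (d := length l) in *.
assert (HL : LK (polyL l)).
{ apply LK_ext with (fun k => 1 * polyL l k); [intros; ring|]. apply LK_polyL; auto; lra. }
apply LK_closed with (fun n => Nat.iter (S n) (euler_step theta (s / INR (S n))) (polyL l)).
- rewrite (Flow_supp s _ d); auto.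
  apply Rlt_le_trans with 1; [lra|].
  assert (forall m, 1 <= sum_f_R0 (fun j => s ^ j / INR (fact j) * (poch (INR 0 + theta) j * polyL l (0 + j)%nat)) m); auto.
  induction m; [simpl; rewrite polyL_0; lra|]. rewrite tech5.
  assert (0 <= s ^ S m / INR (fact (S m)) * (poch (INR 0 + theta) (S m) * polyL l (0 + S m)%nat)).
  { apply Rmult_le_pos; apply Rmult_le_pos; auto using pow_le, polyL_nonneg.
    - apply Rlt_le, Rinv_0_lt_compat, lt_0_INR, lt_O_fact.
    - apply poch_nonneg, order_nonneg. } lra.
- intros n. apply LK_iter_step; auto. apply Rmult_le_pos; auto.
  apply Rlt_le, Rinv_0_lt_compat, lt_0_INR; lia.
- intros k. rewrite (Flow_supp s _ d); auto.
  apply is_lim_seq_ext with (fun n => sum_f_R0 (fun j => euler (S n) j * (s / INR (S n)) ^ j * (poch (INR k + theta) j * polyL l (k + j)%nat)) d).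
  { intros n. symmetry. apply iter_step; auto. }
  generalize d; induction d0; simpl sum_f_R0.
  + apply is_lim_seq_mult'; [apply (euler_lim s 0)|apply is_lim_seq_const].
  + apply is_lim_seq_plus'; auto. apply is_lim_seq_mult'; [apply (euler_lim s (S d0))|apply is_lim_seq_const].
Qed.

Lemma LK_Flow s c : 0 <= s -> LK c -> s * (c 1%nat / c 0%nat) < 1 -> LK (Flow theta s c).
Proof.
intros Hs Hc Hsa. destruct (Hc) as [H0 [l [Hl Hlim]]].
assert (Hu : forall i, LK (fun k => c 0%nat * polyL (l i) k)) by (intros; apply LK_polyL; auto).
apply LK_closed with (fun i => Flow theta s (fun k => c 0%nat * polyL (l i) k)).
- apply Rlt_le_trans with (c 0%nat); auto.
  apply Flow_ge with (c 0%nat) (c 1%nat / c 0%nat); auto using LK_expo, LK_ratio.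
  intros; apply LK_nonneg; auto.
- intros i. apply LK_ext with (fun k => c 0%nat * Flow theta s (polyL (l i)) k).
  + intros; rewrite Flow_scal; auto.
  + apply LK_scal; auto. apply LK_Flow_polyL; auto.
- intros k. apply (Flow_LK_lim (fun i k => c 0%nat * polyL (l i) k) (fun _ => s)); auto.
  + exists 0%nat; auto.
  + apply is_lim_seq_const.
Qed.
End FlowSec.

(** * Riccati comparison for the first two cumulants along the flow *)

Ltac rwD H :=
  let E := fresh in pose proof (is_derive_unique _ _ _ H) as E;
  match type of E with _ = ?r =>
    repeat match goal with |- context [Derive ?f ?x] =>
      let E2 := fresh in assert (E2 : Derive f x = r) by exact E; rewrite !E2; clear E2 end
  end; clear E.

Lemma decreasing_of_derive (g g' : R -> R) (T : R) :
  (forall s, 0 <= s <= T -> is_derive g s (g' s)) ->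
  (forall s, 0 <= s <= T -> g' s <= 0) ->
  forall s t, 0 <= s <= t -> t <= T -> g t <= g s.
Proof.
intros Hd Hn s t Hst Ht. destruct (Req_dec s t) as [->|Hne]; [lra|].
destruct (MVT_cor2 g g' s t) as [c [Hc Hc2]]; [lra| |].
- intros c Hc. apply is_derive_Reals, Hd; lra.
- assert (g' c <= 0) by (apply Hn; lra). nra.
Qed.

(* [a = c_1/c_0] and [b = a^2 - c_2/c_0] along the flow; [q >= 0] is the third cumulant. *)
Section Riccati.
Variables (theta T : R) (a b q : R -> R).
Hypothesis Hth : 0 <= theta.
Hypothesis HT : 0 <= T.
Hypothesis Ha : forall s, 0 <= s <= T -> is_derive a s (a s ^ 2 - (theta + 1) * b s).
Hypothesis Hb : forall s, 0 <= s <= T -> is_derive b s (4 * a s * b s - (theta + 2) * q s).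
Hypothesis Hap : forall s, 0 <= s <= T -> 0 < a s.
Hypothesis Hbp : forall s, 0 <= s <= T -> 0 <= b s.
Hypothesis Hqp : forall s, 0 <= s <= T -> 0 <= q s.
Let A := a 0.
Let B := b 0.
Hypothesis HTA : T * A < 1.

Let D s := 1 - s * A.

Lemma ric_D s : 0 <= s <= T -> 0 < D s <= 1.
Proof.
intros Hs. unfold D. assert (0 < A) by (apply Hap; lra).
assert (s * A <= T * A) by (apply Rmult_le_compat_r; lra).
assert (0 <= s * A) by (apply Rmult_le_pos; lra). lra.
Qed.

Lemma ric_Dd s : is_derive D s (- A).
Proof. unfold D. auto_derive; auto. ring. Qed.

(** From [a' <= a^2] the function [- 1/a - s] is nonincreasing; equality would give the exact
    solution [A / D]. *)
Lemma ric_upper s : 0 <= s <= T -> a s * D s <= A.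
Proof.
intros Hs.
assert (HA : 0 < A) by (apply Hap; lra).
pose proof (decreasing_of_derive (fun s => - / a s - s)
  (fun s => (a s ^ 2 - (theta + 1) * b s) / a s ^ 2 - 1) T) as H.
assert (- / a s - s <= - / a 0 - 0) as H1.
{ apply H; try lra.
  - intros r Hr. pose proof (Hap r Hr). auto_derive.
    + split; [exists (a r ^ 2 - (theta + 1) * b r); auto|split; auto; lra].
    + rwD (Ha r Hr). field; lra.
  - intros r Hr. pose proof (Hap r Hr). pose proof (Hbp r Hr).
    apply Rmult_le_reg_r with (a r ^ 2); [apply pow_lt; auto|].
    replace (((a r ^ 2 - (theta + 1) * b r) / a r ^ 2 - 1) * a r ^ 2)
      with (- ((theta + 1) * b r)) by (field; lra).
    rewrite Rmult_0_l. assert (0 <= (theta + 1) * b r) by (apply Rmult_le_pos; lra). lra. }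
fold A in H1. pose proof (Hap s Hs).
assert (H2 : / A - s <= / a s) by lra.
apply (Rmult_le_compat_r (a s * A)) in H2; [|apply Rmult_le_pos; lra].
replace (/ a s * (a s * A)) with A in H2 by (field; lra).
replace ((/ A - s) * (a s * A)) with (a s * D s) in H2 by (unfold D; field; lra). auto.
Qed.

(** The power [D^4] is the integrating factor of [b' = 4 (A / D) b], the inequality for [b] with [a]
    replaced by its upper bound. *)
Lemma ric_bD_derive s : 0 <= s <= T -> is_derive (fun s => b s * D s ^ 4) s
  ((4 * a s * b s - (theta + 2) * q s) * D s ^ 4 - 4 * A * b s * D s ^ 3).
Proof.
intros Hs. auto_derive.
- split; [eexists; apply Hb; auto|split; [eexists; apply ric_Dd|auto]].
- rwD (Hb s Hs). rwD (ric_Dd s). ring.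
Qed.

Lemma ric_bD_le s : 0 <= s <= T ->
  (4 * a s * b s - (theta + 2) * q s) * D s ^ 4 - 4 * A * b s * D s ^ 3
  <= - 4 * D s ^ 3 * b s * (A - a s * D s).
Proof.
intros Hs. pose proof (Hqp s Hs). destruct (ric_D s Hs).
assert (0 <= (theta + 2) * q s * D s ^ 4).
{ apply Rmult_le_pos; [apply Rmult_le_pos; lra|apply pow_le; lra]. }
simpl in *. nra.
Qed.

Lemma ric_b_decr s t : 0 <= s <= t -> t <= T -> b t * D t ^ 4 <= b s * D s ^ 4.
Proof.
apply (decreasing_of_derive (fun s => b s * D s ^ 4) _ T ric_bD_derive).
intros r Hr. eapply Rle_trans; [apply ric_bD_le; auto|].
pose proof (ric_upper r Hr). pose proof (Hbp r Hr). destruct (ric_D r Hr).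
assert (0 <= D r ^ 3 * b r * (A - a r * D r)).
{ apply Rmult_le_pos; [apply Rmult_le_pos; auto; apply pow_le; lra|lra]. } lra.
Qed.

Lemma ric_b_upper s : 0 <= s <= T -> b s * D s ^ 4 <= B.
Proof.
intros Hs. replace B with (b 0 * D 0 ^ 4) by (unfold D, B; ring).
apply ric_b_decr; lra.
Qed.

(** The auxiliary function [g] vanishes at 0 and, as [(s / D)' = 1 / D^2], has derivative [- (A - a
    D)^2 + (theta + 1) (b D^2 - B / D^2)], which is nonpositive by [b D^4 <= B]. *)
Lemma ric_lower : A * D T - (theta + 1) * B * T / D T <= a T * D T ^ 2.
Proof.
set (g := fun s => A * D s - a s * D s ^ 2 - (theta + 1) * B * (s / D s)).
assert (H : g T <= g 0).
{ apply (decreasing_of_derive g (fun s => - A * A - (a s ^ 2 - (theta + 1) * b s) * D s ^ 2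
     + 2 * A * a s * D s - (theta + 1) * B / D s ^ 2) T); try lra.
  - intros s Hs. destruct (ric_D s Hs). unfold g. auto_derive.
    + repeat split; try lra; [eexists; apply ric_Dd|eexists; apply Ha; auto|eexists; apply ric_Dd..].
    + rwD (Ha s Hs). rwD (ric_Dd s).
      replace (1 * / D s + s * (- (1 * - A) * / (D s * D s))) with (1 / D s ^ 2).
      { field; lra. }
      transitivity ((D s + s * A) / D s ^ 2); [|field; lra].
      replace (D s + s * A) with 1 by (unfold D; ring). auto.
  - intros s Hs. destruct (ric_D s Hs). pose proof (ric_b_upper s Hs) as Hbu.
    assert (0 <= (A - a s * D s) ^ 2) by apply pow2_ge_0.
    assert ((theta + 1) * b s * D s ^ 2 <= (theta + 1) * B / D s ^ 2).
    { apply Rmult_le_reg_r with (D s ^ 2); [apply pow_lt; auto|].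
      replace ((theta + 1) * B / D s ^ 2 * D s ^ 2) with ((theta + 1) * B) by (field; lra).
      replace ((theta + 1) * b s * D s ^ 2 * D s ^ 2) with ((theta + 1) * (b s * D s ^ 4)) by ring.
      apply Rmult_le_compat_l; lra. }
    nra. }
unfold g in H. replace (D 0) with 1 in H by (unfold D; ring).
fold A in H. unfold Rdiv in *. lra.
Qed.

(** The final value of the nonincreasing quantity [b D^4], hence a lower bound for it, and for [b],
    on the whole interval. *)
Let beta := b T * D T ^ 4.

Lemma ric_beta s : 0 <= s <= T -> 0 <= beta <= b s * D s ^ 4 /\ beta <= b s.
Proof.
intros Hs. assert (H0 : 0 <= beta).
{ unfold beta. apply Rmult_le_pos; [apply Hbp; lra|]. apply pow_le.
  destruct (ric_D T); lra. }
assert (H1 : beta <= b s * D s ^ 4) by (apply ric_b_decr; lra).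
repeat split; auto.
apply Rle_trans with (1 := H1). rewrite <- (Rmult_1_r (b s)) at 2.
apply Rmult_le_compat_l; [auto|]. rewrite <- (pow1 4). apply pow_incr.
destruct (ric_D s); auto; lra.
Qed.

(** Because [b >= beta] throughout, the term [- (theta + 1) b] keeps [a] below [A / D] by at least
    [(theta + 1) beta s]. *)
Lemma ric_gap s : 0 <= s <= T -> (theta + 1) * beta * s * D s <= A - a s * D s.
Proof.
intros Hs. set (g := fun s => a s + (theta + 1) * beta * s - A / D s).
assert (H : g s <= g 0).
{ apply (decreasing_of_derive g (fun s => a s ^ 2 - (theta + 1) * b s + (theta + 1) * beta - A * A / D s ^ 2) T); try lra.
  - intros r Hr. destruct (ric_D r Hr). unfold g. auto_derive.
    + repeat split; try lra; [eexists; apply Ha; auto|eexists; apply ric_Dd].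
    + rwD (Ha r Hr). rwD (ric_Dd r). field; lra.
  - intros r Hr. destruct (ric_D r Hr) as [Hd _]. destruct (ric_beta r Hr) as [_ Hbr].
    assert ((theta + 1) * beta <= (theta + 1) * b r) by (apply Rmult_le_compat_l; lra).
    pose proof (ric_upper r Hr). pose proof (Hap r Hr).
    assert (a r ^ 2 <= A * A / D r ^ 2).
    { apply Rmult_le_reg_r with (D r ^ 2); [apply pow_lt; auto|].
      replace (A * A / D r ^ 2 * D r ^ 2) with (A ^ 2) by (field; lra).
      rewrite <- Rpow_mult_distr. apply pow_incr; split; auto. apply Rmult_le_pos; lra. }
    lra. }
unfold g in H. replace (D 0) with 1 in H by (unfold D; ring). fold A in H.
destruct (ric_D s Hs) as [Hd _].
apply Rmult_le_reg_r with (/ D s); [apply Rinv_0_lt_compat; auto|].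
replace ((theta + 1) * beta * s * D s * / D s) with ((theta + 1) * beta * s) by (field; lra).
replace ((A - a s * D s) * / D s) with (A / D s - a s) by (field; lra). lra.
Qed.

(* The quadratic term forces b to 0 along the critical orbit, where the linear bound is not contracting. *)
Lemma ric_strict : beta + 2 * (theta + 1) * beta ^ 2 * T ^ 2 <= B.
Proof.
set (g := fun s => b s * D s ^ 4 + 2 * (theta + 1) * beta ^ 2 * s ^ 2).
assert (H : g T <= g 0).
{ apply (decreasing_of_derive g (fun s => ((4 * a s * b s - (theta + 2) * q s) * D s ^ 4
    - 4 * A * b s * D s ^ 3) + 4 * (theta + 1) * beta ^ 2 * s) T); try lra.
  - intros s Hs. unfold g.
    apply (is_derive_plus (fun s => b s * D s ^ 4) (fun s => 2 * (theta + 1) * beta ^ 2 * s ^ 2));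
      [apply ric_bD_derive; auto|]. auto_derive; auto. ring.
  - intros s Hs. pose proof (ric_bD_le s Hs) as H. pose proof (ric_gap s Hs).
    destruct (ric_beta s Hs) as [[Hb0 Hb1] _]. destruct (ric_D s Hs). pose proof (Hbp s Hs).
    assert (H4 : D s ^ 3 * b s * ((theta + 1) * beta * s * D s) <= D s ^ 3 * b s * (A - a s * D s)).
    { apply Rmult_le_compat_l; auto. apply Rmult_le_pos; auto. apply pow_le; lra. }
    assert (((theta + 1) * beta * s) * beta <= ((theta + 1) * beta * s) * (b s * D s ^ 4)).
    { apply Rmult_le_compat_l; auto. apply Rmult_le_pos; [apply Rmult_le_pos; lra|lra]. }
    replace (-4 * D s ^ 3 * b s * (A - a s * D s)) with (-4 * (D s ^ 3 * b s * (A - a s * D s))) in H by ring.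
    replace (D s ^ 3 * b s * ((theta + 1) * beta * s * D s)) with
      ((theta + 1) * beta * s * (b s * D s ^ 4)) in H4 by ring.
    replace (4 * (theta + 1) * beta ^ 2 * s) with (4 * ((theta + 1) * beta * s * beta)) by ring.
    eapply Rle_trans; [apply Rplus_le_compat_r, H|]. lra. }
unfold g in H. fold beta in H. replace (D 0) with 1 in H by (unfold D; ring).
fold B in H. simpl in *. lra.
Qed.
End Riccati.

Section FlowStep.
Variables (theta T : R) (c : nat -> R).
Hypothesis Hth : 0 <= theta.
Hypothesis HT : 0 <= T.
Hypothesis Hc : LK c.
Hypothesis Hc1 : 0 < c 1%nat.
Definition ra (c : nat -> R) : R := c 1%nat / c 0%nat.
Definition rb (c : nat -> R) : R := (c 1%nat / c 0%nat) ^ 2 - c 2%nat / c 0%nat.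
Hypothesis HTA : T * ra c < 1.

Let u s := Flow theta s c.

Lemma fs_small s : 0 <= s <= T -> Rabs s * ra c < 1.
Proof.
intros Hs. rewrite Rabs_pos_eq by lra. pose proof (LK_ratio c Hc).
eapply Rle_lt_trans; [|exact HTA]. apply Rmult_le_compat_r; lra || auto.
Qed.

Lemma fs_LK s : 0 <= s <= T -> LK (u s).
Proof.
intros Hs. apply LK_Flow; try lra; auto. pose proof (fs_small s Hs) as H.
rewrite Rabs_pos_eq in H; lra || auto.
Qed.

Lemma fs_ge s k : 0 <= s <= T -> c k <= u s k.
Proof.
intros Hs. pose proof (fs_small s Hs) as H. rewrite Rabs_pos_eq in H by lra.
apply Flow_ge with (c 0%nat) (ra c); try lra; auto using LK_expo.
- apply LK_ratio; auto.
- intros; apply LK_nonneg; auto.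
Qed.

Lemma fs_derive s k : 0 <= s <= T ->
  is_derive (fun s => u s k) s ((INR k + theta) * u s (S k)).
Proof.
intros Hs. apply Flow_is_derive with (c 0%nat) (ra c); auto using LK_expo, fs_small.
apply LK_ratio; auto.
Qed.

Lemma fs_ratio_derive s k : 0 <= s <= T ->
  is_derive (fun s => u s k / u s 0%nat) s
    ((INR k + theta) * (u s (S k) / u s 0%nat) - theta * (u s k / u s 0%nat) * ra (u s)).
Proof.
intros Hs. pose proof (LK_pos _ (fs_LK s Hs)).
pose proof (fs_derive s k Hs) as H1. pose proof (fs_derive s 0 Hs) as H2.
evar_last.
- apply (is_derive_div (fun s => u s k) (fun s => u s 0%nat)); [exact H1|exact H2|lra].
- unfold ra. simpl. field; lra.
Qed.

(** The third cumulant of the normalised sequence; for a Laguerre function it equals twice the sum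
    of the [gamma_j^3]. *)
Definition rq (c : nat -> R) : R := c 3%nat / c 0%nat - 3 * (c 2%nat / c 0%nat) * (c 1%nat / c 0%nat)
       + 2 * (c 1%nat / c 0%nat) ^ 3.

Lemma fs_ra_derive s : 0 <= s <= T ->
  is_derive (fun s => ra (u s)) s (ra (u s) ^ 2 - (theta + 1) * rb (u s)).
Proof.
intros Hs. pose proof (fs_ratio_derive s 1 Hs) as H. unfold ra at 1.
replace (_ - (theta + 1) * _) with ((INR 1 + theta) * (u s 2%nat / u s 0%nat) - theta * (u s 1%nat / u s 0%nat) * ra (u s)); auto.
unfold rb, ra. simpl. ring.
Qed.

Lemma fs_rb_derive s : 0 <= s <= T ->
  is_derive (fun s => rb (u s)) s (4 * ra (u s) * rb (u s) - (theta + 2) * rq (u s)).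
Proof.
intros Hs. pose proof (fs_ra_derive s Hs) as H1. pose proof (fs_ratio_derive s 2 Hs) as H2.
change (fun s => rb (u s)) with (fun s => ra (u s) ^ 2 - u s 2%nat / u s 0%nat).
evar_last.
- apply (is_derive_minus (fun s => ra (u s) ^ 2) (fun s => u s 2%nat / u s 0%nat)); [|exact H2].
  apply is_derive_pow, H1.
- unfold minus, plus, opp; simpl. unfold rb, rq, ra. simpl. ring.
Qed.

Lemma rb_nonneg d : LK d -> 0 <= rb d.
Proof. intros Hd. unfold rb. pose proof (LK_turan d Hd). lra. Qed.

Lemma fs_facts :
  (forall s, 0 <= s <= T -> is_derive (fun s => ra (u s)) s (ra (u s) ^ 2 - (theta + 1) * rb (u s))) /\
  (forall s, 0 <= s <= T -> is_derive (fun s => rb (u s)) s (4 * ra (u s) * rb (u s) - (theta + 2) * rq (u s))) /\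
  (forall s, 0 <= s <= T -> 0 < ra (u s)) /\
  (forall s, 0 <= s <= T -> 0 <= rb (u s)) /\
  (forall s, 0 <= s <= T -> 0 <= rq (u s)) /\ ra (u 0) = ra c /\ rb (u 0) = rb c.
Proof.
split; [intros; apply fs_ra_derive; auto|].
split; [intros; apply fs_rb_derive; auto|].
split; [intros s H; pose proof (fs_ge s 1 H); apply Rdiv_lt_0_compat; [lra|apply LK_pos, fs_LK; auto]|].
split; [intros; apply rb_nonneg, fs_LK; auto|].
split; [intros; apply LK_cubic, fs_LK; auto|].
split; unfold ra, rb, u; rewrite !Flow_0; auto.
Qed.

Lemma flow_ra_upper s : 0 <= s <= T -> ra (u s) * (1 - s * ra c) <= ra c.
Proof.
destruct fs_facts as [H1 [H2 [H3 [H4 [H5 [E1 E2]]]]]]. intros Hs.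
pose proof (ric_upper theta T (fun s => ra (u s)) (fun s => rb (u s)) Hth HT H1 H3 H4) as H.
cbv beta in H. rewrite E1 in H. apply H; auto.
Qed.

Lemma flow_ra_lower :
  ra c * (1 - T * ra c) - (theta + 1) * rb c * T / (1 - T * ra c) <= ra (u T) * (1 - T * ra c) ^ 2.
Proof.
destruct fs_facts as [H1 [H2 [H3 [H4 [H5 [E1 E2]]]]]].
pose proof (ric_lower theta T (fun s => ra (u s)) (fun s => rb (u s)) (fun s => rq (u s)) Hth HT H1 H2 H3 H4 H5) as H.
cbv beta in H. rewrite E1, E2 in H. apply H; auto.
Qed.

Lemma flow_rb_strict :
  let be := rb (u T) * (1 - T * ra c) ^ 4 in
  be + 2 * (theta + 1) * be ^ 2 * T ^ 2 <= rb c.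
Proof.
destruct fs_facts as [H1 [H2 [H3 [H4 [H5 [E1 E2]]]]]].
pose proof (ric_strict theta T (fun s => ra (u s)) (fun s => rb (u s)) (fun s => rq (u s)) Hth HT H1 H2 H3 H4 H5) as H.
cbv beta in H. rewrite E1, E2 in H. apply H; auto.
Qed.

End FlowStep.

(** * Powers *)

(** Leibniz's rule for the derivatives of a product at 0, with the binomials split into factorials
    so that it matches the Cauchy product of Taylor series. *)
Definition conv (c d : nat -> R) (k : nat) : R :=
  INR (fact k) *
  sum_f_R0 (fun j => c j / INR (fact j) * (d (k - j)%nat / INR (fact (k - j)))) k.

Lemma conv_ext c c' d d' k : (forall k, c k = c' k) -> (forall k, d k = d' k) ->
  conv c d k = conv c' d' k.
Proof. intros H1 H2. unfold conv. f_equal. apply sum_eq; intros; rewrite H1, H2; auto. Qed.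

Lemma invfact_pos k : 0 < / INR (fact k).
Proof. apply Rinv_0_lt_compat, lt_0_INR, lt_O_fact. Qed.

Lemma conv_le c c' d d' k : (forall k, 0 <= c k <= c' k) -> (forall k, 0 <= d k <= d' k) ->
  0 <= conv c d k <= conv c' d' k.
Proof.
intros H1 H2. unfold conv.
assert (Hf : 0 <= INR (fact k)) by apply pos_INR.
split.
- apply Rmult_le_pos; auto. apply cond_pos_sum. intros j.
  pose proof (invfact_pos j). pose proof (invfact_pos (k - j)).
  destruct (H1 j). destruct (H2 (k - j)%nat).
  apply Rmult_le_pos; apply Rmult_le_pos; lra.
- apply Rmult_le_compat_l; auto. apply sum_Rle. intros j _.
  pose proof (invfact_pos j). pose proof (invfact_pos (k - j)).
  destruct (H1 j). destruct (H2 (k - j)%nat).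
  apply Rmult_le_compat; try (apply Rmult_le_pos; lra); apply Rmult_le_compat_r; lra.
Qed.

Lemma conv_abs c d k : Rabs (conv c d k) <= conv (fun k => Rabs (c k)) (fun k => Rabs (d k)) k.
Proof.
unfold conv. rewrite Rabs_mult, (Rabs_pos_eq (INR _)) by apply pos_INR.
apply Rmult_le_compat_l; [apply pos_INR|].
eapply Rle_trans; [apply Rsum_abs|]. right. apply sum_eq. intros j _.
unfold Rdiv. rewrite !Rabs_mult, !(Rabs_pos_eq (/ _)); auto; apply Rlt_le, invfact_pos.
Qed.

Lemma conv_geom a b k : conv (fun k => a ^ k) (fun k => b ^ k) k = (a + b) ^ k.
Proof.
unfold conv. rewrite binomial, scal_sum. apply sum_eq. intros j Hj.
unfold Binomial.C. field. split; apply INR_fact_neq_0.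
Qed.

Lemma conv_scal m n c d k : conv (fun k => m * c k) (fun k => n * d k) k = m * n * conv c d k.
Proof.
unfold conv. rewrite <- Rmult_assoc, (Rmult_comm (m * n)), Rmult_assoc. f_equal.
rewrite scal_sum. apply sum_eq; intros. unfold Rdiv; ring.
Qed.

Lemma conv_expo M N a b c d : 0 <= a -> 0 <= b -> expo M a c -> expo N b d ->
  expo (M * N) (a + b) (conv c d).
Proof.
intros Ha Hb Hc Hd k. eapply Rle_trans; [apply conv_abs|].
rewrite <- conv_geom, <- conv_scal.
apply conv_le; intros j; split; auto using Rabs_pos.
Qed.

Lemma conv_lower m n a b c d k : 0 <= m -> 0 <= n -> 0 <= a -> 0 <= b ->
  (forall k, m * a ^ k <= c k) -> (forall k, n * b ^ k <= d k) ->
  m * n * (a + b) ^ k <= conv c d k.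
Proof.
intros Hm Hn Ha Hb Hc Hd. rewrite <- conv_geom, <- conv_scal.
apply conv_le; intros j; split; auto; apply Rmult_le_pos; auto using pow_le.
Qed.

Lemma conv_lim (u v : nat -> nat -> R) (c d : nat -> R) k :
  (forall k, is_lim_seq (fun i => u i k) (c k)) ->
  (forall k, is_lim_seq (fun i => v i k) (d k)) ->
  is_lim_seq (fun i => conv (u i) (v i) k) (conv c d k).
Proof.
intros Hu Hv. unfold conv. apply is_lim_seq_mult'; [apply is_lim_seq_const|].
assert (forall n m, is_lim_seq (fun i => sum_f_R0 (fun j => u i j / INR (fact j) * (v i (m - j)%nat / INR (fact (m - j)))) n)
  (sum_f_R0 (fun j => c j / INR (fact j) * (d (m - j)%nat / INR (fact (m - j)))) n)); auto.
intros n m; induction n; simpl sum_f_R0; [|apply is_lim_seq_plus'; auto];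
 (apply is_lim_seq_mult'; apply is_lim_seq_mult'; auto; apply is_lim_seq_const).
Qed.

Lemma conv_oneL d k : conv oneL d k = d k.
Proof.
unfold conv. destruct k; [simpl; field|].
rewrite decomp_sum by lia. simpl pred. rewrite Nat.sub_0_r.
rewrite (sum_eq _ (fun _ => 0)).
- rewrite sum_cte. unfold oneL. simpl (INR (fact 0)). field. apply INR_fact_neq_0.
- intros i _. unfold oneL, Rdiv; ring.
Qed.

Lemma conv_mulL g c d k : conv (mulL g c) d k = mulL g (conv c d) k.
Proof.
unfold mulL at 2. destruct k; [unfold conv, mulL; simpl; field|].
unfold conv. simpl pred.
assert (E : sum_f_R0 (fun j => mulL g c j / INR (fact j) * (d (S k - j)%nat / INR (fact (S k - j)))) (S k)
 = sum_f_R0 (fun j => c j / INR (fact j) * (d (S k - j)%nat / INR (fact (S k - j)))) (S k)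
  + g * sum_f_R0 (fun j => c j / INR (fact j) * (d (k - j)%nat / INR (fact (k - j)))) k).
{ rewrite !(decomp_sum _ (S k)) by lia. simpl pred.
  replace (mulL g c 0) with (c 0%nat) by (unfold mulL; simpl; ring).
  rewrite Rplus_assoc. f_equal.
  rewrite scal_sum, <- sum_plus. apply sum_eq. intros i _.
  change (S k - S i)%nat with (k - i)%nat. unfold mulL. simpl pred.
  rewrite fact_simpl, mult_INR. field.
  repeat split; try apply INR_fact_neq_0. apply not_0_INR; lia. }
rewrite E, Rmult_plus_distr_l. f_equal. rewrite fact_simpl, mult_INR. ring.
Qed.

Lemma conv_polyL l1 l2 k : conv (polyL l1) (polyL l2) k = polyL (l1 ++ l2) k.
Proof.
revert k; induction l1 as [|g l1 IH]; intros k; simpl.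
- apply conv_oneL.
- rewrite conv_mulL. unfold mulL. rewrite !IH; auto.
Qed.

Lemma conv_at0 c d : conv c d 0 = c 0%nat * d 0%nat.
Proof. unfold conv; simpl; field. Qed.
Lemma conv_at1 c d : conv c d 1 = c 1%nat * d 0%nat + c 0%nat * d 1%nat.
Proof. unfold conv; simpl; field. Qed.
Lemma conv_at2 c d : conv c d 2 = c 2%nat * d 0%nat + 2 * c 1%nat * d 1%nat + c 0%nat * d 2%nat.
Proof. unfold conv; simpl; field. Qed.

Lemma LK_conv c d : LK c -> LK d -> LK (conv c d).
Proof.
intros Hc Hd. pose proof (LK_pos _ Hc). pose proof (LK_pos _ Hd).
destruct Hc as [_ [l [Hl Hlim]]]. destruct Hd as [_ [m [Hm Hmim]]].
apply LK_closed with (fun i => conv (fun k => c 0%nat * polyL (l i) k) (fun k => d 0%nat * polyL (m i) k)).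
- rewrite conv_at0. apply Rmult_lt_0_compat; auto.
- intros i. apply LK_ext with (fun k => c 0%nat * d 0%nat * polyL (l i ++ m i) k).
  + intros k. rewrite conv_scal, conv_polyL; auto.
  + apply LK_polyL; [apply Rmult_lt_0_compat; auto|]. apply Forall_app; auto.
- intros k. apply (conv_lim (fun i k => c 0%nat * polyL (l i) k) (fun i k => d 0%nat * polyL (m i) k)); auto.
Qed.

Fixpoint powc (n : nat) (c : nat -> R) : nat -> R :=
  match n with O => oneL | S n => conv c (powc n c) end.

(* Coefficients of [f (s z) ^ n]. *)
Definition Qop (n : nat) (s : R) (c : nat -> R) : nat -> R := powc n (fun k => s ^ k * c k).

Lemma LK_oneL : LK oneL.
Proof.
apply LK_ext with (fun k => 1 * polyL nil k); [intros; simpl; ring|].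
apply LK_polyL; auto; lra.
Qed.

Lemma polyL_scale s l k : s ^ k * polyL l k = polyL (map (Rmult s) l) k.
Proof.
revert k; induction l as [|g l IH]; intros k; simpl.
- destruct k; simpl; ring.
- unfold mulL. rewrite <- !IH. destruct k; simpl pred; simpl; ring.
Qed.

Lemma LK_scale s c : 0 < s -> LK c -> LK (fun k => s ^ k * c k).
Proof.
intros Hs [H0 [l [Hl Hlim]]].
apply LK_closed with (fun i k => c 0%nat * polyL (map (Rmult s) (l i)) k).
- simpl; lra.
- intros i. apply LK_polyL; auto. specialize (Hl i). induction Hl; simpl; constructor; auto.
  apply Rmult_le_pos; lra.
- intros k. apply is_lim_seq_ext with (fun i => s ^ k * (c 0%nat * polyL (l i) k)).
  + intros i. rewrite <- polyL_scale. ring.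
  + apply is_lim_seq_mult'; auto. apply is_lim_seq_const.
Qed.

Lemma LK_powc n c : LK c -> LK (powc n c).
Proof. intros Hc; induction n; simpl; [apply LK_oneL|apply LK_conv; auto]. Qed.

Lemma powc_at0 n c : powc n c 0%nat = c 0%nat ^ n.
Proof. induction n; simpl; auto. rewrite conv_at0, IHn; auto. Qed.

(** Cumulants are Taylor data of the logarithm, hence additive under products; the same holds for
    [rb] below. *)
Lemma powc_ra n c : c 0%nat <> 0 -> ra (powc n c) = INR n * ra c.
Proof.
intros Hc. induction n; [unfold ra; simpl; field; auto|].
rewrite S_INR. assert (Hn : c 0%nat ^ n <> 0) by (apply pow_nonzero; auto).
unfold ra in *. simpl powc. rewrite conv_at0, conv_at1.
rewrite powc_at0 in *.
replace (_ / _) with (c 1%nat / c 0%nat + powc n c 1%nat / c 0%nat ^ n) by (field; auto).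
rewrite IHn. ring.
Qed.

Lemma powc_rb n c : c 0%nat <> 0 -> rb (powc n c) = INR n * rb c.
Proof.
intros Hc. induction n; [unfold rb; simpl; field; auto|].
rewrite S_INR. assert (Hn : c 0%nat ^ n <> 0) by (apply pow_nonzero; auto).
unfold rb in *. simpl powc. rewrite conv_at0, conv_at1, conv_at2.
rewrite powc_at0 in *.
rewrite Rmult_plus_distr_r, Rmult_1_l, <- IHn. field; auto.
Qed.

Lemma powc_expo n M b c : 0 <= b -> expo M b c -> expo (M ^ n) (INR n * b) (powc n c).
Proof.
intros Hb Hc. induction n as [|n IH].
- simpl. intros k. destruct k; simpl; [rewrite Rabs_R1; lra|rewrite Rabs_R0; lra].
- simpl powc. rewrite S_INR.
  replace ((INR n + 1) * b) with (b + INR n * b) by ring.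
  apply (conv_expo M (M ^ n)); auto. apply Rmult_le_pos; auto using pos_INR.
Qed.

Lemma powc_lower n m b c k : 0 <= m -> 0 <= b -> (forall k, m * b ^ k <= c k) ->
  m ^ n * (INR n * b) ^ k <= powc n c k.
Proof.
intros Hm Hb Hc. revert k; induction n as [|n IH]; intros k.
- destruct k; simpl; [lra|]. rewrite !Rmult_0_l, Rmult_0_r. lra.
- rewrite S_INR. replace ((INR n + 1) * b) with (b + INR n * b) by ring.
  simpl. apply conv_lower; auto using pow_le. apply Rmult_le_pos; auto using pos_INR.
Qed.

Lemma powc_geom n m b k : powc n (fun k => m * b ^ k) k = m ^ n * (INR n * b) ^ k.
Proof.
revert k; induction n as [|n IH]; intros k.
- destruct k; simpl; [ring|]. rewrite !Rmult_0_l. ring.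
- rewrite S_INR. replace ((INR n + 1) * b) with (b + INR n * b) by ring.
  change (powc (S n) (fun k => m * b ^ k) k) with (conv (fun k => m * b ^ k) (powc n (fun k => m * b ^ k)) k).
  rewrite (conv_ext _ (fun k => m * b ^ k) _ (fun k => m ^ n * (INR n * b) ^ k)); auto.
  rewrite conv_scal, conv_geom. auto.
Qed.

Lemma powc_lim n (u : nat -> nat -> R) (c : nat -> R) k :
  (forall k, is_lim_seq (fun i => u i k) (c k)) ->
  is_lim_seq (fun i => powc n (u i) k) (powc n c k).
Proof.
intros Hu. revert k; induction n as [|n IH]; intros k; simpl; [apply is_lim_seq_const|].
apply conv_lim; auto.
Qed.

Lemma powc_ext n c d k : (forall k, c k = d k) -> powc n c k = powc n d k.
Proof. intros H; revert k; induction n; intros k; simpl; auto. apply conv_ext; auto. Qed.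

Lemma LK_Qop n s c : 0 < s -> LK c -> LK (Qop n s c).
Proof. intros; apply LK_powc, LK_scale; auto. Qed.

Lemma Qop_at0 n s c : Qop n s c 0%nat = c 0%nat ^ n.
Proof. unfold Qop. rewrite powc_at0. simpl. rewrite Rmult_1_l; auto. Qed.

Lemma Qop_ra n s c : c 0%nat <> 0 -> ra (Qop n s c) = INR n * s * ra c.
Proof.
intros H. unfold Qop. rewrite powc_ra by (simpl; lra). unfold ra; simpl. field; auto.
Qed.

Lemma Qop_rb n s c : c 0%nat <> 0 -> rb (Qop n s c) = INR n * s ^ 2 * rb c.
Proof.
intros H. unfold Qop. rewrite powc_rb by (simpl; lra). unfold rb; simpl. field; auto.
Qed.

Lemma Qop_expo n s M b c : 0 < s -> 0 <= b -> expo M b c ->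
  expo (M ^ n) (INR n * s * b) (Qop n s c).
Proof.
intros Hs Hb Hc. rewrite Rmult_assoc. apply powc_expo; [apply Rmult_le_pos; lra|].
intros k. rewrite Rabs_mult, (Rabs_pos_eq (s ^ k)) by (apply pow_le; lra).
rewrite Rpow_mult_distr. replace (M * (s ^ k * b ^ k)) with (s ^ k * (M * b ^ k)) by ring.
apply Rmult_le_compat_l; auto. apply pow_le; lra.
Qed.

Lemma Qop_lower n s m b c k : 0 < s -> 0 <= m -> 0 <= b -> (forall k, m * b ^ k <= c k) ->
  m ^ n * (INR n * s * b) ^ k <= Qop n s c k.
Proof.
intros Hs Hm Hb Hc. rewrite Rmult_assoc. apply powc_lower; auto; [apply Rmult_le_pos; lra|].
intros j. rewrite Rpow_mult_distr. replace (m * (s ^ j * b ^ j)) with (s ^ j * (m * b ^ j)) by ring.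
apply Rmult_le_compat_l; auto. apply pow_le; lra.
Qed.

Lemma Qop_geom n s m b k : Qop n s (fun k => m * b ^ k) k = m ^ n * (INR n * s * b) ^ k.
Proof.
unfold Qop. rewrite (powc_ext _ _ (fun k => m * (s * b) ^ k)).
- rewrite powc_geom, Rmult_assoc; auto.
- intros j. rewrite Rpow_mult_distr; ring.
Qed.

Lemma Qop_lim n s (u : nat -> nat -> R) (c : nat -> R) k :
  (forall k, is_lim_seq (fun i => u i k) (c k)) ->
  is_lim_seq (fun i => Qop n s (u i) k) (Qop n s c k).
Proof.
intros Hu. apply (powc_lim n (fun i k => s ^ k * u i k)).
intros; apply is_lim_seq_mult'; auto. apply is_lim_seq_const.
Qed.

Lemma powc_scal n m c k : powc n (fun k => m * c k) k = m ^ n * powc n c k.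
Proof.
revert k; induction n as [|n IH]; intros k; [simpl; ring|].
change (powc (S n) (fun k => m * c k) k) with (conv (fun k => m * c k) (powc n (fun k => m * c k)) k).
rewrite (conv_ext _ (fun k => m * c k) _ (fun k => m ^ n * powc n c k)); auto.
rewrite conv_scal. auto.
Qed.

Lemma Qop_scal n s m c k : Qop n s (fun k => m * c k) k = m ^ n * Qop n s c k.
Proof.
unfold Qop. rewrite <- powc_scal. apply powc_ext. intros; ring.
Qed.

Lemma LK_geom a : 0 <= a -> LK (fun k => a ^ k).
Proof.
intros Ha.
(* exp (a z) is the limit of (1 + a z / n)^n *)
apply LK_closed with (fun n => polyL (repeat (a / INR (S n)) (S n))).
- simpl; lra.
- intros n. apply LK_ext with (fun k => 1 * polyL (repeat (a / INR (S n)) (S n)) k); [intros; ring|].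
  apply LK_polyL; [lra|]. apply Forall_forall. intros x Hx. apply repeat_spec in Hx. subst.
  apply Rmult_le_pos; auto. apply Rlt_le, Rinv_0_lt_compat, lt_0_INR; lia.
- intros k.
  assert (E : forall g n k, polyL (repeat g n) k = euler n k * g ^ k * INR (fact k)).
  { clear. intros g n. induction n as [|n IH]; intros k.
    - destruct k; simpl; ring.
    - simpl repeat. simpl polyL. unfold mulL. rewrite !IH. destruct k.
      + simpl. ring.
      + simpl pred. change (euler (S n) (S k)) with (euler n (S k) + euler n k).
        rewrite fact_simpl, mult_INR. simpl pow. ring. }
  apply is_lim_seq_ext with (fun n => euler (S n) k * (a / INR (S n)) ^ k * INR (fact k)).
  { intros; symmetry; apply E. }
  replace (a ^ k) with (a ^ k / INR (fact k) * INR (fact k)) by (field; apply INR_fact_neq_0).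
  apply is_lim_seq_mult'; [apply euler_lim|apply is_lim_seq_const].
Qed.

Lemma ex_series_mul (c : R) (u : nat -> R) : ex_series u -> ex_series (fun n => c * u n).
Proof. exact (ex_series_scal_l (V := R_NormedModule) c u). Qed.

Lemma Cmod_le_sum (z : C) : Cmod z <= Rabs (Re z) + Rabs (Im z).
Proof.
rewrite <- (Rabs_pos_eq (Rabs (Re z) + Rabs (Im z))) by (apply Rplus_le_le_0_compat; apply Rabs_pos).
unfold Cmod. rewrite <- sqrt_Rsqr_abs. apply sqrt_le_1_alt. unfold Rsqr, Re, Im.
pose proof (Rabs_pos (fst z)). pose proof (Rabs_pos (snd z)).
rewrite <- (pow2_abs (fst z)), <- (pow2_abs (snd z)). nra.
Qed.

Lemma im_le_Cmod (z : C) : Rabs (Im z) <= Cmod z.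
Proof. eapply Rle_trans; [apply Rmax_r|apply Rmax_Cmod]. Qed.

(** * Taylor expansion of entire functions *)

(** Complex differentiability with explicit moduli, suited to estimates; [cdiff_is_derive] links it
    to the filter definition. *)
Definition cdiff (f : C -> C) (z l : C) : Prop :=
  forall eps, 0 < eps -> exists d, 0 < d /\
    forall h, Cmod h < d -> Cmod (f (z + h) - f z - l * h)%C <= eps * Cmod h.

Lemma cdiff_is_derive f z l : cdiff f z l <->
  is_derive (K := C_AbsRing) (V := C_NormedModule) f z l.
Proof.
split; intros H.
- split; [apply is_linear_scal_l|]. intros x Hx eps.
  pose proof (@is_filter_lim_locally_unique C_AbsRing (AbsRing_NormedModule C_AbsRing) z x Hx) as Ex.
  rewrite <- Ex. clear x Hx Ex.
  destruct (H eps (cond_pos eps)) as [d [Hd Hd2]].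
  exists (mkposreal d Hd).
  assert (G : forall y : C, Cmod (y - z)%C < d ->
    Cmod (f y - f z - (y - z) * l)%C <= eps * Cmod (y - z)%C).
  { intros y Hy. specialize (Hd2 (y - z)%C Hy).
    replace (z + (y - z))%C with y in Hd2 by ring.
    replace ((y - z) * l)%C with (l * (y - z))%C by ring. exact Hd2. }
  exact G.
- intros eps Heps. destruct H as [_ H].
  specialize (H z (fun P HP => HP) (mkposreal eps Heps)).
  destruct H as [d Hd]. exists d; split; [apply cond_pos|]. intros h Hh.
  specialize (Hd (z + h)%C).
  change (Cmod (z + h - z)%C < d ->
    Cmod (f (z + h) - f z - (z + h - z) * l)%C <= eps * Cmod (z + h - z)%C) in Hd.
  replace (z + h - z)%C with h in Hd by ring.
  replace (h * l)%C with (l * h)%C in Hd by ring. apply Hd, Hh.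
Qed.

Definition Cser (u : nat -> C) : C :=
  (Series (fun n => Re (u n)), Series (fun n => Im (u n))).

Definition csum (u : nat -> C) : Prop := ex_series (fun n => Cmod (u n)).

Lemma csum_le u (B : nat -> R) : ex_series B -> (forall n, Cmod (u n) <= B n) -> csum u.
Proof.
intros HB Hu. apply (ex_series_le (K := R_AbsRing) (V := R_CompleteNormedModule)) with B; auto.
intros n. unfold norm; simpl; unfold abs; simpl. rewrite Rabs_pos_eq by apply Cmod_ge_0. auto.
Qed.

Lemma csum_comp u : csum u ->
  (ex_series (fun n => Rabs (Re (u n))) /\ ex_series (fun n => Re (u n))) /\
  (ex_series (fun n => Rabs (Im (u n))) /\ ex_series (fun n => Im (u n))).
Proof.
intros H. repeat split;
apply (ex_series_le (K := R_AbsRing) (V := R_CompleteNormedModule)) with (2 := H);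
intros n; unfold norm; simpl; unfold abs; simpl; rewrite ?Rabs_Rabsolu; auto using re_le_Cmod, im_le_Cmod.
Qed.

(** Real and imaginary parts are estimated separately, whence the factor 2, which is harmless in the
    uses below. *)
Lemma Cser_bound u (B : nat -> R) : ex_series B -> (forall n, Cmod (u n) <= B n) ->
  Cmod (Cser u) <= 2 * Series B.
Proof.
intros HB Hu. pose proof (csum_le u B HB Hu) as H.
destruct (csum_comp u H) as [[H1 H2] [H3 H4]].
eapply Rle_trans; [apply Cmod_le_sum|]. unfold Cser; simpl Re; simpl Im.
assert (Rabs (Series (fun n => Re (u n))) <= Series B).
{ eapply Rle_trans; [apply Series_Rabs; auto|]. apply Series_le; auto.
  intros n; split; [apply Rabs_pos|]. eapply Rle_trans; [apply re_le_Cmod|auto]. }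
assert (Rabs (Series (fun n => Im (u n))) <= Series B).
{ eapply Rle_trans; [apply Series_Rabs; auto|]. apply Series_le; auto.
  intros n; split; [apply Rabs_pos|]. eapply Rle_trans; [apply im_le_Cmod|auto]. }
lra.
Qed.

Lemma Cser_ext u v : (forall n, u n = v n) -> Cser u = Cser v.
Proof. intros H. unfold Cser. f_equal; apply Series_ext; intros; rewrite H; auto. Qed.

Lemma Cser_plus u v : csum u -> csum v -> Cser (fun n => u n + v n)%C = (Cser u + Cser v)%C.
Proof.
intros Hu Hv. destruct (csum_comp _ Hu) as [[_ H1] [_ H2]]. destruct (csum_comp _ Hv) as [[_ H3] [_ H4]].
unfold Cser, Cplus; simpl. f_equal; rewrite <- Series_plus; auto.
Qed.

Lemma Cser_scal c u : csum u -> Cser (fun n => c * u n)%C = (c * Cser u)%C.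
Proof.
intros Hu. destruct (csum_comp _ Hu) as [[_ H1] [_ H2]].
unfold Cser, Cmult; simpl. destruct c as [x y]; simpl. f_equal.
- rewrite <- !Series_scal_l. rewrite <- Series_minus; auto.
  + apply ex_series_mul; auto.
  + apply ex_series_mul; auto.
- rewrite <- !Series_scal_l. rewrite <- Series_plus; auto.
  + apply ex_series_mul; auto.
  + apply ex_series_mul; auto.
Qed.

Lemma csum_plus u v : csum u -> csum v -> csum (fun n => u n + v n)%C.
Proof.
intros Hu Hv. eapply csum_le; [exact (ex_series_plus _ _ Hu Hv)|].
intros; apply Cmod_triangle.
Qed.

Lemma csum_scal c u : csum u -> csum (fun n => c * u n)%C.
Proof.
intros Hu. apply ex_series_ext with (fun n => Cmod c * Cmod (u n)).
- intros; rewrite Cmod_mult; auto.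
- apply (ex_series_mul (Cmod c)); auto.
Qed.

Lemma Cser_incr u : csum u -> Cser u = (u O + Cser (fun n => u (S n)))%C.
Proof.
intros Hu. destruct (csum_comp _ Hu) as [[_ H1] [_ H2]].
unfold Cser, Cplus; simpl. f_equal; rewrite Series_incr_1; auto.
Qed.

Lemma csum_incr u : csum u <-> csum (fun n => u (S n)).
Proof. unfold csum. split; intros H; [apply ex_series_incr_1 in H|apply ex_series_incr_1]; auto. Qed.

Definition Tay (a : nat -> C) (z : C) : C :=
  Cser (fun k => a k * RtoC (/ INR (fact k)) * Cpow z k)%C.

(** For [rho > 0], the series [Tay a] then has radius of convergence at least [1 / rho]. *)
Definition geom_bd (rho : R) (a : nat -> C) : Prop :=
  exists M, forall k, Cmod (a k) <= M * rho ^ k * INR (fact k).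

Lemma bd_le r s a : 0 <= r <= s -> geom_bd r a -> geom_bd s a.
Proof.
intros Hr [M HM]. exists M. intros k. eapply Rle_trans; [apply HM|].
assert (0 <= M).
{ specialize (HM 0%nat). simpl in HM. pose proof (Cmod_ge_0 (a 0%nat)). lra. }
apply Rmult_le_compat_r; [apply pos_INR|]. apply Rmult_le_compat_l; auto. apply pow_incr; auto.
Qed.

Lemma Tay_term_le rho M a z k : (forall k, Cmod (a k) <= M * rho ^ k * INR (fact k)) ->
  Cmod (a k * RtoC (/ INR (fact k)) * Cpow z k)%C <= M * (Cmod z * rho) ^ k.
Proof.
intros H. rewrite !Cmod_mult, Cmod_pow, Cmod_R, Rabs_pos_eq by apply Rlt_le, invfact_pos.
pose proof (invfact_pos k). pose proof (Cmod_ge_0 z).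
replace (M * (Cmod z * rho) ^ k) with ((M * rho ^ k * INR (fact k)) * / INR (fact k) * Cmod z ^ k).
- apply Rmult_le_compat_r; auto using pow_le. apply Rmult_le_compat_r; [lra|auto].
- rewrite Rpow_mult_distr. field. apply INR_fact_neq_0.
Qed.

Lemma geom_ex M x : Rabs x < 1 -> ex_series (fun k => M * x ^ k).
Proof. intros H. apply (ex_series_mul M). apply ex_series_geom; auto. Qed.

Lemma Tay_csum rho a z : 0 <= rho -> Cmod z * rho < 1 -> geom_bd rho a ->
  csum (fun k => a k * RtoC (/ INR (fact k)) * Cpow z k)%C.
Proof.
intros Hr Hz [M HM]. apply csum_le with (fun k => M * (Cmod z * rho) ^ k).
- apply geom_ex. rewrite Rabs_pos_eq; auto. apply Rmult_le_pos; auto using Cmod_ge_0.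
- intros; apply Tay_term_le; auto.
Qed.

(** Bounds the weight [k^2] of the second-order remainder of [z^k] by [2 * gs 3 k], whose power
    series is known to converge. *)
Lemma gs3 k : gs 3 k = (INR k + 1) * (INR k + 2) / 2.
Proof.
induction k as [|k IH]; [unfold gs; simpl; field|].
rewrite gs_S', IH, S_INR. pose proof (pos_INR k). field. lra.
Qed.

(** The quadratic Taylor remainder of a monomial on a disc. The factor [r^2] on the left avoids the
    exponent [k - 2]. *)
Lemma Cpow_taylor z h r k : Cmod z <= r -> Cmod (z + h)%C <= r ->
  r ^ 2 * Cmod (Cpow (z + h) k - Cpow z k - RtoC (INR k) * Cpow z (pred k) * h)%C
  <= INR k ^ 2 * r ^ k * Cmod h ^ 2.
Proof.
intros Hz Hzh. assert (Hr : 0 <= r) by (eapply Rle_trans; [apply Cmod_ge_0|exact Hz]).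
pose proof (Cmod_ge_0 h) as Hh.
induction k as [|k IH].
- simpl Cpow. simpl INR. replace (_ - _ - _)%C with (RtoC 0) by ring.
  rewrite Cmod_0. simpl; nra.
- set (D := (Cpow (z + h) k - Cpow z k - RtoC (INR k) * Cpow z (pred k) * h)%C) in *.
  assert (E : (Cpow (z + h) (S k) - Cpow z (S k) - RtoC (INR (S k)) * Cpow z (pred (S k)) * h
    = (z + h) * D + RtoC (INR k) * Cpow z (pred k) * (h * h))%C).
  { unfold D. simpl pred. rewrite S_INR, RtoC_plus.
    destruct k; simpl Cpow; simpl pred; [simpl INR|]; ring. }
  rewrite E. clear E.
  eapply Rle_trans; [apply Rmult_le_compat_l; [apply pow2_ge_0|apply Cmod_triangle]|].
  rewrite !Cmod_mult, Cmod_pow, Cmod_R, (Rabs_pos_eq (INR k)) by apply pos_INR.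
  pose proof (Cmod_ge_0 D) as HD.
  assert (H1 : r ^ 2 * (Cmod (z + h) * Cmod D) <= r * (INR k ^ 2 * r ^ k * Cmod h ^ 2)).
  { apply Rle_trans with (r * (r ^ 2 * Cmod D)); [|apply Rmult_le_compat_l; auto].
    replace (r ^ 2 * (Cmod (z + h) * Cmod D)) with (Cmod (z + h) * (r ^ 2 * Cmod D)) by ring.
    apply Rmult_le_compat_r; auto. apply Rmult_le_pos; auto. apply pow2_ge_0. }
  assert (H2 : r ^ 2 * (INR k * Cmod z ^ pred k * (Cmod h * Cmod h)) <= INR k * r ^ S k * Cmod h ^ 2).
  { destruct k; [simpl; lra|]. simpl pred.
    replace (r ^ 2 * (INR (S k) * Cmod z ^ k * (Cmod h * Cmod h))) with
      (INR (S k) * (r ^ 2 * Cmod z ^ k) * Cmod h ^ 2) by ring.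
    apply Rmult_le_compat_r; [apply pow2_ge_0|]. apply Rmult_le_compat_l; [apply pos_INR|].
    replace (r ^ S (S k)) with (r ^ 2 * r ^ k) by (simpl; ring).
    apply Rmult_le_compat_l; [apply pow2_ge_0|]. apply pow_incr; split; auto using Cmod_ge_0. }
  rewrite Rmult_plus_distr_l. eapply Rle_trans; [apply Rplus_le_compat; [exact H1|exact H2]|].
  rewrite S_INR. pose proof (pos_INR k).
  replace (r * (INR k ^ 2 * r ^ k * Cmod h ^ 2) + INR k * r ^ S k * Cmod h ^ 2) with
    ((INR k ^ 2 + INR k) * (r ^ S k * Cmod h ^ 2)) by (simpl; ring).
  replace ((INR k + 1) ^ 2 * r ^ S k * Cmod h ^ 2) with ((INR k + 1) ^ 2 * (r ^ S k * Cmod h ^ 2)) by ring.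
  apply Rmult_le_compat_r; [|nra]. apply Rmult_le_pos; auto using pow_le, pow2_ge_0.
Qed.

(** Shifting costs a factor [k + 1], which Bernoulli's inequality absorbs into [(s / r)^k]; hence
    the strict inequality between the two rates. *)
Lemma bd_shift r s a : 0 <= r < s -> geom_bd r a -> geom_bd s (fun k => a (S k)).
Proof.
intros Hr [M HM].
assert (HM0 : 0 <= M).
{ specialize (HM 0%nat). simpl in HM. pose proof (Cmod_ge_0 (a 0%nat)). lra. }
destruct (Req_dec r 0) as [->|Hr0].
{ exists 0. intros k. specialize (HM (S k)). simpl pow in HM. rewrite Rmult_0_l, Rmult_0_r, Rmult_0_l in HM. lra. }
set (e := s / r - 1).
assert (He : 0 < e).
{ unfold e. apply Rmult_lt_reg_r with r; [lra|]. field_simplify; lra. }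
exists (M * r * (1 + / e)). intros k. eapply Rle_trans; [apply HM|].
rewrite fact_simpl, mult_INR, S_INR. pose proof (pos_INR k).
assert (Hk : INR k + 1 <= (1 + / e) * (s / r) ^ k).
{ pose proof (poly k e He) as Hp. replace (1 + e) with (s / r) in Hp by (unfold e; ring).
  assert (0 < / e) by (apply Rinv_0_lt_compat; auto).
  apply Rle_trans with ((1 + / e) * (1 + INR k * e)).
  - replace ((1 + / e) * (1 + INR k * e)) with (1 + / e + INR k * e + INR k) by (field; lra).
    assert (0 <= INR k * e) by (apply Rmult_le_pos; lra). lra.
  - apply Rmult_le_compat_l; lra. }
replace (M * r ^ S k * ((INR k + 1) * INR (fact k))) with
  (M * r * INR (fact k) * (r ^ k * (INR k + 1))) by (simpl; ring).
replace (M * r * (1 + / e) * s ^ k * INR (fact k)) with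
  (M * r * INR (fact k) * (r ^ k * ((1 + / e) * (s / r) ^ k))).
- apply Rmult_le_compat_l; [repeat apply Rmult_le_pos; auto; try lra; apply pos_INR|].
  apply Rmult_le_compat_l; auto. apply pow_le; lra.
- unfold Rdiv. rewrite Rpow_mult_distr, pow_inv. field. split; [lra|apply pow_nonzero; auto].
Qed.

Lemma Tay_cdiff rho a z : 0 < rho -> Cmod z * rho < 1 -> geom_bd rho a ->
  cdiff (Tay a) z (Tay (fun k => a (S k)) z).
Proof.
intros Hrho Hz Hbd. pose proof (Cmod_ge_0 z) as Hz0.
(* All points [z + h] are kept in the disc of radius [r], halfway between [z] and the guaranteed
   circle of convergence. *)
set (r := (Cmod z + / rho) / 2).
assert (Hzr : Cmod z < / rho).
{ apply Rmult_lt_reg_r with rho; auto. rewrite Rinv_l; lra. }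
assert (Hr1 : Cmod z < r) by (unfold r; lra).
assert (Hr2 : r * rho < 1).
{ unfold r. apply Rmult_lt_reg_r with 2; [lra|]. replace ((Cmod z + / rho) / 2 * rho * 2) with (Cmod z * rho + 1) by (field; lra). lra. }
assert (Hr0 : 0 < r) by lra.
destruct (Hbd) as [M HM].
assert (HM0 : 0 <= M).
{ specialize (HM 0%nat). simpl in HM. pose proof (Cmod_ge_0 (a 0%nat)). lra. }
assert (HK : ex_series (fun k => M * (2 * gs 3 k * (r * rho) ^ k))).
{ apply (ex_series_mul M). apply ex_series_ext with (fun k => 2 * (gs 3 k * (r * rho) ^ k)).
  - intros; simpl; ring.
  - apply (ex_series_mul 2). apply gs_ex_series; [lra|]. split; auto. apply Rmult_le_pos; lra. }
set (K := Series (fun k => M * (2 * gs 3 k * (r * rho) ^ k))).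
assert (HK0 : 0 <= K).
{ unfold K. rewrite <- (Rmult_0_l (Series (fun _ => 0))), <- Series_scal_l. apply Series_le; auto.
  intros n; split; [lra|]. rewrite Rmult_0_l. apply Rmult_le_pos; auto.
  apply Rmult_le_pos; [|apply pow_le, Rmult_le_pos; lra].
  apply Rmult_le_pos; [lra|apply gs_nonneg; lra]. }
(* The derived series is bounded only at a strictly larger rate than [rho]; [/ r] leaves [z] inside
   its disc. *)
assert (Hs : exists rho', rho < rho' /\ Cmod z * rho' < 1).
{ exists (/ r). split.
  - apply Rmult_lt_reg_l with r; auto. rewrite Rinv_r; lra.
  - apply Rmult_lt_reg_r with r; auto. rewrite Rmult_assoc, Rinv_l; lra. }
destruct Hs as [rho' [Hrr Hzr']].
assert (Hbd' : geom_bd rho' (fun k => a (S k))) by (apply bd_shift with rho; auto; lra).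
assert (key : forall h, Cmod h < r - Cmod z ->
  Cmod (Tay a (z + h) - Tay a z - Tay (fun k => a (S k)) z * h)%C <= 2 * (K / r ^ 2 * Cmod h ^ 2)).
{ intros h Hh.
  assert (Hzh : Cmod (z + h)%C <= r) by (eapply Rle_trans; [apply Cmod_triangle|lra]).
  set (u := fun k => (a k * RtoC (/ INR (fact k)) *
    (Cpow (z + h) k - Cpow z k - RtoC (INR k) * Cpow z (pred k) * h))%C).
  assert (Hb : forall k, Cmod (u k) <= / r ^ 2 * Cmod h ^ 2 * (M * (2 * gs 3 k * (r * rho) ^ k))).
  { intros k. unfold u. rewrite !Cmod_mult, Cmod_R, Rabs_pos_eq by apply Rlt_le, invfact_pos.
    pose proof (Cpow_taylor z h r k (Rlt_le _ _ Hr1) Hzh) as HT.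
    set (X := Cmod (Cpow (z + h) k - Cpow z k - RtoC (INR k) * Cpow z (pred k) * h)%C) in *.
    assert (HX : X <= / r ^ 2 * (INR k ^ 2 * r ^ k * Cmod h ^ 2)).
    { apply Rmult_le_reg_l with (r ^ 2); [apply pow_lt; auto|].
      rewrite <- Rmult_assoc, Rinv_r, Rmult_1_l; auto. apply pow_nonzero; lra. }
    pose proof (invfact_pos k). pose proof (Cmod_ge_0 h).
    assert (Hr3 : 0 < / r ^ 2) by (apply Rinv_0_lt_compat, pow_lt; auto).
    apply Rle_trans with ((M * rho ^ k * INR (fact k)) * / INR (fact k) * (/ r ^ 2 * (INR k ^ 2 * r ^ k * Cmod h ^ 2))).
    - apply Rmult_le_compat; auto; try apply Cmod_ge_0.
      + apply Rmult_le_pos; [apply Cmod_ge_0|lra].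
      + apply Rmult_le_compat_r; [lra|auto].
    - replace ((M * rho ^ k * INR (fact k)) * / INR (fact k) * (/ r ^ 2 * (INR k ^ 2 * r ^ k * Cmod h ^ 2)))
       with (/ r ^ 2 * Cmod h ^ 2 * (M * (INR k ^ 2 * (r * rho) ^ k))).
      2:{ rewrite Rpow_mult_distr. field. split; [lra|apply INR_fact_neq_0]. }
      apply Rmult_le_compat_l; [apply Rmult_le_pos; [lra|apply pow2_ge_0]|].
      apply Rmult_le_compat_l; auto. apply Rmult_le_compat_r; [apply pow_le, Rmult_le_pos; lra|].
      rewrite gs3. pose proof (pos_INR k). nra. }
  assert (HE : (Tay a (z + h) - Tay a z - Tay (fun k => a (S k)) z * h)%C = Cser u).
  { assert (S1 : csum (fun k => a k * RtoC (/ INR (fact k)) * Cpow (z + h) k)%C).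
    { apply Tay_csum with rho; auto; [lra|]. eapply Rle_lt_trans; [|exact Hr2].
      apply Rmult_le_compat_r; lra. }
    assert (S2 : csum (fun k => a k * RtoC (/ INR (fact k)) * Cpow z k)%C) by (apply Tay_csum with rho; auto; lra).
    assert (S3 : csum (fun k => a (S k) * RtoC (/ INR (fact k)) * Cpow z k)%C) by
      (apply (Tay_csum rho' (fun k => a (S k))); auto; lra).
    assert (Tm : forall k, (a (S k) * RtoC (/ INR (fact (S k))) * (RtoC (INR (S k)) * Cpow z (pred (S k)) * h)
      = h * (a (S k) * RtoC (/ INR (fact k)) * Cpow z k))%C).
    { intros k. simpl pred. rewrite fact_simpl, mult_INR.
      replace (RtoC (/ INR (fact k))) with (RtoC (/ (INR (S k) * INR (fact k))) * RtoC (INR (S k)))%C; [ring|].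
      rewrite <- RtoC_mult. f_equal. field. split; [apply INR_fact_neq_0|apply not_0_INR; lia]. }
    set (v := fun k => (a k * RtoC (/ INR (fact k)) * (RtoC (INR k) * Cpow z (pred k) * h))%C).
    assert (S4 : csum v).
    { apply csum_incr. eapply ex_series_ext; [|apply (csum_scal h _ S3)].
      intros k; simpl. unfold v. rewrite <- Tm. auto. }
    assert (V : Cser v = (Tay (fun k => a (S k)) z * h)%C).
    { rewrite Cser_incr; auto. unfold v at 1. simpl INR.
      replace (a 0%nat * _ * _)%C with (RtoC 0) by ring.
      rewrite (Cser_ext _ (fun k => h * (a (S k) * RtoC (/ INR (fact k)) * Cpow z k))%C) by (intros; apply Tm).
      rewrite Cser_scal; auto. unfold Tay. ring. }
    rewrite <- V. unfold Tay.
    replace (Cser (fun k => a k * RtoC (/ INR (fact k)) * Cpow (z + h) k)%C - Cser (fun k => a k * RtoC (/ INR (fact k)) * Cpow z k)%C - Cser v)%C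
     with (Cser (fun k => a k * RtoC (/ INR (fact k)) * Cpow (z + h) k)%C + (RtoC (-1)) * (Cser (fun k => a k * RtoC (/ INR (fact k)) * Cpow z k)%C + Cser v))%C by ring.
    rewrite <- Cser_plus, <- Cser_scal, <- Cser_plus; auto.
    - apply Cser_ext. intros k. unfold u, v. ring.
    - apply csum_scal, csum_plus; auto.
    - apply csum_plus; auto. }
  rewrite HE. eapply Rle_trans; [apply Cser_bound with (2 := Hb)|].
  - apply (ex_series_mul (/ r ^ 2 * Cmod h ^ 2)); auto.
  - rewrite Series_scal_l. fold K. right. unfold Rdiv; ring. }
intros eps Heps.
set (L := 2 * (K / r ^ 2)).
assert (HL : 0 <= L).
{ unfold L. apply Rmult_le_pos; [lra|]. apply Rmult_le_pos; auto. apply Rlt_le, Rinv_0_lt_compat, pow_lt; auto. }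
exists (Rmin (r - Cmod z) (eps / (L + 1))). split.
- apply Rmin_case; [lra|]. apply Rdiv_lt_0_compat; lra.
- intros h Hh. pose proof (Rmin_l (r - Cmod z) (eps / (L + 1))). pose proof (Rmin_r (r - Cmod z) (eps / (L + 1))).
  eapply Rle_trans; [apply key; lra|]. pose proof (Cmod_ge_0 h).
  replace (2 * (K / r ^ 2 * Cmod h ^ 2)) with (L * Cmod h * Cmod h) by (unfold L; ring).
  apply Rmult_le_compat_r; auto.
  assert (Hh2 : Cmod h <= eps / (L + 1)) by lra.
  apply Rle_trans with ((L + 1) * (eps / (L + 1))); [|right; field; lra].
  apply Rmult_le_compat; auto; lra.
Qed.

(** * Goursat's theorem for the circulation of a real form [P dx + Q dy] around rectangles *)

Definition circ (P Q : R -> R -> R) (a b c d : R) : R :=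
  RInt (fun x => P x c - P x d) a b + RInt (fun y => Q b y - Q a y) c d.

Lemma ex_P (P : R -> R -> R) (H : forall x y : R, continuous (fun x => P x y) x) a b c d :
  ex_RInt (fun x => P x c - P x d) a b.
Proof.
apply (ex_RInt_continuous (V := R_CompleteNormedModule)). intros z _.
apply (continuous_minus (fun x => P x c) (fun x => P x d)); auto.
Qed.

Lemma ex_Q (Q : R -> R -> R) (H : forall x y : R, continuous (fun y => Q x y) y) a b c d :
  ex_RInt (fun y => Q b y - Q a y) c d.
Proof.
apply (ex_RInt_continuous (V := R_CompleteNormedModule)). intros z _.
apply (continuous_minus (fun x => Q b x) (fun x => Q a x)); auto.
Qed.

Section Goursat.
Variables P Q : R -> R -> R.
Hypothesis HP : forall x y : R, continuous (fun x => P x y) x.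
Hypothesis HQ : forall x y : R, continuous (fun y => Q x y) y.

Lemma circ_split_x a m b c d : circ P Q a b c d = circ P Q a m c d + circ P Q m b c d.
Proof.
unfold circ. rewrite <- (RInt_Chasles (fun x => P x c - P x d) a m b); try (apply ex_P; auto).
rewrite (RInt_ext (fun y => Q b y - Q a y) (fun y => plus (Q m y - Q a y) (Q b y - Q m y))).
- rewrite (RInt_plus (fun y => Q m y - Q a y) (fun y => Q b y - Q m y)); try (apply ex_Q; auto). unfold plus; simpl; ring.
- intros; unfold plus; simpl; ring.
Qed.

Lemma circ_split_y a b c m d : circ P Q a b c d = circ P Q a b c m + circ P Q a b m d.
Proof.
unfold circ. rewrite <- (RInt_Chasles (fun y => Q b y - Q a y) c m d); try (apply ex_Q; auto).
rewrite (RInt_ext (fun x => P x c - P x d) (fun x => plus (P x c - P x m) (P x m - P x d))).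
- rewrite (RInt_plus (fun x => P x c - P x m) (fun x => P x m - P x d)); try (apply ex_P; auto). unfold plus; simpl; ring.
- intros; unfold plus; simpl; ring.
Qed.

(** The only trace of complex differentiability that Goursat's bisection uses: near the point, the
    form differs by a first-order small error from one whose circulations all vanish. *)
Definition locally_exact (x0 y0 : R) : Prop :=
  exists P0 Q0 : R -> R -> R,
    (forall x y : R, continuous (fun x => P0 x y) x) /\
    (forall x y : R, continuous (fun y => Q0 x y) y) /\
    (forall a b c d, circ P0 Q0 a b c d = 0) /\
    forall eps, 0 < eps -> exists de, 0 < de /\
      forall x y, Rabs (x - x0) < de -> Rabs (y - y0) < de ->
        Rabs (P x y - P0 x y) <= eps * (Rabs (x - x0) + Rabs (y - y0)) /\
        Rabs (Q x y - Q0 x y) <= eps * (Rabs (x - x0) + Rabs (y - y0)).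

Lemma circ_small a b c d x0 y0 (P0 Q0 : R -> R -> R) eps :
  (forall x y : R, continuous (fun x => P0 x y) x) ->
  (forall x y : R, continuous (fun y => Q0 x y) y) ->
  circ P0 Q0 a b c d = 0 -> 0 <= eps ->
  a <= x0 <= b -> c <= y0 <= d ->
  (forall x y, a <= x <= b -> c <= y <= d ->
     Rabs (P x y - P0 x y) <= eps * (Rabs (x - x0) + Rabs (y - y0)) /\
     Rabs (Q x y - Q0 x y) <= eps * (Rabs (x - x0) + Rabs (y - y0))) ->
  Rabs (circ P Q a b c d) <= 2 * eps * ((b - a) + (d - c)) ^ 2.
Proof.
intros HP0 HQ0 H0 Heps Hx Hy H.
set (L := (b - a) + (d - c)).
assert (HL : forall x y, a <= x <= b -> c <= y <= d ->
   Rabs (P x y - P0 x y) <= eps * L /\ Rabs (Q x y - Q0 x y) <= eps * L).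
{ intros x y Hxx Hyy. destruct (H x y Hxx Hyy) as [A B].
  assert (Rabs (x - x0) + Rabs (y - y0) <= L).
  { unfold L. apply Rplus_le_compat; apply Rabs_le; lra. }
  assert (eps * (Rabs (x - x0) + Rabs (y - y0)) <= eps * L) by (apply Rmult_le_compat_l; auto). lra. }
rewrite <- (Rminus_0_r (circ P Q a b c d)), <- H0. unfold circ.
replace (_ - _) with
  ((RInt (fun x => P x c - P x d) a b - RInt (fun x => P0 x c - P0 x d) a b) +
   (RInt (fun y => Q b y - Q a y) c d - RInt (fun y => Q0 b y - Q0 a y) c d)) by ring.
rewrite <- (RInt_minus (fun x => P x c - P x d) (fun x => P0 x c - P0 x d)) by (apply ex_P; auto).
rewrite <- (RInt_minus (fun y => Q b y - Q a y) (fun y => Q0 b y - Q0 a y)) by (apply ex_Q; auto).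
eapply Rle_trans; [apply Rabs_triang|].
assert (E1 : Rabs (RInt (fun x => minus (P x c - P x d) (P0 x c - P0 x d)) a b) <= (b - a) * (2 * eps * L)).
{ apply abs_RInt_le_const; [lra| |].
  - apply (ex_RInt_minus (fun x => P x c - P x d) (fun x => P0 x c - P0 x d)); apply ex_P; auto.
  - intros t Ht. unfold minus, plus, opp; simpl.
    replace (P t c - P t d + - (P0 t c - P0 t d)) with ((P t c - P0 t c) - (P t d - P0 t d)) by ring.
    eapply Rle_trans; [apply Rabs_triang|]. rewrite Rabs_Ropp.
    destruct (HL t c Ht ltac:(lra)). destruct (HL t d Ht ltac:(lra)). lra. }
assert (E2 : Rabs (RInt (fun y => minus (Q b y - Q a y) (Q0 b y - Q0 a y)) c d) <= (d - c) * (2 * eps * L)).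
{ apply abs_RInt_le_const; [lra| |].
  - apply (ex_RInt_minus (fun y => Q b y - Q a y) (fun y => Q0 b y - Q0 a y)); apply ex_Q; auto.
  - intros t Ht. unfold minus, plus, opp; simpl.
    replace (Q b t - Q a t + - (Q0 b t - Q0 a t)) with ((Q b t - Q0 b t) - (Q a t - Q0 a t)) by ring.
    eapply Rle_trans; [apply Rabs_triang|]. rewrite Rabs_Ropp.
    destruct (HL b t ltac:(lra) Ht). destruct (HL a t ltac:(lra) Ht). lra. }
eapply Rle_trans; [apply Rplus_le_compat; [exact E1|exact E2]|].
right. unfold L. ring.
Qed.

Variables (a b c d : R).
Hypothesis Hab : a < b.
Hypothesis Hcd : c < d.
Hypothesis Hloc : forall x y, a <= x <= b -> c <= y <= d -> locally_exact x y.

Lemma goursat_rect : circ P Q a b c d = 0.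
Proof.
destruct (Req_dec (circ P Q a b c d) 0) as [|Hne]; auto. exfalso.
set (w0 := Rabs (circ P Q a b c d)).
assert (Hw0 : 0 < w0) by (apply Rabs_pos_lt; auto).
set (lx := fun n => (b - a) / 2 ^ n). set (ly := fun n => (d - c) / 2 ^ n).
assert (Hlx : forall n, 0 < lx n) by (intros; apply Rdiv_lt_0_compat; [lra|apply pow_lt; lra]).
assert (Hly : forall n, 0 < ly n) by (intros; apply Rdiv_lt_0_compat; [lra|apply pow_lt; lra]).
assert (HlxS : forall n, lx n = lx (S n) + lx (S n)).
{ intros; unfold lx; simpl; field. apply pow_nonzero; lra. }
assert (HlyS : forall n, ly n = ly (S n) + ly (S n)).
{ intros; unfold ly; simpl; field. apply pow_nonzero; lra. }
set (W := fun n (p : R * R) => Rabs (circ P Q (fst p) (fst p + lx n) (snd p) (snd p + ly n))).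
(* The lower left corner [p] of an [n]-th generation rectangle is bad when the circulation has lost
   at most a factor 4 per bisection; one of the four quarters of a bad rectangle is bad. *)
set (bad := fun n (p : R * R) => w0 / 4 ^ n <= W n p).
assert (Hstep : forall n p, bad n p -> exists q, bad (S n) q /\
   (fst p <= fst q /\ fst q + lx (S n) <= fst p + lx n) /\
   (snd p <= snd q /\ snd q + ly (S n) <= snd p + ly n)).
{ intros n [x y] Hb. unfold bad, W in Hb. simpl fst in Hb; simpl snd in Hb.
  rewrite (circ_split_x x (x + lx (S n)) (x + lx n)) in Hb.
  rewrite (circ_split_y x _ y (y + ly (S n)) (y + ly n)) in Hb.
  rewrite (circ_split_y (x + lx (S n)) _ y (y + ly (S n)) (y + ly n)) in Hb.
  pose proof (Hlx (S n)). pose proof (Hly (S n)). pose proof (HlxS n). pose proof (HlyS n).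
  replace (x + lx n) with (x + lx (S n) + lx (S n)) in Hb by lra.
  replace (y + ly n) with (y + ly (S n) + ly (S n)) in Hb by lra.
  apply Classical_Prop.NNPP. intros Hno.
  assert (Hall : forall q, (fst q = x \/ fst q = x + lx (S n)) -> (snd q = y \/ snd q = y + ly (S n)) ->
    W (S n) q < w0 / 4 ^ S n).
  { intros q H1q H2q. apply Rnot_le_lt. intros Hq. apply Hno. exists q.
    unfold bad; split; auto. simpl. destruct H1q as [->| ->], H2q as [->| ->]; lra. }
  pose proof (Hall (x, y) ltac:(simpl; auto) ltac:(simpl; auto)) as A1.
  pose proof (Hall (x + lx (S n), y) ltac:(simpl; auto) ltac:(simpl; auto)) as A2.
  pose proof (Hall (x, y + ly (S n)) ltac:(simpl; auto) ltac:(simpl; auto)) as A3.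
  pose proof (Hall (x + lx (S n), y + ly (S n)) ltac:(simpl; auto) ltac:(simpl; auto)) as A4.
  unfold W in *. simpl fst in *; simpl snd in *.
  set (X1 := circ P Q x (x + lx (S n)) y (y + ly (S n))) in *.
  set (X2 := circ P Q x (x + lx (S n)) (y + ly (S n)) (y + ly (S n) + ly (S n))) in *.
  set (X3 := circ P Q (x + lx (S n)) (x + lx (S n) + lx (S n)) y (y + ly (S n))) in *.
  set (X4 := circ P Q (x + lx (S n)) (x + lx (S n) + lx (S n)) (y + ly (S n)) (y + ly (S n) + ly (S n))) in *.
  pose proof (Rabs_triang (X1 + X2) (X3 + X4)). pose proof (Rabs_triang X1 X2). pose proof (Rabs_triang X3 X4).
  replace (w0 / 4 ^ n) with (4 * (w0 / 4 ^ S n)) in Hb by (simpl; field; apply pow_nonzero; lra).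
  lra. }
set (next := fun n (p : {p | bad n p}) =>
  let q := constructive_indefinite_description _ (Hstep n (proj1_sig p) (proj2_sig p)) in
  exist (bad (S n)) (proj1_sig q) (proj1 (proj2_sig q))).
assert (Hb0 : bad 0%nat (a, c)).
{ unfold bad, W, lx, ly; simpl. replace (a + (b - a) / 1) with b by field.
  replace (c + (d - c) / 1) with d by field. fold w0. right; field. }
set (sq := fix sq n : {p | bad n p} := match n with O => exist _ (a, c) Hb0 | S n => next n (sq n) end).
set (u := fun n => proj1_sig (sq n)).
assert (Hu : forall n, (fst (u n) <= fst (u (S n)) /\ fst (u (S n)) + lx (S n) <= fst (u n) + lx n) /\
   (snd (u n) <= snd (u (S n)) /\ snd (u (S n)) + ly (S n) <= snd (u n) + ly n)).
{ intros n. unfold u. simpl sq. unfold next. simpl.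
  destruct (constructive_indefinite_description _ _) as [q Hq]; simpl. apply Hq. }
assert (Hbad : forall n, bad n (u n)) by (intros; exact (proj2_sig (sq n))).
assert (Hlim : forall (v l : nat -> R), (forall n, v n <= v (S n)) -> (forall n, v (S n) + l (S n) <= v n + l n) ->
   (forall n, 0 < l n) -> exists x, forall n, v n <= x <= v n + l n).
{ intros v l H1 H2 H3.
  assert (H4 : forall n m, (n <= m)%nat -> v m + l m <= v n + l n).
  { intros n m Hm; induction Hm; [lra|]. specialize (H2 m). lra. }
  destruct (ex_finite_lim_seq_incr v (v 0%nat + l 0%nat)) as [x Hx]; auto.
  { intros n. specialize (H4 0%nat n ltac:(lia)). specialize (H3 n). lra. }
  exists x. intros n. split.
  - apply (is_lim_seq_incr_compare v); auto.
  - apply (is_lim_seq_le_loc v (fun _ => v n + l n) x (v n + l n)); auto.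
    + exists n. intros m Hm. specialize (H4 n m Hm). specialize (H3 m). lra.
    + apply is_lim_seq_const. }
destruct (Hlim (fun n => fst (u n)) lx) as [x0 Hx0]; auto; try (intros; apply Hu).
destruct (Hlim (fun n => snd (u n)) ly) as [y0 Hy0]; auto; try (intros; apply Hu).
assert (Hx0ab : a <= x0 <= b).
{ specialize (Hx0 0%nat). unfold u, lx in Hx0; simpl in Hx0. replace (a + (b - a) / 1) with b in Hx0 by field. auto. }
assert (Hy0cd : c <= y0 <= d).
{ specialize (Hy0 0%nat). unfold u, ly in Hy0; simpl in Hy0. replace (c + (d - c) / 1) with d in Hy0 by field. auto. }
destruct (Hloc x0 y0 Hx0ab Hy0cd) as [P0 [Q0 [HP0 [HQ0 [HW0 Happ]]]]].
set (L := (b - a) + (d - c)).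
assert (HL : 0 < L) by (unfold L; lra).
(* With this tolerance [circ_small] bounds the [n]-th circulation by half of [w0 / 4 ^ n], against
   badness. *)
assert (Heps : 0 < w0 / (4 * L ^ 2)) by (apply Rdiv_lt_0_compat; auto; assert (0 < L ^ 2) by (apply pow_lt; auto); lra).
destruct (Happ _ Heps) as [de [Hde Hnear]].
assert (Hn : exists n, L / 2 ^ n < de).
{ assert (Hl : is_lim_seq (fun n => L * (/ 2) ^ n) 0).
  { replace (Finite 0) with (Finite (L * 0)) by (f_equal; ring).
    apply is_lim_seq_mult'; [apply is_lim_seq_const|]. apply is_lim_seq_geom. rewrite Rabs_pos_eq; lra. }
  destruct (proj1 (is_lim_seq_eps _ _) Hl (mkposreal _ Hde)) as [n Hn]. exists n.
  specialize (Hn n (le_n _)). simpl in Hn. rewrite Rminus_0_r in Hn. rewrite pow_inv in Hn.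
  apply Rabs_def2 in Hn. apply Hn. }
destruct Hn as [n Hn].
assert (HLn : lx n + ly n = L / 2 ^ n) by (unfold lx, ly, L; field; apply pow_nonzero; lra).
pose proof (Hlx n). pose proof (Hly n). specialize (Hx0 n). specialize (Hy0 n). cbv beta in Hx0, Hy0.
pose proof (circ_small (fst (u n)) (fst (u n) + lx n) (snd (u n)) (snd (u n) + ly n) x0 y0 P0 Q0
  (w0 / (4 * L ^ 2)) HP0 HQ0 (HW0 _ _ _ _) (Rlt_le _ _ Heps) Hx0 Hy0) as HS.
assert (HS' : Rabs (circ P Q (fst (u n)) (fst (u n) + lx n) (snd (u n)) (snd (u n) + ly n))
  <= 2 * (w0 / (4 * L ^ 2)) * (L / 2 ^ n) ^ 2).
{ rewrite <- HLn. replace (lx n + ly n) with (fst (u n) + lx n - fst (u n) + (snd (u n) + ly n - snd (u n))) by ring.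
  apply HS. intros x y Hx Hy. apply Hnear; apply Rabs_def1; lra. }
pose proof (Hbad n) as Hbn. unfold bad, W in Hbn.
assert (Hc : w0 / 4 ^ n <= w0 / 2 / 4 ^ n).
{ eapply Rle_trans; [exact Hbn|]. eapply Rle_trans; [exact HS'|]. right.
  replace 4 with (2 * 2) at 2 by ring. rewrite Rpow_mult_distr. field.
  split; [apply pow_nonzero; lra|]. unfold L; lra. }
assert (0 < w0 / 4 ^ n) by (apply Rdiv_lt_0_compat; auto; apply pow_lt; lra).
replace (w0 / 2 / 4 ^ n) with (w0 / 4 ^ n / 2) in Hc by (field; apply pow_nonzero; lra). lra.
Qed.
End Goursat.

(** * Cauchy's integral theorem on circles, in polar coordinates *)

Definition cis (t : R) : C := (cos t, sin t).
Definition polar (r t : R) : C := (r * cos t, r * sin t).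

Lemma cos_lip x y : Rabs (cos x - cos y) <= Rabs (x - y).
Proof.
destruct (MVT_gen cos y x (fun z => - sin z)) as [c [_ Hc]].
- intros; apply is_derive_cos.
- intros; apply continuity_cos.
- rewrite Hc, Rabs_mult, Rabs_Ropp. rewrite <- (Rmult_1_l (Rabs (x - y))) at 2.
  apply Rmult_le_compat_r; [apply Rabs_pos|]. apply Rabs_le. apply SIN_bound.
Qed.

Lemma sin_lip x y : Rabs (sin x - sin y) <= Rabs (x - y).
Proof.
destruct (MVT_gen sin y x cos) as [c [_ Hc]].
- intros; apply is_derive_sin.
- intros; apply continuity_sin.
- rewrite Hc, Rabs_mult. rewrite <- (Rmult_1_l (Rabs (x - y))) at 2.
  apply Rmult_le_compat_r; [apply Rabs_pos|]. apply Rabs_le. apply COS_bound.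
Qed.

Lemma Cmod_cis t : Cmod (cis t) = 1.
Proof.
unfold Cmod, cis; simpl. replace (_ + _) with 1; [apply sqrt_1|].
pose proof (sin2_cos2 t) as H. unfold Rsqr in H. lra.
Qed.

Lemma polar_cis r t : polar r t = (RtoC r * cis t)%C.
Proof. unfold polar, cis, Cmult; simpl. f_equal; ring. Qed.

Lemma Cmod_polar r t : Cmod (polar r t) = Rabs r.
Proof. rewrite polar_cis, Cmod_mult, Cmod_cis, Cmod_R. ring. Qed.

Lemma polar_near r t r0 t0 :
  Cmod (polar r t - polar r0 t0)%C <= Rabs (r - r0) + 2 * Rabs r0 * Rabs (t - t0).
Proof.
replace (polar r t - polar r0 t0)%C with (RtoC (r - r0) * cis t + RtoC r0 * (cis t - cis t0))%C.
- eapply Rle_trans; [apply Cmod_triangle|]. rewrite !Cmod_mult, Cmod_cis, !Cmod_R, Rmult_1_r.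
  apply Rplus_le_compat_l. rewrite (Rmult_comm 2), Rmult_assoc.
  apply Rmult_le_compat_l; [apply Rabs_pos|].
  eapply Rle_trans; [apply Cmod_le_sum|]. unfold cis; simpl.
  pose proof (cos_lip t t0). pose proof (sin_lip t t0). unfold Rminus in *. lra.
- rewrite !polar_cis, RtoC_minus. ring.
Qed.

Definition ccont (g : C -> C) : Prop :=
  forall z eps, 0 < eps -> exists d, 0 < d /\ forall h, Cmod h < d -> Cmod (g (z + h) - g z)%C < eps.

Lemma cdiff_cont g z l : cdiff g z l ->
  forall eps, 0 < eps -> exists d, 0 < d /\ forall h, Cmod h < d -> Cmod (g (z + h) - g z)%C < eps.
Proof.
intros H eps Heps. destruct (H 1 Rlt_0_1) as [d [Hd H1]].
pose proof (Cmod_ge_0 l).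
exists (Rmin d (eps / (Cmod l + 2))). split.
- apply Rmin_case; auto. apply Rdiv_lt_0_compat; lra.
- intros h Hh. pose proof (Rmin_l d (eps / (Cmod l + 2))). pose proof (Rmin_r d (eps / (Cmod l + 2))).
  specialize (H1 h ltac:(lra)).
  replace (g (z + h) - g z)%C with ((g (z + h) - g z - l * h) + l * h)%C by ring.
  eapply Rle_lt_trans; [apply Cmod_triangle|]. rewrite Cmod_mult.
  pose proof (Cmod_ge_0 h).
  apply Rle_lt_trans with ((Cmod l + 1) * Cmod h); [lra|].
  apply Rle_lt_trans with ((Cmod l + 1) * (eps / (Cmod l + 2))).
  + apply Rmult_le_compat_l; lra.
  + apply Rmult_lt_reg_r with (Cmod l + 2); [lra|]. field_simplify; lra.
Qed.

(** With [polarQ], the real part of the form [k g(z) dz] pulled back by polar coordinates, where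
    [dz = cis t dr + i r cis t dt]. The constant [k] allows real and imaginary parts to be treated
    together. *)
Definition polarP (k : C) (g : C -> C) (r t : R) : R := Re (k * g (polar r t) * cis t)%C.
Definition polarQ (k : C) (g : C -> C) (r t : R) : R := Re (k * Ci * RtoC r * g (polar r t) * cis t)%C.

Lemma ccont_2d g : ccont g -> forall r t,
  continuity_2d_pt (fun r t => Re (g (polar r t))) r t /\
  continuity_2d_pt (fun r t => Im (g (polar r t))) r t.
Proof.
intros Hg r t.
assert (H : forall eps : posreal, exists de : posreal, forall r' t', Rabs (r' - r) < de -> Rabs (t' - t) < de ->
  Cmod (g (polar r' t') - g (polar r t))%C < eps).
{ intros eps. destruct (Hg (polar r t) eps (cond_pos eps)) as [d [Hd H]].
  assert (Hp : 0 < d / (2 + 2 * Rabs r)).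
  { apply Rdiv_lt_0_compat; auto. pose proof (Rabs_pos r); lra. }
  exists (mkposreal _ Hp). simpl. intros r' t' H1 H2.
  replace (polar r' t') with (polar r t + (polar r' t' - polar r t))%C by ring.
  apply H. eapply Rle_lt_trans; [apply polar_near|].
  pose proof (Rabs_pos r).
  apply Rle_lt_trans with ((1 + 2 * Rabs r) * (d / (2 + 2 * Rabs r))).
  - rewrite Rmult_plus_distr_r. apply Rplus_le_compat; [lra|]. apply Rmult_le_compat_l; lra.
  - apply Rmult_lt_reg_r with (2 + 2 * Rabs r); [lra|]. field_simplify; lra. }
split; intros eps; destruct (H eps) as [de Hde]; exists de; intros r' t' H1 H2;
  (eapply Rle_lt_trans; [|apply (Hde r' t' H1 H2)]).
- apply (re_le_Cmod (g (polar r' t') - g (polar r t))%C).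
- apply (im_le_Cmod (g (polar r' t') - g (polar r t))%C).
Qed.

Lemma polarPQ_2d k g : ccont g -> forall r t,
  continuity_2d_pt (polarP k g) r t /\ continuity_2d_pt (polarQ k g) r t.
Proof.
intros Hg r t. destruct (ccont_2d g Hg r t) as [HU HV]. destruct k as [k1 k2].
assert (Hc : continuity_2d_pt (fun r t => cos t) r t).
{ apply (continuity_1d_2d_pt_comp cos (fun r t => t)); [apply continuity_cos|apply continuity_2d_pt_id2]. }
assert (Hs : continuity_2d_pt (fun r t => sin t) r t).
{ apply (continuity_1d_2d_pt_comp sin (fun r t => t)); [apply continuity_sin|apply continuity_2d_pt_id2]. }
set (U := fun r t => Re (g (polar r t))) in *. set (V := fun r t => Im (g (polar r t))) in *.
assert (H1 : continuity_2d_pt (fun r t => U r t * cos t - V r t * sin t) r t).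
{ apply continuity_2d_pt_minus; apply continuity_2d_pt_mult; auto. }
assert (H2 : continuity_2d_pt (fun r t => U r t * sin t + V r t * cos t) r t).
{ apply continuity_2d_pt_plus; apply continuity_2d_pt_mult; auto. }
split.
- apply continuity_2d_pt_ext with (fun r t => k1 * (U r t * cos t - V r t * sin t) - k2 * (U r t * sin t + V r t * cos t)).
  + intros x y. unfold polarP, U, V, cis, Re, Im; simpl. ring.
  + apply continuity_2d_pt_minus; apply continuity_2d_pt_mult; auto using continuity_2d_pt_const.
- apply continuity_2d_pt_ext with (fun r t => - r * (k1 * (U r t * sin t + V r t * cos t) + k2 * (U r t * cos t - V r t * sin t))).
  + intros x y. unfold polarQ, U, V, cis, Re, Im; simpl. ring.
  + apply continuity_2d_pt_mult; [apply continuity_2d_pt_opp, continuity_2d_pt_id1|].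
    apply continuity_2d_pt_plus; apply continuity_2d_pt_mult; auto using continuity_2d_pt_const.
Qed.

Lemma cont_2d_1 f x y : continuity_2d_pt f x y -> continuous (fun x : R => f x y) x.
Proof.
intros H. apply continuity_pt_filterlim. intros eps Heps.
destruct (H (mkposreal eps Heps)) as [d Hd]. exists d; split; [apply cond_pos|].
intros x' [_ Hx']. apply Hd; auto. rewrite Rminus_eq_0, Rabs_R0. apply cond_pos.
Qed.

Lemma cont_2d_2 f x y : continuity_2d_pt f x y -> continuous (fun y : R => f x y) y.
Proof.
intros H. apply continuity_pt_filterlim. intros eps Heps.
destruct (H (mkposreal eps Heps)) as [d Hd]. exists d; split; [apply cond_pos|].
intros x' [_ Hx']. apply Hd; auto. rewrite Rminus_eq_0, Rabs_R0. apply cond_pos.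
Qed.

Lemma circ_exact (H P Q : R -> R -> R) a b c d :
  (forall x y, is_derive (fun x => H x y) x (P x y)) ->
  (forall x y, is_derive (fun y => H x y) y (Q x y)) ->
  (forall x y : R, continuous (fun x => P x y) x) ->
  (forall x y : R, continuous (fun y => Q x y) y) -> circ P Q a b c d = 0.
Proof.
intros H1 H2 H3 H4. unfold circ.
assert (E1 : RInt (fun x => P x c - P x d) a b = (H b c - H b d) - (H a c - H a d)).
{ apply is_RInt_unique. apply (is_RInt_derive (fun x => H x c - H x d) (fun x => P x c - P x d)).
  - intros x _. apply (is_derive_minus (fun x => H x c) (fun x => H x d)); auto.
  - intros x _. apply (continuous_minus (fun x => P x c) (fun x => P x d)); auto. }
assert (E2 : RInt (fun y => Q b y - Q a y) c d = (H b d - H a d) - (H b c - H a c)).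
{ apply is_RInt_unique. apply (is_RInt_derive (fun y => H b y - H a y) (fun y => Q b y - Q a y)).
  - intros x _. apply (is_derive_minus (fun y => H b y) (fun y => H a y)); auto.
  - intros x _. apply (continuous_minus (fun y => Q b y) (fun y => Q a y)); auto. }
rewrite E1, E2. ring.
Qed.

Lemma ccont_affine A B : ccont (fun z => A + B * z)%C.
Proof.
intros z eps Heps. pose proof (Cmod_ge_0 B). exists (eps / (Cmod B + 1)). split.
- apply Rdiv_lt_0_compat; lra.
- intros h Hh. replace (A + B * (z + h) - (A + B * z))%C with (B * h)%C by ring. rewrite Cmod_mult.
  apply Rle_lt_trans with (Cmod B * (eps / (Cmod B + 1))).
  + apply Rmult_le_compat_l; lra.
  + apply Rmult_lt_reg_r with (Cmod B + 1); [lra|]. field_simplify; lra.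
Qed.

(** The form has the primitive [Re (k (A z + B z^2 / 2))]. *)
Lemma affine_exact k A B a b c d :
  circ (polarP k (fun z => A + B * z)%C) (polarQ k (fun z => A + B * z)%C) a b c d = 0.
Proof.
pose proof (polarPQ_2d k _ (ccont_affine A B)) as H2d.
apply (circ_exact (fun r t => Re (k * (A * polar r t + RtoC (1/2) * B * (polar r t * polar r t))))%C).
- intros r t. unfold polarP, polar, cis, Re; simpl. auto_derive; auto. field.
- intros r t. unfold polarQ, polar, cis, Re; simpl. auto_derive; auto. field.
- intros; apply cont_2d_1, H2d.
- intros; apply cont_2d_2, H2d.
Qed.

(** The first-order Taylor polynomial of [g] provides the exact form; [polar_near] converts the
    remainder from distances in the plane to distances in [(r, t)]. *)
Lemma polar_locally_exact k g r0 t0 l : cdiff g (polar r0 t0) l ->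
  locally_exact (polarP k g) (polarQ k g) r0 t0.
Proof.
intros Hd. set (z0 := polar r0 t0) in *.
set (g0 := fun z : C => ((g z0 - l * z0) + l * z)%C).
pose proof (polarPQ_2d k g0 (ccont_affine _ _)) as H2d.
exists (polarP k g0), (polarQ k g0). split; [intros; apply cont_2d_1, H2d|].
split; [intros; apply cont_2d_2, H2d|]. split; [intros; apply affine_exact|].
intros eps Heps.
pose proof (Rabs_pos r0) as Hr0. pose proof (Cmod_ge_0 k) as Hk.
(* Collects the losses: the factor [k], the factor [r] of [polarQ] for [r] within 1 of [r0], and the
   Lipschitz constant of [polar]. *)
set (M := (Cmod k + 1) * (Rabs r0 + 1) * (1 + 2 * Rabs r0)).
assert (HM : 0 < M) by (unfold M; repeat apply Rmult_lt_0_compat; lra).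
destruct (Hd (eps / M)) as [d [Hd0 Hd1]]; [apply Rdiv_lt_0_compat; auto|].
exists (Rmin 1 (d / (2 + 2 * Rabs r0))). split.
{ apply Rmin_case; [lra|]. apply Rdiv_lt_0_compat; lra. }
intros r t Hr Ht.
pose proof (Rmin_l 1 (d / (2 + 2 * Rabs r0))). pose proof (Rmin_r 1 (d / (2 + 2 * Rabs r0))).
pose proof (polar_near r t r0 t0) as Hnear. fold z0 in Hnear.
set (h := (polar r t - z0)%C) in *.
assert (Hh : Cmod h < d).
{ eapply Rle_lt_trans; [exact Hnear|].
  apply Rle_lt_trans with ((1 + 2 * Rabs r0) * (d / (2 + 2 * Rabs r0))).
  - rewrite Rmult_plus_distr_r. apply Rplus_le_compat; [lra|]. apply Rmult_le_compat_l; lra.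
  - apply Rmult_lt_reg_r with (2 + 2 * Rabs r0); [lra|]. field_simplify; lra. }
specialize (Hd1 h Hh).
assert (Hz : polar r t = (z0 + h)%C) by (unfold h; ring).
assert (HE : (g (polar r t) - g0 (polar r t) = g (z0 + h) - g z0 - l * h)%C).
{ rewrite Hz. unfold g0. ring. }
set (E := (g (polar r t) - g0 (polar r t))%C) in *.
set (S := Rabs (r - r0) + Rabs (t - t0)).
assert (HS : Cmod h <= (1 + 2 * Rabs r0) * S).
{ eapply Rle_trans; [exact Hnear|]. unfold S. pose proof (Rabs_pos (r - r0)). pose proof (Rabs_pos (t - t0)). nra. }
assert (HEb : (Cmod k + 1) * (Rabs r0 + 1) * Cmod E <= eps * S).
{ rewrite HE. apply Rle_trans with ((Cmod k + 1) * (Rabs r0 + 1) * (eps / M * ((1 + 2 * Rabs r0) * S))).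
  - apply Rmult_le_compat_l; [apply Rmult_le_pos; lra|]. eapply Rle_trans; [exact Hd1|].
    apply Rmult_le_compat_l; auto. apply Rlt_le, Rdiv_lt_0_compat; auto.
  - right. unfold M. field. lra. }
pose proof (Cmod_ge_0 E).
assert (Hrr : Rabs r <= Rabs r0 + 1).
{ replace r with (r0 + (r - r0)) by ring. eapply Rle_trans; [apply Rabs_triang|]. lra. }
split.
- replace (polarP k g r t - polarP k g0 r t) with (Re (k * E * cis t)%C).
  2:{ unfold polarP, E, Re; simpl. ring. }
  eapply Rle_trans; [apply re_le_Cmod|]. rewrite !Cmod_mult, Cmod_cis.
  eapply Rle_trans; [|exact HEb]. rewrite Rmult_1_r. apply Rmult_le_compat_r; auto. nra.
- replace (polarQ k g r t - polarQ k g0 r t) with (Re (k * Ci * RtoC r * E * cis t)%C).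
  2:{ unfold polarQ, E, Re; simpl. ring. }
  eapply Rle_trans; [apply re_le_Cmod|]. rewrite !Cmod_mult, Cmod_cis, Cmod_Ci, Cmod_R.
  eapply Rle_trans; [|exact HEb]. rewrite !Rmult_1_r. apply Rmult_le_compat_r; auto.
  apply Rmult_le_compat; auto using Rabs_pos; lra.
Qed.

Section Polar.
Variables (g : C -> C) (rho0 : R) (k : C).
Hypothesis Hg : ccont g.
Hypothesis Hrho : 0 <= rho0.
Hypothesis Hd : forall z, Cmod z <> rho0 -> exists l, cdiff g z l.

Let J r := RInt (polarQ k g r) 0 (2 * PI).

(** Goursat on the rectangle [[r1, r2] x [0, 2 PI]]: the two radial sides cancel by periodicity,
    which leaves the difference of the circle integrals. *)
Lemma J_const r1 r2 : 0 < r1 -> r1 < r2 -> (r2 < rho0 \/ rho0 < r1) -> J r1 = J r2.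
Proof.
intros H1 H2 H3. pose proof PI_RGT_0.
assert (HC : circ (polarP k g) (polarQ k g) r1 r2 0 (2 * PI) = 0).
{ apply goursat_rect; auto; try lra.
  - intros; apply cont_2d_1, polarPQ_2d; auto.
  - intros; apply cont_2d_2, polarPQ_2d; auto.
  - intros x y Hx Hy. destruct (Hd (polar x y)) as [l Hl].
    + rewrite Cmod_polar, Rabs_pos_eq by lra. lra.
    + apply polar_locally_exact with l; auto. }
unfold circ in HC.
rewrite (RInt_ext _ (fun _ => 0)) in HC.
2:{ intros x _. apply Rminus_diag_eq. unfold polarP, polar, cis. rewrite cos_2PI, sin_2PI, cos_0, sin_0. auto. }
rewrite RInt_const in HC.
pose proof (RInt_minus (polarQ k g r2) (polarQ k g r1) 0 (2 * PI)) as HM.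
unfold minus, plus, opp in HM; simpl in HM. unfold Rminus in HC. rewrite HM in HC.
- unfold J. unfold scal in HC; simpl in HC; unfold mult in HC; simpl in HC. lra.
- apply (ex_RInt_continuous (V := R_CompleteNormedModule)). intros; apply cont_2d_2, polarPQ_2d; auto.
- apply (ex_RInt_continuous (V := R_CompleteNormedModule)). intros; apply cont_2d_2, polarPQ_2d; auto.
Qed.

Lemma J_cont r : continuity_pt J r.
Proof.
intros eps Heps. pose proof PI_RGT_0.
assert (He : 0 < eps / (4 * PI)) by (apply Rdiv_lt_0_compat; lra).
destruct (uniform_continuity_2d_1d' (polarQ k g) 0 (2 * PI) r (fun x _ => proj2 (polarPQ_2d k g Hg r x))
  (mkposreal _ He)) as [d Hdd]. simpl in Hdd.
exists d; split; [apply cond_pos|]. intros x [_ Hx]. simpl in Hx. unfold R_dist in Hx.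
simpl. unfold R_dist. unfold J.
pose proof (RInt_minus (polarQ k g x) (polarQ k g r) 0 (2 * PI)) as HM.
unfold minus, plus, opp in HM; simpl in HM. unfold Rminus at 1. rewrite <- HM.
- apply Rle_lt_trans with ((2 * PI - 0) * (eps / (4 * PI))).
  + apply abs_RInt_le_const; [lra| |].
    * apply (ex_RInt_minus (polarQ k g x) (polarQ k g r)); apply (ex_RInt_continuous (V := R_CompleteNormedModule)); intros; apply cont_2d_2, polarPQ_2d; auto.
    * intros t Ht. apply Rlt_le. apply Rabs_def2 in Hx. apply (Hdd t r t x); try lra.
      rewrite Rminus_eq_0, Rabs_R0. apply cond_pos.
  + replace ((2 * PI - 0) * (eps / (4 * PI))) with (eps / 2) by (field; lra). lra.
- apply (ex_RInt_continuous (V := R_CompleteNormedModule)). intros; apply cont_2d_2, polarPQ_2d; auto.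
- apply (ex_RInt_continuous (V := R_CompleteNormedModule)). intros; apply cont_2d_2, polarPQ_2d; auto.
Qed.

(** Continuity extends the constancy of [J] up to the exceptional radius [rho0] and down to the
    radius 0; [g] need not be differentiable on the circle of radius [rho0]. *)
Lemma J_interval a b : 0 <= a -> a <= b -> (b <= rho0 \/ rho0 <= a) -> J a = J b.
Proof.
intros Ha Hab Hr. destruct (Req_dec a b) as [->|Hne]; auto.
destruct (MVT_gen J a b (fun _ => 0)) as [c [_ Hc]].
- rewrite Rmin_left, Rmax_right by lra. intros x Hx.
  set (d := Rmin (x - a) (b - x)).
  assert (Hdp : 0 < d) by (unfold d; apply Rmin_case; lra).
  assert (HdL : d <= x - a /\ d <= b - x) by (unfold d; split; [apply Rmin_l|apply Rmin_r]).
  apply is_derive_ext_loc with (fun _ => J x).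
  + exists (mkposreal d Hdp). intros y Hy. change (Rabs (y - x) < d) in Hy. apply Rabs_def2 in Hy.
    destruct (Rtotal_order x y) as [Hxy|[->|Hxy]]; auto.
    * apply J_const; lra.
    * symmetry; apply J_const; lra.
  + apply @is_derive_const.
- intros; apply J_cont.
- rewrite Rmult_0_l in Hc. lra.
Qed.

(** At radius 0 the integrand vanishes thanks to its factor [r], and [J] keeps this value on both
    sides of [rho0]. *)
Lemma polar_zero r : 0 <= r -> RInt (polarQ k g r) 0 (2 * PI) = 0.
Proof.
intros Hr.
assert (H0 : J 0 = 0).
{ unfold J. rewrite (RInt_ext _ (fun _ => 0)).
  - rewrite RInt_const. unfold scal; simpl; unfold mult; simpl. ring.
  - intros x _. assert (E : polarQ k g 0 x = 0) by (unfold polarQ, Re; simpl; ring). exact E. }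
change (J r = 0).
destruct (Rle_lt_dec r rho0).
- rewrite <- H0. symmetry. apply J_interval; lra.
- rewrite <- H0. rewrite (J_interval 0 rho0) by lra. symmetry. apply J_interval; lra.
Qed.
End Polar.

(** * Cauchy's formula and the Taylor expansion of entire functions *)

Section Cauchy.
Variable f : C -> C.
Hypothesis Hf : forall z, exists l, cdiff f z l.

Lemma f_ccont : ccont f.
Proof. intros z. destruct (Hf z) as [l Hl]. apply (cdiff_cont f z l Hl). Qed.

Variables (z0 l0 : C).
Hypothesis Hl0 : cdiff f z0 l0.

(* Cauchy's formula comes from the vanishing of the integral of this difference quotient over large
   circles. *)
Definition dq (z : C) : C :=
  if excluded_middle_informative (z = z0) then l0 else ((f z - f z0) / (z - z0))%C.

Lemma dq_neq z : z <> z0 -> dq z = ((f z - f z0) / (z - z0))%C.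
Proof. intros H. unfold dq. destruct excluded_middle_informative; tauto. Qed.

Lemma Cminus_neq (z w : C) : z <> w -> (z - w)%C <> RtoC 0.
Proof. intros H E. apply H. replace z with (z - w + w)%C by ring. rewrite E. ring. Qed.

Lemma dq_cdiff z : z <> z0 -> exists m, cdiff dq z m.
Proof.
intros Hz. destruct (Hf z) as [l Hl]. pose proof (Cminus_neq _ _ Hz) as Hw.
set (w := (z - z0)%C) in *. set (p := (f z - f z0)%C).
exists ((l * w - p) / (w * w))%C. intros eps Heps.
pose proof (proj1 (Cmod_gt_0 w) Hw) as Hw0.
set (A := Cmod (p - l * w)%C). assert (HA : 0 <= A) by apply Cmod_ge_0.
assert (Hw3 : 0 < Cmod w ^ 3) by (apply pow_lt; auto).
assert (He1 : 0 < eps / 4 * Cmod w) by (apply Rmult_lt_0_compat; lra).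
destruct (Hl _ He1) as [d [Hd0 Hd]].
assert (He2 : 0 < eps / 4 * Cmod w ^ 3 / (A + 1)).
{ apply Rdiv_lt_0_compat; [|lra]. apply Rmult_lt_0_compat; lra. }
(* The second bound keeps [w + h] away from 0; the first and the third make each of the two
   remainder terms of the quotient rule at most [eps / 2] times [Cmod h]. *)
exists (Rmin d (Rmin (Cmod w / 2) (eps / 4 * Cmod w ^ 3 / (A + 1)))).
split; [repeat apply Rmin_case; lra|].
intros h Hh.
assert (Hh1 : Cmod h < d) by (eapply Rlt_le_trans; [exact Hh|apply Rmin_l]).
assert (Hh2 : Cmod h < Cmod w / 2).
{ eapply Rlt_le_trans; [exact Hh|]. eapply Rle_trans; [apply Rmin_r|apply Rmin_l]. }
assert (Hh3 : Cmod h < eps / 4 * Cmod w ^ 3 / (A + 1)).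
{ eapply Rlt_le_trans; [exact Hh|]. eapply Rle_trans; [apply Rmin_r|apply Rmin_r]. }
specialize (Hd h Hh1). set (rho := (f (z + h) - f z - l * h)%C) in *.
assert (Hwh : Cmod w / 2 <= Cmod (w + h)%C).
{ pose proof (Cmod_triangle (w + h) (- h)) as Ht. rewrite Cmod_opp in Ht.
  replace (w + h + - h)%C with w in Ht by ring. lra. }
assert (Hwh0 : (w + h)%C <> RtoC 0) by (apply Cmod_gt_0; lra).
assert (Hzh : (z + h)%C <> z0).
{ intros E. apply Hwh0. unfold w. replace (z - z0 + h)%C with (z + h - z0)%C by ring. rewrite E. ring. }
rewrite !dq_neq; auto. fold w. fold p.
replace (z + h - z0)%C with (w + h)%C by (unfold w; ring).
replace (f (z + h) - f z0)%C with (p + l * h + rho)%C by (unfold p, rho; ring).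
replace ((p + l * h + rho) / (w + h) - p / w - (l * w - p) / (w * w) * h)%C with
  (rho / (w + h) + (p - l * w) * (h * h) / (w * w * (w + h)))%C by (field; auto).
eapply Rle_trans; [apply Cmod_triangle|].
assert (Hww : (w * w * (w + h))%C <> RtoC 0) by (repeat apply Cmult_neq_0; auto).
rewrite !Cmod_div, !Cmod_mult by auto. fold A.
pose proof (Cmod_ge_0 h) as Hh0. pose proof (Cmod_ge_0 rho).
assert (Hi : / Cmod (w + h)%C <= 2 / Cmod w).
{ replace (2 / Cmod w) with (/ (Cmod w / 2)) by (field; lra). apply Rinv_le_contravar; lra. }
assert (Hip : 0 < / Cmod (w + h)%C) by (apply Rinv_0_lt_compat; lra).
assert (H1 : Cmod rho / Cmod (w + h)%C <= eps / 2 * Cmod h).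
{ apply Rle_trans with (eps / 4 * Cmod w * Cmod h * (2 / Cmod w)).
  - apply Rmult_le_compat; auto; lra.
  - right; field; lra. }
assert (H2 : A * (Cmod h * Cmod h) / (Cmod w * Cmod w * Cmod (w + h)%C) <= eps / 2 * Cmod h).
{ replace (A * (Cmod h * Cmod h) / (Cmod w * Cmod w * Cmod (w + h)%C)) with
    (A * Cmod h * Cmod h / (Cmod w ^ 2) * / Cmod (w + h)%C) by (field; lra).
  apply Rle_trans with (A * Cmod h * Cmod h / (Cmod w ^ 2) * (2 / Cmod w)).
  - apply Rmult_le_compat_l; auto. apply Rmult_le_pos; [repeat apply Rmult_le_pos; auto|].
    apply Rlt_le, Rinv_0_lt_compat, pow_lt; auto.
  - replace (A * Cmod h * Cmod h / Cmod w ^ 2 * (2 / Cmod w)) with ((2 * (A * Cmod h) / Cmod w ^ 3) * Cmod h) by (field; lra).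
    apply Rmult_le_compat_r; auto.
    apply Rmult_le_reg_r with (Cmod w ^ 3); auto.
    replace (2 * (A * Cmod h) / Cmod w ^ 3 * Cmod w ^ 3) with (2 * (A * Cmod h)) by (field; lra).
    assert (A * Cmod h <= eps / 4 * Cmod w ^ 3).
    { apply Rle_trans with ((A + 1) * (eps / 4 * Cmod w ^ 3 / (A + 1))); [|right; field; lra].
      apply Rmult_le_compat; auto; lra. }
    lra. }
lra.
Qed.

Lemma dq_ccont : ccont dq.
Proof.
intros z. destruct (excluded_middle_informative (z = z0)) as [->|Hz].
- intros eps Heps. destruct (Hl0 (eps / 2)) as [d [Hd0 Hd]]; [lra|].
  exists d; split; auto. intros h Hh.
  unfold dq at 2. destruct (excluded_middle_informative (z0 = z0)); [|tauto].
  unfold dq. destruct (excluded_middle_informative ((z0 + h)%C = z0)) as [E|E].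
  + replace (l0 - l0)%C with (RtoC 0) by ring. rewrite Cmod_0; auto.
  + specialize (Hd h Hh).
    assert (Hh0 : h <> RtoC 0) by (intros ->; apply E; ring).
    replace ((f (z0 + h) - f z0) / (z0 + h - z0) - l0)%C with ((f (z0 + h) - f z0 - l0 * h) / h)%C.
    * rewrite Cmod_div by auto. apply Rle_lt_trans with (eps / 2); [|lra].
      pose proof (proj1 (Cmod_gt_0 h) Hh0). apply Rmult_le_reg_r with (Cmod h); auto.
      replace (_ / Cmod h * Cmod h) with (Cmod (f (z0 + h) - f z0 - l0 * h)%C) by (field; lra). auto.
    * replace (z0 + h - z0)%C with h by ring. field. auto.
- destruct (dq_cdiff z Hz) as [m Hm]. apply (cdiff_cont dq z m Hm).
Qed.

Variable Rad : R.
Hypothesis HR : Cmod z0 < Rad.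

Lemma Rad_pos : 0 < Rad.
Proof. pose proof (Cmod_ge_0 z0). lra. Qed.

Definition CI (u : R -> C) : C := (RInt (fun t => Re (u t)) 0 (2 * PI), RInt (fun t => Im (u t)) 0 (2 * PI)).

Definition Cct (u : R -> C) : Prop := forall t : R, continuous (fun t => Re (u t)) t /\ continuous (fun t => Im (u t)) t.

Lemma Cct_ex u : Cct u -> ex_RInt (fun t => Re (u t)) 0 (2 * PI) /\ ex_RInt (fun t => Im (u t)) 0 (2 * PI).
Proof.
intros H. split; apply (ex_RInt_continuous (V := R_CompleteNormedModule)); intros; apply H.
Qed.

Lemma Cct_plus u v : Cct u -> Cct v -> Cct (fun t => u t + v t)%C.
Proof.
intros Hu Hv t. destruct (Hu t), (Hv t). split.
- apply (continuous_plus (fun t => Re (u t)) (fun t => Re (v t))); auto.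
- apply (continuous_plus (fun t => Im (u t)) (fun t => Im (v t))); auto.
Qed.

Lemma Cct_mult u v : Cct u -> Cct v -> Cct (fun t => u t * v t)%C.
Proof.
intros Hu Hv t. destruct (Hu t) as [A B], (Hv t) as [A' B']. split.
- apply (continuous_minus (fun t => Re (u t) * Re (v t)) (fun t => Im (u t) * Im (v t)));
  apply (continuous_mult (K := R_AbsRing)); auto.
- apply (continuous_plus (fun t => Re (u t) * Im (v t)) (fun t => Im (u t) * Re (v t)));
  apply (continuous_mult (K := R_AbsRing)); auto.
Qed.

Lemma Cct_const c : Cct (fun _ => c).
Proof. intros t; split; apply continuous_const. Qed.

Lemma Cct_pow u n : Cct u -> Cct (fun t => Cpow (u t) n).
Proof. intros H. induction n; simpl; [apply Cct_const|apply Cct_mult; auto]. Qed.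

Lemma Cct_comp g : ccont g -> Cct (fun t => g (polar Rad t)).
Proof.
intros Hg t. destruct (ccont_2d g Hg Rad t) as [A B].
split; [apply (cont_2d_2 _ _ _ A)|apply (cont_2d_2 _ _ _ B)].
Qed.

Lemma CI_plus u v : Cct u -> Cct v -> CI (fun t => u t + v t)%C = (CI u + CI v)%C.
Proof.
intros Hu Hv. destruct (Cct_ex _ Hu), (Cct_ex _ Hv). unfold CI, Cplus; simpl. f_equal.
- apply (RInt_plus (fun t => Re (u t)) (fun t => Re (v t))); auto.
- apply (RInt_plus (fun t => Im (u t)) (fun t => Im (v t))); auto.
Qed.

Lemma CI_scal c u : Cct u -> CI (fun t => c * u t)%C = (c * CI u)%C.
Proof.
intros Hu. destruct (Cct_ex _ Hu) as [A B]. destruct c as [x y].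
assert (S1 : forall a w, ex_RInt w 0 (2 * PI) -> ex_RInt (fun t => a * w t) 0 (2 * PI)).
{ intros a w Hw. apply (ex_RInt_scal w 0 (2 * PI) a); auto. }
assert (S2 : forall a w, ex_RInt w 0 (2 * PI) -> RInt (fun t => a * w t) 0 (2 * PI) = a * RInt w 0 (2 * PI)).
{ intros a w Hw. apply (RInt_scal w 0 (2 * PI) a); auto. }
unfold CI, Cmult; simpl. f_equal.
- rewrite <- !S2; auto. apply (RInt_minus (fun t => x * Re (u t)) (fun t => y * Im (u t))); auto.
- rewrite <- !S2; auto. apply (RInt_plus (fun t => x * Im (u t)) (fun t => y * Re (u t))); auto.
Qed.

Lemma CI_ext u v : (forall t, u t = v t) -> CI u = CI v.
Proof. intros H. unfold CI. f_equal; apply RInt_ext; intros; rewrite H; auto. Qed.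

Lemma CI_bound u M : Cct u -> (forall t, 0 <= t <= 2 * PI -> Cmod (u t) <= M) -> Cmod (CI u) <= 4 * PI * M.
Proof.
intros Hu HM. destruct (Cct_ex _ Hu) as [A B]. pose proof PI_RGT_0.
eapply Rle_trans; [apply Cmod_le_sum|]. unfold CI. simpl Re. simpl Im.
assert (Rabs (RInt (fun t => Re (u t)) 0 (2 * PI)) <= (2 * PI - 0) * M).
{ apply abs_RInt_le_const; auto; [lra|]. intros t Ht. eapply Rle_trans; [apply re_le_Cmod|auto]. }
assert (Rabs (RInt (fun t => Im (u t)) 0 (2 * PI)) <= (2 * PI - 0) * M).
{ apply abs_RInt_le_const; auto; [lra|]. intros t Ht. eapply Rle_trans; [apply im_le_Cmod|auto]. }
lra.
Qed.

Lemma Cct_bounded u : Cct u -> exists M, 0 <= M /\ forall t, 0 <= t <= 2 * PI -> Cmod (u t) <= M.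
Proof.
intros Hu. destruct (Cct_ex _ Hu) as [A B]. pose proof PI_RGT_0.
destruct (ex_RInt_ub (V := R_NormedModule) _ _ _ A) as [M1 H1].
destruct (ex_RInt_ub (V := R_NormedModule) _ _ _ B) as [M2 H2].
rewrite Rmin_left, Rmax_right in H1, H2 by lra.
exists (Rabs M1 + Rabs M2). split; [pose proof (Rabs_pos M1); pose proof (Rabs_pos M2); lra|].
intros t Ht. eapply Rle_trans; [apply Cmod_le_sum|].
specialize (H1 t Ht). specialize (H2 t Ht). unfold norm in H1, H2; simpl in H1, H2; unfold abs in H1, H2; simpl in H1, H2.
pose proof (Rle_abs M1). pose proof (Rle_abs M2). lra.
Qed.

(* 1/zeta on the circle *)
Definition xi (t : R) : C := (/ Rad * cos t, - / Rad * sin t).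

Lemma Cct_xi : Cct xi.
Proof.
intros t. unfold xi; simpl. split.
- apply continuity_pt_filterlim. apply continuity_pt_mult; [apply continuity_pt_const; red; auto|apply continuity_cos].
- apply continuity_pt_filterlim. apply continuity_pt_mult; [apply continuity_pt_const; red; auto|apply continuity_sin].
Qed.

Lemma xi_polar t : (xi t * polar Rad t)%C = RtoC 1.
Proof.
pose proof Rad_pos. unfold xi, polar, Cmult, RtoC; simpl. f_equal.
- replace (_ - _) with ((cos t)² + (sin t)²) by (unfold Rsqr; field; lra).
  rewrite Rplus_comm. apply sin2_cos2.
- field; lra.
Qed.

Lemma Cmod_xi t : Cmod (xi t) = / Rad.
Proof.
pose proof Rad_pos. pose proof (f_equal Cmod (xi_polar t)) as E.
rewrite Cmod_mult, Cmod_polar, Cmod_1, Rabs_pos_eq in E by lra.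
apply Rmult_eq_reg_r with Rad; [|lra]. rewrite E, Rinv_l; lra.
Qed.

Lemma xi_pow n t : Cpow (xi t) n = ((/ Rad) ^ n * cos (INR n * t), - (/ Rad) ^ n * sin (INR n * t)).
Proof.
induction n as [|n IH].
- simpl. rewrite !Rmult_0_l, cos_0, sin_0. unfold RtoC. f_equal; ring.
- simpl Cpow. rewrite IH, S_INR. unfold xi, Cmult; simpl.
  replace ((INR n + 1) * t) with (t + INR n * t) by ring. rewrite cos_plus, sin_plus. f_equal; ring.
Qed.

Lemma CI_xi_pow n : (0 < n)%nat -> CI (fun t => Cpow (xi t) n) = RtoC 0.
Proof.
intros Hn. assert (HnR : INR n <> 0) by (apply not_0_INR; lia).
unfold CI, RtoC. f_equal.
- rewrite (RInt_ext _ (fun t => (/ Rad) ^ n * cos (INR n * t))).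
  2:{ intros t _. rewrite xi_pow. auto. }
  apply is_RInt_unique.
  replace 0 with (minus ((/ Rad) ^ n * / INR n * sin (INR n * (2 * PI))) ((/ Rad) ^ n * / INR n * sin (INR n * 0))) at 2.
  + apply (is_RInt_derive (fun t => (/ Rad) ^ n * / INR n * sin (INR n * t))).
    * intros t _. auto_derive; auto. pose proof Rad_pos. field; repeat split; auto; lra.
    * intros t _. apply continuity_pt_filterlim. apply derivable_continuous_pt, ex_derive_Reals_0. auto_derive; auto.
  + rewrite Rmult_0_r, sin_0. replace (INR n * (2 * PI)) with (0 + 2 * INR n * PI) by ring.
    rewrite sin_period, sin_0. unfold minus, plus, opp; simpl. ring.
- rewrite (RInt_ext _ (fun t => - (/ Rad) ^ n * sin (INR n * t))).
  2:{ intros t _. rewrite xi_pow. auto. }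
  apply is_RInt_unique.
  replace 0 with (minus ((/ Rad) ^ n * / INR n * cos (INR n * (2 * PI))) ((/ Rad) ^ n * / INR n * cos (INR n * 0))) at 2.
  + apply (is_RInt_derive (fun t => (/ Rad) ^ n * / INR n * cos (INR n * t))).
    * intros t _. auto_derive; auto. pose proof Rad_pos. field; repeat split; auto; lra.
    * intros t _. apply continuity_pt_filterlim. apply derivable_continuous_pt, ex_derive_Reals_0. auto_derive; auto.
  + rewrite Rmult_0_r, cos_0. replace (INR n * (2 * PI)) with (0 + 2 * INR n * PI) by ring.
    rewrite cos_period, cos_0. unfold minus, plus, opp; simpl. ring.
Qed.

(** Up to the factor [i], the integrand of the contour integral of [dq] over the circle of radius
    [Rad]. *)
Definition zG (t : R) : C := (polar Rad t * dq (polar Rad t))%C.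

Lemma Cct_zG : Cct zG.
Proof.
apply Cct_mult; [|apply Cct_comp, dq_ccont].
apply (Cct_comp (fun z => z)). intros z eps He. exists eps; split; auto. intros h Hh.
replace (z + h - z)%C with h by ring. auto.
Qed.

(** Cauchy's theorem with [rho0 = Cmod z0]; the constants [k = -i] and [k = -1] extract the real and
    the imaginary part. *)
Lemma CI_zG : CI zG = RtoC 0.
Proof.
pose proof Rad_pos.
assert (HP : forall k, RInt (polarQ k dq Rad) 0 (2 * PI) = 0).
{ intros k. apply polar_zero with (Cmod z0); auto using dq_ccont, Cmod_ge_0; [|lra].
  intros z Hz. apply dq_cdiff. intros ->; auto. }
unfold CI, RtoC. f_equal.
- transitivity (RInt (polarQ (- Ci)%C dq Rad) 0 (2 * PI)); [|apply HP]. apply RInt_ext. intros t _. unfold polarQ, zG. rewrite polar_cis.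
  f_equal. replace (- Ci * Ci)%C with (RtoC 1) by (unfold Ci, Cmult, Copp, RtoC; simpl; f_equal; ring). ring.
- transitivity (RInt (polarQ (RtoC (-1)) dq Rad) 0 (2 * PI)); [|apply HP]. apply RInt_ext. intros t _. unfold polarQ, zG. rewrite polar_cis.
  set (w := dq _). replace (RtoC (-1) * Ci * Rad * w * cis t)%C with (- Ci * (Rad * cis t * w))%C by ring.
  set (v := (Rad * cis t * w)%C). unfold Re, Im; simpl. ring.
Qed.

(** By Cauchy's formula, [2 PI] times the [n]-th Taylor coefficient. *)
Definition Acoef (n : nat) : C := CI (fun t => f (polar Rad t) * Cpow (xi t) n)%C.

Definition Trem (n : nat) : C := CI (fun t => Cpow (z0 * xi t) n * zG t)%C.

Lemma Cct_w n : Cct (fun t => Cpow (z0 * xi t) n).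
Proof. apply Cct_pow. apply (Cct_mult (fun _ => z0)); [apply Cct_const|apply Cct_xi]. Qed.

Lemma Cct_fxi n : Cct (fun t => f (polar Rad t) * Cpow (xi t) n)%C.
Proof. apply Cct_mult; [apply Cct_comp, f_ccont|apply Cct_pow, Cct_xi]. Qed.

(** On the circle [f(zeta) - f(z0) = (1 - z0 xi) zG], so [(z0 xi)^n zG] splits off
    [z0^n xi^n (f(zeta) - f(z0))]. Repeating this peels off the Taylor polynomial without
    interchanging a series and an integral. *)
Lemma Trem_rec n : Trem n =
  (Cpow z0 n * (Acoef n + - f z0 * CI (fun t => Cpow (xi t) n)) + Trem (S n))%C.
Proof.
unfold Trem, Acoef.
rewrite <- (CI_scal (- f z0)) by (apply Cct_pow, Cct_xi).
rewrite <- CI_plus; [|apply Cct_fxi|apply (Cct_mult (fun _ => _)); [apply Cct_const|apply Cct_pow, Cct_xi]].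
rewrite <- CI_scal.
2:{ apply Cct_plus; [apply Cct_fxi|apply (Cct_mult (fun _ => _)); [apply Cct_const|apply Cct_pow, Cct_xi]]. }
rewrite <- CI_plus.
- apply CI_ext. intros t.
  assert (Hz : polar Rad t <> z0).
  { intros E. pose proof (f_equal Cmod E) as E2. rewrite Cmod_polar, Rabs_pos_eq in E2; [lra|].
    pose proof Rad_pos; lra. }
  pose proof (Cminus_neq _ _ Hz) as Hw.
  assert (HE : ((f (polar Rad t) - f z0) = zG t - z0 * xi t * zG t)%C).
  { unfold zG. replace (polar Rad t * dq (polar Rad t) - z0 * xi t * (polar Rad t * dq (polar Rad t)))%C with
      (dq (polar Rad t) * (polar Rad t - z0 * (xi t * polar Rad t)))%C by ring.
    rewrite xi_polar, dq_neq by auto. field. auto. }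
  simpl Cpow. rewrite !Cpow_mult_l.
  transitivity (Cpow z0 n * Cpow (xi t) n * ((f (polar Rad t) - f z0) + z0 * xi t * zG t))%C; [|ring].
  rewrite HE. ring.
- apply (Cct_mult (fun _ => _)); [apply Cct_const|].
  apply Cct_plus; [apply Cct_fxi|apply (Cct_mult (fun _ => _)); [apply Cct_const|apply Cct_pow, Cct_xi]].
- apply Cct_mult; [apply (Cct_w (S n))|apply Cct_zG].
Qed.

Lemma Trem_bound : exists K, 0 <= K /\ forall n, Cmod (Trem n) <= K * (Cmod z0 / Rad) ^ n.
Proof.
destruct (Cct_bounded zG Cct_zG) as [M [HM0 HM]]. pose proof PI_RGT_0.
exists (4 * PI * M). split; [apply Rmult_le_pos; lra|]. intros n.
eapply Rle_trans; [apply (CI_bound _ ((Cmod z0 / Rad) ^ n * M))|right; ring].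
- apply Cct_mult; [apply Cct_w|apply Cct_zG].
- intros t Ht. rewrite Cmod_mult, Cmod_pow, Cmod_mult, Cmod_xi.
  apply Rmult_le_compat_l; auto. apply pow_le. apply Rmult_le_pos; [apply Cmod_ge_0|].
  apply Rlt_le, Rinv_0_lt_compat, Rad_pos.
Qed.

Lemma CI_one : CI (fun t => Cpow (xi t) 0) = RtoC (2 * PI).
Proof.
unfold CI. simpl. rewrite !RInt_const. unfold scal; simpl; unfold mult; simpl. unfold RtoC. f_equal; ring.
Qed.

Fixpoint Csumn (u : nat -> C) (n : nat) : C := match n with O => RtoC 0 | S n => (Csumn u n + u n)%C end.

(** Only the index 0 contributes [f z0], since the integrals of the higher powers of [xi] vanish,
    and the initial remainder [Trem 0] is zero by [CI_zG]. *)
Lemma Cauchy_sum n :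
  (RtoC (2 * PI) * f z0 = Csumn (fun k => Cpow z0 k * Acoef k) (S n) + Trem (S n))%C.
Proof.
induction n as [|n IH].
- pose proof (Trem_rec 0) as H. rewrite CI_one in H.
  assert (H0 : Trem 0 = RtoC 0).
  { rewrite <- CI_zG. apply CI_ext. intros t; simpl; ring. }
  rewrite H0 in H. simpl Csumn. simpl Cpow in *.
  transitivity (RtoC 0 + RtoC (2 * PI) * f z0)%C; [ring|]. rewrite H at 1. ring.
- rewrite IH. rewrite (Trem_rec (S n)), CI_xi_pow by lia.
  change (Csumn (fun k => Cpow z0 k * Acoef k)%C (S (S n))) with
   (Csumn (fun k => Cpow z0 k * Acoef k)%C (S n) + Cpow z0 (S n) * Acoef (S n))%C. ring.
Qed.

End Cauchy.

Lemma Cser_limit (u : nat -> C) (s : C) (e : nat -> R) :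
  (forall n, Cmod (s - Csumn u (S n))%C <= e n) -> is_lim_seq e 0 -> Cser u = s.
Proof.
intros Hu He.
assert (H : forall (p : C -> R), (forall z, Rabs (p z) <= Cmod z) -> (forall z w, p (z + w)%C = p z + p w) ->
   p (RtoC 0) = 0 -> Series (fun n => p (u n)) = p s).
{ intros p H1 H2 H3. apply is_series_unique.
  assert (E : forall n, sum_n (fun n => p (u n)) n = p (Csumn u (S n))).
  { induction n as [|n IH].
    - rewrite sum_O. simpl. rewrite H2, H3. ring.
    - rewrite sum_Sn, IH. change (Csumn u (S (S n))) with (Csumn u (S n) + u (S n))%C. rewrite H2. auto. }
  assert (HL : is_lim_seq (sum_n (fun n => p (u n))) (p s)).
  { apply is_lim_seq_eps. intros eps.
    destruct (proj1 (is_lim_seq_eps _ _) He eps) as [N HN]. exists N. intros n Hn.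
    rewrite E. assert (E2 : p s - p (Csumn u (S n)) = p (s - Csumn u (S n))%C).
    { replace s with ((s - Csumn u (S n)) + Csumn u (S n))%C at 1 by ring. rewrite H2. ring. }
    rewrite Rabs_minus_sym, E2. eapply Rle_lt_trans; [apply H1|].
    eapply Rle_lt_trans; [apply Hu|]. specialize (HN n Hn). rewrite Rminus_0_r in HN.
    apply Rabs_def2 in HN. lra. }
  exact HL. }
unfold Cser. rewrite (H Re), (H Im); auto using re_le_Cmod, im_le_Cmod.
destruct s; auto.
Qed.

Lemma entire_taylor (f : C -> C) Rad : (forall z, exists l, cdiff f z l) -> 0 < Rad ->
  exists a, geom_bd (/ Rad) a /\ forall z, Cmod z < Rad -> f z = Tay a z.
Proof.
intros Hf HR. pose proof PI_RGT_0 as HPI.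
exists (fun k => RtoC (INR (fact k)) * (RtoC (/ (2 * PI)) * Acoef f Rad k))%C.
assert (Hz0 : Cmod (RtoC 0) < Rad) by (rewrite Cmod_0; auto).
split.
- destruct (Cct_bounded _ (Cct_comp Rad f (f_ccont f Hf))) as [M [HM0 HM]].
  exists (/ (2 * PI) * (4 * PI * M)). intros k.
  assert (HA : Cmod (Acoef f Rad k) <= 4 * PI * ((/ Rad) ^ k * M)).
  { apply CI_bound.
    - apply Cct_mult; [apply Cct_comp, f_ccont; auto|apply Cct_pow, Cct_xi].
    - intros t Ht. rewrite Cmod_mult, Cmod_pow, (Cmod_xi (RtoC 0) Rad Hz0).
      rewrite Rmult_comm. apply Rmult_le_compat_l; auto. apply pow_le, Rlt_le, Rinv_0_lt_compat; auto. }
  rewrite !Cmod_mult, !Cmod_R, (Rabs_pos_eq (INR _)) by apply pos_INR.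
  rewrite Rabs_pos_eq by (apply Rlt_le, Rinv_0_lt_compat; lra).
  rewrite Rmult_comm. apply Rmult_le_compat_r; [apply pos_INR|].
  apply Rle_trans with (/ (2 * PI) * (4 * PI * ((/ Rad) ^ k * M))); [|right; ring].
  apply Rmult_le_compat_l; auto. apply Rlt_le, Rinv_0_lt_compat; lra.
- intros z Hz. destruct (Hf z) as [l Hl]. symmetry. unfold Tay.
  destruct (Trem_bound f Hf z l Hl Rad Hz) as [K [HK0 HK]].
  apply Cser_limit with (fun n => / (2 * PI) * (K * (Cmod z / Rad) ^ S n)).
  + intros n. pose proof (Cauchy_sum f Hf z l Hl Rad Hz n) as HC.
    replace (f z - _)%C with (RtoC (/ (2 * PI)) * Trem f z l Rad (S n))%C.
    * rewrite Cmod_mult, Cmod_R, Rabs_pos_eq by (apply Rlt_le, Rinv_0_lt_compat; lra).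
      apply Rmult_le_compat_l; auto. apply Rlt_le, Rinv_0_lt_compat; lra.
    * assert (E : forall n, Csumn (fun k => RtoC (INR (fact k)) * (RtoC (/ (2 * PI)) * Acoef f Rad k) * RtoC (/ INR (fact k)) * Cpow z k)%C n
        = (RtoC (/ (2 * PI)) * Csumn (fun k => Cpow z k * Acoef f Rad k) n)%C).
      { induction n0 as [|n0 IH]; simpl Csumn; [ring|]. rewrite IH.
        replace (RtoC (INR (fact n0)) * (RtoC (/ (2 * PI)) * Acoef f Rad n0) * RtoC (/ INR (fact n0)) * Cpow z n0)%C with
          ((RtoC (INR (fact n0)) * RtoC (/ INR (fact n0))) * (RtoC (/ (2 * PI)) * (Cpow z n0 * Acoef f Rad n0)))%C by ring.
        rewrite <- RtoC_mult, Rinv_r by apply INR_fact_neq_0. ring. }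
      rewrite E.
      replace (f z) with (RtoC (/ (2 * PI)) * (RtoC (2 * PI) * f z))%C.
      -- rewrite HC. ring.
      -- rewrite Cmult_assoc, <- RtoC_mult, Rinv_l by lra. ring.
  + replace (Finite 0) with (Finite (/ (2 * PI) * (K * 0))) by (f_equal; ring).
    apply is_lim_seq_mult'; [apply is_lim_seq_const|]. apply is_lim_seq_mult'; [apply is_lim_seq_const|].
    apply (is_lim_seq_incr_1 (fun n => (Cmod z / Rad) ^ n)). apply is_lim_seq_geom.
    pose proof (Cmod_ge_0 z). rewrite Rabs_pos_eq.
    * apply Rmult_lt_reg_r with Rad; auto. field_simplify; lra.
    * apply Rmult_le_pos; auto. apply Rlt_le, Rinv_0_lt_compat; auto.
Qed.

Lemma cdiff_ext_loc f g z l r : 0 < r -> (forall h, Cmod h < r -> f (z + h)%C = g (z + h)%C) ->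
  cdiff f z l -> cdiff g z l.
Proof.
intros Hr E H eps Heps. destruct (H eps Heps) as [d [Hd H1]].
exists (Rmin d r). split; [apply Rmin_case; auto|]. intros h Hh.
assert (E0 : f z = g z).
{ specialize (E (RtoC 0)). rewrite Cplus_0_r in E. apply E. rewrite Cmod_0; auto. }
rewrite <- E, <- E0.
- apply H1. eapply Rlt_le_trans; [exact Hh|apply Rmin_l].
- eapply Rlt_le_trans; [exact Hh|apply Rmin_r].
Qed.

Lemma cdiff_C_derive f z l : cdiff f z l -> C_derive f z = l.
Proof. intros H. apply is_C_derive_unique. apply cdiff_is_derive, H. Qed.

Lemma entire_cdiff f : entire f <-> forall z, exists l, cdiff f z l.
Proof.
split; intros H z.
- destruct (H z) as [l Hl]. exists l. apply cdiff_is_derive, Hl.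
- destruct (H z) as [l Hl]. exists l. apply cdiff_is_derive, Hl.
Qed.

Lemma Tay_ext a b z : (forall k, a k = b k) -> Tay a z = Tay b z.
Proof. intros H. apply Cser_ext. intros; rewrite H; auto. Qed.

Lemma Tay_at0 a : Tay a (RtoC 0) = a O.
Proof.
unfold Tay. rewrite Cser_incr.
- rewrite (Cser_ext _ (fun _ => RtoC 0)).
  + unfold Cser. simpl.
    rewrite (Series_ext _ (fun n => 0 * 0)) by (intros; ring). rewrite Series_scal_l.
    destruct (a 0%nat) as [x y]. unfold Cmult, Cplus, RtoC; simpl. f_equal; field.
  + intros n. simpl. ring.
- apply csum_incr. apply csum_le with (fun _ => 0).
  + exists 0. apply filterlim_ext with (fun _ => 0); [|apply filterlim_const].
    intros n. rewrite sum_n_const. ring.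
  + intros n. simpl. replace (_ * (0 * _))%C with (RtoC 0) by ring. rewrite Cmod_0. lra.
Qed.

(** The bound is asked for every [rho] above [/ Rad] rather than at [/ Rad], because each
    differentiation shifts the coefficients and enlarges the rate a little. *)
Lemma derive_n_Tay F a Rad : 0 < Rad ->
  (forall rho, / Rad < rho -> geom_bd rho a) -> (forall z, Cmod z < Rad -> F z = Tay a z) ->
  forall k z, Cmod z < Rad -> C_derive_n F k z = Tay (fun j => a (k + j)%nat) z.
Proof.
intros HR Hbd HF k. induction k as [|k IH]; intros z Hz; [apply HF; auto|].
simpl C_derive_n. apply cdiff_C_derive.
apply cdiff_ext_loc with (Tay (fun j => a (k + j)%nat)) (Rad - Cmod z); [lra| |].
- intros h Hh. symmetry. apply IH. eapply Rle_lt_trans; [apply Cmod_triangle|lra].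
- assert (HbdS : forall m rho, / Rad < rho -> geom_bd rho (fun j => a (m + j)%nat)).
  { pose proof (Rinv_0_lt_compat _ HR).
    induction m as [|m IHm]; intros rho Hrho; [apply Hbd; auto|].
    assert (Hmid : / Rad < (/ Rad + rho) / 2) by lra.
    destruct (bd_shift ((/ Rad + rho) / 2) rho _ ltac:(lra) (IHm _ Hmid)) as [M HM].
    exists M. intros j. specialize (HM j). replace (S m + j)%nat with (m + S j)%nat by lia. auto. }
  pose proof (Cmod_ge_0 z).
  assert (Hr : exists rho, / Rad < rho /\ Cmod z * rho < 1).
  { exists (2 / (Rad + Cmod z)). split.
    - apply Rmult_lt_reg_r with (Rad * (Rad + Cmod z)); [apply Rmult_lt_0_compat; lra|]. field_simplify; lra.
    - apply Rmult_lt_reg_r with (Rad + Cmod z); [lra|]. field_simplify; lra. }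
  destruct Hr as [rho [H1 H2]]. pose proof (Rinv_0_lt_compat _ HR).
  pose proof (Tay_cdiff rho (fun j => a (k + j)%nat) z ltac:(lra) H2 (HbdS k rho H1)) as HT.
  replace (Tay (fun j => a (S k + j)%nat) z) with (Tay (fun j => a (k + S j)%nat) z); [exact HT|].
  apply Tay_ext. intros j. f_equal. lia.
Qed.

Definition ent (a : nat -> C) : Prop := forall rho, 0 < rho -> geom_bd rho a.

(** * Taylor coefficients and the spaces A_a *)

Definition coef (f : C -> C) (k : nat) : C := C_derive_n f k (RtoC 0).

(** The coefficients found on the circle of radius [Rad] are derivatives at 0, hence independent of
    [Rad]; letting [Rad] grow gives the bounds at every rate. *)
Lemma entire_coef f : entire f -> ent (coef f) /\ forall z, f z = Tay (coef f) z.
Proof.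
intros Hf0. pose proof (proj1 (entire_cdiff f) Hf0) as Hf.
assert (H : forall Rad, 0 < Rad -> geom_bd (/ Rad) (coef f) /\ forall z, Cmod z < Rad -> f z = Tay (coef f) z).
{ intros Rad HR. destruct (entire_taylor f Rad Hf HR) as [a [Ha HT]].
  assert (E : forall k, a k = coef f k).
  { intros k. unfold coef.
    rewrite (derive_n_Tay f a Rad HR); auto.
    - rewrite Tay_at0. f_equal. lia.
    - intros rho Hrho. apply bd_le with (/ Rad); auto. pose proof (Rinv_0_lt_compat _ HR). lra.
    - rewrite Cmod_0; auto. }
  split.
  - destruct Ha as [M HM]. exists M. intros k. rewrite <- E. auto.
  - intros z Hz. rewrite (HT z Hz). apply Tay_ext, E. }
split.
- intros rho Hrho. destruct (H (/ rho)) as [A _]; [apply Rinv_0_lt_compat; auto|].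
  rewrite Rinv_inv in A. auto.
- intros z. destruct (H (Cmod z + 1)) as [_ A]; [pose proof (Cmod_ge_0 z); lra|]. apply A; lra.
Qed.

Lemma ent_Tay a : ent a -> entire (Tay a) /\ forall k, coef (Tay a) k = a k.
Proof.
intros Ha. split.
- apply (proj2 (entire_cdiff _)). intros z. eexists. pose proof (Cmod_ge_0 z).
  apply Tay_cdiff with (/ (Cmod z + 1)); [apply Rinv_0_lt_compat; lra| |].
  + apply Rmult_lt_reg_r with (Cmod z + 1); [lra|]. field_simplify; lra.
  + apply Ha, Rinv_0_lt_compat; lra.
- intros k. unfold coef. rewrite (derive_n_Tay (Tay a) a 1 Rlt_0_1); auto.
  + rewrite Tay_at0. f_equal; lia.
  + intros rho Hr. apply Ha. rewrite Rinv_1 in Hr. lra.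
  + rewrite Cmod_0; lra.
Qed.

Lemma ent_csum a z : ent a -> csum (fun k => a k * RtoC (/ INR (fact k)) * Cpow z k)%C.
Proof.
intros Ha. pose proof (Cmod_ge_0 z). apply Tay_csum with (/ (Cmod z + 1)).
- apply Rlt_le, Rinv_0_lt_compat; lra.
- apply Rmult_lt_reg_r with (Cmod z + 1); [lra|]. field_simplify; lra.
- apply Ha, Rinv_0_lt_compat; lra.
Qed.

Lemma ent_plus a b : ent a -> ent b -> ent (fun k => a k + b k)%C.
Proof.
intros Ha Hb rho Hr. destruct (Ha rho Hr) as [M HM]. destruct (Hb rho Hr) as [N HN].
exists (M + N). intros k. eapply Rle_trans; [apply Cmod_triangle|].
rewrite !Rmult_plus_distr_r. apply Rplus_le_compat; auto.
Qed.

Lemma ent_scal c a : ent a -> ent (fun k => c * a k)%C.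
Proof.
intros Ha rho Hr. destruct (Ha rho Hr) as [M HM].
exists (Cmod c * M). intros k. rewrite Cmod_mult, !Rmult_assoc. apply Rmult_le_compat_l; [apply Cmod_ge_0|].
rewrite <- Rmult_assoc. auto.
Qed.

Lemma ent_shift a : ent a -> ent (fun k => a (S k)).
Proof. intros Ha rho Hr. apply bd_shift with (rho / 2); [lra|]. apply Ha; lra. Qed.

Lemma Tay_plus a b z : ent a -> ent b -> Tay (fun k => a k + b k)%C z = (Tay a z + Tay b z)%C.
Proof.
intros Ha Hb. unfold Tay. rewrite <- Cser_plus by (apply ent_csum; auto). apply Cser_ext; intros; ring.
Qed.

Lemma Tay_scal c a z : ent a -> Tay (fun k => c * a k)%C z = (c * Tay a z)%C.
Proof.
intros Ha. unfold Tay. rewrite <- Cser_scal by (apply ent_csum; auto). apply Cser_ext; intros; ring.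
Qed.

Lemma Tay_zmul a z : ent a -> Tay (fun k => RtoC (INR k) * a (pred k))%C z = (z * Tay a z)%C.
Proof.
intros Ha. unfold Tay. rewrite Cser_incr.
- simpl INR at 1. replace (RtoC 0 * _ * _ * _)%C with (RtoC 0) by ring. rewrite Cplus_0_l.
  rewrite <- Cser_scal by (apply ent_csum; auto). apply Cser_ext. intros k. simpl pred.
  simpl Cpow. rewrite fact_simpl, mult_INR.
  replace (RtoC (/ INR (fact k))) with (RtoC (INR (S k)) * RtoC (/ (INR (S k) * INR (fact k))))%C; [ring|].
  rewrite <- RtoC_mult. f_equal. field. split; [apply INR_fact_neq_0|apply not_0_INR; lia].
- apply csum_incr. eapply ex_series_ext; [|apply (csum_scal z _ (ent_csum a z Ha))].
  intros k. simpl. f_equal. simpl Cpow.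
  change (fact k + k * fact k)%nat with (fact (S k)). change (match k with O => 1 | S _ => INR k + 1 end) with (INR (S k)).
  rewrite fact_simpl, mult_INR.
  replace (RtoC (/ INR (fact k))) with (RtoC (INR (S k)) * RtoC (/ (INR (S k) * INR (fact k))))%C; [ring|].
  rewrite <- RtoC_mult. f_equal. field. split; [apply INR_fact_neq_0|apply not_0_INR; lia].
Qed.

Lemma entire_C_derive f z : entire f ->
  C_derive f z = Tay (fun k => coef f (S k)) z /\ C_derive_n f 2 z = Tay (fun k => coef f (S (S k))) z.
Proof.
intros Hf. destruct (entire_coef f Hf) as [He HT].
assert (HR : 0 < Cmod z + 1) by (pose proof (Cmod_ge_0 z); lra).
assert (Hb : forall rho, / (Cmod z + 1) < rho -> geom_bd rho (coef f)).
{ intros rho Hr. apply He. pose proof (Rinv_0_lt_compat _ HR). lra. }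
split.
- exact (derive_n_Tay f (coef f) _ HR Hb (fun z _ => HT z) 1%nat z ltac:(lra)).
- exact (derive_n_Tay f (coef f) _ HR Hb (fun z _ => HT z) 2%nat z ltac:(lra)).
Qed.

Lemma ent_Dl theta a : ent a -> ent (fun k => RtoC (INR k + theta) * a (S k))%C.
Proof.
intros Ha rho Hr.
assert (H1 : ent (fun k => RtoC theta * a (S k))%C) by (apply ent_scal, ent_shift; auto).
destruct (H1 rho Hr) as [M HM].
destruct (Ha (rho / 2) ltac:(lra)) as [N HN].
assert (HN0 : 0 <= N).
{ specialize (HN 0%nat). simpl in HN. pose proof (Cmod_ge_0 (a 0%nat)). lra. }
exists (N * (rho / 2) * 4 * 4 + M). intros k.
rewrite RtoC_plus, Cmult_plus_distr_r. eapply Rle_trans; [apply Cmod_triangle|].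
rewrite !Rmult_plus_distr_r. apply Rplus_le_compat; [|auto].
rewrite Cmod_mult, Cmod_R, Rabs_pos_eq by apply pos_INR.
apply Rle_trans with (INR k * (N * (rho / 2) ^ S k * INR (fact (S k)))).
{ apply Rmult_le_compat_l; [apply pos_INR|auto]. }
rewrite fact_simpl, mult_INR.
(* The bound on [a] is taken at rate [rho / 2], so a factor [2^k] is free to absorb [k (k + 1)];
   each linear factor takes [sqrt 2 ^ k]. *)
assert (Hk : INR k * INR (S k) <= 16 * 2 ^ k).
{ assert (Hp : forall k, INR k + 1 <= 2 * (sqrt 2) ^ k * 2).
  { intros j. pose proof (poly j (sqrt 2 - 1)) as Hp.
    assert (Hs : 1.4 < sqrt 2).
    { rewrite <- (sqrt_Rsqr 1.4) by lra. apply sqrt_lt_1; unfold Rsqr; lra. }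
    specialize (Hp ltac:(lra)). replace (1 + (sqrt 2 - 1)) with (sqrt 2) in Hp by ring.
    pose proof (pos_INR j). nra. }
  pose proof (Hp k) as Hk. rewrite S_INR. pose proof (pos_INR k).
  assert (E : (2 * sqrt 2 ^ k * 2) * (2 * sqrt 2 ^ k * 2) = 16 * 2 ^ k).
  { replace (2 ^ k) with (sqrt 2 ^ k * sqrt 2 ^ k); [ring|]. rewrite <- Rpow_mult_distr, sqrt_def by lra. auto. }
  rewrite <- E. apply Rmult_le_compat; lra. }
replace (INR k * (N * (rho / 2) ^ S k * (INR (S k) * INR (fact k)))) with
  (N * (rho / 2) * (rho / 2) ^ k * INR (fact k) * (INR k * INR (S k))) by (simpl; ring).
replace (N * (rho / 2) * 4 * 4 * rho ^ k * INR (fact k)) with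
  (N * (rho / 2) * (rho / 2) ^ k * INR (fact k) * (16 * 2 ^ k)).
- apply Rmult_le_compat_l; auto. pose proof (pos_INR (fact k)).
  repeat apply Rmult_le_pos; auto; try lra. apply pow_le; lra.
- unfold Rdiv. rewrite Rpow_mult_distr, pow_inv. field. apply pow_nonzero; lra.
Qed.

Lemma Delta_entire theta f z : entire f ->
  Defs.Delta theta f z = Tay (fun k => RtoC (INR k + theta) * coef f (S k))%C z.
Proof.
intros Hf. destruct (entire_C_derive f z Hf) as [H1 H2]. destruct (entire_coef f Hf) as [He _].
unfold Defs.Delta. rewrite H1, H2.
rewrite <- Tay_zmul by (apply (ent_shift (fun k => coef f (S k))), ent_shift; auto).
rewrite <- Tay_scal by (apply ent_shift; auto).
rewrite <- Tay_plus.
- apply Tay_ext. intros k. rewrite RtoC_plus. destruct k; simpl pred; [simpl INR|]; ring.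
- apply ent_scal, ent_shift; auto.
- intros rho Hr. destruct (ent_Dl 0 _ He rho Hr) as [M HM]. exists M. intros k.
  specialize (HM k). rewrite Rplus_0_r in HM.
  destruct k; simpl pred; [simpl INR in *; rewrite Cmult_0_l in *; auto|auto].
Qed.

Lemma pow_le_fact x : 0 <= x -> exists M, 0 <= M /\ forall k, x ^ k <= M * INR (fact k).
Proof.
intros Hx. destruct (nfloor_ex x Hx) as [N [_ HN]].
set (m := Rmax 1 x). assert (Hm1 : 1 <= m) by apply Rmax_l. assert (Hmx : x <= m) by apply Rmax_r.
exists (m ^ S N). split; [apply pow_le; lra|]. intros k.
destruct (Nat.le_gt_cases k (S N)) as [Hk|Hk].
- apply Rle_trans with (m ^ k); [apply pow_incr; lra|].
  apply Rle_trans with (m ^ S N); [apply Rle_pow; auto|].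
  rewrite <- (Rmult_1_r (m ^ S N)) at 1. apply Rmult_le_compat_l; [apply pow_le; lra|].
  apply (le_INR 1). pose proof (lt_O_fact k). lia.
- induction Hk as [|k Hk IH].
  + rewrite fact_simpl, mult_INR. simpl pow.
    apply Rle_trans with (INR (S (S N)) * (m * m ^ N)).
    * apply Rmult_le_compat; [lra|apply Rmult_le_pos; [lra|apply pow_le; lra]|rewrite !S_INR; lra|].
      change (x ^ S N <= m ^ S N). apply pow_incr; lra.
    * replace (m * m ^ N * (INR (S (S N)) * INR (fact (S N)))) with (INR (S (S N)) * (m * m ^ N) * INR (fact (S N))) by ring.
      rewrite <- (Rmult_1_r (INR (S (S N)) * (m * m ^ N))) at 1. apply Rmult_le_compat_l.
      -- apply Rmult_le_pos; [apply pos_INR|]. apply Rmult_le_pos; [lra|apply pow_le; lra].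
      -- apply (le_INR 1). pose proof (lt_O_fact (S N)). lia.
  + rewrite fact_simpl, mult_INR. simpl (x ^ S k).
    replace (m ^ S N * (INR (S k) * INR (fact k))) with (INR (S k) * (m ^ S N * INR (fact k))) by ring.
    apply Rmult_le_compat; auto using pow_le. rewrite S_INR.
    assert (INR N + 1 <= INR k) by (rewrite <- S_INR; apply le_INR; lia). lra.
Qed.

Lemma ent_expo M b (a : nat -> C) : 0 <= b -> (forall k, Cmod (a k) <= M * b ^ k) -> ent a.
Proof.
intros Hb Ha rho Hr.
assert (HM : 0 <= M).
{ specialize (Ha 0%nat). simpl in Ha. pose proof (Cmod_ge_0 (a 0%nat)). lra. }
assert (Hbr : 0 <= b / rho) by (apply Rmult_le_pos; auto; apply Rlt_le, Rinv_0_lt_compat; auto).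
destruct (pow_le_fact _ Hbr) as [K [HK0 HK]].
exists (M * K). intros k. eapply Rle_trans; [apply Ha|].
replace (b ^ k) with ((b / rho) ^ k * rho ^ k).
- replace (M * K * rho ^ k * INR (fact k)) with (M * ((K * INR (fact k)) * rho ^ k)) by ring.
  apply Rmult_le_compat_l; auto. apply Rmult_le_compat_r; auto. apply pow_le; lra.
- rewrite <- Rpow_mult_distr. f_equal. field; lra.
Qed.

Lemma Cser_mult u v : csum u -> csum v ->
  Cser (fun n => (sum_f_R0 (fun k => Re (u k * v (n - k)%nat)%C) n,
                  sum_f_R0 (fun k => Im (u k * v (n - k)%nat)%C) n)) = (Cser u * Cser v)%C.
Proof.
intros Hu Hv. destruct (csum_comp _ Hu) as [[A1 A2] [A3 A4]]. destruct (csum_comp _ Hv) as [[B1 B2] [B3 B4]].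
apply Series_correct in A2, A4, B2, B4.
pose proof (is_series_mult _ _ _ _ A2 B2 A1 B1) as M1.
pose proof (is_series_mult _ _ _ _ A4 B4 A3 B3) as M2.
pose proof (is_series_mult _ _ _ _ A2 B4 A1 B3) as M3.
pose proof (is_series_mult _ _ _ _ A4 B2 A3 B1) as M4.
unfold Cser at 1. unfold Cmult, Cser. simpl. f_equal.
- apply is_series_unique. eapply is_series_ext; [|exact (is_series_minus _ _ _ _ M1 M2)].
  intros n. simpl. unfold plus, opp; simpl. rewrite <- Rminus_def, <- minus_sum. apply sum_eq. intros i _. unfold Re, Im; simpl. auto.
- apply is_series_unique. eapply is_series_ext; [|exact (is_series_plus _ _ _ _ M3 M4)].
  intros n. simpl. unfold plus; simpl. rewrite <- sum_plus. apply sum_eq. intros i _. unfold Re, Im; simpl. auto.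
Qed.

Definition rT (c : nat -> R) (z : C) : C := Tay (fun k => RtoC (c k)) z.

Lemma rT_conv c d z : ent (fun k => RtoC (c k)) -> ent (fun k => RtoC (d k)) ->
  rT (conv c d) z = (rT c z * rT d z)%C.
Proof.
intros Hc Hd. unfold rT, Tay. rewrite <- Cser_mult by (apply ent_csum; auto).
apply Cser_ext. intros n.
set (s := sum_f_R0 (fun j => c j / INR (fact j) * (d (n - j)%nat / INR (fact (n - j)))) n).
assert (E : forall k, (k <= n)%nat ->
  (RtoC (c k) * RtoC (/ INR (fact k)) * Cpow z k * (RtoC (d (n - k)%nat) * RtoC (/ INR (fact (n - k))) * Cpow z (n - k)))%C
   = (RtoC (c k / INR (fact k) * (d (n - k)%nat / INR (fact (n - k)))) * Cpow z n)%C).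
{ intros k Hk. replace (Cpow z n) with (Cpow z k * Cpow z (n - k))%C by (rewrite <- Cpow_add_r; f_equal; lia).
  unfold Rdiv. rewrite !RtoC_mult. ring. }
replace (RtoC (conv c d n) * RtoC (/ INR (fact n)) * Cpow z n)%C with (RtoC s * Cpow z n)%C.
- apply injective_projections; simpl.
  + rewrite Rmult_0_l, Rminus_0_r. unfold s. rewrite Rmult_comm, scal_sum. apply sum_eq. intros k Hk.
    change (fst (z ^ n)%C) with (Re (z ^ n)%C). pose proof (E k Hk) as Ek.
    apply (f_equal Re) in Ek. unfold Re in *. simpl in *. rewrite Ek. ring.
  + rewrite Rmult_0_l, Rplus_0_r. unfold s. rewrite Rmult_comm, scal_sum. apply sum_eq. intros k Hk.
    pose proof (E k Hk) as Ek.
    apply (f_equal Im) in Ek. unfold Im in *. simpl in *. rewrite Ek. ring.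
- unfold conv. fold s. rewrite <- RtoC_mult. f_equal. f_equal. field. apply INR_fact_neq_0.
Qed.

Lemma rent_expo M b c : 0 <= b -> expo M b c -> ent (fun k => RtoC (c k)).
Proof. intros Hb Hc. apply ent_expo with M b; auto. intros; rewrite Cmod_R; auto. Qed.

Lemma rT_oneL z : rT oneL z = RtoC 1.
Proof.
unfold rT, Tay. rewrite Cser_incr.
- rewrite (Cser_ext _ (fun _ => RtoC 0)) by (intros n; simpl; ring).
  unfold Cser. simpl.
  rewrite (Series_ext _ (fun n => 0 * 0)) by (intros; ring). rewrite Series_scal_l.
  unfold Cmult, Cplus, RtoC; simpl. f_equal; field.
- apply (ent_csum (fun k => RtoC (oneL k))). apply rent_expo with 1 1; [lra|].
  intros k. rewrite pow1. destruct k; simpl; [rewrite Rabs_R1|rewrite Rabs_R0]; lra.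
Qed.

Lemma rT_powc n M b c z : 0 <= b -> expo M b c -> rT (powc n c) z = Cpow (rT c z) n.
Proof.
intros Hb Hc. induction n as [|n IH]; [apply rT_oneL|].
simpl. rewrite rT_conv.
- rewrite IH; auto.
- apply rent_expo with M b; auto.
- apply rent_expo with (M ^ n) (INR n * b); [apply Rmult_le_pos; auto using pos_INR|apply powc_expo; auto].
Qed.

Lemma rT_scale s c z : rT (fun k => s ^ k * c k) z = rT c (z * RtoC s)%C.
Proof.
unfold rT, Tay. apply Cser_ext. intros k. rewrite Cpow_mult_l, <- RtoC_pow, RtoC_mult. ring.
Qed.

Lemma rT_Qop n s M b c z : 0 < s -> 0 <= b -> expo M b c -> rT (Qop n s c) z = Cpow (rT c (z * RtoC s)%C) n.
Proof.
intros Hs Hb Hc. unfold Qop. rewrite (rT_powc n M (s * b)), rT_scale; auto.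
- apply Rmult_le_pos; lra.
- intros k. rewrite Rabs_mult, (Rabs_pos_eq (s ^ k)) by (apply pow_le; lra).
  rewrite Rpow_mult_distr. replace (M * (s ^ k * b ^ k)) with (s ^ k * (M * b ^ k)) by ring.
  apply Rmult_le_compat_l; auto. apply pow_le; lra.
Qed.

(** * The complex exponential *)

Lemma cexp_plus z w : cexp (z + w) = (cexp z * cexp w)%C.
Proof.
unfold cexp, Cmult, Cplus, Re, Im; simpl. rewrite exp_plus, cos_plus, sin_plus. f_equal; ring.
Qed.

Lemma deriv_eps (f : R -> R) l : f 0 = f 0 -> is_derive f 0 l -> forall eps, 0 < eps ->
  exists d, 0 < d /\ forall x, Rabs x < d -> Rabs (f x - f 0 - l * x) <= eps * Rabs x.
Proof.
intros _ Hd eps Heps. apply is_derive_Reals in Hd. destruct (Hd eps Heps) as [d H].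
exists d. split; [apply cond_pos|]. intros x Hx.
destruct (Req_dec x 0) as [->|Hx0].
- rewrite Rmult_0_r, Rminus_0_r, Rminus_eq_0, Rabs_R0. lra.
- specialize (H x Hx0 Hx). rewrite Rplus_0_l in H.
  replace (f x - f 0 - l * x) with (((f x - f 0) / x - l) * x) by (field; auto).
  rewrite Rabs_mult. apply Rmult_le_compat_r; [apply Rabs_pos|lra].
Qed.

(** The functional equation reduces the claim to the origin, where the first-order expansions of
    [exp], [cos] and [sin] are combined. *)
Lemma cdiff_cexp z : cdiff cexp z (cexp z).
Proof.
assert (key : forall eps, 0 < eps -> exists d, 0 < d /\ forall h, Cmod h < d -> Cmod (cexp h - 1 - h)%C <= eps * Cmod h).
{ intros eps Heps.
  (* The real and imaginary parts will cost 3 and 5 times [e * m], so 20 leaves room. *)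
  assert (He : 0 < Rmin 1 eps / 20) by (assert (0 < Rmin 1 eps) by (apply Rmin_case; lra); lra).
  set (e := Rmin 1 eps / 20) in *.
  assert (He1 : e <= 1 / 20 /\ e <= eps / 20).
  { unfold e. pose proof (Rmin_l 1 eps). pose proof (Rmin_r 1 eps). lra. }
  destruct (deriv_eps exp 1 eq_refl) with (eps := e) as [d1 [Hd1 H1]]; auto.
  { pose proof (is_derive_exp 0) as H. rewrite exp_0 in H. auto. }
  destruct (deriv_eps cos 0 eq_refl) with (eps := e) as [d2 [Hd2 H2]]; auto.
  { pose proof (is_derive_cos 0) as H. rewrite sin_0, Ropp_0 in H. auto. }
  destruct (deriv_eps sin 1 eq_refl) with (eps := e) as [d3 [Hd3 H3]]; auto.
  { pose proof (is_derive_sin 0) as H. rewrite cos_0 in H. auto. }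
  exists (Rmin e (Rmin d1 (Rmin d2 d3))). split; [repeat apply Rmin_case; auto|].
  intros [x y] Hh.
  assert (Hm : Cmod (x, y) < e /\ Cmod (x, y) < d1 /\ Cmod (x, y) < d2 /\ Cmod (x, y) < d3).
  { repeat split; (eapply Rlt_le_trans; [exact Hh|]).
    - apply Rmin_l.
    - eapply Rle_trans; [apply Rmin_r|apply Rmin_l].
    - eapply Rle_trans; [apply Rmin_r|]. eapply Rle_trans; [apply Rmin_r|apply Rmin_l].
    - eapply Rle_trans; [apply Rmin_r|]. eapply Rle_trans; [apply Rmin_r|apply Rmin_r]. }
  set (m := Cmod (x, y)) in *.
  assert (Hx : Rabs x <= m) by apply (re_le_Cmod (x, y)).
  assert (Hy : Rabs y <= m) by apply (im_le_Cmod (x, y)).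
  specialize (H1 x ltac:(lra)). specialize (H2 y ltac:(lra)). specialize (H3 y ltac:(lra)).
  rewrite exp_0 in H1. rewrite cos_0 in H2. rewrite sin_0 in H3.
  pose proof (Rabs_pos x) as Hx0. pose proof (Rabs_pos y) as Hy0. assert (Hm0 : 0 <= m) by lra.
  eapply Rle_trans; [apply Cmod_le_sum|]. unfold cexp, Re, Im; simpl.
  set (E := exp x - 1 - 1 * x) in *. set (Co := cos y - 1 - 0 * y) in *. set (Si := sin y - 0 - 1 * y) in *.
  assert (HE : Rabs E <= e * m) by (eapply Rle_trans; [exact H1|apply Rmult_le_compat_l; lra]).
  assert (HCo : Rabs Co <= e * m) by (eapply Rle_trans; [exact H2|apply Rmult_le_compat_l; lra]).
  assert (HSi : Rabs Si <= e * m) by (eapply Rle_trans; [exact H3|apply Rmult_le_compat_l; lra]).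
  assert (Hx1 : Rabs x <= 1) by lra.
  assert (Hem : e * m <= e * 1) by (apply Rmult_le_compat_l; lra).
  assert (HE1 : Rabs E <= 1) by lra.
  replace (exp x * cos y + - (1) + - x) with (E * cos y + (1 + x) * Co) by (unfold E, Co; ring).
  replace (exp x * sin y + - 0 + - y) with ((E + 1 + x) * Si + (E + x) * y) by (unfold E, Si; ring).
  assert (B1 : Rabs (E * cos y + (1 + x) * Co) <= 3 * (e * m)).
  { eapply Rle_trans; [apply Rabs_triang|]. rewrite !Rabs_mult.
    assert (Rabs (cos y) <= 1) by (apply Rabs_le, COS_bound).
    assert (Rabs (1 + x) <= 2) by (eapply Rle_trans; [apply Rabs_triang|rewrite Rabs_R1; lra]).
    pose proof (Rabs_pos (cos y)). pose proof (Rabs_pos (1 + x)). pose proof (Rabs_pos E). pose proof (Rabs_pos Co).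
    assert (Rabs E * Rabs (cos y) <= (e * m) * 1) by (apply Rmult_le_compat; lra).
    assert (Rabs (1 + x) * Rabs Co <= 2 * (e * m)) by (apply Rmult_le_compat; lra). lra. }
  assert (B2 : Rabs ((E + 1 + x) * Si + (E + x) * y) <= 5 * (e * m)).
  { eapply Rle_trans; [apply Rabs_triang|]. rewrite !Rabs_mult.
    assert (Rabs (E + 1 + x) <= 3).
    { eapply Rle_trans; [apply Rabs_triang|]. apply Rle_trans with (Rabs E + Rabs 1 + Rabs x).
      - apply Rplus_le_compat_r, Rabs_triang.
      - rewrite Rabs_R1; lra. }
    assert (Rabs (E + x) <= 2 * e).
    { eapply Rle_trans; [apply Rabs_triang|]. lra. }
    pose proof (Rabs_pos (E + 1 + x)). pose proof (Rabs_pos (E + x)). pose proof (Rabs_pos Si).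
    assert (Rabs (E + 1 + x) * Rabs Si <= 3 * (e * m)) by (apply Rmult_le_compat; [lra|lra|lra|lra]).
    assert (Rabs (E + x) * Rabs y <= (2 * e) * m) by (apply Rmult_le_compat; [lra|lra|lra|lra]). lra. }
  assert (e * m <= eps / 20 * m) by (apply Rmult_le_compat_r; lra).
  assert (0 <= eps * m) by (apply Rmult_le_pos; lra). lra. }
intros eps Heps. pose proof (Cmod_ge_0 (cexp z)) as H0.
destruct (key (eps / (Cmod (cexp z) + 1))) as [d [Hd H]]; [apply Rdiv_lt_0_compat; lra|].
exists d; split; auto. intros h Hh. rewrite cexp_plus.
replace (cexp z * cexp h - cexp z - cexp z * h)%C with (cexp z * (cexp h - 1 - h))%C by ring.
rewrite Cmod_mult. specialize (H h Hh). pose proof (Cmod_ge_0 h).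
apply Rle_trans with (Cmod (cexp z) * (eps / (Cmod (cexp z) + 1) * Cmod h)).
- apply Rmult_le_compat_l; auto.
- rewrite <- Rmult_assoc. apply Rmult_le_compat_r; auto.
  apply Rmult_le_reg_r with (Cmod (cexp z) + 1); [lra|]. field_simplify; lra.
Qed.

Lemma cexp_rT b z : cexp (RtoC b * z)%C = rT (fun k => b ^ k) z.
Proof.
assert (Hent : entire cexp) by (apply (proj2 (entire_cdiff _)); intros w; eexists; apply cdiff_cexp).
destruct (entire_coef cexp Hent) as [_ HT]. rewrite HT.
assert (E : forall k w, C_derive_n cexp k w = cexp w).
{ induction k as [|k IH]; intros w; simpl; auto.
  apply cdiff_C_derive. apply cdiff_ext_loc with cexp 1; [lra|intros; symmetry; apply IH|apply cdiff_cexp]. }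
unfold rT, Tay. apply Cser_ext. intros k. unfold coef. rewrite E, Cpow_mult_l, <- RtoC_pow.
replace (cexp (RtoC 0)) with (RtoC 1); [ring|].
unfold cexp, RtoC; simpl. rewrite exp_0, cos_0, sin_0. f_equal; ring.
Qed.

(** * The norms of [A_a] on coefficients *)

Lemma A_norm_fin b f : 0 < b -> Rbar_lt (A_norm b f) p_infty -> exists M, forall k, Cmod (coef f k) <= M * b ^ k.
Proof.
intros Hb H.
assert (H0 : Rbar_le 0 (A_norm b f)).
{ apply (Sup_seq_minor_le _ 0 0%nat). simpl. apply Rmult_le_pos; [rewrite Rinv_1; lra|apply Cmod_ge_0]. }
assert (Hk : forall k, Rbar_le (/ b ^ k * Cmod (coef f k)) (A_norm b f)).
{ intros k. apply (Sup_seq_minor_le _ _ k). simpl. apply Rle_refl. }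
destruct (A_norm b f) as [M| |]; try (simpl in *; tauto).
exists M. intros k. specialize (Hk k). simpl in Hk.
assert (0 < b ^ k) by (apply pow_lt; auto).
apply Rmult_le_reg_l with (/ b ^ k); [apply Rinv_0_lt_compat; auto|].
replace (/ b ^ k * (M * b ^ k)) with M by (field; lra). auto.
Qed.

Lemma A_norm_lt_coef b f (e : R) k : 0 < b -> Rbar_lt (A_norm b f) e -> Cmod (coef f k) <= e * b ^ k.
Proof.
intros Hb H.
assert (Hk : Rbar_le (/ b ^ k * Cmod (coef f k)) e).
{ apply Rbar_le_trans with (A_norm b f); [|apply Rbar_lt_le; auto].
  apply (Sup_seq_minor_le _ _ k). simpl. apply Rle_refl. }
simpl in Hk. assert (0 < b ^ k) by (apply pow_lt; auto).
apply Rmult_le_reg_l with (/ b ^ k); [apply Rinv_0_lt_compat; auto|].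
replace (/ b ^ k * (e * b ^ k)) with e by (field; lra). auto.
Qed.

Lemma A_norm_le b f (M : R) : 0 < b -> (forall k, Cmod (coef f k) <= M * b ^ k) -> Rbar_le (A_norm b f) M.
Proof.
intros Hb H. unfold A_norm. apply Rbar_not_lt_le. intros Hlt.
apply (proj1 (Sup_seq_minor_lt _ M)) in Hlt. destruct Hlt as [k Hk]. simpl in Hk.
specialize (H k). unfold coef in H. assert (Hp : 0 < b ^ k) by (apply pow_lt; auto).
apply (Rmult_le_compat_l (/ b ^ k)) in H; [|apply Rlt_le, Rinv_0_lt_compat; auto].
replace (/ b ^ k * (M * b ^ k)) with M in H by (field; lra). lra.
Qed.

Lemma A_norm_lt b f (M e : R) : 0 < b -> M < e -> (forall k, Cmod (coef f k) <= M * b ^ k) -> Rbar_lt (A_norm b f) e.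
Proof.
intros Hb HM H. eapply Rbar_le_lt_trans; [apply A_norm_le with (M := M); auto|auto].
Qed.

Lemma A_space_coef a f : 0 <= a -> A_space a f -> entire f /\ forall b, a < b -> exists M, forall k, Cmod (coef f k) <= M * b ^ k.
Proof. intros Ha [H1 H2]. split; auto. intros b Hb. apply A_norm_fin; auto. lra. Qed.

Lemma A_space_Tay a c : 0 <= a -> (forall b, a < b -> exists M, forall k, Cmod (c k) <= M * b ^ k) ->
  ent c /\ A_space a (Tay c).
Proof.
intros Ha Hc. assert (He : ent c).
{ destruct (Hc (a + 1)) as [M HM]; [lra|]. apply ent_expo with M (a + 1); auto; lra. }
split; auto. destruct (ent_Tay c He) as [H1 H2]. split; auto.
intros b Hb. destruct (Hc b Hb) as [M HM]. eapply Rbar_le_lt_trans; [apply A_norm_le with (M := M)|exact I].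
- lra.
- intros k. rewrite H2. auto.
Qed.

Lemma coef_minus f g k : entire f -> entire g -> coef (fun z => (f z - g z)%C) k = (coef f k - coef g k)%C.
Proof.
intros Hf Hg. destruct (entire_coef f Hf) as [F1 F2]. destruct (entire_coef g Hg) as [G1 G2].
assert (E : forall z, (f z - g z)%C = Tay (fun k => coef f k + RtoC (-1) * coef g k)%C z).
{ intros z. rewrite Tay_plus, Tay_scal; auto using ent_scal. rewrite <- F2, <- G2. ring. }
assert (HE : ent (fun k => coef f k + RtoC (-1) * coef g k)%C) by (apply ent_plus; auto using ent_scal).
unfold coef at 1. rewrite (derive_n_Tay _ _ 1 Rlt_0_1 (fun rho Hr => HE rho ltac:(rewrite Rinv_1 in Hr; lra)) (fun z _ => E z)).
- rewrite Tay_at0. simpl. rewrite Nat.add_0_r. ring.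
- rewrite Cmod_0; lra.
Qed.

Lemma coef_ext f g : (forall z, f z = g z) -> forall k, coef f k = coef g k.
Proof.
intros E k. unfold coef.
assert (f = g) as -> by (apply FunctionalExtensionality.functional_extensionality; auto). auto.
Qed.

Lemma Cdiv_RtoC (x : C) r : r <> 0 -> (x / RtoC r)%C = (RtoC (/ r) * x)%C.
Proof. intros Hr. unfold Cdiv. rewrite <- RtoC_inv by auto. ring. Qed.

(** Brings the defect of the difference quotient into a single Taylor series, so that the derivative
    in the topology of [A_a] becomes an estimate on coefficients, for uniqueness and for existence
    alike. *)
Lemma quot_Tay f g theta tau (r : R) z : r <> 0 -> entire f -> entire g ->
  ((f z - g z) / RtoC r - RtoC tau * Defs.Delta theta g z)%C =
  Tay (fun k => RtoC (/ r) * (coef f k - coef g k) - RtoC (tau * (INR k + theta)) * coef g (S k))%C z /\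
  ent (fun k => RtoC (/ r) * (coef f k - coef g k) - RtoC (tau * (INR k + theta)) * coef g (S k))%C.
Proof.
intros Hr Hf Hg. destruct (entire_coef f Hf) as [F1 F2]. destruct (entire_coef g Hg) as [G1 G2].
set (e1 := fun k => (RtoC (/ r) * (coef f k + RtoC (-1) * coef g k))%C).
set (e2 := fun k => (RtoC (- tau) * (RtoC (INR k + theta) * coef g (S k)))%C).
assert (E1 : ent e1) by (apply ent_scal, ent_plus; auto using ent_scal).
assert (E2 : ent e2) by (apply ent_scal, ent_Dl; auto).
assert (E : (fun k => RtoC (/ r) * (coef f k - coef g k) - RtoC (tau * (INR k + theta)) * coef g (S k))%C
  = (fun k => e1 k + e2 k)%C).
{ apply functional_extensionality. intros k. unfold e1, e2. rewrite RtoC_mult, RtoC_opp. ring. }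
rewrite E. split; [|apply ent_plus; auto].
rewrite Tay_plus; auto. unfold e1, e2.
rewrite !Tay_scal; auto using ent_Dl, ent_plus, ent_scal.
rewrite Tay_plus, Tay_scal; auto using ent_scal.
rewrite <- F2, <- G2, <- Delta_entire, Cdiv_RtoC, RtoC_opp; auto. ring.
Qed.

(** * The heat equation *)

Section Uniqueness.
Variables (theta tau a : R).
Hypothesis Hth : 0 <= theta.
Hypothesis Htau : 0 <= tau.
Hypothesis Ha : 0 <= a.

(** The heat equation on coefficients. Differentiability in the norms means that [d] does not depend
    on [k]; uniqueness rests on this uniformity. *)
Definition heat_coef (D : R -> nat -> C) : Prop :=
  (forall t, 0 <= t <= 1 -> forall b, a < b -> exists M, forall k, Cmod (D t k) <= M * b ^ k) /\
  (forall t, 0 <= t <= 1 -> forall b eps, a < b -> 0 < eps -> exists d, 0 < d /\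
     forall s, 0 <= s <= 1 -> s <> t -> Rabs (s - t) < d -> forall k,
       Cmod (RtoC (/ (s - t)) * (D s k - D t k) - RtoC (tau * (INR k + theta)) * D t (S k))%C <= eps * b ^ k).

Lemma heat_equation_coef f : heat_equation theta tau a f -> heat_coef (fun t k => coef (f t) k).
Proof.
intros Hf. split.
- intros t Ht b Hb. destruct (Hf t Ht) as [H1 _]. apply A_space_coef with a; auto.
- intros t Ht b eps Hb Heps. destruct (Hf t Ht) as [H1 [_ [_ H2]]].
  specialize (H2 b Hb eps Heps). destruct H2 as [d Hd].
  exists d. split; [apply cond_pos|]. intros s Hs Hst Hd1 k.
  specialize (Hd s Hd1 Hst Hs).
  apply A_norm_lt_coef with (k := k) in Hd; [|lra].
  destruct (Hf s Hs) as [H3 _].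
  assert (Hr : s - t <> 0) by lra.
  rewrite (coef_ext _ _ (fun z => proj1 (quot_Tay (f s) (f t) theta tau (s - t) z Hr (proj1 H3) (proj1 H1)))) in Hd.
  rewrite (proj2 (ent_Tay _ (proj2 (quot_Tay (f s) (f t) theta tau (s - t) (RtoC 0) Hr (proj1 H3) (proj1 H1))))) in Hd.
  exact Hd.
Qed.

Lemma heat_coef_minus D E : heat_coef D -> heat_coef E -> heat_coef (fun t k => D t k - E t k)%C.
Proof.
intros [D1 D2] [E1 E2]. split.
- intros t Ht b Hb. destruct (D1 t Ht b Hb) as [M HM]. destruct (E1 t Ht b Hb) as [N HN].
  exists (M + N). intros k. eapply Rle_trans; [apply Cmod_triangle|]. rewrite Cmod_opp, Rmult_plus_distr_r.
  apply Rplus_le_compat; auto.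
- intros t Ht b eps Hb Heps.
  destruct (D2 t Ht b (eps / 2) Hb ltac:(lra)) as [d [Hd HD]].
  destruct (E2 t Ht b (eps / 2) Hb ltac:(lra)) as [e [He HE]].
  exists (Rmin d e). split; [apply Rmin_case; auto|]. intros s Hs Hst Hse k.
  pose proof (Rmin_l d e). pose proof (Rmin_r d e).
  specialize (HD s Hs Hst ltac:(lra) k). specialize (HE s Hs Hst ltac:(lra) k).
  match type of HD with Cmod ?x <= _ => match type of HE with Cmod ?y <= _ =>
    replace (_ - _)%C with (x + - y)%C by ring end end.
  eapply Rle_trans; [apply Cmod_triangle|]. rewrite Cmod_opp. lra.
Qed.

(** The mean value theorem for [e * phi] minus the primitive of the bound, with [e = 1] and
    [e = -1]. *)
Lemma integrate_bound (phi dphi : R -> R) t0 t1 K j :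
  (forall s, t0 <= s <= t1 -> continuity_pt phi s) -> phi t0 = 0 -> t0 <= t1 ->
  (forall s, t0 < s < t1 -> is_derive phi s (dphi s)) ->
  (forall s, t0 <= s <= t1 -> Rabs (dphi s) <= K * (s - t0) ^ j) ->
  Rabs (phi t1) <= K * (t1 - t0) ^ S j / INR (S j).
Proof.
intros Hc H0 Ht Hd Hb.
assert (HSj : INR (S j) <> 0) by (apply not_0_INR; lia).
assert (key : forall e, e * e = 1 -> e * phi t1 <= K * (t1 - t0) ^ S j / INR (S j)).
{ intros e He. set (g := fun s => e * phi s - K * (s - t0) ^ S j / INR (S j)).
  destruct (MVT_gen g t0 t1 (fun s => e * dphi s - K * (s - t0) ^ j)) as [c [Hc1 Hc2]].
  - rewrite Rmin_left, Rmax_right by lra. intros s Hs. unfold g.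
    apply (is_derive_minus (fun s => e * phi s) (fun s => K * (s - t0) ^ S j / INR (S j))).
    + apply (is_derive_scal phi s e). auto.
    + auto_derive; auto. change (match j with O => 1 | S _ => INR j + 1 end) with (INR (S j)).
      simpl pred. unfold Rminus. field. auto.
  - rewrite Rmin_left, Rmax_right by lra. intros s Hs. unfold g.
    apply continuity_pt_minus; [apply continuity_pt_scal; auto|].
    apply derivable_continuous_pt, ex_derive_Reals_0. auto_derive; auto.
  - rewrite Rmin_left, Rmax_right in Hc1 by lra.
    assert (Hs : e * dphi c - K * (c - t0) ^ j <= 0).
    { specialize (Hb c Hc1). assert (Rabs (e * dphi c) = Rabs (dphi c)).
      { rewrite Rabs_mult. replace (Rabs e) with 1; [ring|].
        assert (Rabs e * Rabs e = 1) by (rewrite <- Rabs_mult, He; apply Rabs_R1).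
        pose proof (Rabs_pos e). nra. }
      pose proof (Rle_abs (e * dphi c)). lra. }
    assert (Hg : g t1 <= g t0) by nra. unfold g in Hg.
    rewrite H0 in Hg. replace (t0 - t0) with 0 in Hg by ring. rewrite pow_i in Hg by lia.
    unfold Rdiv in *. lra. }
pose proof (key 1 ltac:(ring)). pose proof (key (-1) ltac:(ring)).
apply Rabs_le. lra.
Qed.

(** Extends functions on [[0, 1]] by constants, so that one-sided continuity at the ends becomes
    ordinary continuity. *)
Definition clamp (t : R) : R := Rmax 0 (Rmin 1 t).

Lemma clamp_in t : 0 <= clamp t <= 1.
Proof. unfold clamp. split; [apply Rmax_l|]. apply Rmax_case; [lra|apply Rmin_l]. Qed.

Lemma clamp_id t : 0 <= t <= 1 -> clamp t = t.
Proof. intros Ht. unfold clamp. rewrite Rmin_right, Rmax_right; lra. Qed.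

Lemma clamp_lip s t : Rabs (clamp s - clamp t) <= Rabs (s - t).
Proof.
unfold clamp, Rmax, Rmin. repeat (destruct Rle_dec; simpl); unfold Rabs; repeat destruct Rcase_abs; lra.
Qed.

Section HeatZero.
Variable D : R -> nat -> C.
Hypothesis HD : heat_coef D.

(** The functional [p] stands for [Re] and [Im], which are thus handled at once by real calculus. *)
Lemma hc_component (p : C -> R) : (forall z, Rabs (p z) <= Cmod z) ->
  (forall z w, p (z - w)%C = p z - p w) -> (forall r z, p (RtoC r * z)%C = r * p z) ->
  forall k, (forall t, continuity_pt (fun t => p (D (clamp t) k)) t) /\
    (forall t, 0 < t < 1 -> is_derive (fun t => p (D (clamp t) k)) t (tau * (INR k + theta) * p (D t (S k)))).
Proof.
intros P1 P2 P3 k. destruct HD as [_ H2].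
assert (Hest : forall t eps, 0 <= t <= 1 -> 0 < eps -> exists d, 0 < d /\ forall s, 0 <= s <= 1 -> Rabs (s - t) < d ->
  Rabs (p (D s k) - p (D t k) - tau * (INR k + theta) * p (D t (S k)) * (s - t)) <= eps * Rabs (s - t)).
{ intros t eps Ht Heps.
  assert (Hp : 0 < (a + 1) ^ k) by (apply pow_lt; lra).
  destruct (H2 t Ht (a + 1) (eps / (a + 1) ^ k) ltac:(lra)) as [d [Hd H]]; [apply Rdiv_lt_0_compat; auto|].
  exists d; split; auto. intros s Hs Hsd. destruct (Req_dec s t) as [->|Hst].
  { rewrite !Rminus_eq_0, Rmult_0_r, Rminus_0_r, Rabs_R0. lra. }
  specialize (H s Hs Hst Hsd k).
  replace (eps / (a + 1) ^ k * (a + 1) ^ k) with eps in H by (field; lra).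
  assert (Hst0 : s - t <> 0) by lra.
  replace (p (D s k) - p (D t k) - tau * (INR k + theta) * p (D t (S k)) * (s - t)) with
    ((s - t) * p (RtoC (/ (s - t)) * (D s k - D t k) - RtoC (tau * (INR k + theta)) * D t (S k))%C).
  - rewrite Rabs_mult, Rmult_comm. apply Rmult_le_compat_r; [apply Rabs_pos|].
    eapply Rle_trans; [apply P1|auto].
  - rewrite P2, !P3, P2. field. auto. }
split.
- intros t eps Heps. set (t' := clamp t).
  set (L := Rabs (tau * (INR k + theta) * p (D t' (S k)))).
  assert (HL : 0 <= L) by apply Rabs_pos.
  destruct (Hest t' 1 (clamp_in t) Rlt_0_1) as [d [Hd H]].
  exists (Rmin d (eps / (L + 2))). split; [apply Rmin_case; auto; apply Rdiv_lt_0_compat; lra|].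
  intros s [_ Hs]. simpl in Hs. unfold R_dist in Hs. simpl. unfold R_dist.
  pose proof (clamp_lip s t) as Hlip. fold t' in Hlip |- *. set (s' := clamp s) in *.
  pose proof (Rmin_l d (eps / (L + 2))). pose proof (Rmin_r d (eps / (L + 2))).
  specialize (H s' (clamp_in s) ltac:(lra)).
  replace (p (D s' k) - p (D t' k)) with ((p (D s' k) - p (D t' k) - tau * (INR k + theta) * p (D t' (S k)) * (s' - t'))
    + tau * (INR k + theta) * p (D t' (S k)) * (s' - t')) by ring.
  eapply Rle_lt_trans; [apply Rabs_triang|].
  rewrite (Rabs_mult _ (s' - t')). fold L.
  apply Rle_lt_trans with ((L + 1) * Rabs (s' - t')); [lra|].
  apply Rle_lt_trans with ((L + 1) * (eps / (L + 2))).
  + apply Rmult_le_compat_l; lra.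
  + apply Rmult_lt_reg_r with (L + 2); [lra|]. field_simplify; lra.
- intros t Ht. apply is_derive_Reals. intros eps Heps.
  destruct (Hest t (eps / 2) ltac:(lra) ltac:(lra)) as [d [Hd H]].
  assert (Hm : 0 < Rmin d (Rmin t (1 - t))) by (repeat apply Rmin_case; lra).
  exists (mkposreal _ Hm). intros h Hh Hhd. simpl in Hhd.
  pose proof (Rmin_l d (Rmin t (1 - t))). pose proof (Rmin_r d (Rmin t (1 - t))).
  pose proof (Rmin_l t (1 - t)). pose proof (Rmin_r t (1 - t)).
  apply Rabs_def2 in Hhd as Hh2.
  rewrite !clamp_id by lra.
  specialize (H (t + h) ltac:(lra)). replace (t + h - t) with h in H by ring. specialize (H ltac:(lra)).
  replace ((p (D (t + h) k) - p (D t k)) / h - tau * (INR k + theta) * p (D t (S k))) with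
   ((p (D (t + h) k) - p (D t k) - tau * (INR k + theta) * p (D t (S k)) * h) / h) by (field; auto).
  unfold Rdiv. rewrite Rabs_mult, Rabs_inv. pose proof (Rabs_pos_lt h Hh).
  apply Rmult_lt_reg_r with (Rabs h); auto. rewrite Rmult_assoc, Rinv_l by lra. nra.
Qed.

(** The system [D_k' = tau (k + theta) D_(k+1)] is integrated [j] times from the vanishing data at
    [t0]. A crude bound [b^k] turns into [b^k gs (k + theta) j (tau b (s - t0))^j], the general term
    of a convergent series once [tau b (s - t0) < 1], hence tending to 0. *)
Lemma hc_local t0 : 0 <= t0 < 1 -> (forall k, D t0 k = RtoC 0) ->
  exists e, 0 < e /\ forall s, t0 <= s -> s <= t0 + e -> s <= 1 -> forall k, D s k = RtoC 0.
Proof.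
intros Ht0 Hz. destruct HD as [_ H2].
destruct (H2 t0 ltac:(lra) (a + 1) 1 ltac:(lra) Rlt_0_1) as [d [Hd Hloc]].
set (b := a + 1) in *. assert (Hb : 1 <= b) by (unfold b; lra).
(* As [D] vanishes at [t0], differentiability there bounds [D s k / (s - t0)] by [b ^ k] uniformly
   in [k]: the bound from which the iteration starts. *)
assert (HB : forall s k, 0 <= s <= 1 -> Rabs (s - t0) < d -> Cmod (D s k) <= 1 * b ^ k).
{ intros s k Hs Hsd. assert (Hpk : 0 < b ^ k) by (apply pow_lt; lra).
  destruct (Req_dec s t0) as [->|Hst].
  { rewrite Hz, Cmod_0. lra. }
  specialize (Hloc s Hs Hst Hsd k). rewrite !Hz in Hloc.
  replace (RtoC (/ (s - t0)) * (D s k - RtoC 0) - RtoC (tau * (INR k + theta)) * RtoC 0)%C with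
    (RtoC (/ (s - t0)) * D s k)%C in Hloc by ring.
  rewrite Cmod_mult, Cmod_R, Rabs_inv in Hloc.
  assert (Hp : 0 < Rabs (s - t0)) by (apply Rabs_pos_lt; lra).
  assert (Hle : Rabs (s - t0) <= 1) by (apply Rabs_le; lra).
  apply (Rmult_le_compat_l (Rabs (s - t0))) in Hloc; [|lra].
  rewrite <- Rmult_assoc, Rinv_r, Rmult_1_l in Hloc by lra. nra. }
set (e := Rmin (d / 2) (/ (2 * (tau * b + 1)))).
assert (Htb : 0 <= tau * b) by (apply Rmult_le_pos; lra).
assert (Hi : 0 < / (2 * (tau * b + 1))) by (apply Rinv_0_lt_compat; lra).
assert (He : 0 < e) by (unfold e; apply Rmin_case; lra).
assert (Hed : e < d) by (unfold e; pose proof (Rmin_l (d / 2) (/ (2 * (tau * b + 1)))); lra).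
assert (Heb : e * (tau * b) < 1).
{ apply Rle_lt_trans with (/ (2 * (tau * b + 1)) * (tau * b)).
  - apply Rmult_le_compat_r; auto. apply Rmin_r.
  - apply Rmult_lt_reg_l with (2 * (tau * b + 1)); [lra|]. rewrite <- Rmult_assoc, Rinv_r; lra. }
exists e; split; auto.
assert (main : forall p : C -> R, (forall z, Rabs (p z) <= Cmod z) ->
  (forall z w, p (z - w)%C = p z - p w) -> (forall r z, p (RtoC r * z)%C = r * p z) ->
  forall s, t0 <= s -> s <= t0 + e -> s <= 1 -> forall k, p (D s k) = 0).
{ intros p P1 P2 P3.
  assert (Hp0 : p (RtoC 0) = 0).
  { specialize (P3 0 (RtoC 0)). rewrite Cmult_0_l in P3. lra. }
  assert (bnd : forall j k s, t0 <= s -> s <= t0 + e -> s <= 1 ->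
     Rabs (p (D s k)) <= b ^ k * gs (INR k + theta) j * (tau * b * (s - t0)) ^ j).
  { induction j as [|j IH]; intros k s Hs1 Hs2 Hs3.
    - unfold gs; simpl. eapply Rle_trans; [apply P1|]. eapply Rle_trans; [apply HB; [lra|]|].
      + rewrite Rabs_pos_eq; lra.
      + right; field.
    - destruct (hc_component p P1 P2 P3 k) as [Hc Hd1].
      pose proof (integrate_bound (fun t => p (D (clamp t) k)) (fun t => tau * (INR k + theta) * p (D t (S k)))
        t0 s (tau * (INR k + theta) * (b ^ S k * gs (INR (S k) + theta) j * (tau * b) ^ j)) j) as HI.
      cbv beta in HI. rewrite (clamp_id t0), (clamp_id s) in HI by lra.
      pose proof (order_nonneg theta Hth k) as Hk.
      specialize (HI (fun x _ => Hc x)). rewrite Hz in HI. specialize (HI Hp0 Hs1).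
      specialize (HI (fun x Hx => Hd1 x ltac:(lra))).
      eapply Rle_trans; [apply HI|].
      + intros x Hx. rewrite Rabs_mult, Rabs_pos_eq by (apply Rmult_le_pos; auto).
        rewrite (Rmult_assoc (tau * (INR k + theta)) (_ * _)).
        apply Rmult_le_compat_l; [apply Rmult_le_pos; auto|].
        eapply Rle_trans; [apply (IH (S k) x); lra|]. right. rewrite !Rpow_mult_distr. ring.
      + right. pose proof (gs_S (INR k + theta) j) as Eg.
        assert (Hj : INR (S j) <> 0) by (apply not_0_INR; lia).
        replace (gs (INR k + theta) (S j)) with ((INR k + theta) * gs (INR (S k) + theta) j / INR (S j)).
        * rewrite !Rpow_mult_distr. simpl pow. field. auto.
        * apply Rmult_eq_reg_l with (INR (S j)); auto. rewrite Eg, (S_INR k).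
          replace (INR k + 1 + theta) with (INR k + theta + 1) by ring. field. auto. }
  intros s Hs1 Hs2 Hs3 k.
  set (x := tau * b * (s - t0)).
  assert (Hx : 0 <= x < 1).
  { unfold x. split; [apply Rmult_le_pos; lra|].
    apply Rle_lt_trans with (e * (tau * b)); auto. rewrite Rmult_comm. apply Rmult_le_compat_r; lra. }
  assert (Hl : is_lim_seq (fun j => b ^ k * (gs (INR k + theta) j * x ^ j)) 0).
  { replace (Finite 0) with (Finite (b ^ k * 0)) by (f_equal; ring).
    apply is_lim_seq_mult'; [apply is_lim_seq_const|].
    apply ex_series_lim_0, gs_ex_series; auto. apply order_nonneg; auto. }
  assert (Habs : Rabs (p (D s k)) <= 0).
  { apply (is_lim_seq_le (fun _ => Rabs (p (D s k))) _ (Rabs (p (D s k))) 0) with (3 := Hl).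
    - intros j. rewrite <- Rmult_assoc. apply bnd; auto.
    - apply is_lim_seq_const. }
  pose proof (Rabs_pos (p (D s k))). apply Rabs_eq_0. lra. }
intros s H1 H3 H4 k.
assert (ER : Re (D s k) = 0).
{ apply main; auto using re_le_Cmod. intros r z; unfold Re; simpl; ring. }
assert (EI : Im (D s k) = 0).
{ apply main; auto using im_le_Cmod. intros r z; unfold Im; simpl; ring. }
destruct (D s k) as [x y]. unfold Re, Im in *; simpl in *. subst. auto.
Qed.

(** Continuation: the times up to which [D] vanishes have a supremum, attained by continuity and, if
    less than 1, exceeded by [hc_local]. *)
Lemma hc_zero : (forall k, D 0 k = RtoC 0) -> forall t, 0 <= t <= 1 -> forall k, D t k = RtoC 0.
Proof.
intros Hz.
set (S := fun t => 0 <= t <= 1 /\ forall s, 0 <= s <= t -> forall k, D s k = RtoC 0).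
assert (HS0 : S 0).
{ split; [lra|]. intros s Hs k. replace s with 0 by lra. auto. }
destruct (completeness S) as [m [Hm1 Hm2]].
{ exists 1. intros x [Hx _]. lra. }
{ exists 0; auto. }
assert (Hm0 : 0 <= m) by (apply Hm1; auto).
assert (HmL : m <= 1) by (apply Hm2; intros x [Hx _]; lra).
assert (Hbelow : forall s, 0 <= s < m -> forall k, D s k = RtoC 0).
{ intros s Hs k. destruct (Classical_Prop.classic (exists x, S x /\ s <= x)) as [[x [[_ Hx] Hsx]]|Hno].
  - apply Hx; lra.
  - exfalso. assert (m <= s); [|lra]. apply Hm2. intros x Hx.
    destruct (Rle_lt_dec x s); auto. exfalso. apply Hno. exists x; split; auto; lra. }
assert (Hm : forall k, D m k = RtoC 0).
{ intros k. destruct (Req_dec m 0) as [->|Hne]; auto.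
  assert (main : forall p : C -> R, (forall z, Rabs (p z) <= Cmod z) ->
   (forall z w, p (z - w)%C = p z - p w) -> (forall r z, p (RtoC r * z)%C = r * p z) -> p (D m k) = 0).
  { intros p P1 P2 P3. assert (Hp0 : p (RtoC 0) = 0).
    { specialize (P3 0 (RtoC 0)). rewrite Cmult_0_l in P3. lra. }
    destruct (hc_component p P1 P2 P3 k) as [Hc _].
    destruct (Req_dec (p (D m k)) 0) as [|Hnz]; auto. exfalso.
    destruct (Hc m (Rabs (p (D m k)))) as [d [Hd H]]; [apply Rabs_pos_lt; auto|].
    set (s := Rmax 0 (m - d / 2)).
    assert (Hs : 0 <= s < m) by (unfold s; split; [apply Rmax_l|apply Rmax_case; lra]).
    assert (Hs2 : m - d / 2 <= s) by apply Rmax_r.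
    specialize (H s). simpl in H. unfold R_dist in H. rewrite !clamp_id in H by lra.
    rewrite Hbelow, Hp0 in H by lra.
    assert (Hlt : Rabs (0 - p (D m k)) < Rabs (p (D m k))).
    { apply H. split; [split; [exact I|lra]|]. apply Rabs_def1; lra. }
    rewrite Rminus_0_l, Rabs_Ropp in Hlt. lra. }
  assert (ER : Re (D m k) = 0).
  { apply main; auto using re_le_Cmod. intros r z; unfold Re; simpl; ring. }
  assert (EI : Im (D m k) = 0).
  { apply main; auto using im_le_Cmod. intros r z; unfold Im; simpl; ring. }
  destruct (D m k) as [x y]. unfold Re, Im in *; simpl in *. subst. auto. }
destruct (Req_dec m 1) as [->|Hne].
{ intros t Ht k. destruct (Req_dec t 1) as [->|]; auto. apply Hbelow; lra. }
exfalso. destruct (hc_local m ltac:(lra) Hm) as [e [He H]].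
set (x := Rmin 1 (m + e)).
assert (Hx : m < x <= 1) by (unfold x; split; [apply Rmin_case; lra|apply Rmin_l]).
assert (Hx2 : x <= m + e) by apply Rmin_r.
assert (S x); [|pose proof (Hm1 x H0); lra].
split; [lra|]. intros s Hs k. destruct (Rlt_le_dec s m); [apply Hbelow; lra|]. apply H; lra.
Qed.
End HeatZero.

Lemma heat_unique f h : heat_equation theta tau a f -> heat_equation theta tau a h ->
  (forall z, f 0 z = h 0 z) -> forall t z, 0 <= t <= 1 -> f t z = h t z.
Proof.
intros Hf Hh H0 t z Ht.
pose proof (heat_coef_minus _ _ (heat_equation_coef f Hf) (heat_equation_coef h Hh)) as HD.
assert (E : forall k, (coef (f t) k - coef (h t) k)%C = RtoC 0).
{ apply (hc_zero _ HD); auto. intros k. rewrite (coef_ext (f 0) (h 0)); auto. ring. }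
destruct (Hf t Ht) as [[F _] _]. destruct (Hh t Ht) as [[H _] _].
rewrite (proj2 (entire_coef _ F)), (proj2 (entire_coef _ H)). apply Tay_ext.
intros k. specialize (E k). replace (coef (f t) k) with (coef (f t) k - coef (h t) k + coef (h t) k)%C by ring.
rewrite E. ring.
Qed.
End Uniqueness.

(** * Existence: the flow solves the heat equation *)

Lemma poly_growth theta b b' : 0 <= theta -> 0 < b' < b -> exists K, 0 <= K /\
  forall k, (INR k + theta) * (INR k + 1 + theta) * b' ^ k <= K * b ^ k.
Proof.
intros Hth Hb. set (q := sqrt (b / b')).
assert (Hbb : 1 < b / b') by (apply Rmult_lt_reg_r with b'; [lra|]; field_simplify; lra).
assert (Hq : 1 < q) by (unfold q; rewrite <- sqrt_1; apply sqrt_lt_1; lra).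
set (L := / (q - 1) + 1 + theta).
assert (Hi : 0 < / (q - 1)) by (apply Rinv_0_lt_compat; lra).
assert (HL : forall k, INR k + 1 + theta <= L * q ^ k).
{ intros k. pose proof (poly k (q - 1) ltac:(lra)) as Hp. replace (1 + (q - 1)) with q in Hp by ring.
  pose proof (pos_INR k).
  assert (H1 : INR k <= / (q - 1) * q ^ k).
  { apply Rmult_le_reg_l with (q - 1); [lra|]. rewrite <- Rmult_assoc, Rinv_r by lra. lra. }
  assert (H2 : 1 <= q ^ k) by (apply pow_R1_Rle; lra).
  unfold L. rewrite !Rmult_plus_distr_r. nra. }
exists (L * L). split; [apply Rmult_le_pos; unfold L; lra|]. intros k.
pose proof (HL k). pose proof (pos_INR k).
replace (b ^ k) with ((q ^ k * q ^ k) * b' ^ k).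
- replace (L * L * (q ^ k * q ^ k * b' ^ k)) with ((L * q ^ k) * (L * q ^ k) * b' ^ k) by ring.
  apply Rmult_le_compat_r; [apply pow_le; lra|]. apply Rmult_le_compat; lra.
- rewrite <- !Rpow_mult_distr. f_equal. unfold q. rewrite sqrt_def by lra. field. lra.
Qed.

Section Existence.
Variables (theta tau a : R) (d : nat -> R).
Hypothesis Hth : 0 <= theta.
Hypothesis Htau : 0 <= tau.
Hypothesis Ha : 0 <= a.
Hypothesis Hd0 : forall k, 0 <= d k.
Hypothesis Hd : forall b, a < b -> exists M, expo M (b / (1 + tau * b)) d.

Lemma be_small b s : a < b -> 0 <= s <= tau ->
  0 <= b / (1 + tau * b) /\ s * (b / (1 + tau * b)) < 1 /\ / (1 + tau * b) <= 1 - s * (b / (1 + tau * b)) <= 1.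
Proof.
intros Hb Hs. assert (Htb : 0 <= tau * b) by (apply Rmult_le_pos; lra).
assert (H0 : 0 <= b / (1 + tau * b)) by (apply Rmult_le_pos; [lra|apply Rlt_le, Rinv_0_lt_compat; lra]).
assert (H1 : s * (b / (1 + tau * b)) <= tau * (b / (1 + tau * b))) by (apply Rmult_le_compat_r; lra).
assert (H2 : 1 - tau * (b / (1 + tau * b)) = / (1 + tau * b)) by (field; lra).
assert (0 < / (1 + tau * b)) by (apply Rinv_0_lt_compat; lra).
assert (0 <= s * (b / (1 + tau * b))) by (apply Rmult_le_pos; lra).
repeat split; lra.
Qed.

(** The flow up to time [tau] turns type [be] into [be / (1 - tau be)], and [be = b / (1 + tau b)]
    is the value for which this is [b]; hence the form of the hypothesis on [d]. *)
Lemma Flow_type b : a < b -> exists M, 0 <= M /\ forall s, 0 <= s <= tau -> forall k, 0 <= Flow theta s d k <= M * b ^ k.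
Proof.
intros Hb. destruct (Hd b Hb) as [M HM].
assert (HM0 : 0 <= M).
{ specialize (HM 0%nat). simpl in HM. pose proof (Rabs_pos (d 0%nat)). lra. }
assert (Htb : 0 <= tau * b) by (apply Rmult_le_pos; lra).
exists (M * Rpower (1 + tau * b) theta). split; [apply Rmult_le_pos; auto; apply Rlt_le, exp_pos|].
intros s Hs k. destruct (be_small b s Hb Hs) as [B0 [B1 [B2 B3]]].
destruct (Flow_bound theta Hth M _ d k s B0 ltac:(lra) B1) as [F1 F2].
{ intros j. specialize (HM j). rewrite Rabs_pos_eq in HM; auto. }
split; auto. eapply Rle_trans; [exact F2|].
set (be := b / (1 + tau * b)) in *.
assert (Hp : 0 < 1 + tau * b) by lra.
assert (Hin : Rpower (1 - s * be) (- (INR k + theta)) <= (1 + tau * b) ^ k * Rpower (1 + tau * b) theta).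
{ rewrite <- Rpower_pow, <- Rpower_plus by lra.
  rewrite Rpower_Ropp. unfold Rpower. rewrite <- exp_Ropp.
  assert (Hln : - ln (1 - s * be) <= ln (1 + tau * b)).
  { rewrite <- (Rinv_inv (1 + tau * b)), ln_Rinv by (apply Rinv_0_lt_compat; lra).
    assert (ln (/ (1 + tau * b)) <= ln (1 - s * be)); [|lra].
    apply ln_le; auto. apply Rinv_0_lt_compat; lra. }
  pose proof (order_nonneg theta Hth k) as Hk.
  assert (Hfin : - ((INR k + theta) * ln (1 - s * be)) <= (INR k + theta) * ln (1 + tau * b)) by nra.
  destruct Hfin as [Hfin|Hfin]; [left; apply exp_increasing; auto|right; rewrite Hfin; auto]. }
apply Rle_trans with (M * be ^ k * ((1 + tau * b) ^ k * Rpower (1 + tau * b) theta)).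
- apply Rmult_le_compat_l; auto. apply Rmult_le_pos; auto using pow_le.
- right. replace (b ^ k) with (be ^ k * (1 + tau * b) ^ k); [ring|].
  rewrite <- Rpow_mult_distr. f_equal. unfold be. field. lra.
Qed.

Lemma Flow_derive_tau s k : 0 <= s <= tau ->
  is_derive (fun s => Flow theta s d k) s ((INR k + theta) * Flow theta s d (S k)).
Proof.
intros Hs. destruct (Hd (a + 1)) as [M HM]; [lra|].
destruct (be_small (a + 1) s) as [B0 [B1 _]]; [lra|auto|].
apply Flow_is_derive with M ((a + 1) / (1 + tau * (a + 1))); auto. rewrite Rabs_pos_eq; lra.
Qed.

Definition sol (t : R) (z : C) : C := rT (Flow theta (tau * t) d) z.

Lemma tau_in t : 0 <= t <= 1 -> 0 <= tau * t <= tau.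
Proof. intros Ht. split; [apply Rmult_le_pos; lra|]. rewrite <- (Rmult_1_r tau) at 2. apply Rmult_le_compat_l; lra. Qed.

Lemma sol_coef t : 0 <= t <= 1 ->
  A_space a (sol t) /\ (forall k, coef (sol t) k = RtoC (Flow theta (tau * t) d k)).
Proof.
intros Ht. destruct (A_space_Tay a (fun k => RtoC (Flow theta (tau * t) d k)) Ha) as [H1 H2].
- intros b Hb. destruct (Flow_type b Hb) as [M [HM0 HM]]. exists M. intros k.
  rewrite Cmod_R. destruct (HM (tau * t) (tau_in t Ht) k). rewrite Rabs_pos_eq; auto.
- split; [exact H2|]. apply (ent_Tay _ H1).
Qed.

Lemma mvt_flow s t k : 0 <= s <= 1 -> 0 <= t <= 1 -> exists r, 0 <= r <= 1 /\ Rabs (r - t) <= Rabs (s - t) /\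
  Flow theta (tau * s) d k - Flow theta (tau * t) d k = tau * (INR k + theta) * Flow theta (tau * r) d (S k) * (s - t).
Proof.
intros Hs Ht.
assert (Hin : forall x, Rmin t s <= x <= Rmax t s -> 0 <= x <= 1).
{ intros x Hx. revert Hx. unfold Rmin, Rmax. destruct Rle_dec; lra. }
destruct (MVT_gen (fun r => Flow theta (tau * r) d k) t s (fun r => tau * ((INR k + theta) * Flow theta (tau * r) d (S k)))) as [r [Hr1 Hr2]].
- intros x Hx. apply (is_derive_comp (fun s => Flow theta s d k) (fun r => tau * r)).
  + apply Flow_derive_tau, tau_in, Hin; lra.
  + auto_derive; auto. ring.
- intros x Hx. apply derivable_continuous_pt, ex_derive_Reals_0.
  eexists. apply (is_derive_comp (fun s => Flow theta s d k) (fun r => tau * r)).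
  + apply Flow_derive_tau, tau_in, Hin; lra.
  + auto_derive; auto.
- exists r. split; [apply Hin; auto|]. split.
  + revert Hr1. unfold Rmin, Rmax, Rabs. destruct Rle_dec; repeat destruct Rcase_abs; lra.
  + rewrite Hr2. ring.
Qed.

(** Two applications of the mean value theorem express the defect of the difference quotient by a
    second time derivative, which is at most [M b^k] uniformly in time; so the defect has norm at
    most [M * Rabs (s - t)]. *)
Lemma sol_heat : heat_equation theta tau a sol.
Proof.
intros t Ht. destruct (sol_coef t Ht) as [St Ct]. split; auto.
assert (Fn : forall s k, 0 <= s <= 1 -> 0 <= Flow theta (tau * s) d k).
{ intros s k Hs. destruct (Flow_type (a + 1) ltac:(lra)) as [M [_ HM]]. apply (HM _ (tau_in s Hs) k). }
(* First and second time derivatives carry polynomial factors in [k]; they are absorbed between a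
   type [b'] strictly above [a] and [b]. *)
assert (TB : forall b, a < b -> exists M, 0 <= M /\ forall s k, 0 <= s <= 1 ->
   tau * (INR k + theta) * Flow theta (tau * s) d (S k) <= M * b ^ k /\
   tau * tau * ((INR k + theta) * (INR k + 1 + theta)) * Flow theta (tau * s) d (S (S k)) <= M * b ^ k).
{ intros b Hb. set (b' := (a + b) / 2).
  destruct (Flow_type b' ltac:(unfold b'; lra)) as [M [HM0 HM]].
  destruct (poly_growth theta b b' Hth ltac:(unfold b'; lra)) as [K [HK0 HK]].
  assert (Hb'0 : 0 < b') by (unfold b'; lra).
  exists (tau * K * M * b' + tau * tau * K * M * b' * b').
  assert (0 <= tau * K * M * b') by (repeat apply Rmult_le_pos; lra).
  assert (0 <= tau * tau * K * M * b' * b') by (repeat apply Rmult_le_pos; lra).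
  split; [lra|]. intros s k Hs. pose proof (HM _ (tau_in s Hs)) as HMs.
  pose proof (order_nonneg theta Hth k) as Hk. specialize (HK k).
  assert (Hpb : 0 <= b ^ k) by (apply pow_le; lra).
  assert (Hpb' : 0 <= b' ^ k) by (apply pow_le; lra).
  rewrite Rmult_plus_distr_r. split.
  - apply Rle_trans with (tau * K * M * b' * b ^ k); [|nra].
    apply Rle_trans with (tau * (INR k + theta) * (M * b' ^ S k)).
    + apply Rmult_le_compat_l; [apply Rmult_le_pos; auto|]. apply HMs.
    + replace (tau * (INR k + theta) * (M * b' ^ S k)) with (tau * M * b' * ((INR k + theta) * b' ^ k)) by (simpl; ring).
      replace (tau * K * M * b' * b ^ k) with (tau * M * b' * (K * b ^ k)) by ring.
      apply Rmult_le_compat_l; [repeat apply Rmult_le_pos; lra|].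
      eapply Rle_trans; [|exact HK]. apply Rmult_le_compat_r; auto.
      destruct k; [|rewrite S_INR in *; pose proof (pos_INR k); nra].
      simpl INR in *. nra.
  - apply Rle_trans with (tau * tau * K * M * b' * b' * b ^ k); [|nra].
    apply Rle_trans with (tau * tau * ((INR k + theta) * (INR k + 1 + theta)) * (M * b' ^ S (S k))).
    + apply Rmult_le_compat_l; [repeat apply Rmult_le_pos; auto; lra|]. apply HMs.
    + replace (tau * tau * ((INR k + theta) * (INR k + 1 + theta)) * (M * b' ^ S (S k))) with
        (tau * tau * M * b' * b' * ((INR k + theta) * (INR k + 1 + theta) * b' ^ k)) by (simpl; ring).
      replace (tau * tau * K * M * b' * b' * b ^ k) with (tau * tau * M * b' * b' * (K * b ^ k)) by ring.
      apply Rmult_le_compat_l; [repeat apply Rmult_le_pos; lra|auto]. }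
assert (ED : forall z, (RtoC tau * Defs.Delta theta (sol t) z)%C = Tay (fun k => RtoC (tau * (INR k + theta) * Flow theta (tau * t) d (S k))) z /\
  ent (fun k => RtoC (tau * (INR k + theta) * Flow theta (tau * t) d (S k)))).
{ intros z. assert (HE : ent (fun k => RtoC (tau * (INR k + theta) * Flow theta (tau * t) d (S k)))).
  { destruct (TB (a + 1) ltac:(lra)) as [M [HM0 HM]]. apply ent_expo with M (a + 1); [lra|].
    intros k. rewrite Cmod_R, Rabs_pos_eq; [apply HM; auto|].
    apply Rmult_le_pos; [|auto]. apply Rmult_le_pos; auto. apply order_nonneg; auto. }
  split; auto. rewrite Delta_entire by apply St. rewrite <- Tay_scal.
  - apply Tay_ext. intros k. rewrite Ct, !RtoC_mult. ring.
  - apply ent_Dl, entire_coef, St. }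
split; [|split].
- replace (fun z => (RtoC tau * Defs.Delta theta (sol t) z)%C) with (Tay (fun k => RtoC (tau * (INR k + theta) * Flow theta (tau * t) d (S k))))
    by (apply functional_extensionality; intros z; symmetry; apply ED).
  apply A_space_Tay; auto. intros b Hb. destruct (TB b Hb) as [M [HM0 HM]]. exists M. intros k.
  rewrite Cmod_R, Rabs_pos_eq; [apply HM; auto|].
  apply Rmult_le_pos; [|auto]. apply Rmult_le_pos; auto. apply order_nonneg; auto.
- exists (mkposreal 1 Rlt_0_1). intros s _ Hst Hs.
  destruct (sol_coef s Hs) as [Ss Cs].
  assert (Hr : s - t <> 0) by lra.
  set (c := fun k => RtoC (tau * (INR k + theta) * Flow theta (tau * t) d (S k))) in *.
  set (q := fun k => (RtoC (/ (s - t)) * (coef (sol s) k - coef (sol t) k))%C).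
  assert (Hq : forall b, a < b -> exists M, forall k, Cmod (q k) <= M * b ^ k).
  { intros b Hb. destruct (TB b Hb) as [M [HM0 HM]]. exists M. intros k. unfold q. rewrite Cs, Ct.
    rewrite <- RtoC_minus, <- RtoC_mult, Cmod_R.
    destruct (mvt_flow s t k Hs Ht) as [r [Hr0 [_ ->]]].
    replace (/ (s - t) * (tau * (INR k + theta) * Flow theta (tau * r) d (S k) * (s - t))) with
      (tau * (INR k + theta) * Flow theta (tau * r) d (S k)) by (field; auto).
    rewrite Rabs_pos_eq; [apply HM; auto|].
    apply Rmult_le_pos; [|auto]. apply Rmult_le_pos; auto. apply order_nonneg; auto. }
  destruct (A_space_Tay a q Ha Hq) as [Eq Sq].
  replace (fun z => ((sol s z - sol t z) / RtoC (s - t))%C) with (Tay q); auto.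
  apply functional_extensionality. intros z.
  destruct (quot_Tay (sol s) (sol t) theta 0 (s - t) z Hr (proj1 Ss) (proj1 St)) as [E _].
  rewrite Cmult_0_l in E. replace ((sol s z - sol t z) / RtoC (s - t))%C with ((sol s z - sol t z) / RtoC (s - t) - RtoC 0)%C by ring.
  rewrite E. apply Tay_ext. intros k. unfold q. rewrite Rmult_0_l. ring.
- intros b Hb eps Heps. destruct (TB b Hb) as [M [HM0 HM]].
  assert (He : 0 < eps / (M + 1) / 2) by (apply Rdiv_lt_0_compat; [apply Rdiv_lt_0_compat; lra|lra]).
  exists (mkposreal _ He). intros s Hsb Hst Hs. change (Rabs (s - t) < eps / (M + 1) / 2) in Hsb.
  destruct (sol_coef s Hs) as [Ss Cs].
  assert (Hr : s - t <> 0) by lra.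
  apply A_norm_lt with (M * Rabs (s - t)); [lra| |].
  + apply Rle_lt_trans with ((M + 1) * (eps / (M + 1) / 2)).
    * apply Rmult_le_compat; try lra. apply Rabs_pos.
    * replace ((M + 1) * (eps / (M + 1) / 2)) with (eps / 2) by (field; lra). lra.
  + intros k.
    rewrite (coef_ext _ _ (fun z => proj1 (quot_Tay (sol s) (sol t) theta tau (s - t) z Hr (proj1 Ss) (proj1 St)))).
    rewrite (proj2 (ent_Tay _ (proj2 (quot_Tay (sol s) (sol t) theta tau (s - t) (RtoC 0) Hr (proj1 Ss) (proj1 St))))).
    rewrite !Ct, Cs, <- RtoC_minus, <- !RtoC_mult, <- RtoC_minus, Cmod_R.
    destruct (mvt_flow s t k Hs Ht) as [r [Hr0 [Hr1 ->]]].
    replace (/ (s - t) * (tau * (INR k + theta) * Flow theta (tau * r) d (S k) * (s - t)) - tau * (INR k + theta) * Flow theta (tau * t) d (S k)) with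
      (tau * (INR k + theta) * (Flow theta (tau * r) d (S k) - Flow theta (tau * t) d (S k))) by (field; auto).
    destruct (mvt_flow r t (S k) Hr0 Ht) as [r' [Hr0' [_ ->]]].
    replace (tau * (INR k + theta) * (tau * (INR (S k) + theta) * Flow theta (tau * r') d (S (S k)) * (r - t))) with
      (tau * tau * ((INR k + theta) * (INR k + 1 + theta)) * Flow theta (tau * r') d (S (S k)) * (r - t)) by (rewrite S_INR; ring).
    destruct (HM r' k Hr0') as [_ HB].
    pose proof (order_nonneg theta Hth k).
    rewrite Rabs_mult, Rabs_pos_eq.
    * replace (M * Rabs (s - t) * b ^ k) with (M * b ^ k * Rabs (s - t)) by ring.
      apply Rmult_le_compat; auto using Rabs_pos.
      apply Rmult_le_pos; [|auto]. repeat apply Rmult_le_pos; auto; lra.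
    * apply Rmult_le_pos; [|auto]. repeat apply Rmult_le_pos; auto; lra.
Qed.

Lemma sol_0 z : sol 0 z = rT d z.
Proof. unfold sol. rewrite Rmult_0_r. apply Tay_ext. intros k. rewrite Flow_0; auto. Qed.
End Existence.

Lemma supp_expo c d b : 0 < b -> supp d c -> (forall k, 0 <= c k) -> exists M, 0 <= M /\ forall k, c k <= M * b ^ k.
Proof.
intros Hb Hs Hc. set (M := sum_f_R0 (fun k => c k / b ^ k) d).
assert (Hp : forall k, 0 < b ^ k) by (intros; apply pow_lt; auto).
assert (Ht : forall k, 0 <= c k / b ^ k).
{ intros k. apply Rmult_le_pos; auto. apply Rlt_le, Rinv_0_lt_compat; auto. }
assert (HM0 : 0 <= M) by (apply cond_pos_sum; auto).
exists M. split; auto. intros k. destruct (Nat.le_gt_cases k d) as [Hk|Hk].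
- assert (H : c k / b ^ k <= M).
  { unfold M. clear -Hk Ht. induction d as [|d IH].
    - replace k with 0%nat by lia. simpl. lra.
    - rewrite tech5. destruct (Nat.eq_dec k (S d)) as [->|Hne].
      + assert (0 <= sum_f_R0 (fun k => c k / b ^ k) d) by (apply cond_pos_sum; auto). lra.
      + specialize (IH ltac:(lia)). specialize (Ht (S d)). lra. }
  apply (Rmult_le_compat_r (b ^ k)) in H; [|apply Rlt_le; auto].
  replace (c k / b ^ k * b ^ k) with (c k) in H by (field; apply pow_nonzero; lra). auto.
- rewrite Hs by auto. apply Rmult_le_pos; auto. apply Rlt_le; auto.
Qed.

Lemma ent_zmul a : ent a -> ent (fun k => RtoC (INR k) * a (pred k))%C.
Proof.
intros Ha rho Hr. destruct (Ha rho Hr) as [M HM].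
assert (HM0 : 0 <= M).
{ specialize (HM 0%nat). simpl in HM. pose proof (Cmod_ge_0 (a 0%nat)). lra. }
exists (M / rho). intros k. rewrite Cmod_mult, Cmod_R, Rabs_pos_eq by apply pos_INR.
destruct k.
- simpl INR at 1. rewrite Rmult_0_l. simpl. rewrite !Rmult_1_r. apply Rmult_le_pos; auto.
  apply Rlt_le, Rinv_0_lt_compat; auto.
- simpl pred. rewrite fact_simpl, mult_INR.
  apply Rle_trans with (INR (S k) * (M * rho ^ k * INR (fact k))).
  + apply Rmult_le_compat_l; [apply pos_INR|auto].
  + right. simpl pow. field. lra.
Qed.

Lemma rT_mulL g c z : ent (fun k => RtoC (c k)) -> rT (mulL g c) z = ((1 + RtoC g * z) * rT c z)%C.
Proof.
intros Hc. unfold rT.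
rewrite (Tay_ext _ (fun k => RtoC (c k) + RtoC g * (RtoC (INR k) * RtoC (c (pred k))))%C).
- rewrite Tay_plus, Tay_scal; auto using ent_scal, (ent_zmul (fun k => RtoC (c k))).
  rewrite (Tay_zmul (fun k => RtoC (c k))) by auto. ring.
- intros k. unfold mulL. rewrite RtoC_plus, !RtoC_mult. ring.
Qed.

Lemma rT_lim (u : nat -> nat -> R) (c : nat -> R) M b z : 0 <= b -> (forall i, expo M b (u i)) ->
  (forall k, is_lim_seq (fun i => u i k) (c k)) ->
  is_lim_seq (fun i => Re (rT (u i) z)) (Re (rT c z)) /\ is_lim_seq (fun i => Im (rT (u i) z)) (Im (rT c z)).
Proof.
intros Hb Hu Hlim.
assert (He : ent (fun k => RtoC (M * b ^ k))).
{ apply ent_expo with M b; auto. intros k. rewrite Cmod_R, Rabs_pos_eq; [lra|].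
  specialize (Hu 0%nat k). pose proof (Rabs_pos (u 0%nat k)). lra. }
pose proof (ent_csum _ z He) as HS. unfold csum in HS.
assert (HB : forall i k, Cmod (RtoC (u i k) * RtoC (/ INR (fact k)) * Cpow z k)%C <= Cmod (RtoC (M * b ^ k) * RtoC (/ INR (fact k)) * Cpow z k)%C).
{ intros i k. rewrite !Cmod_mult, !Cmod_R. apply Rmult_le_compat_r; [apply Cmod_ge_0|].
  apply Rmult_le_compat_r; [apply Rabs_pos|]. eapply Rle_trans; [apply Hu|apply Rle_abs]. }
assert (E : forall (p : C -> R) x k, (p = Re \/ p = Im) -> p (RtoC x * RtoC (/ INR (fact k)) * Cpow z k)%C = x * p (RtoC (/ INR (fact k)) * Cpow z k)%C).
{ intros p x k [->| ->]; unfold Re, Im; simpl; ring. }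
split; unfold rT, Tay, Cser; simpl.
- apply (Series_tannery (fun i k => Re (RtoC (u i k) * RtoC (/ INR (fact k)) * Cpow z k)%C)
    (fun k => Re (RtoC (c k) * RtoC (/ INR (fact k)) * Cpow z k)%C) _ HS).
  + exists 0%nat. intros i _ k. eapply Rle_trans; [apply re_le_Cmod|apply HB].
  + intros k. rewrite (E Re) by auto. apply is_lim_seq_ext with (fun i => u i k * Re (RtoC (/ INR (fact k)) * Cpow z k)%C).
    * intros i. rewrite (E Re); auto.
    * apply is_lim_seq_mult'; auto. apply is_lim_seq_const.
- apply (Series_tannery (fun i k => Im (RtoC (u i k) * RtoC (/ INR (fact k)) * Cpow z k)%C)
    (fun k => Im (RtoC (c k) * RtoC (/ INR (fact k)) * Cpow z k)%C) _ HS).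
  + exists 0%nat. intros i _ k. eapply Rle_trans; [apply im_le_Cmod|apply HB].
  + intros k. rewrite (E Im) by auto. apply is_lim_seq_ext with (fun i => u i k * Im (RtoC (/ INR (fact k)) * Cpow z k)%C).
    * intros i. rewrite (E Im); auto.
    * apply is_lim_seq_mult'; auto. apply is_lim_seq_const.
Qed.

(** * Laguerre products *)

Section Product.
Variable gamma : nat -> R.
Hypothesis Hg : forall j, 0 <= gamma j.
Hypothesis Hsum : ex_series gamma.

Fixpoint first_factors (n : nat) : list R := match n with O => nil | S n => gamma n :: first_factors n end.

Lemma gl_nonneg n : nonneg_list (first_factors n).
Proof. induction n; simpl; constructor; auto. Qed.

Lemma gl_1 n : polyL (first_factors n) 1%nat = sum_f_R0 gamma n - gamma n.
Proof.
induction n as [|n IH]; [simpl; ring|]. simpl polyL. unfold mulL. simpl pred. rewrite IH, polyL_0. simpl. ring.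
Qed.

Lemma gl_lim1 : is_lim_seq (fun n => polyL (first_factors n) 1%nat) (Series gamma).
Proof.
apply is_lim_seq_ext with (fun n => sum_n gamma n - gamma n).
{ intros n. rewrite gl_1, sum_n_Reals. auto. }
replace (Finite (Series gamma)) with (Finite (Series gamma - 0)) by (f_equal; ring).
apply is_lim_seq_minus'; [apply (Series_correct gamma Hsum)|apply ex_series_lim_0; auto].
Qed.

Lemma gl_mono n k : polyL (first_factors n) k <= polyL (first_factors (S n)) k.
Proof.
simpl. unfold mulL. pose proof (polyL_nonneg (first_factors n) (pred k) (gl_nonneg n)). pose proof (pos_INR k).
assert (0 <= gamma n * INR k * polyL (first_factors n) (pred k)) by (repeat apply Rmult_le_pos; auto). lra.
Qed.

Lemma gl_le1 n : polyL (first_factors n) 1%nat <= Series gamma.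
Proof. apply (is_lim_seq_incr_compare (fun n => polyL (first_factors n) 1%nat)); [apply gl_lim1|intros; apply gl_mono]. Qed.

Lemma gl_bound n k : 0 <= polyL (first_factors n) k <= Series gamma ^ k.
Proof.
split; [apply polyL_nonneg, gl_nonneg|].
eapply Rle_trans; [apply polyL_le_pow, gl_nonneg|]. apply pow_incr. split; [apply polyL_nonneg, gl_nonneg|apply gl_le1].
Qed.

Definition prodL (k : nat) : R := real (Lim_seq (fun n => polyL (first_factors n) k)).

Lemma prodL_lim k : is_lim_seq (fun n => polyL (first_factors n) k) (prodL k).
Proof.
apply Lim_seq_correct'. apply ex_finite_lim_seq_incr with (Series gamma ^ k).
- intros; apply gl_mono.
- intros; apply gl_bound.
Qed.

Lemma prodL_0 : prodL 0%nat = 1.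
Proof.
unfold prodL. rewrite (Lim_seq_ext _ (fun _ => 1)) by (intros; apply polyL_0). rewrite Lim_seq_const. auto.
Qed.

Lemma prodL_1 : prodL 1%nat = Series gamma.
Proof. unfold prodL. rewrite (is_lim_seq_unique _ _ gl_lim1). auto. Qed.

Lemma prodL_LK : LK prodL.
Proof.
apply LK_closed with (fun n => polyL (first_factors n)).
- rewrite prodL_0; lra.
- intros n. apply LK_ext with (fun k => 1 * polyL (first_factors n) k); [intros; ring|]. apply LK_polyL; [lra|apply gl_nonneg].
- apply prodL_lim.
Qed.

(** For finite products the second coefficient is twice the second elementary symmetric function, so
    the difference is the sum of squares; it then passes to the limit. *)
Lemma prodL_2 : prodL 1%nat ^ 2 - prodL 2%nat = Series (fun j => gamma j ^ 2).
Proof.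
symmetry. apply is_series_unique.
assert (H : is_lim_seq (fun n => sum_n (fun j => gamma j ^ 2) n) (prodL 1%nat * prodL 1%nat - prodL 2%nat)).
{ apply is_lim_seq_ext with (fun n => polyL (first_factors (S n)) 1%nat * polyL (first_factors (S n)) 1%nat - polyL (first_factors (S n)) 2%nat).
  - induction n as [|n IH].
    + rewrite sum_O. simpl. unfold mulL; simpl. ring.
    + rewrite sum_Sn, <- IH. set (l := first_factors (S n)).
      assert (E1 : polyL (first_factors (S (S n))) 1%nat = polyL l 1%nat + gamma (S n)).
      { change (first_factors (S (S n))) with (gamma (S n) :: l). simpl polyL. unfold mulL. simpl pred.
        rewrite polyL_0. simpl; ring. }
      assert (E2 : polyL (first_factors (S (S n))) 2%nat = polyL l 2%nat + 2 * gamma (S n) * polyL l 1%nat).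
      { change (first_factors (S (S n))) with (gamma (S n) :: l). simpl polyL. unfold mulL. simpl pred. simpl INR. ring. }
      rewrite E1, E2. change (?x = plus ?y ?z) with (x = y + z). ring.
  - apply is_lim_seq_minus'; [apply is_lim_seq_mult'|].
    + apply (is_lim_seq_incr_1 (fun n => polyL (first_factors n) 1%nat)), prodL_lim.
    + apply (is_lim_seq_incr_1 (fun n => polyL (first_factors n) 1%nat)), prodL_lim.
    + apply (is_lim_seq_incr_1 (fun n => polyL (first_factors n) 2%nat)), prodL_lim. }
replace (prodL 1%nat ^ 2 - prodL 2%nat) with (prodL 1%nat * prodL 1%nat - prodL 2%nat) by ring. exact H.
Qed.

(* order type zero: the tail of the product has small first coefficient *)
Lemma prodL_type b : 0 < b -> exists M, expo M b prodL.
Proof.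
intros Hb.
destruct (proj1 (is_lim_seq_eps _ _) gl_lim1 (mkposreal (b / 2) ltac:(lra))) as [N HN]. simpl in HN.
destruct (supp_expo (polyL (first_factors N)) (length (first_factors N)) (b / 2)) as [M [HM0 HM]]; [lra|apply supp_polyL|intros; apply polyL_nonneg, gl_nonneg|].
exists (1 * M). intros k. rewrite Rabs_pos_eq by (apply LK_nonneg, prodL_LK).
apply (is_lim_seq_le_loc (fun n => polyL (first_factors n) k) (fun _ => 1 * M * b ^ k) (prodL k) (1 * M * b ^ k)).
2: apply prodL_lim. 2: apply is_lim_seq_const.
exists N. intros n Hn.
assert (Hsplit : exists tl, nonneg_list tl /\ first_factors n = tl ++ first_factors N).
{ clear -Hn Hg. induction Hn as [|n Hn [tl [H1 H2]]]; [exists nil; split; auto; constructor|].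
  exists (gamma n :: tl). split; [constructor; auto|]. simpl. rewrite H2. auto. }
destruct Hsplit as [tl [Htl Etl]].
assert (H1 : polyL tl 1%nat <= b / 2).
{ pose proof (gl_le1 n) as Hle. rewrite Etl, <- conv_polyL, conv_at1, !polyL_0 in Hle.
  specialize (HN N (le_n _)). apply Rabs_def2 in HN. lra. }
rewrite Etl, <- conv_polyL. replace b with (b / 2 + b / 2) at 1 by field.
eapply Rle_trans; [apply Rle_abs|]. apply conv_expo; try lra.
- intros j. rewrite Rabs_pos_eq by (apply polyL_nonneg; auto). rewrite Rmult_1_l.
  eapply Rle_trans; [apply polyL_le_pow; auto|]. apply pow_incr. split; auto. apply polyL_nonneg; auto.
- intros j. rewrite Rabs_pos_eq by (apply polyL_nonneg, gl_nonneg). apply HM.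
Qed.

Lemma Cprod_gl n z : Cprod_n (fun j => (1 + RtoC (gamma j) * z)%C) n = rT (polyL (first_factors n)) z.
Proof.
induction n as [|n IH]; simpl; [rewrite rT_oneL; auto|].
rewrite rT_mulL, IH; [ring|]. apply rent_expo with 1 (polyL (first_factors n) 1%nat).
- apply polyL_nonneg, gl_nonneg.
- intros k. rewrite Rabs_pos_eq by (apply polyL_nonneg, gl_nonneg). rewrite Rmult_1_l. apply polyL_le_pow, gl_nonneg.
Qed.

Lemma Cprod_value z p : is_Cprod (fun j => (1 + RtoC (gamma j) * z)%C) p -> p = rT prodL z.
Proof.
intros Hp.
assert (HS0 : 0 <= Series gamma) by (rewrite <- prodL_1; apply LK_nonneg, prodL_LK).
destruct (rT_lim (fun n => polyL (first_factors n)) prodL 1 (Series gamma) z HS0) as [L1 L2].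
{ intros n k. rewrite Rabs_pos_eq by apply gl_bound. rewrite Rmult_1_l. apply gl_bound. }
{ apply prodL_lim. }
assert (P1 : is_lim_seq (fun n => Re (rT (polyL (first_factors n)) z)) (Re p)).
{ apply is_lim_seq_eps. intros eps.
  destruct (Hp (fun y => Rabs (Re y - Re p) < eps)) as [n Hn].
  - exists eps. intros y [Hy _]. exact Hy.
  - exists n. intros m Hm. rewrite <- Cprod_gl. apply Hn; auto. }
assert (P2 : is_lim_seq (fun n => Im (rT (polyL (first_factors n)) z)) (Im p)).
{ apply is_lim_seq_eps. intros eps.
  destruct (Hp (fun y => Rabs (Im y - Im p) < eps)) as [n Hn].
  - exists eps. intros y [_ Hy]. exact Hy.
  - exists n. intros m Hm. rewrite <- Cprod_gl. apply Hn; auto. }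
apply is_lim_seq_unique in L1, L2, P1, P2. rewrite L1 in P1. rewrite L2 in P2.
injection P1 as E1. injection P2 as E2.
apply injective_projections; [exact (eq_sym E1)|exact (eq_sym E2)].
Qed.
End Product.

Lemma rT_at0 c : rT c (RtoC 0) = RtoC (c 0%nat).
Proof. unfold rT. apply Tay_at0. Qed.

(** The value [g(0) = 1] forces [m = 0] and [C = 1]. If [c_1] were zero, [LK_le_pow] would kill all
    higher coefficients and [g] would be constant. The last clause records that the type is at least
    [alpha]; it matters at the right end of [I(g)]. *)
Lemma laguerre_sequence g alpha gamma : laguerre1 g alpha gamma ->
  (exists z1 z2, g z1 <> g z2) ->
  exists c, LK c /\ c 0%nat = 1 /\ 0 < c 1%nat /\
    ra c = alpha + moment gamma 1 /\ rb c = moment gamma 2 /\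
    (forall z, g z = rT c z) /\
    (forall b, alpha < b -> exists M, expo M b c) /\ (forall k, alpha ^ k <= c k).
Proof.
intros [[cc [m [Ha [Hgam [Hsum Hform]]]]] Hg0] [z1 [z2 Hz]].
assert (Hg : forall j, 0 <= gamma j).
{ intros j. specialize (Hgam j). lra. }
set (L := prodL gamma).
assert (HL : LK L) by (apply prodL_LK; auto).
assert (HL0 : L 0%nat = 1) by (apply prodL_0; auto).
assert (Hgz : forall z, g z = (cc * Cpow z m * (cexp (RtoC alpha * z) * rT L z))%C).
{ intros z. destruct (Hform z) as [p [Hp ->]]. rewrite (Cprod_value gamma Hg Hsum z p Hp). fold L. ring. }
set (c := conv (fun k => alpha ^ k) L).
assert (EL : ent (fun k => RtoC (L k))).
{ destruct (prodL_type gamma Hg Hsum 1 Rlt_0_1) as [M HM]. apply rent_expo with M 1; auto; lra. }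
assert (EA : ent (fun k => RtoC (alpha ^ k))).
{ apply rent_expo with 1 alpha; auto. intros k. rewrite Rabs_pos_eq by (apply pow_le; auto). lra. }
assert (Hm : m = 0%nat /\ cc = RtoC 1).
{ pose proof (Hgz (RtoC 0)) as H. rewrite Hg0, rT_at0, HL0, cexp_rT, rT_at0 in H. simpl in H.
  destruct m as [|m].
  - split; auto. simpl in H. rewrite !Cmult_1_r in H. auto.
  - exfalso. simpl in H. rewrite Cmult_0_l, Cmult_0_r, Cmult_0_l in H. apply RtoC_inj in H. lra. }
destruct Hm as [-> ->].
assert (HLKc : LK c) by (apply LK_conv; auto; apply LK_geom; auto).
assert (Hgc : forall z, g z = rT c z).
{ intros z. rewrite Hgz. unfold c. rewrite rT_conv, <- cexp_rT by auto. simpl. ring. }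
assert (Hc0 : c 0%nat = 1) by (unfold c; rewrite conv_at0, HL0; simpl; ring).
assert (Hm1 : moment gamma 1 = L 1%nat).
{ unfold moment, L. rewrite prodL_1 by auto. apply Series_ext. intros; simpl; ring. }
assert (Hm2 : moment gamma 2 = L 1%nat ^ 2 - L 2%nat) by (unfold L; rewrite prodL_2; auto).
exists c. split; auto. split; auto.
assert (Hra : ra c = alpha + moment gamma 1).
{ unfold ra. rewrite Hc0. unfold c. rewrite conv_at1, HL0, Hm1. simpl. field. }
split; [|split; [auto|split; [|split; [auto|split]]]].
- destruct (Rle_lt_or_eq_dec 0 (c 1%nat) (LK_nonneg c HLKc 1)) as [|E]; auto. exfalso.
  apply Hz. assert (Hone : forall z, g z = RtoC 1).
  { intros z. rewrite Hgc, <- (rT_oneL z). unfold rT. apply Tay_ext. intros k. f_equal.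
    destruct k; [exact Hc0|]. simpl oneL.
    pose proof (LK_le_pow c HLKc (S k)) as Hle. rewrite <- E in Hle.
    pose proof (LK_nonneg c HLKc (S k)). simpl in Hle. unfold Rdiv in Hle. rewrite !Rmult_0_l, Rmult_0_r in Hle. lra. }
  rewrite !Hone. auto.
- unfold rb. rewrite Hc0, Hm2. unfold c. rewrite conv_at1, conv_at2, HL0. simpl. field.
- intros b Hb. destruct (prodL_type gamma Hg Hsum (b - alpha)) as [M HM]; [lra|].
  exists (1 * M). replace b with (alpha + (b - alpha)) by ring. apply conv_expo; try lra; auto.
  intros k. rewrite Rabs_pos_eq by (apply pow_le; auto). lra.
- intros k. unfold c. replace (alpha ^ k) with (1 * 1 * (alpha + 0) ^ k) by (rewrite Rplus_0_r; ring).
  apply conv_lower; try lra; auto.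
  + intros j; lra.
  + intros j. destruct j; simpl; [rewrite HL0; lra|]. rewrite !Rmult_0_l, Rmult_0_r. apply LK_nonneg; auto.
Qed.

(** * The critical parameter *)

Section Dynamics.
Variables (delta : nat) (sigma L e theta alpha : R) (c0 : nat -> R).
Hypothesis Hsigma : 0 < sigma.
Hypothesis HL : 1 < L.
Hypothesis He : 0 < e < 1.
Hypothesis Hth : 0 <= theta.
Hypothesis Hs1 : INR delta * sigma = / L.
Hypothesis Hs2 : INR delta * sigma ^ 2 = (e / L) ^ 4.
Hypothesis Hc0 : LK c0.
Hypothesis Hc01 : 0 < c0 1%nat.
Hypothesis Halpha : 0 <= alpha.
Hypothesis Hlow : forall k, alpha ^ k <= c0 k.

Let X := L - e.
Let Xs := L - 1.

Hypothesis Hfam : rb c0 / ra c0 ^ 2 <= L / e ^ 2 / (theta + 1) * ((1 - e) / X).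

Fixpoint cs (tau : R) (n : nat) : nat -> R :=
  match n with
  | O => c0
  | S n => Flow theta tau (Qop delta sigma (cs tau n))
  end.

Definition xs (tau : R) (n : nat) : R := tau * ra (cs tau n).
Definition ys (tau : R) (n : nat) : R := tau ^ 2 * rb (cs tau n).
Definition admissible (tau : R) (n : nat) : Prop := LK (cs tau n) /\ 0 < cs tau n 1%nat.

Lemma admissible_ra tau n : admissible tau n -> 0 < ra (cs tau n).
Proof. intros [H1 H2]. apply Rdiv_lt_0_compat; auto. apply LK_pos; auto. Qed.

Lemma Q_facts tau n : admissible tau n ->
  LK (Qop delta sigma (cs tau n)) /\ 0 < Qop delta sigma (cs tau n) 1%nat /\
  ra (Qop delta sigma (cs tau n)) = / L * ra (cs tau n) /\
  rb (Qop delta sigma (cs tau n)) = (e / L) ^ 4 * rb (cs tau n).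
Proof.
intros H. pose proof (admissible_ra tau n H) as Hr. destruct H as [H1 H2].
pose proof (LK_pos _ H1) as Hp. assert (Hp0 : cs tau n 0%nat <> 0) by lra.
assert (HQ : LK (Qop delta sigma (cs tau n))) by (apply LK_Qop; auto).
rewrite Qop_ra, Qop_rb, Hs1, Hs2 by auto.
split; auto. split; auto.
assert (Hra : 0 < ra (Qop delta sigma (cs tau n))).
{ rewrite Qop_ra, Hs1 by auto. apply Rmult_lt_0_compat; auto. apply Rinv_0_lt_compat; lra. }
unfold ra in Hra. pose proof (LK_pos _ HQ) as HQ0.
apply (Rmult_lt_compat_r (Qop delta sigma (cs tau n) 0%nat)) in Hra; auto.
rewrite Rmult_0_l in Hra. unfold Rdiv in Hra. rewrite Rmult_assoc, Rinv_l in Hra by lra. lra.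
Qed.

Lemma xs_nonneg tau n : 0 <= tau -> admissible tau n -> 0 <= xs tau n.
Proof. intros Ht H. apply Rmult_le_pos; auto. apply Rlt_le, admissible_ra; auto. Qed.

Lemma ys_nonneg tau n : admissible tau n -> 0 <= ys tau n.
Proof. intros [H _]. apply Rmult_le_pos; [apply pow2_ge_0|apply rb_nonneg; auto]. Qed.

Section Step.
Variables (tau : R) (n : nat).
Hypothesis Htau : 0 <= tau.
Hypothesis HOK : admissible tau n.
Hypothesis Hx : xs tau n < L.

Let x := xs tau n.
Let x' := xs tau (S n).
Let y := ys tau n.
Let y' := ys tau (S n).

Lemma step_small : tau * ra (Qop delta sigma (cs tau n)) = x / L /\ x / L < 1.
Proof.
destruct (Q_facts tau n HOK) as [_ [_ [-> _]]]. unfold x, xs in *. split.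
- field. lra.
- apply Rmult_lt_reg_r with L; [lra|]. field_simplify; lra.
Qed.

Lemma step_admissible : admissible tau (S n).
Proof.
destruct (Q_facts tau n HOK) as [H1 [H2 _]]. destruct step_small as [E Hl].
assert (Hs : tau * ra (Qop delta sigma (cs tau n)) < 1) by (rewrite E; auto).
split; simpl.
- apply LK_Flow; auto.
- apply Rlt_le_trans with (1 := H2). apply fs_ge with tau; auto. lra.
Qed.

Lemma step_ra_upper : ra (cs tau (S n)) * (1 - x / L) <= / L * ra (cs tau n).
Proof.
destruct (Q_facts tau n HOK) as [H1 [H2 [H3 _]]]. destruct step_small as [E Hl].
pose proof (flow_ra_upper theta tau (Qop delta sigma (cs tau n)) Hth Htau H1 H2) as H.
rewrite E in H. specialize (H Hl tau ltac:(lra)). rewrite E in H. rewrite <- H3. exact H.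
Qed.

Lemma step_x_lower : x / L * (1 - x / L) - (theta + 1) * (e / L) ^ 4 * y / (1 - x / L) <= x' * (1 - x / L) ^ 2.
Proof.
destruct (Q_facts tau n HOK) as [H1 [H2 [H3 H4]]]. destruct step_small as [E Hl].
pose proof (flow_ra_lower theta tau (Qop delta sigma (cs tau n)) Hth Htau H1 H2) as H.
rewrite E, H4 in H. specialize (H Hl).
apply (Rmult_le_compat_l tau) in H; auto. unfold x', xs. unfold y, ys.
simpl cs. assert (HD : 1 - x / L <> 0) by lra. set (D := 1 - x / L) in *.
rewrite <- E. eapply Rle_trans; [|eapply Rle_trans; [exact H|]].
- right. field. split; [lra|auto].
- right. ring.
Qed.

Lemma step_y : let z := y' * (1 - x / L) ^ 4 in z + 2 * (theta + 1) * z ^ 2 <= (e / L) ^ 4 * y.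
Proof.
destruct (Q_facts tau n HOK) as [H1 [H2 [H3 H4]]]. destruct step_small as [E Hl].
pose proof (flow_rb_strict theta tau (Qop delta sigma (cs tau n)) Hth Htau H1 H2) as H.
rewrite E, H4 in H. specialize (H Hl). cbv zeta in *.
apply (Rmult_le_compat_l (tau ^ 2)) in H; [|apply pow2_ge_0]. unfold y', y, ys. simpl cs.
eapply Rle_trans; [|eapply Rle_trans; [exact H|]]; right; ring.
Qed.

(* below the fixed point of the upper envelope the orbit contracts *)
Lemma step_sub : x < Xs -> x' <= x.
Proof.
intros Hlt. pose proof step_ra_upper as H. pose proof (xs_nonneg tau n Htau HOK) as Hx0.
pose proof (xs_nonneg tau (S n) Htau step_admissible) as Hx1. fold x in Hx0. fold x' in Hx1.
apply (Rmult_le_compat_l tau) in H; auto.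
assert (H' : x' * (1 - x / L) <= x / L) by (unfold x', xs; unfold x at 2; unfold xs; unfold Rdiv in *; lra).
assert (Hd : / L <= 1 - x / L).
{ apply Rmult_le_reg_r with L; [lra|]. unfold Xs in Hlt. field_simplify; lra. }
apply Rmult_le_reg_r with (/ L); [apply Rinv_0_lt_compat; lra|].
apply Rle_trans with (x' * (1 - x / L)); [apply Rmult_le_compat_l; auto|exact H'].
Qed.

Hypothesis HxX : x <= X.

Lemma step_D : e / L <= 1 - x / L.
Proof.
apply Rmult_le_reg_r with L; [lra|]. unfold X in HxX. field_simplify; lra.
Qed.

Lemma eL_pos : 0 < e / L.
Proof. apply Rdiv_lt_0_compat; lra. Qed.

(** The bound [x <= X] means [1 - x / L >= e / L], so the fourth power lost along the flow is
    compensated exactly by the factor [(e / L)^4] gained in the power step. *)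
Lemma step_y_decr : y' + 2 * (theta + 1) * (e / L) ^ 4 * y' ^ 2 <= y.
Proof.
pose proof step_y as H. cbv zeta in H. pose proof step_D as HD. pose proof eL_pos as HE.
pose proof (ys_nonneg tau (S n) step_admissible) as Hy'. fold y' in Hy'.
assert (H4 : (e / L) ^ 4 <= (1 - x / L) ^ 4) by (apply pow_incr; lra).
assert (HE4 : 0 < (e / L) ^ 4) by (apply pow_lt; auto).
set (E4 := (e / L) ^ 4) in *. set (z := y' * (1 - x / L) ^ 4) in *.
assert (Hz : y' * E4 <= z) by (unfold z; apply Rmult_le_compat_l; auto).
assert (0 <= y' * E4) by (apply Rmult_le_pos; lra).
assert ((y' * E4) ^ 2 <= z ^ 2) by (apply pow_incr; auto).
assert (Hfin : E4 * (y' + 2 * (theta + 1) * E4 * y' ^ 2) <= E4 * y).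
{ eapply Rle_trans; [|exact H].
  replace (E4 * (y' + 2 * (theta + 1) * E4 * y' ^ 2)) with (y' * E4 + 2 * (theta + 1) * (y' * E4) ^ 2) by ring.
  apply Rplus_le_compat; auto. apply Rmult_le_compat_l; lra. }
apply Rmult_le_reg_l with E4; auto.
Qed.

(** Divides [step_x_lower] by [(1 - x / L)^2] and uses [1 - x / L >= e / L] three times. The leading
    map [x / (L - x)] has the fixed points 0 and [L - 1]. *)
Lemma step_x_lower2 : x / (L - x) - (theta + 1) * (e / L) * y <= x'.
Proof.
pose proof step_x_lower as H. pose proof step_D as HD. pose proof eL_pos as HE.
pose proof (ys_nonneg tau n HOK) as Hy. fold y in Hy.
set (D := 1 - x / L) in *. assert (HDp : 0 < D) by lra.
assert (E1 : x / (L - x) = x / L / D).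
{ unfold D, X in *. field. split; lra. }
rewrite E1.
apply Rmult_le_reg_r with (D ^ 2); [apply pow_lt; auto|].
eapply Rle_trans; [|exact H].
replace ((x / L / D - (theta + 1) * (e / L) * y) * D ^ 2) with (x / L * D - (theta + 1) * y * ((e / L) * D ^ 2)) by (field; lra).
replace ((theta + 1) * (e / L) ^ 4 * y / D) with ((theta + 1) * y * ((e / L) ^ 4 / D)) by (field; lra).
assert ((e / L) ^ 4 / D <= e / L * D ^ 2).
{ apply Rmult_le_reg_r with D; auto. replace ((e / L) ^ 4 / D * D) with (e / L * (e / L) ^ 3) by (field; lra).
  replace (e / L * D ^ 2 * D) with (e / L * D ^ 3) by ring.
  apply Rmult_le_compat_l; [lra|]. apply pow_incr; lra. }
assert ((theta + 1) * y * ((e / L) ^ 4 / D) <= (theta + 1) * y * (e / L * D ^ 2)).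
{ apply Rmult_le_compat_l; auto. apply Rmult_le_pos; lra. }
lra.
Qed.

(* the bound on y is exactly what pushes the orbit over the threshold X *)
Lemma step_push : x = X -> (theta + 1) * y <= L / e ^ 2 * (1 - e) * X -> X <= x'.
Proof.
intros Ex Hy. eapply Rle_trans; [|exact step_x_lower2]. rewrite Ex.
replace (L - X) with e by (unfold X; ring).
apply (Rmult_le_compat_l (e / L)) in Hy; [|apply Rlt_le, eL_pos].
replace (e / L * (L / e ^ 2 * (1 - e) * X)) with (X / e - X) in Hy by (field; lra).
replace (e / L * ((theta + 1) * y)) with ((theta + 1) * (e / L) * y) in Hy by ring. lra.
Qed.
End Step.

Lemma Xs_X : 0 < Xs < X /\ X < L.
Proof. unfold X, Xs. lra. Qed.

Lemma admissible_0 tau : admissible tau 0.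
Proof. split; auto. Qed.

Lemma good_admissible tau n : 0 <= tau -> (forall m, (m < n)%nat -> xs tau m <= X) -> admissible tau n.
Proof.
intros Ht H. destruct Xs_X as [_ HX]. induction n as [|n IH]; [apply admissible_0|].
apply step_admissible; auto. apply Rle_lt_trans with X; auto.
Qed.

Definition ymax : R := L / e ^ 2 * (1 - e) * X / (theta + 1).

Lemma ys_0 tau : 0 <= tau -> xs tau 0 <= X -> ys tau 0 <= ymax.
Proof.
intros Ht Hx. pose proof (admissible_ra tau 0 (admissible_0 tau)) as Hr. simpl in Hr.
destruct Xs_X as [HXs _].
unfold ys, xs in *. simpl cs in *.
replace (tau ^ 2 * rb c0) with ((tau * ra c0) ^ 2 * (rb c0 / ra c0 ^ 2)) by (field; lra).
assert (Hq : 0 <= rb c0 / ra c0 ^ 2).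
{ apply Rmult_le_pos; [apply rb_nonneg; auto|]. apply Rlt_le, Rinv_0_lt_compat, pow_lt; auto. }
apply Rle_trans with (X ^ 2 * (L / e ^ 2 / (theta + 1) * ((1 - e) / X))).
- apply Rmult_le_compat; auto; [apply pow2_ge_0|]. apply pow_incr. split; auto. apply Rmult_le_pos; lra.
- right. unfold ymax. field. repeat split; lra.
Qed.

Lemma ys_bound tau n : 0 <= tau -> (forall m, (m <= n)%nat -> xs tau m <= X) -> ys tau n <= ymax.
Proof.
intros Ht H. induction n as [|n IH]; [apply ys_0; auto|].
assert (HOK : admissible tau n) by (apply good_admissible; auto; intros; apply H; lia).
destruct Xs_X as [_ HX].
assert (Hn : xs tau n <= X) by (apply H; lia).
pose proof (step_y_decr tau n Ht HOK ltac:(lra) Hn) as Hd.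
assert (ys tau n <= ymax) by (apply IH; intros; apply H; lia).
assert (0 <= 2 * (theta + 1) * (e / L) ^ 4 * ys tau (S n) ^ 2).
{ apply Rmult_le_pos; [|apply pow2_ge_0]. apply Rmult_le_pos; [lra|]. apply pow_le, Rlt_le, eL_pos. }
lra.
Qed.

(** An orbit that never exceeds [X] and touches it is therefore stuck at [X]. *)
Lemma push tau n : 0 <= tau -> (forall m, xs tau m <= X) -> X <= xs tau n -> X <= xs tau (S n).
Proof.
intros Ht H Hn. assert (E : xs tau n = X) by (specialize (H n); lra).
destruct Xs_X as [_ HX].
assert (HOK : admissible tau n) by (apply good_admissible; auto).
apply step_push; auto; try lra.
pose proof (ys_bound tau n Ht ltac:(auto)) as Hy. unfold ymax in Hy.
apply (Rmult_le_compat_l (theta + 1)) in Hy; [|lra].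
replace ((theta + 1) * (L / e ^ 2 * (1 - e) * X / (theta + 1))) with (L / e ^ 2 * (1 - e) * X) in Hy by (field; lra).
auto.
Qed.

Lemma sub_persist tau n : 0 <= tau -> admissible tau n -> xs tau n < Xs ->
  forall j, admissible tau (n + j) /\ xs tau (n + j) <= xs tau n.
Proof.
intros Ht HOK Hx j. destruct Xs_X as [HXs HX]. induction j as [|j [IH1 IH2]].
- rewrite Nat.add_0_r. split; auto. lra.
- rewrite Nat.add_succ_r. split.
  + apply step_admissible; auto. lra.
  + eapply Rle_trans; [apply step_sub; auto; lra|auto].
Qed.

(** From [n] on the ratio contracts by [1 / (L - x) < 1] at each step. The argument runs on [ra]
    instead of [xs] so that it also gives something at [tau = 0]. *)
Lemma sub_to_0 tau n : 0 <= tau -> admissible tau n -> xs tau n < Xs ->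
  is_lim_seq (fun m => ra (cs tau m)) 0.
Proof.
intros Ht HOK Hx. destruct Xs_X as [HXs HX].
pose proof (sub_persist tau n Ht HOK Hx) as Hp.
set (x := xs tau n) in *. assert (Hx0 : 0 <= x) by (apply xs_nonneg; auto).
set (rho := / (L - x)).
assert (Hrho : 0 < rho < 1).
{ unfold rho, Xs in *. split; [apply Rinv_0_lt_compat; lra|].
  rewrite <- Rinv_1. apply Rinv_lt_contravar; lra. }
assert (Hstep : forall j, ra (cs tau (n + S j)) <= rho * ra (cs tau (n + j))).
{ intros j. destruct (Hp j) as [H1 H2]. rewrite Nat.add_succ_r.
  assert (HxL : xs tau (n + j) < L) by lra.
  pose proof (step_ra_upper tau (n + j) Ht H1 HxL) as Hu.
  pose proof (admissible_ra _ _ H1) as Ha. pose proof (admissible_ra _ _ (step_admissible tau (n + j) Ht H1 HxL)) as Ha'.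
  set (xj := xs tau (n + j)) in *.
  apply Rmult_le_reg_l with ((L - x) / L); [apply Rdiv_lt_0_compat; lra|].
  replace ((L - x) / L * (rho * ra (cs tau (n + j)))) with (/ L * ra (cs tau (n + j))) by (unfold rho; field; lra).
  eapply Rle_trans; [|exact Hu]. rewrite Rmult_comm. apply Rmult_le_compat_l; [lra|].
  apply Rmult_le_reg_r with L; [lra|]. field_simplify; lra. }
apply is_lim_seq_incr_n with n.
apply is_lim_seq_le_le with (fun _ => 0) (fun j => rho ^ j * ra (cs tau n)).
- intros j. rewrite Nat.add_comm. split; [apply Rlt_le, admissible_ra, Hp|].
  induction j as [|j IH]; [rewrite Nat.add_0_r; simpl; lra|].
  eapply Rle_trans; [apply Hstep|]. simpl. rewrite Rmult_assoc. apply Rmult_le_compat_l; lra.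
- apply is_lim_seq_const.
- replace (Finite 0) with (Finite (0 * ra (cs tau n))) by (f_equal; ring).
  apply is_lim_seq_mult'; [|apply is_lim_seq_const]. apply is_lim_seq_geom. rewrite Rabs_pos_eq; lra.
Qed.

(** Continuity in the parameter at a fixed index. Only the orbit at the limit parameter has to be
    controlled; admissibility of nearby orbits follows by induction, since [X < L]. *)
Lemma cs_cont (t : nat -> R) (tau : R) n :
  (forall i, 0 <= t i) -> is_lim_seq t tau -> 0 <= tau ->
  (forall m, (m < n)%nat -> xs tau m <= X) ->
  (forall k, is_lim_seq (fun i => cs (t i) n k) (cs tau n k)) /\
  eventually (fun i => admissible (t i) n) /\ is_lim_seq (fun i => xs (t i) n) (xs tau n).
Proof.
intros Ht Hlim Htau. destruct Xs_X as [HXs HX].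
assert (Hx : forall n, (forall m, (m < n)%nat -> xs tau m <= X) -> (forall k, is_lim_seq (fun i => cs (t i) n k) (cs tau n k)) ->
  is_lim_seq (fun i => xs (t i) n) (xs tau n)).
{ intros m Hm H. apply is_lim_seq_mult'; auto. apply is_lim_seq_div'; auto.
  apply Rgt_not_eq, LK_pos. apply (good_admissible tau m); auto. }
induction n as [|n IH]; intros Hgood.
- split; [intros; apply is_lim_seq_const|]. split; [exists 0%nat; intros; apply admissible_0|].
  apply Hx; auto. intros; apply is_lim_seq_const.
- destruct IH as [IH1 [[n0 IH2] IH3]]; [intros; apply Hgood; lia|].
  assert (HOKn : admissible tau n) by (apply good_admissible; auto).
  assert (Hxn : xs tau n <= X) by (apply Hgood; lia).
  assert (HxL : xs tau n < L) by lra.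
  assert (Hpp : 0 < L - xs tau n) by lra.
  destruct (proj1 (is_lim_seq_eps _ _) IH3 (mkposreal _ Hpp)) as [n1 Hn1]. simpl in Hn1.
  assert (HxLi : forall i, (n1 <= i)%nat -> xs (t i) n < L).
  { intros i Hi. specialize (Hn1 i Hi). apply Rabs_def2 in Hn1. lra. }
  assert (H1 : forall k, is_lim_seq (fun i => cs (t i) (S n) k) (cs tau (S n) k)).
  { intros k. simpl. apply (Flow_LK_lim theta Hth (fun i => Qop delta sigma (cs (t i) n)) t); auto.
    - exists n0. intros i Hi. apply Q_facts. auto.
    - apply Q_facts; auto.
    - destruct (step_small tau n HOKn HxL) as [E Hl]. unfold ra in E. rewrite E. auto.
    - intros j. apply Qop_lim. auto. }
  split; auto. split; [|apply Hx; auto].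
  exists (max n0 n1). intros i Hi. apply step_admissible; auto.
  + apply IH2; lia.
  + apply HxLi; lia.
Qed.

Definition inI (tau : R) : Prop := 0 <= tau /\ (0 < alpha -> tau <= (L - 1) / alpha).

(** Quantifying over all smaller parameters makes this an interval, so its supremum can be
    approached from below within it. *)
Definition bdd (tau : R) : Prop := inI tau /\ forall t n, 0 <= t <= tau -> xs t n <= X.

Lemma inv_S_lim (r : R) : is_lim_seq (fun i => r / INR (S i)) 0.
Proof.
replace (Finite 0) with (Finite (r * 0)) by (f_equal; ring).
apply is_lim_seq_mult'; [apply is_lim_seq_const|].
apply is_lim_seq_incr_1 with (u := fun n => / INR n).
replace (Finite 0) with (Rbar_inv p_infty) by reflexivity.
apply is_lim_seq_inv; [apply is_lim_seq_INR|discriminate].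
Qed.

Lemma exists_max_bdd : exists tp, bdd tp /\ forall t, bdd t -> t <= tp.
Proof.
pose proof (admissible_ra 0 0 (admissible_0 0)) as Hr. simpl in Hr. destruct Xs_X as [HXs HX].
destruct (completeness bdd) as [tp [Htp1 Htp2]].
- exists (X / ra c0). intros t [[Ht0 _] H]. specialize (H t 0%nat ltac:(lra)). unfold xs in H. simpl in H.
  apply Rmult_le_reg_r with (ra c0); auto. field_simplify; lra.
- exists 0. split.
  + split; [lra|]. intros Ha. apply Rmult_le_pos; [lra|]. apply Rlt_le, Rinv_0_lt_compat; auto.
  + intros t n Ht. replace t with 0 by lra. unfold xs. rewrite Rmult_0_l. lra.
- exists tp. split; [|exact Htp1].
  assert (H0 : bdd 0).
  { split.
    + split; [lra|]. intros Ha. apply Rmult_le_pos; [lra|]. apply Rlt_le, Rinv_0_lt_compat; auto.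
    + intros t n Ht. replace t with 0 by lra. unfold xs. rewrite Rmult_0_l. lra. }
  assert (Htp0 : 0 <= tp) by (apply Htp1; auto).
  assert (Hbelow : forall t, 0 <= t < tp -> forall n, xs t n <= X).
  { intros t Ht n. destruct (Classical_Prop.classic (exists s, bdd s /\ t <= s)) as [[s [[_ Hs] Hts]]|Hno].
    - apply Hs; lra.
    - exfalso. assert (tp <= t); [|lra]. apply Htp2. intros s Hs.
      destruct (Rle_lt_dec s t); auto. exfalso. apply Hno. exists s; split; auto; lra. }
  (* The bound passes to the supremum by continuity from below; strong induction, because [cs_cont]
     at [n] needs the bound at all earlier indices. *)
  assert (Htop : forall n, xs tp n <= X).
  { intros n. induction n as [n IH] using (well_founded_induction Wf_nat.lt_wf).
    destruct (Req_dec tp 0) as [E|E].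
    { rewrite E. unfold xs. rewrite Rmult_0_l. lra. }
    set (t := fun i => tp - tp / INR (S i)).
    assert (Hti : forall i, 0 <= t i < tp).
    { intros i. unfold t. assert (Hi : 1 <= INR (S i)) by (apply (le_INR 1); lia).
      assert (0 < tp / INR (S i)) by (apply Rdiv_lt_0_compat; lra).
      assert (tp / INR (S i) <= tp).
      { apply Rmult_le_reg_r with (INR (S i)); [lra|]. field_simplify; [|lra]. nra. }
      lra. }
    assert (Hlim : is_lim_seq t tp).
    { replace (Finite tp) with (Finite (tp - 0)) by (f_equal; ring).
      apply is_lim_seq_minus'; [apply is_lim_seq_const|apply inv_S_lim]. }
    destruct (cs_cont t tp n) as [_ [_ H3]]; auto; [intros; apply Hti|].
    apply (is_lim_seq_le (fun i => xs (t i) n) (fun _ => X) (xs tp n) X) with (2 := H3).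
    - intros i. apply Hbelow, Hti.
    - apply is_lim_seq_const. }
  split.
  + split; auto. intros Ha. apply Htp2. intros s [[_ Hs] _]. auto.
  + intros t n Ht. destruct (Req_dec t tp) as [->|]; auto. apply Hbelow; lra.
Qed.

(** At the right end of [I(g)] the type [alpha] is a fixed point of one step: the power step gives
    [alpha / L], and the flow divides by [1 - tau alpha / L = 1 / L]. *)
Lemma lower_type tau n : 0 < alpha -> tau = (L - 1) / alpha -> (forall m, xs tau m <= X) ->
  exists m, 0 < m /\ forall k, m * alpha ^ k <= cs tau n k.
Proof.
intros Ha Et Hx. destruct Xs_X as [HXs HX].
assert (Ht0 : 0 <= tau) by (rewrite Et; apply Rmult_le_pos; [lra|apply Rlt_le, Rinv_0_lt_compat; auto]).
induction n as [|n [m [Hm IH]]].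
- exists 1. split; [lra|]. intros k. rewrite Rmult_1_l. apply Hlow.
- assert (HOK : admissible tau n) by (apply good_admissible; auto).
  assert (HxL : xs tau n < L) by (specialize (Hx n); lra).
  destruct (Q_facts tau n HOK) as [Q1 [Q2 _]]. destruct (step_small tau n HOK HxL) as [E Hl].
  assert (HLi : 0 < / L) by (apply Rinv_0_lt_compat; lra).
  assert (Hb0 : 0 <= / L * alpha) by (apply Rmult_le_pos; lra).
  assert (Hsb : tau * (/ L * alpha) = 1 - / L) by (rewrite Et; field; lra).
  exists (m ^ delta * Rpower (/ L) (- theta)). split.
  { apply Rmult_lt_0_compat; [apply pow_lt; auto|apply exp_pos]. }
  intros k. simpl cs.
  assert (Hq : forall j, m ^ delta * (/ L * alpha) ^ j <= Qop delta sigma (cs tau n) j).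
  { intros j. rewrite <- Hs1. apply Qop_lower; auto; lra. }
  assert (Hm' : 0 <= m ^ delta) by (apply pow_le; lra).
  assert (Hsmall : tau * ra (Qop delta sigma (cs tau n)) < 1) by (rewrite E; auto).
  pose proof (Flow_lower theta Hth (m ^ delta) _ (/ L * alpha) (ra (Qop delta sigma (cs tau n)))
    (Qop delta sigma (cs tau n)) k tau Hm' Hb0 (LK_ratio _ Q1) Ht0 ltac:(lra) Hsmall (LK_expo _ Q1) Hq) as HF.
  rewrite Hsb in HF. replace (1 - (1 - / L)) with (/ L) in HF by ring.
  eapply Rle_trans; [|exact HF]. right.
  rewrite Ropp_plus_distr, Rpower_plus.
  replace (Rpower (/ L) (- INR k)) with (L ^ k).
  + rewrite Rpow_mult_distr, pow_inv. field. apply pow_nonzero; lra.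
  + rewrite Rpower_Ropp, Rpower_pow, pow_inv, Rinv_inv by auto. auto.
Qed.

Lemma lower_type_ra c m : LK c -> 0 < alpha -> 0 < m -> (forall k, m * alpha ^ k <= c k) -> alpha <= ra c.
Proof.
intros Hc Ha Hm H. destruct (Rle_lt_dec alpha (ra c)) as [|Hlt]; auto. exfalso.
pose proof (LK_pos c Hc) as Hp. pose proof (LK_ratio c Hc) as Hr. fold (ra c) in Hr.
assert (Hl : is_lim_seq (fun k => c 0%nat * (ra c / alpha) ^ k) 0).
{ replace (Finite 0) with (Finite (c 0%nat * 0)) by (f_equal; ring).
  apply is_lim_seq_mult'; [apply is_lim_seq_const|]. apply is_lim_seq_geom.
  rewrite Rabs_pos_eq by (apply Rmult_le_pos; auto; apply Rlt_le, Rinv_0_lt_compat; auto).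
  apply Rmult_lt_reg_r with alpha; auto. field_simplify; lra. }
assert (m <= 0); [|lra].
apply (is_lim_seq_le (fun _ => m) (fun k => c 0%nat * (ra c / alpha) ^ k) m 0) with (3 := Hl).
- intros k. apply Rmult_le_reg_r with (alpha ^ k); [apply pow_lt; auto|].
  eapply Rle_trans; [apply H|]. eapply Rle_trans; [apply LK_le_pow; auto|]. fold (ra c).
  right. unfold Rdiv. rewrite Rpow_mult_distr, pow_inv. field. apply pow_nonzero; lra.
- apply is_lim_seq_const.
Qed.

Lemma top_not_sub tp : bdd tp -> (forall t, bdd t -> t <= tp) -> forall n, Xs <= xs tp n.
Proof.
intros [[Htp0 HtpI] Hb] Hmax n. destruct Xs_X as [HXs HX].
assert (Htop : forall m, xs tp m <= X) by (intros; apply Hb; lra).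
destruct (Rle_lt_dec Xs (xs tp n)) as [|Hlt]; auto. exfalso.
(* Either [tp] is the right end of [I(g)], where the lower bound on the type applies, or [I(g)]
   leaves room above [tp] to contradict maximality. *)
assert (Hcase : (0 < alpha /\ tp = (L - 1) / alpha) \/ exists eta, 0 < eta /\ inI (tp + eta)).
{ destruct (Rle_lt_or_eq_dec 0 alpha Halpha) as [Ha|Ha].
  - destruct (Rle_lt_or_eq_dec _ _ (HtpI Ha)) as [Hl|Hl].
    + right. exists ((L - 1) / alpha - tp). split; [lra|]. split; [lra|]. intros _. lra.
    + left; auto.
  - right. exists 1. split; [lra|]. split; [lra|]. intros; lra. }
destruct Hcase as [[Ha Et]|[eta [Heta HI]]].
- destruct (lower_type tp n Ha Et Htop) as [m [Hm Hk]].
  assert (HOK : admissible tp n) by (apply good_admissible; auto).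
  pose proof (lower_type_ra _ m (proj1 HOK) Ha Hm Hk) as Hra.
  unfold xs in Hlt. apply (Rmult_le_compat_l tp) in Hra; auto.
  replace (tp * alpha) with Xs in Hra by (rewrite Et; unfold Xs; field; lra). lra.
(* By maximality of [tp], arbitrarily close above it there are parameters whose orbit exceeds [X] at
   some index. *)
- assert (Hex : forall i : nat, exists p : R * nat, tp <= fst p <= tp + eta / INR (S i) /\ X < xs (fst p) (snd p)).
  { intros i. assert (Hi : 1 <= INR (S i)) by (apply (le_INR 1); lia).
    assert (He1 : 0 < eta / INR (S i)) by (apply Rdiv_lt_0_compat; lra).
    assert (He2 : eta / INR (S i) <= eta).
    { apply Rmult_le_reg_r with (INR (S i)); [lra|]. field_simplify; [|lra]. nra. }
    apply Classical_Prop.NNPP. intros Hno.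
    assert (Hbad : bdd (tp + eta / INR (S i))); [|specialize (Hmax _ Hbad); lra].
    split.
    - split; [lra|]. intros Ha. destruct HI as [_ HI]. specialize (HI Ha). lra.
    - intros t m Ht. destruct (Rle_lt_dec t tp); [apply Hb; lra|].
      apply Rnot_lt_le. intros Hx. apply Hno. exists (t, m). cbn [fst snd]. split; auto; lra. }
  set (p := fun i => proj1_sig (constructive_indefinite_description _ (Hex i))).
  assert (Hp : forall i, tp <= fst (p i) <= tp + eta / INR (S i) /\ X < xs (fst (p i)) (snd (p i))).
  { intros i. unfold p. destruct (constructive_indefinite_description _ _); auto. }
  set (t := fun i => fst (p i)).
  assert (Hlim : is_lim_seq t tp).
  { apply is_lim_seq_le_le with (fun _ => tp) (fun i => tp + eta / INR (S i)).
    - intros i. apply Hp.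
    - apply is_lim_seq_const.
    - replace (Finite tp) with (Finite (tp + 0)) by (f_equal; ring).
      apply is_lim_seq_plus'; [apply is_lim_seq_const|apply inv_S_lim]. }
  assert (Ht0 : forall i, 0 <= t i) by (intros i; destruct (Hp i); unfold t; lra).
  destruct (cs_cont t tp n Ht0 Hlim Htp0) as [_ [[n0 HOKn] Hxn]]; auto.
  assert (Hgap : 0 < Xs - xs tp n) by lra.
  destruct (proj1 (is_lim_seq_eps _ _) Hxn (mkposreal _ Hgap)) as [n1 Hn1]. simpl in Hn1.
  destruct (Classical_Prop.classic (exists m, (m < n)%nat /\ X <= xs tp m)) as [[m [Hmn HmX]]|Hno].
  + (* stuck at X from m on *)
    assert (Hall : forall j, X <= xs tp (m + j)).
    { induction j as [|j IH]; [rewrite Nat.add_0_r; auto|]. rewrite Nat.add_succ_r. apply push; auto. }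
    specialize (Hall (n - m)%nat). replace (m + (n - m))%nat with n in Hall by lia. lra.
  + assert (Hev : exists N, forall i, (N <= i)%nat -> forall m, (m < n)%nat -> xs (t i) m < X).
    { assert (Hgen : forall n', (n' <= n)%nat -> exists N, forall i, (N <= i)%nat -> forall m, (m < n')%nat -> xs (t i) m < X).
      { induction n' as [|n' IHn']; intros Hn'.
        - exists 0%nat. intros; lia.
        - destruct IHn' as [N HN]; [lia|].
          assert (Hlt' : 0 < X - xs tp n').
          { apply Rlt_0_minus. apply Rnot_le_lt. intros Hc. apply Hno. exists n'; split; auto; lia. }
          destruct (cs_cont t tp n' Ht0 Hlim Htp0) as [_ [_ Hx']]; auto.
          destruct (proj1 (is_lim_seq_eps _ _) Hx' (mkposreal _ Hlt')) as [N' HN']. simpl in HN'.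
          exists (max N N'). intros i Hi m Hm. destruct (Nat.eq_dec m n') as [->|Hne].
          + specialize (HN' i ltac:(lia)). apply Rabs_def2 in HN'. lra.
          + apply HN; lia. }
      apply Hgen; auto. }
    (* The index of excess cannot precede [n], by continuity and strictness there, nor follow it,
       since the orbit lies below [Xs] at [n] and stays there. *)
    destruct Hev as [N HN]. set (i := max N (max n0 n1)).
    destruct (Hp i) as [_ Hpi]. fold (t i) in Hpi.
    destruct (Nat.lt_ge_cases (snd (p i)) n) as [Hl|Hl].
    * specialize (HN i ltac:(lia) _ Hl). lra.
    * specialize (HOKn i ltac:(lia)). specialize (Hn1 i ltac:(lia)). apply Rabs_def2 in Hn1.
      destruct (sub_persist (t i) n (Ht0 i) HOKn ltac:(lra) (snd (p i) - n)) as [_ Hs].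
      replace (n + (snd (p i) - n))%nat with (snd (p i)) in Hs by lia. lra.
Qed.

(** The decreasing [y_n] have a limit [l] with [l + K l^2 <= l], so [l = 0]. Then [x_n - Xs] is
    expanded by [L] at each step up to a vanishing error, and being bounded it must tend to 0. *)
Lemma crit_limits tau : 0 < tau -> (forall n, Xs <= xs tau n <= X) ->
  is_lim_seq (fun n => ra (cs tau n)) (Xs / tau) /\ is_lim_seq (fun n => rb (cs tau n)) 0.
Proof.
intros Ht Hx. destruct Xs_X as [HXs HX].
assert (HOK : forall n, admissible tau n) by (intros; apply good_admissible; [lra|intros; apply Hx]).
set (K := 2 * (theta + 1) * (e / L) ^ 4).
assert (HK : 0 < K).
{ unfold K. apply Rmult_lt_0_compat; [lra|]. apply pow_lt, eL_pos. }
assert (Hy : forall n, ys tau (S n) + K * ys tau (S n) ^ 2 <= ys tau n).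
{ intros n. destruct (Hx n). apply step_y_decr; auto; lra. }
assert (Hy0 : forall n, 0 <= ys tau n) by (intros; apply ys_nonneg; auto).
assert (Hylim : is_lim_seq (ys tau) 0).
{ destruct (ex_finite_lim_seq_decr (ys tau) 0) as [l Hl].
  - intros n. specialize (Hy n). assert (0 <= K * ys tau (S n) ^ 2) by (apply Rmult_le_pos; [lra|apply pow2_ge_0]). lra.
  - auto.
  - assert (Hle : l + K * (l * l) <= l).
    { apply (is_lim_seq_le (fun n => ys tau (S n) + K * (ys tau (S n) * ys tau (S n))) (ys tau) (l + K * (l * l)) l); auto.
      - intros n. specialize (Hy n). replace (ys tau (S n) ^ 2) with (ys tau (S n) * ys tau (S n)) in Hy by ring. auto.
      - assert (HlS : is_lim_seq (fun n => ys tau (S n)) l) by (apply (is_lim_seq_incr_1 (ys tau)); auto).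
        apply is_lim_seq_plus'; auto. apply is_lim_seq_mult'; [apply is_lim_seq_const|]. apply is_lim_seq_mult'; auto. }
    assert (Hll : l * l <= 0) by (apply Rmult_le_reg_l with K; lra).
    assert (l = 0) by nra. subst; auto. }
assert (Hstep : forall n, L * (xs tau n - Xs) <= (xs tau (S n) - Xs) + (theta + 1) * (e / L) * ys tau n).
{ intros n. destruct (Hx n) as [H1 H2].
  pose proof (step_x_lower2 tau n ltac:(lra) (HOK n) ltac:(lra) H2) as H3.
  assert (H4 : L * (xs tau n - Xs) <= xs tau n / (L - xs tau n) - Xs).
  { replace (xs tau n / (L - xs tau n) - Xs) with (L * (xs tau n - Xs) / (L - xs tau n)) by (unfold Xs; field; lra).
    apply Rmult_le_reg_r with (L - xs tau n); [lra|].
    replace (L * (xs tau n - Xs) / (L - xs tau n) * (L - xs tau n)) with (L * (xs tau n - Xs)) by (field; lra).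
    rewrite <- (Rmult_1_r (L * (xs tau n - Xs))) at 2. apply Rmult_le_compat_l.
    - apply Rmult_le_pos; lra.
    - unfold Xs in *; lra. }
  lra. }
assert (Hxlim : is_lim_seq (xs tau) Xs).
{ apply is_lim_seq_eps. intros eps.
  set (q := (theta + 1) * (e / L)). assert (Hq : 0 < q) by (unfold q; apply Rmult_lt_0_compat; [lra|apply eL_pos]).
  assert (Heps' : 0 < eps * (L - 1) / 2 / q).
  { apply Rdiv_lt_0_compat; auto. destruct eps; simpl. assert (0 < pos * (L - 1)) by (apply Rmult_lt_0_compat; lra). lra. }
  destruct (proj1 (is_lim_seq_eps _ _) Hylim (mkposreal _ Heps')) as [N HN]. simpl in HN.
  exists N. intros n Hn.
  (* The expansion read backwards: the excess at [m] is at most [1 / L] times the excess at [m + 1]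
     plus a small term, and [eps / 2] is the fixed point of that recursion. *)
  assert (Hit : forall j m, (N <= m)%nat -> xs tau m - Xs <= (X - Xs) / L ^ j + eps / 2).
  { induction j as [|j IHj]; intros m Hm.
    - simpl. destruct (Hx m). destruct eps; simpl. lra.
    - specialize (Hstep m). specialize (IHj (S m) ltac:(lia)). specialize (HN m Hm).
      rewrite Rminus_0_r in HN. apply Rabs_def2 in HN. fold q in Hstep.
      assert (Hqy : q * ys tau m <= eps * (L - 1) / 2).
      { apply Rle_trans with (q * (eps * (L - 1) / 2 / q)); [apply Rmult_le_compat_l; lra|right; field; lra]. }
      apply Rmult_le_reg_l with L; [lra|]. eapply Rle_trans; [exact Hstep|].
      apply Rle_trans with ((X - Xs) / L ^ j + eps / 2 + eps * (L - 1) / 2); [lra|].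
      right. simpl. field. split; [apply pow_nonzero; lra|lra]. }
  assert (Hle : xs tau n - Xs <= 0 + eps / 2).
  { apply (is_lim_seq_le (fun _ => xs tau n - Xs) (fun j => (X - Xs) * (/ L) ^ j + eps / 2) (xs tau n - Xs) (0 + eps / 2)).
    - intros j. rewrite pow_inv. apply (Hit j n Hn).
    - apply is_lim_seq_const.
    - apply is_lim_seq_plus'; [|apply is_lim_seq_const].
      replace (Finite 0) with (Finite ((X - Xs) * 0)) by (f_equal; ring).
      apply is_lim_seq_mult'; [apply is_lim_seq_const|]. apply is_lim_seq_geom.
      rewrite Rabs_pos_eq by (apply Rlt_le, Rinv_0_lt_compat; lra).
      rewrite <- Rinv_1. apply Rinv_lt_contravar; lra. }
  destruct (Hx n). rewrite Rabs_pos_eq by lra. destruct eps; simpl in *. lra. }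
split.
- apply is_lim_seq_ext with (fun n => xs tau n / tau); [intros; unfold xs; field; lra|].
  apply is_lim_seq_div'; auto; [apply is_lim_seq_const|lra].
- apply is_lim_seq_ext with (fun n => ys tau n / tau ^ 2); [intros; unfold ys; field; lra|].
  replace (Finite 0) with (Finite (0 / tau ^ 2)) by (f_equal; field; lra).
  apply is_lim_seq_div'; auto; [apply is_lim_seq_const|]. apply pow_nonzero; lra.
Qed.

Lemma critical_point : exists ts, 0 < ts /\ inI ts /\
  (forall tau n, 0 <= tau <= ts -> admissible tau n /\ xs tau n <= X) /\
  (forall tau, 0 <= tau < ts -> is_lim_seq (fun n => ra (cs tau n)) 0) /\
  is_lim_seq (fun n => ra (cs ts n)) ((L - 1) / ts) /\ is_lim_seq (fun n => rb (cs ts n)) 0.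
Proof.
destruct Xs_X as [HXs HX].
destruct exists_max_bdd as [tp [Hb Hmax]].
pose proof (top_not_sub tp Hb Hmax) as Htop. destruct Hb as [[Htp0 HtpI] Hb].
(* Parameters enter with a minus sign, so that the least upper bound [m] gives the infimum
   [ts = - m]. *)
set (S := fun r => exists t, r = - t /\ 0 <= t <= tp /\ forall n, Xs <= xs t n).
destruct (completeness S) as [m [Hm1 Hm2]].
{ exists 0. intros r [t [-> [Ht _]]]. lra. }
{ exists (- tp). exists tp. repeat split; auto; lra. }
set (ts := - m).
assert (Hts : 0 <= ts <= tp).
{ unfold ts. split.
  - assert (m <= 0); [|lra]. apply Hm2. intros r [t [-> [Ht _]]]. lra.
  - assert (- tp <= m); [|lra]. apply Hm1. exists tp. repeat split; auto; lra. }
assert (Hbelow : forall t, 0 <= t < ts -> exists n, xs t n < Xs).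
{ intros t Ht. apply Classical_Prop.NNPP. intros Hno.
  assert (- t <= m); [|unfold ts in Ht; lra]. apply Hm1. exists t. repeat split; try lra.
  intros n. apply Rnot_lt_le. intros Hc. apply Hno. exists n; auto. }
assert (HOKall : forall tau n, 0 <= tau <= ts -> admissible tau n /\ xs tau n <= X).
{ intros tau n Ht. split; [|apply Hb; lra]. apply good_admissible; [lra|]. intros; apply Hb; lra. }
assert (Hat : forall n, Xs <= xs ts n).
{ intros n.
  assert (Hex : forall i : nat, exists t, ts <= t <= ts + 1 / INR (Datatypes.S i) /\ 0 <= t <= tp /\ forall n, Xs <= xs t n).
  { intros i. assert (Hi : 0 < 1 / INR (Datatypes.S i)) by (apply Rdiv_lt_0_compat; [lra|apply lt_0_INR; lia]).
    apply Classical_Prop.NNPP. intros Hno.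
    assert (m <= m - 1 / INR (Datatypes.S i)); [|lra]. apply Hm2. intros r [t [-> [Ht HtX]]].
    apply Rnot_lt_le. intros Hc. apply Hno. exists t. repeat split; try lra; auto.
    - assert (- t <= m); [|unfold ts; lra]. apply Hm1. exists t. auto.
    - unfold ts; lra. }
  set (t := fun i => proj1_sig (constructive_indefinite_description _ (Hex i))).
  assert (Hp : forall i, ts <= t i <= ts + 1 / INR (Datatypes.S i) /\ 0 <= t i <= tp /\ forall n, Xs <= xs (t i) n).
  { intros i. unfold t. destruct (constructive_indefinite_description _ _); auto. }
  assert (Hlim : is_lim_seq t ts).
  { apply is_lim_seq_le_le with (fun _ => ts) (fun i => ts + 1 / INR (Datatypes.S i)).
    - intros i. apply Hp.
    - apply is_lim_seq_const.
    - replace (Finite ts) with (Finite (ts + 0)) by (f_equal; ring).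
      apply is_lim_seq_plus'; [apply is_lim_seq_const|apply inv_S_lim]. }
  assert (Ht0 : forall i, 0 <= t i) by (intros i; destruct (Hp i) as [_ [H _]]; lra).
  destruct (cs_cont t ts n Ht0 Hlim (proj1 Hts)) as [_ [_ Hx]].
  - intros k _. apply Hb; lra.
  - apply (is_lim_seq_le (fun _ => Xs) (fun i => xs (t i) n) Xs (xs ts n)) with (3 := Hx).
    + intros i. apply Hp.
    + apply is_lim_seq_const. }
assert (Hts0 : 0 < ts).
{ destruct (Rle_lt_or_eq_dec 0 ts (proj1 Hts)) as [|E]; auto. exfalso.
  specialize (Hat 0%nat). rewrite <- E in Hat. unfold xs in Hat. rewrite Rmult_0_l in Hat. lra. }
exists ts. split; auto. split.
{ split; [lra|]. intros Ha. specialize (HtpI Ha). lra. }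
split; auto. split.
- intros tau Ht. destruct (Hbelow tau Ht) as [n Hn]. assert (Ht0 : 0 <= tau) by lra. apply (sub_to_0 tau n Ht0); auto.
  apply HOKall; lra.
- apply (crit_limits ts Hts0). intros n. split; [apply Hat|]. apply HOKall; lra.
Qed.
End Dynamics.

(** * Convergence *)

(** A squeeze between [LK_lower] and [LK_le_pow]; the lower bound at [S k] involves [k] and
    [pred k], so the induction carries both. *)
Lemma ratio_lim (u : nat -> nat -> R) (a : R) :
  eventually (fun n => LK (u n)) -> is_lim_seq (fun n => ra (u n)) a -> is_lim_seq (fun n => rb (u n)) 0 ->
  forall k, is_lim_seq (fun n => u n k / u n 0%nat) (a ^ k).
Proof.
intros [N HN] Hra Hrb k.
assert (Hpow : forall k, is_lim_seq (fun n => ra (u n) ^ k) (a ^ k)).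
{ induction k0; simpl; [apply is_lim_seq_const|apply is_lim_seq_mult'; auto]. }
assert (H : is_lim_seq (fun n => u n k / u n 0%nat) (a ^ k) /\ is_lim_seq (fun n => u n (pred k) / u n 0%nat) (a ^ pred k)).
{ induction k as [|k [IH1 IH2]].
  - simpl. assert (E : is_lim_seq (fun n => u n 0%nat / u n 0%nat) 1).
    { apply is_lim_seq_ext_loc with (fun _ => 1); [|apply is_lim_seq_const].
      exists N. intros n Hn. pose proof (LK_pos _ (HN n Hn)). field. lra. }
    split; auto.
  - split; [|simpl pred; exact IH1].
    apply is_lim_seq_le_le_loc with
      (fun n => ra (u n) * (u n k / u n 0%nat) - INR k * rb (u n) * (u n (pred k) / u n 0%nat))
      (fun n => ra (u n) ^ S k).
    + exists N. intros n Hn. specialize (HN n Hn). split; [apply (LK_lower _ HN k)|].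
      pose proof (LK_pos _ HN). pose proof (LK_le_pow _ HN (S k)) as H1. fold (ra (u n)) in H1.
      apply Rmult_le_reg_l with (u n 0%nat); auto. eapply Rle_trans; [|exact H1]. right. field. lra.
    + replace (Finite (a ^ S k)) with (Finite (a * a ^ k - INR k * 0 * a ^ pred k)) by (f_equal; simpl; ring).
      apply is_lim_seq_minus'; [apply is_lim_seq_mult'; auto|].
      apply is_lim_seq_mult'; auto. apply is_lim_seq_mult'; auto. apply is_lim_seq_const.
    + apply Hpow. }
apply H.
Qed.

Lemma A_space_le a b f : a <= b -> A_space a f -> A_space b f.
Proof. intros Hab [H1 H2]. split; auto. intros c Hc. apply H2. lra. Qed.

(** For coefficients in [LK], convergence one by one is convergence in [A_a]: eventually all have a
    common type [b'] between [a] and [b], which makes the high indices small in the norm [b], and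
    finitely many indices remain. *)
Lemma A_lim_LK (u : nat -> nat -> R) (w : nat -> R) (F : nat -> C -> C) (l : C -> C) (a : R) :
  0 <= a -> eventually (fun n => LK (u n)) -> LK w -> ra w <= a ->
  (forall k, is_lim_seq (fun n => u n k) (w k)) ->
  eventually (fun n => A_space a (F n) /\ forall k, coef (F n) k = RtoC (u n k)) ->
  (forall z, l z = rT w z) ->
  A_lim eventually a F l.
Proof.
intros Ha [N1 HN1] Hw Hwa Hlim [N2 HN2] Hl.
pose proof (LK_pos w Hw) as Hw0. pose proof (LK_ratio w Hw) as Hwr. fold (ra w) in Hwr.
assert (Hwk : forall k, 0 <= w k <= w 0%nat * a ^ k).
{ intros k. split; [apply LK_nonneg; auto|]. eapply Rle_trans; [apply LK_le_pow; auto|]. fold (ra w).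
  apply Rmult_le_compat_l; [lra|]. apply pow_incr; auto. }
destruct (A_space_Tay a (fun k => RtoC (w k)) Ha) as [Ew Sw].
{ intros b Hb. exists (w 0%nat). intros k. rewrite Cmod_R, Rabs_pos_eq by apply Hwk.
  eapply Rle_trans; [apply Hwk|]. apply Rmult_le_compat_l; [lra|]. apply pow_incr; lra. }
assert (El : l = rT w) by (apply functional_extensionality; auto). subst l.
destruct (ent_Tay _ Ew) as [Ent Cw].
split; [exact Sw|]. split.
{ exists N2. intros n Hn. apply HN2; auto. }
intros b Hb eps Heps.
set (b' := (a + b) / 2). assert (Hb' : a < b' < b) by (unfold b'; lra).
assert (Hra : is_lim_seq (fun n => ra (u n)) (ra w)).
{ apply is_lim_seq_div'; auto. lra. }
destruct (proj1 (is_lim_seq_eps _ _) Hra (mkposreal (b' - a) ltac:(lra))) as [N3 HN3]. simpl in HN3.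
destruct (proj1 (is_lim_seq_eps _ _) (Hlim 0%nat) (mkposreal 1 Rlt_0_1)) as [N4 HN4]. simpl in HN4.
set (K := w 0%nat + 1).
assert (Hub : forall n, (N1 + N3 + N4 <= n)%nat -> forall k, Rabs (u n k - w k) <= K * b' ^ k).
{ intros n Hn k. specialize (HN1 n ltac:(lia)). specialize (HN3 n ltac:(lia)). specialize (HN4 n ltac:(lia)).
  apply Rabs_def2 in HN3. apply Rabs_def2 in HN4.
  pose proof (LK_nonneg _ HN1 k). pose proof (LK_le_pow _ HN1 k) as H1. fold (ra (u n)) in H1.
  pose proof (LK_ratio _ HN1) as H2. fold (ra (u n)) in H2. pose proof (LK_pos _ HN1).
  assert (u n k <= K * b' ^ k).
  { eapply Rle_trans; [exact H1|]. unfold K. apply Rmult_le_compat; try lra; [apply pow_le; auto|].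
    apply pow_incr; lra. }
  assert (w k <= K * b' ^ k).
  { eapply Rle_trans; [apply Hwk|]. unfold K. apply Rmult_le_compat; try lra; [apply pow_le; auto|].
    apply pow_incr; lra. }
  destruct (Hwk k). apply Rabs_le. lra. }
assert (Hgeo : is_lim_seq (fun k => K * (b' / b) ^ k) 0).
{ replace (Finite 0) with (Finite (K * 0)) by (f_equal; ring).
  apply is_lim_seq_mult'; [apply is_lim_seq_const|]. apply is_lim_seq_geom.
  rewrite Rabs_pos_eq by (apply Rmult_le_pos; [lra|apply Rlt_le, Rinv_0_lt_compat; lra]).
  apply Rmult_lt_reg_r with b; [lra|]. field_simplify; lra. }
destruct (proj1 (is_lim_seq_eps _ _) Hgeo (mkposreal (eps / 2) ltac:(lra))) as [k0 Hk0]. simpl in Hk0.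
assert (Hsmall : exists N5, forall n, (N5 <= n)%nat -> forall k, (k < k0)%nat -> Rabs (u n k - w k) <= eps / 2 * b ^ k).
{ clear Hk0. induction k0 as [|k0 [N IH]]; [exists 0%nat; intros; lia|].
  assert (Hp : 0 < eps / 2 * b ^ k0) by (apply Rmult_lt_0_compat; [lra|apply pow_lt; lra]).
  destruct (proj1 (is_lim_seq_eps _ _) (Hlim k0) (mkposreal _ Hp)) as [N' HN']. simpl in HN'.
  exists (max N N'). intros n Hn k Hk. destruct (Nat.eq_dec k k0) as [->|Hne].
  - apply Rlt_le, HN'; lia.
  - apply IH; lia. }
destruct Hsmall as [N5 HN5].
exists (N1 + N2 + N3 + N4 + N5)%nat. intros n Hn.
destruct (HN2 n ltac:(lia)) as [Sn Cn].
apply A_norm_lt with (eps / 2); [lra|lra|]. intros k.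
rewrite coef_minus; [|apply Sn|exact Ent].
rewrite Cn. unfold rT. rewrite Cw, <- RtoC_minus, Cmod_R.
destruct (Nat.lt_ge_cases k k0) as [Hk|Hk]; [apply HN5; auto; lia|].
eapply Rle_trans; [apply Hub; lia|]. specialize (Hk0 k Hk). rewrite Rminus_0_r in Hk0.
apply Rabs_def2 in Hk0.
assert (Hbk : 0 < b ^ k) by (apply pow_lt; lra).
replace (b' ^ k) with ((b' / b) ^ k * b ^ k).
- rewrite <- Rmult_assoc. apply Rmult_le_compat_r; lra.
- rewrite <- Rpow_mult_distr. f_equal. field. lra.
Qed.

(** * The normalised solutions and their constant *)

Section Recursion.
Variables (delta : nat) (sigma L e lambda theta alpha : R) (c0 : nat -> R) (g : C -> C) (tau : R).
Hypothesis Hdelta : (2 <= delta)%nat.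
Hypothesis Hsig : sigma = Rpower (INR delta) (- 1 - lambda).
Hypothesis Hsigma : 0 < sigma.
Hypothesis HL : 1 < L.
Hypothesis He : 0 < e < 1.
Hypothesis Hth : 0 <= theta.
Hypothesis Hs1 : INR delta * sigma = / L.
Hypothesis Hs2 : INR delta * sigma ^ 2 = (e / L) ^ 4.
Hypothesis Halpha : 0 <= alpha.
Hypothesis Hc00 : c0 0%nat = 1.
Hypothesis Hg : forall z, g z = rT c0 z.
Hypothesis Htype : forall b, alpha < b -> exists M, expo M b c0.
Hypothesis HI : inI L alpha tau.
Hypothesis HOK : forall n, admissible delta sigma theta c0 tau n /\ xs delta sigma theta c0 tau n <= L - e.

Let d := INR delta.
Local Notation c n := (cs delta sigma theta c0 tau n).
Local Notation Q n := (Qop delta sigma (c n)).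

Let Htau : 0 <= tau.
Proof. apply HI. Qed.
Let Hd : 2 <= d.
Proof. unfold d. change 2 with (INR 2). apply le_INR; auto. Qed.

Lemma Q_LK n : LK (Q n).
Proof. apply LK_Qop; auto. apply HOK. Qed.

(** Undoing the scaling by [1 / L], the type to be started from is [L b / (1 + tau b)], and it
    exceeds [alpha] for every [b > alpha] because [tau alpha <= L - 1]. This is the role of
    [I(g)]. *)
Lemma type_Q n : (forall b, alpha < b -> exists M, expo M b (c n)) ->
  forall b, alpha < b -> exists M, expo M (b / (1 + tau * b)) (Q n).
Proof.
intros H b Hb. destruct HI as [_ HI'].
assert (0 <= tau * b) by (apply Rmult_le_pos; lra).
assert (Ht : tau * alpha <= L - 1).
{ destruct Halpha as [Ha|Ha]; [|rewrite <- Ha; lra].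
  specialize (HI' Ha). apply Rmult_le_compat_r with (r := alpha) in HI'; [|lra].
  replace ((L - 1) / alpha * alpha) with (L - 1) in HI' by (field; lra). auto. }
destruct (H (L * b / (1 + tau * b))) as [M HM].
{ apply Rmult_lt_reg_r with (1 + tau * b); [lra|]. unfold Rdiv at 1. rewrite Rmult_assoc, Rinv_l by lra.
  assert (tau * alpha * b <= (L - 1) * b) by (apply Rmult_le_compat_r; lra). lra. }
exists (M ^ delta).
replace (b / (1 + tau * b)) with (INR delta * sigma * (L * b / (1 + tau * b))).
- apply Qop_expo; auto. apply Rmult_le_pos; [|apply Rlt_le, Rinv_0_lt_compat; lra].
  apply Rmult_le_pos; lra.
- rewrite Hs1. field. lra.
Qed.

Lemma type_c n : forall b, alpha < b -> exists M, expo M b (c n).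
Proof.
induction n as [|n IH]; [exact Htype|]. intros b Hb.
destruct (Flow_type theta tau alpha (Q n) Hth Htau Halpha (LK_nonneg _ (Q_LK n)) (type_Q n IH) b Hb) as [M [HM H]].
exists M. intros k. destruct (H tau ltac:(lra) k). simpl. rewrite Rabs_pos_eq; auto.
Qed.

Definition growth (n : nat) : R := Flow theta tau (Q n) 0%nat / Q n 0%nat.

(* In terms of p_n = ln f_n(1, 0) the recursion reads p_(n+1) = d p_n + ln (growth n); this is the only
   p_0 for which p_n stays bounded. *)
Definition cst : R := exp (- Series (fun k => ln (growth k) / d ^ S k)).
(** The initial constant is raised to the power [delta] at every step, so [f_n(1, z)] is [Mn n]
    times the unnormalised iterate. *)
Definition Mn (n : nat) : R := cst ^ (delta ^ n).
Definition dseq (n : nat) : nat -> R := Qop delta sigma (fun k => Mn n * c n k).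
Definition fsol (n : nat) (t : R) (z : C) : C :=
  match n with
  | O => (RtoC cst * g z)%C
  | S m => sol theta tau (dseq m) t z
  end.

Lemma Mn_pos n : 0 < Mn n.
Proof. apply pow_lt, exp_pos. Qed.

Lemma Mn_S n : Mn (S n) = Mn n ^ delta.
Proof. unfold Mn. rewrite <- pow_mult. f_equal. simpl. lia. Qed.

Lemma dseq_Q n k : dseq n k = Mn (S n) * Q n k.
Proof. unfold dseq. rewrite Qop_scal, Mn_S. auto. Qed.

Lemma dseq_LK n : LK (dseq n).
Proof. apply LK_Qop; auto. apply LK_scal; [apply Mn_pos|apply HOK]. Qed.

Lemma dseq_type n b : alpha < b -> exists M, expo M (b / (1 + tau * b)) (dseq n).
Proof.
intros Hb. destruct (type_Q n (type_c n) b Hb) as [M HM]. exists (Mn (S n) * M). intros k.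
rewrite dseq_Q, Rabs_mult, (Rabs_pos_eq (Mn (S n))), Rmult_assoc by apply Rlt_le, Mn_pos.
apply Rmult_le_compat_l; [apply Rlt_le, Mn_pos|auto].
Qed.

Lemma fsol_1 n z : fsol n 1 z = rT (fun k => Mn n * c n k) z.
Proof.
destruct n as [|n].
- simpl. rewrite Hg. unfold Mn, rT. simpl pow. rewrite Rmult_1_r.
  destruct (Htype (alpha + 1) ltac:(lra)) as [M HM].
  rewrite <- Tay_scal by (apply rent_expo with M (alpha + 1); auto; lra).
  apply Tay_ext. intros k. rewrite RtoC_mult. auto.
- change (fsol (S n) 1 z) with (rT (Flow theta (tau * 1) (dseq n)) z).
  apply Tay_ext. intros k. f_equal. rewrite Rmult_1_r.
  rewrite (Flow_ext theta tau _ _ k (dseq_Q n)). apply Flow_scal.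
Qed.

Lemma fsol_recursive : recursive_solution delta lambda theta tau alpha (fun z => (RtoC cst * g z)%C) fsol.
Proof.
split; [reflexivity|]. intros n. split.
- apply sol_heat; auto; [apply LK_nonneg, dseq_LK|apply dseq_type].
- intros z. rewrite fsol_1. change (fsol (S n) 0 z) with (sol theta tau (dseq n) 0 z).
  rewrite sol_0. unfold dseq. destruct (type_c n (alpha + 1) ltac:(lra)) as [M HM].
  rewrite <- Hsig. apply rT_Qop with (Mn n * M) (alpha + 1); auto; try lra.
  intros k. rewrite Rabs_mult, (Rabs_pos_eq (Mn n)), Rmult_assoc by apply Rlt_le, Mn_pos.
  apply Rmult_le_compat_l; [apply Rlt_le, Mn_pos|auto].
Qed.

Lemma fsol_unique : unique_recursive_solution delta lambda theta tau alpha (fun z => (RtoC cst * g z)%C) fsol.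
Proof.
split; [apply fsol_recursive|]. intros h [Hh0 Hh].
destruct fsol_recursive as [Hf0 Hf].
assert (H : forall n, (forall z, h n 1 z = fsol n 1 z) -> forall t z, 0 <= t <= 1 -> h (S n) t z = fsol (S n) t z).
{ intros n Hn. apply heat_unique with theta tau alpha; auto; [apply Hh|apply Hf|].
  intros z. rewrite (proj2 (Hh n)), (proj2 (Hf n)), Hn. auto. }
intros n. apply H. induction n as [|n IH]; intros z; [rewrite Hh0, Hf0; auto|].
apply H; auto. lra.
Qed.

Section Limit.
Variables (a : R).
Hypothesis Ha : 0 <= a.
Hypothesis Hra : is_lim_seq (fun n => ra (c n)) a.
Hypothesis Hrb : is_lim_seq (fun n => rb (c n)) 0.

(** The limit of the ratio of the first two coefficients at [t = 0], i.e. after the power step and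
    before the flow. *)
Let a' := a / L.

Lemma a'_pos : 0 <= a'.
Proof. apply Rmult_le_pos; auto. apply Rlt_le, Rinv_0_lt_compat; lra. Qed.

Lemma tau_a' : tau * a' < 1.
Proof.
assert (H : tau * a <= L - e).
{ assert (Hl : is_lim_seq (fun n => tau * ra (c n)) (tau * a)).
  { apply is_lim_seq_mult'; auto. apply is_lim_seq_const. }
  apply (is_lim_seq_le _ (fun _ => L - e) (Finite (tau * a)) (Finite (L - e))) in Hl.
  - exact Hl.
  - intros n. apply HOK.
  - apply is_lim_seq_const. }
unfold a'. apply Rmult_lt_reg_r with L; [lra|]. field_simplify; lra.
Qed.

Lemma tau_t_a' t : 0 <= t <= 1 -> 0 <= tau * t /\ tau * t * a' < 1.
Proof.
intros Ht. destruct (tau_in tau Htau t Ht) as [H1 H2]. split; auto.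
pose proof tau_a'. pose proof a'_pos.
apply Rle_lt_trans with (tau * a'); auto. apply Rmult_le_compat_r; auto.
Qed.

Let Rinf := Rpower (1 - tau * a') (- theta).

(** The iterates themselves need not converge yet, but [growth] is invariant under scaling, so they
    are divided by their value at 0 and tend to [exp (a z)]. *)
Lemma growth_lim : is_lim_seq growth Rinf.
Proof.
set (u := fun n k => / c n 0%nat * c n k).
assert (Hp : forall n, 0 < c n 0%nat) by (intros n; apply LK_pos, HOK).
assert (Hu : forall k, is_lim_seq (fun n => u n k) (1 * a ^ k)).
{ intros k. rewrite Rmult_1_l. apply is_lim_seq_ext with (fun n => c n k / c n 0%nat); [intros; unfold u, Rdiv; ring|].
  apply ratio_lim; auto. exists 0%nat; intros; apply HOK. }
pose proof a'_pos. pose proof tau_a'.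
assert (HQu : forall k, is_lim_seq (fun n => Qop delta sigma (u n) k) (a' ^ k)).
{ intros k. replace (a' ^ k) with (Qop delta sigma (fun k => 1 * a ^ k) k).
  - apply Qop_lim; auto.
  - rewrite Qop_geom, pow1, Rmult_1_l, Hs1. f_equal. unfold a', Rdiv. ring. }
replace Rinf with (Flow theta tau (fun k => a' ^ k) 0%nat).
- apply is_lim_seq_ext with (fun n => Flow theta tau (Qop delta sigma (u n)) 0%nat).
  + intros n. unfold u. rewrite (Flow_ext theta tau _ _ 0%nat (Qop_scal delta sigma (/ c n 0%nat) (c n))).
    rewrite Flow_scal. unfold growth. rewrite Qop_at0. pose proof (Hp n).
    rewrite pow_inv. unfold Rdiv. ring.
  + apply Flow_LK_lim; auto.
    * exists 0%nat. intros n _. apply LK_Qop; auto. apply LK_scal; [apply Rinv_0_lt_compat; auto|apply HOK].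
    * apply LK_geom; auto.
    * apply is_lim_seq_const.
    * simpl. lra.
- rewrite Flow_geom; auto. unfold Rinf. simpl. rewrite Rmult_1_l. f_equal. ring.
Qed.

Lemma growth_pos n : 0 < growth n.
Proof.
apply Rdiv_lt_0_compat.
- change (0 < c (S n) 0%nat). apply LK_pos, HOK.
- apply LK_pos, Q_LK.
Qed.

Let l n := ln (growth n).
Let linf := ln Rinf.

Lemma l_lim : is_lim_seq l linf.
Proof.
unfold l. apply (is_lim_seq_continuous ln growth Rinf); [|apply growth_lim].
apply derivable_continuous_pt. exists (/ Rinf). apply derivable_pt_lim_ln. unfold Rinf, Rpower. apply exp_pos.
Qed.

Lemma l_bounded : exists K, forall n, Rabs (l n) <= K.
Proof.
assert (H : ex_lim_seq (fun n => Rabs (l n))).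
{ exists (Rabs linf). apply is_lim_seq_abs with (l := Finite linf). apply l_lim. }
destruct (maj_by_pos l) as [K [_ HK]]; [|exists K; auto].
exists linf. apply is_lim_seq_Reals. apply l_lim.
Qed.

Lemma inv_d_series K : is_series (fun k => K / d ^ S k) (K / (d - 1)).
Proof.
replace (K / (d - 1)) with ((K / d) * / (1 - / d)) by (field; lra).
apply is_series_ext with (fun k => K / d * (/ d) ^ k).
- intros k. simpl. rewrite pow_inv. field. split; [apply pow_nonzero|]; lra.
- apply (is_series_scal_l (V := R_NormedModule) (K / d) (fun k => (/ d) ^ k) (/ (1 - / d))). apply is_series_geom.
  rewrite Rabs_pos_eq by (apply Rlt_le, Rinv_0_lt_compat; lra).
  rewrite <- Rinv_1. apply Rinv_lt_contravar; lra.
Qed.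

Lemma l_ex_series n : ex_series (fun k => l (n + k)%nat / d ^ S k).
Proof.
destruct l_bounded as [K HK]. apply (ex_series_le (V := R_CompleteNormedModule)) with (fun k => K / d ^ S k).
- intros k. change (Rabs (l (n + k)%nat / d ^ S k) <= K / d ^ S k).
  assert (0 < d ^ S k) by (apply pow_lt; lra).
  unfold Rdiv. rewrite Rabs_mult, (Rabs_pos_eq (/ _)) by (apply Rlt_le, Rinv_0_lt_compat; auto).
  apply Rmult_le_compat_r; auto. apply Rlt_le, Rinv_0_lt_compat; auto.
- eexists. apply inv_d_series.
Qed.

(** The affine recursion with multiplier [d] strips the first term off the series defining [cst] and
    rescales the rest, so the logarithm stays equal to a tail of bounded terms against a geometric
    weight. *)
Lemma log_Mn n : ln (Mn n * c n 0%nat) = - Series (fun k => l (n + k)%nat / d ^ S k).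
Proof.
induction n as [|n IH].
- unfold Mn. simpl pow. simpl cs. rewrite Hc00, !Rmult_1_r. unfold cst. rewrite ln_exp. auto.
- assert (Hp : 0 < c n 0%nat) by apply LK_pos, HOK.
  pose proof (Mn_pos n).
  assert (E : Mn (S n) * c (S n) 0%nat = (Mn n * c n 0%nat) ^ delta * growth n).
  { rewrite Mn_S, Rpow_mult_distr. change (c (S n) 0%nat) with (Flow theta tau (Q n) 0%nat).
    unfold growth. rewrite Qop_at0. field. apply pow_nonzero; lra. }
  rewrite E, ln_mult, ln_pow; [|apply Rmult_lt_0_compat; auto|apply pow_lt, Rmult_lt_0_compat; auto|apply growth_pos].
  rewrite IH. rewrite Series_incr_1 by apply l_ex_series.
  replace (Series (fun k => l (n + S k)%nat / d ^ S (S k)))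
    with (/ d * Series (fun k => l (S n + k)%nat / d ^ S k)).
  + fold d. rewrite Nat.add_0_r. change (ln (growth n)) with (l n). simpl (d ^ 1). field. lra.
  + rewrite <- Series_scal_l. apply Series_ext. intros k.
    replace (n + S k)%nat with (S n + k)%nat by lia. simpl (d ^ _). field.
    split; [apply pow_nonzero; lra|lra].
Qed.

Let V := exp (- (linf / (d - 1))).

Lemma Mn_lim : is_lim_seq (fun n => Mn n * c n 0%nat) V.
Proof.
destruct l_bounded as [K HK].
destruct (Series_tannery (fun n k => l (n + k)%nat / d ^ S k) (fun k => linf / d ^ S k) (fun k => K / d ^ S k)) as [_ H].
- eexists. apply inv_d_series.
- exists 0%nat. intros n _ k. assert (0 < d ^ S k) by (apply pow_lt; lra).
  unfold Rdiv. rewrite Rabs_mult, (Rabs_pos_eq (/ _)) by (apply Rlt_le, Rinv_0_lt_compat; auto).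
  apply Rmult_le_compat_r; auto. apply Rlt_le, Rinv_0_lt_compat; auto.
- intros k. apply is_lim_seq_div'; [|apply is_lim_seq_const|apply pow_nonzero; lra].
  pose proof (proj1 (is_lim_seq_incr_n l k linf) l_lim) as Hk.
  apply is_lim_seq_ext with (2 := Hk). auto.
- rewrite (is_series_unique _ _ (inv_d_series linf)) in H.
  apply is_lim_seq_ext with (fun n => exp (- Series (fun k => l (n + k)%nat / d ^ S k))).
  + intros n. rewrite <- log_Mn. apply exp_ln. apply Rmult_lt_0_compat; [apply Mn_pos|apply LK_pos, HOK].
  + apply (is_lim_seq_continuous exp).
    * apply derivable_continuous_pt, derivable_pt_exp.
    * apply (proj1 (is_lim_seq_opp _ (Finite _)) H).
Qed.

Lemma dseq_lim k : is_lim_seq (fun n => dseq n k) (V ^ delta * a' ^ k).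
Proof.
replace (V ^ delta * a' ^ k) with (Qop delta sigma (fun k => V * a ^ k) k).
- apply Qop_lim. intros j.
  apply is_lim_seq_ext with (fun n => Mn n * c n 0%nat * (c n j / c n 0%nat)).
  + intros n. assert (Hp : 0 < c n 0%nat) by apply LK_pos, HOK. field. lra.
  + apply is_lim_seq_mult'; [apply Mn_lim|]. apply ratio_lim; auto.
    exists 0%nat; intros; apply HOK.
- rewrite Qop_geom, Hs1. do 2 f_equal. unfold a', Rdiv. ring.
Qed.

Lemma fsol_lim a0 t : 0 <= t <= 1 -> alpha <= a0 -> a' / (1 - tau * t * a') <= a0 ->
  A_lim eventually a0 (fun n => fsol n t)
    (rT (fun k => V ^ delta * (a' ^ k * Rpower (1 - tau * t * a') (- (INR k + theta))))).
Proof.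
intros Ht Ha0 Hw. destruct (tau_t_a' t Ht) as [Htt Hta]. pose proof a'_pos as Ha'.
assert (HV : 0 < V ^ delta) by apply pow_lt, exp_pos.
set (w := fun k => V ^ delta * (a' ^ k * Rpower (1 - tau * t * a') (- (INR k + theta)))).
assert (Ew : forall k, Flow theta (tau * t) (fun k => V ^ delta * a' ^ k) k = w k).
{ intros k. rewrite Flow_scal, Flow_geom; auto. }
assert (HVa : LK (fun k => V ^ delta * a' ^ k)) by (apply LK_scal; auto; apply LK_geom; auto).
assert (Hsm : tau * t * (V ^ delta * a' ^ 1 / (V ^ delta * a' ^ 0)) < 1).
{ replace (V ^ delta * a' ^ 1 / (V ^ delta * a' ^ 0)) with a' by (simpl; field; lra). auto. }
assert (Hlim : forall k, is_lim_seq (fun n => Flow theta (tau * t) (dseq n) k) (w k)).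
{ intros k. rewrite <- Ew. apply Flow_LK_lim; auto.
  - exists 0%nat; intros; apply dseq_LK.
  - apply is_lim_seq_const.
  - apply dseq_lim. }
assert (HFL : forall n, LK (Flow theta (tau * t) (dseq n))).
{ intros n. apply LK_Flow; auto; [apply dseq_LK|].
  destruct (step_small delta sigma L e theta c0 Hsigma HL Hs1 Hs2 tau n) as [E1 E2].
  - apply HOK.
  - destruct (HOK n). lra.
  - pose proof (LK_pos _ (Q_LK n)) as HQp. pose proof (Mn_pos (S n)).
    replace (dseq n 1%nat / dseq n 0%nat) with (ra (Q n)).
    + apply Rle_lt_trans with (tau * ra (Q n)); [|lra].
      apply Rmult_le_compat_r; [apply LK_ratio, Q_LK|apply tau_in; auto].
    + rewrite !dseq_Q. unfold ra. field. lra. }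
(* The solution [f_n] with [n >= 1] flows from the data [dseq (n - 1)]; the index 0 is irrelevant to
   the limit. *)
apply A_lim_LK with (fun n => Flow theta (tau * t) (dseq (pred n))) w; auto.
- lra.
- exists 0%nat. auto.
- apply LK_ext with (Flow theta (tau * t) (fun k => V ^ delta * a' ^ k)); auto. apply LK_Flow; auto.
- replace (ra w) with (a' / (1 - tau * t * a')); auto. unfold ra, w.
  replace (- (INR 1 + theta)) with (- (1) + - (INR 0 + theta)) by (simpl; ring).
  rewrite Rpower_plus, Rpower_Ropp, Rpower_1 by lra.
  assert (0 < Rpower (1 - tau * t * a') (- (INR 0 + theta))) by apply exp_pos.
  simpl (a' ^ _). field. lra.
- intros k. apply (is_lim_seq_incr_1 (fun n => Flow theta (tau * t) (dseq (pred n)) k)). apply Hlim.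
- exists 1%nat. intros [|n] Hn; [lia|]. change (pred (S n)) with n.
  destruct (sol_coef theta tau alpha (dseq n) Hth Htau Halpha (LK_nonneg _ (dseq_LK n)) (dseq_type n) t Ht) as [S1 S2].
  split; auto. apply A_space_le with alpha; auto.
Qed.

End Limit.
End Recursion.

(** * The two limit functions and the conclusion *)

Lemma Rpower_base_1 x : Rpower 1 x = 1.
Proof. unfold Rpower. rewrite ln_1, Rmult_0_r, exp_0. auto. Qed.

Lemma subcritical_limit (L theta tau t d : R) (delta : nat) z :
  rT (fun k => exp (- (ln (Rpower (1 - tau * (0 / L)) (- theta)) / (d - 1))) ^ delta *
        ((0 / L) ^ k * Rpower (1 - tau * t * (0 / L)) (- (INR k + theta)))) z = RtoC 1.
Proof.
rewrite <- (rT_oneL z). apply Tay_ext. intros k. f_equal.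
replace (0 / L) with 0 by (unfold Rdiv; ring).
rewrite !Rmult_0_r, Rminus_0_r, !Rpower_base_1, ln_1, Rmult_1_r.
unfold Rdiv. rewrite Rmult_0_l, Ropp_0, exp_0, pow1. destruct k; simpl; ring.
Qed.

(** Here [ts * a' = 1 - 1/L = q], so [1 - ts * a'] is [delta^(-lambda)], which produces the constant
    factor of [f_star]; the rest is the flow of [exp (a' z)] at time [ts * t]. *)
Lemma critical_limit (lambda theta ts t : R) (delta : nat) z :
  (2 <= delta)%nat -> 0 < lambda -> 0 < ts -> 0 <= t <= 1 ->
  let L := Rpower (INR delta) lambda in
  let a' := (L - 1) / ts / L in
  rT (fun k => exp (- (ln (Rpower (1 - ts * a') (- theta)) / (INR delta - 1))) ^ delta *
        (a' ^ k * Rpower (1 - ts * t * a') (- (INR k + theta)))) z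
  = f_star delta lambda theta ts t z.
Proof.
intros Hd Hl Hts Ht L a'.
assert (Hd2 : 2 <= INR delta) by (change 2 with (INR 2); apply le_INR; auto).
assert (HL : 1 < L) by (unfold L; rewrite <- (Rpower_O (INR delta)) by lra; apply Rpower_lt; lra).
unfold f_star. set (q := 1 - Rpower (INR delta) (- lambda)).
assert (Hq : q = 1 - / L) by (unfold q, L; rewrite Rpower_Ropp; auto).
assert (Eq : ts * a' = q) by (rewrite Hq; unfold a'; field; lra).
assert (HLi : 0 < / L < 1) by (split; [apply Rinv_0_lt_compat|rewrite <- Rinv_1; apply Rinv_lt_contravar]; lra).
assert (Hq1 : 0 < q < 1) by lra.
assert (Htq : 0 < 1 - t * q).
{ assert (t * q <= 1 * q) by (apply Rmult_le_compat_r; lra). lra. }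
assert (Eq' : ts * t * a' = t * q) by (rewrite <- Eq; ring).
assert (EV : exp (- (ln (Rpower (1 - ts * a') (- theta)) / (INR delta - 1))) ^ delta
           = Rpower (INR delta) (- (INR delta * theta * lambda / (INR delta - 1)))).
{ rewrite Eq. unfold q. replace (1 - (1 - Rpower (INR delta) (- lambda))) with (Rpower (INR delta) (- lambda)) by ring.
  rewrite Rpower_mult. unfold Rpower at 1. rewrite ln_exp, <- Rpower_pow by apply exp_pos.
  unfold Rpower. rewrite ln_exp. f_equal. field. lra. }
rewrite EV, Eq', cexp_rT.
unfold rT. rewrite <- Tay_scal.
- apply Tay_ext. intros k. rewrite <- RtoC_mult. f_equal.
  set (V := Rpower (INR delta) _).
  replace (- (INR k + theta)) with (- theta + - INR k) by ring.
  rewrite Rpower_plus, (Rpower_Ropp _ (INR k)), Rpower_pow by auto.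
  replace (1 / ts * (q / (1 - t * q))) with (a' * / (1 - t * q)) by (replace a' with (q / ts) by (rewrite <- Eq; field; lra); field; lra).
  rewrite Rpow_mult_distr, pow_inv. ring.
- apply rent_expo with 1 (1 / ts * (q / (1 - t * q))).
  + apply Rmult_le_pos; apply Rlt_le, Rdiv_lt_0_compat; lra.
  + intros k. rewrite Rmult_1_l. rewrite Rabs_pos_eq; [lra|]. apply pow_le.
    apply Rmult_le_pos; apply Rlt_le, Rdiv_lt_0_compat; lra.
Qed.

Lemma squeeze_rb (u : nat -> nat -> R) :
  (forall n, LK (u n)) -> is_lim_seq (fun n => ra (u n)) 0 -> is_lim_seq (fun n => rb (u n)) 0.
Proof.
intros Hu Hra. apply is_lim_seq_le_le with (fun _ => 0) (fun n => ra (u n) * ra (u n)).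
- intros n. split; [apply rb_nonneg; auto|]. unfold rb, ra.
  pose proof (LK_pos _ (Hu n)). pose proof (LK_nonneg _ (Hu n) 2%nat).
  assert (0 <= u n 2%nat / u n 0%nat) by (apply Rmult_le_pos; auto; apply Rlt_le, Rinv_0_lt_compat; auto).
  simpl. lra.
- apply is_lim_seq_const.
- replace (Finite 0) with (Finite (0 * 0)) by (f_equal; ring). apply is_lim_seq_mult'; auto.
Qed.

Theorem theorem1p2
    (lambda : R) (Hlambda : 0 < lambda < 1 / 2)
    (delta : nat) (Hdelta : (2 <= delta)%nat)
    (theta : R) (Htheta : 0 <= theta)
    (g : C -> C) (alpha : R) (gamma : nat -> R)
    (Hg : laguerre_family delta lambda theta g alpha gamma) :
  exists (tau_star : R) (Cst : R -> R),
    0 < tau_star /\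
    in_I delta lambda alpha tau_star /\
    (forall tau, 0 <= tau <= tau_star -> 0 <= Cst tau) /\
    let beta_star := tau_star / (Rpower (INR delta) lambda - 1) in
    (forall tau, 0 <= tau < tau_star ->
      exists f : nat -> R -> C -> C,
        unique_recursive_solution delta lambda theta tau alpha
          (fun z => (RtoC (Cst tau) * g z)%C) f /\
        forall t, 0 <= t <= 1 ->
          A_lim eventually (/ beta_star) (fun n => f n t) (fun _ => RtoC 1)) /\
    (exists f : nat -> R -> C -> C,
      unique_recursive_solution delta lambda theta tau_star alpha
        (fun z => (RtoC (Cst tau_star) * g z)%C) f /\
      forall t, 0 <= t <= 1 ->
        A_lim eventually (/ beta_star) (fun n => f n t)
          (f_star delta lambda theta tau_star t)).
Proof.
destruct Hg as [Hg1 [Hnc [Hfam _]]].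
assert (Halpha : 0 <= alpha) by (destruct Hg1 as [[c [m [H _]]] _]; auto).
destruct (laguerre_sequence g alpha gamma Hg1 Hnc) as [c0 [Hc0 [Hc00 [Hc01 [Era [Erb [Hgz [Htype Hlow]]]]]]]].
set (d := INR delta) in *.
assert (Hd : 2 <= d) by (unfold d; change 2 with (INR 2); apply le_INR; auto).
set (L := Rpower d lambda). set (e := Rpower d (- ((1 - 2 * lambda) / 4))).
set (sigma := Rpower d (- 1 - lambda)).
assert (Hlt1 : forall x y, x < y -> Rpower d x < Rpower d y) by (intros; apply Rpower_lt; lra).
assert (Hsigma : 0 < sigma) by apply exp_pos.
assert (HL : 1 < L) by (rewrite <- (Rpower_O d) by lra; apply Hlt1; lra).
assert (He : 0 < e < 1) by (split; [apply exp_pos|rewrite <- (Rpower_O d) by lra; apply Hlt1; lra]).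
assert (Hs1 : d * sigma = / L).
{ unfold sigma, L. rewrite <- Rpower_Ropp. rewrite <- (Rpower_1 d) at 1 by lra. rewrite <- Rpower_plus. f_equal. ring. }
assert (HeL : e / L = Rpower d (- ((1 - 2 * lambda) / 4) - lambda)).
{ unfold Rdiv, e, L. rewrite <- Rpower_Ropp, <- Rpower_plus. auto. }
assert (Hpw : forall x n, Rpower d x ^ n = Rpower d (x * INR n)).
{ intros. rewrite <- Rpower_pow by apply exp_pos. apply Rpower_mult. }
(* Both sides are [delta^(-1 - 2 lambda)]; this identity fixes [epsilon = (1 - 2 lambda) / 4]. *)
assert (Hs2 : d * sigma ^ 2 = (e / L) ^ 4).
{ rewrite HeL. unfold sigma. rewrite !Hpw. rewrite <- (Rpower_1 d) at 1 by lra. rewrite <- Rpower_plus.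
  f_equal. simpl. field. }
(* The factor [delta^(1/2)] of the family is [L / e^2], and [vartheta] is [(1 - e) / (L - e)]. *)
assert (Hfam' : rb c0 / ra c0 ^ 2 <= L / e ^ 2 / (theta + 1) * ((1 - e) / (L - e))).
{ rewrite Era, Erb. replace (L / e ^ 2) with (Rpower d (1 / 2)); [exact Hfam|].
  unfold L, e. rewrite Hpw. unfold Rdiv at 2. rewrite <- Rpower_Ropp, <- Rpower_plus. f_equal. simpl. field. }
destruct (critical_point delta sigma L e theta alpha c0) as [ts [Hts [HI [HOK [Hsub [Hcra Hcrb]]]]]]; auto.
assert (Ha0 : / (ts / (L - 1)) = (L - 1) / ts) by (field; lra).
(* Membership of [ts] in [I(g)] in the form needed here: solutions in [A_alpha] lie in the space of
   the limit. *)
assert (Haa : alpha <= (L - 1) / ts).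
{ destruct Halpha as [Ha|Ha]; [|rewrite <- Ha; apply Rlt_le, Rdiv_lt_0_compat; lra].
  destruct HI as [_ HI]. specialize (HI Ha).
  apply Rmult_le_compat_r with (r := alpha / ts) in HI; [|apply Rlt_le, Rdiv_lt_0_compat; auto].
  replace (ts * (alpha / ts)) with alpha in HI by (field; lra).
  replace ((L - 1) / alpha * (alpha / ts)) with ((L - 1) / ts) in HI by (field; lra). auto. }
assert (HIle : forall tau, 0 <= tau <= ts -> inI L alpha tau).
{ intros tau Ht. split; [lra|]. intros Ha. destruct HI as [_ HI]. specialize (HI Ha). lra. }
exists ts, (cst delta sigma theta c0).
split; [exact Hts|]. split; [exact HI|]. split; [intros; apply Rlt_le, exp_pos|].
intros beta_star. change (/ beta_star) with (/ (ts / (L - 1))). rewrite Ha0.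
split.
- intros tau Ht. exists (fsol delta sigma theta c0 g tau). split.
  + apply (fsol_unique delta sigma L e); auto; [apply HIle; lra|intros; apply HOK; lra].
  + intros t Htt. replace (fun _ : C => RtoC 1) with
      (rT (fun k => exp (- (ln (Rpower (1 - tau * (0 / L)) (- theta)) / (d - 1))) ^ delta *
        ((0 / L) ^ k * Rpower (1 - tau * t * (0 / L)) (- (INR k + theta)))))
      by (apply functional_extensionality; intros z; apply subcritical_limit).
    apply (fsol_lim delta sigma L e theta alpha c0 g tau); auto.
    * apply HIle; lra.
    * intros; apply HOK; lra.
    * lra.
    * apply squeeze_rb; auto. intros n. apply (HOK tau n); lra.
    * unfold Rdiv. rewrite !Rmult_0_l. apply Rle_trans with alpha; auto.
- exists (fsol delta sigma theta c0 g ts). split.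
  + apply (fsol_unique delta sigma L e); auto; intros; apply HOK; lra.
  + intros t Ht. set (a' := (L - 1) / ts / L).
    replace (f_star delta lambda theta ts t) with
      (rT (fun k => exp (- (ln (Rpower (1 - ts * a') (- theta)) / (d - 1))) ^ delta *
        (a' ^ k * Rpower (1 - ts * t * a') (- (INR k + theta)))))
      by (apply functional_extensionality; intros z; apply critical_limit; auto; lra).
    apply (fsol_lim delta sigma L e theta alpha c0 g ts); auto.
    * intros; apply HOK; lra.
    * apply Rlt_le, Rdiv_lt_0_compat; lra.
    (* The type of the limit function increases with [t] and reaches [(L - 1) / ts], the inverse of
       [beta_star], at [t = 1]. *)
    * fold a'. assert (Ea : ts * a' = 1 - / L) by (unfold a'; field; lra).
      assert (HLi : 0 < / L < 1) by (split; [apply Rinv_0_lt_compat|rewrite <- Rinv_1; apply Rinv_lt_contravar]; lra).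
      assert (Ha' : 0 < a') by (unfold a'; repeat apply Rdiv_lt_0_compat; lra).
      assert (Hden : / L <= 1 - ts * t * a').
      { replace (ts * t * a') with (t * (1 - / L)) by (rewrite <- Ea; ring).
        assert (t * (1 - / L) <= 1 * (1 - / L)) by (apply Rmult_le_compat_r; lra). lra. }
      replace ((L - 1) / ts) with (a' / / L) by (unfold a'; field; lra).
      apply Rmult_le_compat_l; [lra|]. apply Rinv_le_contravar; lra.
Qed.
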